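(* Let $\mathfrak g=\mathfrak{sp}(4)$ and let $\mathfrak k\simeq\mathfrak{sl}(2)$ be a principal $\mathfrak{sl}(2)$-subalgebra of $\mathfrak g$. Up to isomorphism, there are exactly four simple bounded $(\mathfrak g,\mathfrak k)$-modules with central character $\chi(\frac32,\frac12)$. They have the following $\mathfrak k$-module decompositions: $$V_0\oplus V_6\oplus V_{12}\oplus\cdots,\quad V_1\oplus V_7\oplus V_{13}\oplus\cdots,\quad V_3\oplus V_9\oplus V_{15}\oplus\cdots,\quad V_4\oplus V_{10}\oplus V_{16}\oplus\cdots.$$
   Context: Everything is over $\mathbb C$. The roots of $\mathfrak g=\mathfrak{sp}(4)$ are $\pm2\varepsilon_1,\pm2\varepsilon_2,\pm\varepsilon_1\pm\varepsilon_2$, with simple roots $\varepsilon_1-\varepsilon_2$, $2\varepsilon_2$ and $\rho=2\varepsilon_1+\varepsilon_2$; $\chi(a,b)$ is the central character of the simple highest weight module with highest weight $a\varepsilon_1+b\varepsilon_2-\rho$. A principal $\mathfrak{sl}(2)$-subalgebra is one containing a regular nilpotent element. A $(\mathfrak g,\mathfrak k)$-module is a $\mathfrak g$-module on which $\mathfrak k$ acts locally finitely and semisimply; it is bounded if the dimensions $\dim\mathrm{Hom}_{\mathfrak k}(V,M)$, $V$ simple finite dimensional, are uniformly bounded. $V_k$ is the simple $(k+1)$-dimensional $\mathfrak{sl}(2)$-module. *)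

(* Defs.v *)
From HB Require Import structures.
From mathcomp Require Import all_boot all_order all_algebra.
From mathcomp Require Import boolp classical_sets reals.
From mathcomp Require Export complex.

Set Implicit Arguments.
Unset Strict Implicit.
Unset Printing Implicit Defensive.

Import GRing.Theory.
Local Open Scope ring_scope.

Section Brackets.
Variable C : fieldType.

Definition lie_br n (x y : 'M[C]_n) : 'M[C]_n := x *m y - y *m x.

Lemma lie_br_linear n (x : 'M[C]_n) : linear (lie_br x).
Proof.
move=> a y z; rewrite /lie_br mulmxDr mulmxDl -scalemxAr -scalemxAl.
by rewrite scalerBr opprD addrACA.
Qed.

HB.instance Definition _ n (x : 'M[C]_n) :=
  GRing.isLinear.Build C 'M[C]_n 'M[C]_n *:%R (lie_br x) (lie_br_linear x).

(* Finite dimensional Lie algebras are given as subalgebras of gl(n). *)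
Record lieAlg n := LieAlg {
  lie_space :> {vspace 'M[C]_n};
  lie_closed : {in lie_space &, forall x y, lie_br x y \in lie_space}
}.

Definition sl2_form (x : 'M[C]_2) : C^o := \tr x.

Lemma sl2_form_linear : linear sl2_form.
Proof. by move=> a x y; rewrite /sl2_form linearP. Qed.

HB.instance Definition _ :=
  GRing.isLinear.Build C 'M[C]_2 C^o *:%R sl2_form sl2_form_linear.

Definition sl2_space : {vspace 'M[C]_2} := lker (linfun sl2_form).

Lemma mem_sl2 x : (x \in sl2_space) = (\tr x == 0).
Proof. by rewrite memv_ker lfunE. Qed.

Lemma sl2_closed : {in sl2_space &, forall x y, lie_br x y \in sl2_space}.
Proof.
by move=> x y _ _; rewrite mem_sl2 /lie_br linearB /= mxtrace_mulC subrr.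
Qed.

Definition sl2 : lieAlg 2 := LieAlg sl2_closed.

Definition symplJ : 'M[C]_4 :=
  (block_mx 0 1%:M (- 1%:M) 0 : 'M[C]_(2 + 2)).

Definition sp4_form (x : 'M[C]_4) : 'M[C]_4 := x^T *m symplJ + symplJ *m x.

Lemma sp4_form_linear : linear sp4_form.
Proof.
move=> a x y; rewrite /sp4_form linearP /= mulmxDl mulmxDr.
by rewrite -scalemxAl -scalemxAr scalerDr addrACA.
Qed.

HB.instance Definition _ :=
  GRing.isLinear.Build C 'M[C]_4 'M[C]_4 *:%R sp4_form sp4_form_linear.

Definition sp4_space : {vspace 'M[C]_4} := lker (linfun sp4_form).

Lemma mem_sp4 x : (x \in sp4_space) = (x^T *m symplJ + symplJ *m x == 0).
Proof. by rewrite memv_ker lfunE. Qed.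

Lemma sp4_closed : {in sp4_space &, forall x y, lie_br x y \in sp4_space}.
Proof.
move=> x y; rewrite !mem_sp4 !addr_eq0 => /eqP hx /eqP hy; apply/eqP.
rewrite /lie_br linearB /= !trmx_mul mulmxBl mulmxBr -!mulmxA hx hy.
by rewrite !mulmxN !mulmxA hx hy !mulNmx !opprK opprB.
Qed.

Definition sp4 : lieAlg 4 := LieAlg sp4_closed.

End Brackets.

Arguments sl2 {C}.
Arguments sp4 {C}.

Section PrincipalSl2.
Variables (C : fieldType) (n : nat).
Implicit Types (g k : lieAlg C n) (x : 'M[C]_n).

Definition lie_iso m (h : lieAlg C m) k : Prop :=
  exists f : 'Hom('M[C]_m, 'M[C]_n),
    [/\ {in h &, injective f}, (f @: h)%VS = k
      & {in h &, forall u v, f (lie_br u v) = lie_br (f u) (f v)}].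

Definition centralizer g x : {vspace 'M[C]_n} :=
  (g :&: lker (linfun (lie_br x)))%VS.

(* The minimal dimension of a centralizer is the rank of [g]. *)
Definition regular g x : Prop :=
  {in g, forall y, (\dim (centralizer g x) <= \dim (centralizer g y))%N}.

Definition ad_nilpotent g x : Prop :=
  exists d : nat, {in g, forall y, iter d (lie_br x) y = 0}.

Record principal_sl2 g := PrincipalSl2 {
  psl2_alg :> lieAlg C n;
  psl2_sub : (psl2_alg <= g)%VS;
  psl2_iso : lie_iso (@sl2 C) psl2_alg;
  psl2_principal : exists x, [/\ x \in psl2_alg, regular g x & ad_nilpotent g x]
}.

End PrincipalSl2.

Section Modules.
Variables (C : fieldType) (n : nat).

(* [act x] is meaningful only for [x \in g]. *)
Record lieMod (g : lieAlg C n) := LieMod {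
  lm_car :> lmodType C;
  act : 'M[C]_n -> lm_car -> lm_car;
  act_linear : {in g, forall x, linear (act x)};
  act_linearl : forall a, {in g &, forall x y, forall m,
    act (a *: x + y) m = a *: act x m + act y m};
  act_br : {in g &, forall x y, forall m,
    act (lie_br x y) m = act x (act y m) - act y (act x m)}
}.

Definition lm_res (g k : lieAlg C n) (kg : (k <= g)%VS) (M : lieMod g) :
  lieMod k :=
  LieMod
    (fun x kx => @act_linear g M x (subvP kg x kx))
    (fun a x y kx ky => @act_linearl g M a x y (subvP kg x kx) (subvP kg y ky))
    (fun x y kx ky => @act_br g M x y (subvP kg x kx) (subvP kg y ky)).

Variable g : lieAlg C n.
Implicit Types M N V : lieMod g.

Definition lm_hom M N (f : M -> N) : Prop :=
  linear f /\ {in g, forall x m, f (act x m) = act x (f m)}.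

Definition lm_iso M N : Prop := exists f : M -> N, lm_hom f /\ bijective f.

Definition submodule M (P : M -> Prop) : Prop :=
  [/\ P 0, forall a u v, P u -> P v -> P (a *: u + v)
    & {in g, forall x m, P m -> P (act x m)}].

Definition simple_mod M : Prop :=
  (exists m : M, m != 0) /\
  forall P : M -> Prop, submodule P ->
    (forall m, P m -> m = 0) \/ (forall m, P m).

Definition has_dim M (d : nat) : Prop :=
  exists f : {linear 'rV[C]_d -> M}, bijective f.

Definition finite_dim M : Prop := exists d, has_dim M d.

Definition fin_spanned M (P : M -> Prop) : Prop :=
  exists s : seq M, forall m, P m ->
    exists c : 'I_(size s) -> C, m = \sum_i c i *: s`_i.

Definition locally_finite M : Prop :=
  forall m : M, exists P, [/\ submodule P, fin_spanned P & P m].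

Definition semisimple_mod M : Prop :=
  forall P : M -> Prop, submodule P ->
    exists Q : M -> Prop,
      [/\ submodule Q, forall m, P m -> Q m -> m = 0
        & forall m, exists u v, [/\ P u, Q v & m = u + v]].

Definition lin_indep M (V : Type) d (f : 'I_d -> V -> M) : Prop :=
  forall c : 'I_d -> C,
    (forall v, \sum_i c i *: f i v = 0) -> forall i, c i = 0.

Definition hom_dim_le V M (b : nat) : Prop :=
  forall d (f : 'I_d -> V -> M),
    (forall i, lm_hom (f i)) -> lin_indep f -> (d <= b)%N.

Definition bounded_mult M : Prop :=
  exists b, forall V, simple_mod V -> finite_dim V -> hom_dim_le V M b.

(* [M] is isomorphic to the external direct sum of the [V i]; elements of the
   latter are the finitely supported families. *)
Definition direct_sum_of (V : nat -> lieMod g) M : Prop :=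
  exists f : forall i, V i -> M,
    [/\ forall i, lm_hom (f i),
        forall m, exists b (v : forall i, V i), m = \sum_(i < b) f i (v i)
      & forall b (v : forall i, V i),
          \sum_(i < b) f i (v i) = 0 -> forall i, (i < b)%N -> v i = 0].

(* For [g] isomorphic to sl(2), [M] is the direct sum of V_(d 0), V_(d 1), ... *)
Definition decomposes_as M (d : nat -> nat) : Prop :=
  exists V : nat -> lieMod g,
    (forall i, simple_mod (V i) /\ has_dim (V i) (d i).+1) /\ direct_sum_of V M.

(* The enveloping algebra U(g), as terms modulo the congruence [Ueq]. *)
Inductive Uterm : Type :=
| Ugen of subvs_of g
| Uscal of C
| Uadd of Uterm & Uterm
| Umul of Uterm & Uterm.

Inductive Ueq : Uterm -> Uterm -> Prop :=
| Ueq_refl u : Ueq u u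
| Ueq_sym u v : Ueq u v -> Ueq v u
| Ueq_trans u v w : Ueq u v -> Ueq v w -> Ueq u w
| Ueq_add u u' v v' : Ueq u u' -> Ueq v v' -> Ueq (Uadd u v) (Uadd u' v')
| Ueq_mul u u' v v' : Ueq u u' -> Ueq v v' -> Ueq (Umul u v) (Umul u' v')
| Ueq_addA u v w : Ueq (Uadd u (Uadd v w)) (Uadd (Uadd u v) w)
| Ueq_addC u v : Ueq (Uadd u v) (Uadd v u)
| Ueq_add0 u : Ueq (Uadd (Uscal 0) u) u
| Ueq_mulA u v w : Ueq (Umul u (Umul v w)) (Umul (Umul u v) w)
| Ueq_mul1 u : Ueq (Umul (Uscal 1) u) u
| Ueq_mul0 u : Ueq (Umul (Uscal 0) u) (Uscal 0)
| Ueq_mulDl u v w : Ueq (Umul (Uadd u v) w) (Uadd (Umul u w) (Umul v w))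
| Ueq_mulDr u v w : Ueq (Umul u (Uadd v w)) (Uadd (Umul u v) (Umul u w))
| Ueq_scalD a b : Ueq (Uscal (a + b)) (Uadd (Uscal a) (Uscal b))
| Ueq_scalM a b : Ueq (Uscal (a * b)) (Umul (Uscal a) (Uscal b))
| Ueq_scalC a u : Ueq (Umul (Uscal a) u) (Umul u (Uscal a))
| Ueq_gen a x y :
    Ueq (Ugen (a *: x + y)) (Uadd (Umul (Uscal a) (Ugen x)) (Ugen y))
| Ueq_br x y z : vsval z = lie_br (vsval x) (vsval y) ->
    Ueq (Uadd (Ugen z) (Umul (Ugen y) (Ugen x))) (Umul (Ugen x) (Ugen y)).

Fixpoint Uact M (u : Uterm) (m : M) : M :=
  match u with
  | Ugen x => act (vsval x) m
  | Uscal a => a *: m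
  | Uadd u v => Uact u m + Uact v m
  | Umul u v => Uact u (Uact v m)
  end.

Lemma Uact_linear M u : linear (@Uact M u).
Proof.
elim: u => [x|c|u IHu v IHv|u IHu v IHv] a m p /=.
- exact: (act_linear (subvsP x)).
- by rewrite scalerDr !scalerA mulrC.
- by rewrite IHu IHv scalerDr addrACA.
- by rewrite IHv IHu.
Qed.

Lemma Uact_Ueq M u v : Ueq u v -> forall m : M, Uact u m = Uact v m.
Proof.
have addE w (m p : M) : Uact w (m + p) = Uact w m + Uact w p.
  by have := @Uact_linear M w 1 m p; rewrite !scale1r.
have act0 w : Uact w (0 : M) = 0.
  by apply: (@addrI _ (Uact w (0 : M))); rewrite -addE !addr0.
elim=> {u v} //=.
- by move=> u v w _ IHu _ IHv m; rewrite IHu.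
- by move=> u u' v v' _ IHu _ IHv m; rewrite IHu IHv.
- by move=> u u' v v' _ IHu _ IHv m; rewrite IHu IHv.
- by move=> u v w m; rewrite addrA.
- by move=> u v m; rewrite addrC.
- by move=> u m; rewrite scale0r add0r.
- by move=> u m; rewrite scale1r.
- by move=> u m; rewrite !scale0r.
- by move=> a b m; rewrite scalerDl.
- by move=> a b m; rewrite scalerA.
- move=> a u m; have := @Uact_linear M u a m 0.
  by rewrite !addr0 act0 addr0 => ->.
- by move=> a x y m; rewrite (act_linearl a (subvsP x) (subvsP y)).
- move=> x y z -> m; rewrite (act_br (subvsP x) (subvsP y)).
  by rewrite subrK.
Qed.

Definition Ucentral (z : Uterm) : Prop := forall u, Ueq (Umul z u) (Umul u z).

(* Only the values of [chi] on central elements matter. *)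
Definition has_central_character M (chi : Uterm -> C) : Prop :=
  forall z, Ucentral z -> forall m : M, Uact z m = chi z *: m.

End Modules.

Definition gk_module (C : fieldType) n (g k : lieAlg C n) (kg : (k <= g)%VS)
    (M : lieMod g) : Prop :=
  locally_finite (lm_res kg M) /\ semisimple_mod (lm_res kg M).

Definition bounded_gk_module (C : fieldType) n (g k : lieAlg C n)
    (kg : (k <= g)%VS) (M : lieMod g) : Prop :=
  gk_module kg M /\ bounded_mult (lm_res kg M).

Section Sp4Weights.
Variable C : fieldType.

Definition cartan (h : 'M[C]_4) : Prop := h \in @sp4 C /\ is_diag_mx h.

(* The elements of the Cartan subalgebra are diag(h1, h2, -h1, -h2), and
   eps_i takes the value h_i; the pair (a, b) stands for a eps_1 + b eps_2. *)
Definition weight (l : C * C) (h : 'M[C]_4) : C :=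
  l.1 * h (inord 0) (inord 0) + l.2 * h (inord 1) (inord 1).

Definition positive_roots : seq (C * C) :=
  [:: (1, -1); (0, 2%:R); (1, 1); (2%:R, 0)].

Definition root_vector (l : C * C) (x : 'M[C]_4) : Prop :=
  x \in @sp4 C /\ forall h, cartan h -> lie_br h x = weight l h *: x.

Definition highest_weight_vector (l : C * C) (M : lieMod (@sp4 C)) (v : M) :
  Prop :=
  [/\ v != 0, forall h, cartan h -> act h v = weight l h *: v
    & {in positive_roots, forall r x, root_vector r x -> act x v = 0}].

Definition simple_highest_weight (l : C * C) (M : lieMod (@sp4 C)) : Prop :=
  simple_mod M /\ exists v : M, highest_weight_vector l v.

Definition rho : C * C := (2%:R, 1).

(* The central character chi(a, b): the scalar by which a central element acts
   on the simple module of highest weight (a, b) - rho, which is unique up to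
   isomorphism; the value at a non-central [z] is irrelevant. *)
Definition central_char (a b : C) (z : Uterm (@sp4 C)) : C :=
  xget 0 [set c : C | exists L : lieMod (@sp4 C),
    simple_highest_weight (a - rho.1, b - rho.2) L /\
    forall m : L, Uact z m = c *: m].

End Sp4Weights.

(* Main.v *)
From HB Require Import structures.
Require Import Defs.
From mathcomp Require Import all_boot all_order all_algebra ring lra zify.
From mathcomp Require Import boolp classical_sets functions reals.

Set Implicit Arguments.
Unset Strict Implicit.
Unset Printing Implicit Defensive.

Import Order.TTheory GRing.Theory Num.Theory.
Local Open Scope ring_scope.

(** Central character. The quadratic elements of the Weyl algebra in two variables span a copy of
    sp(4), so modules over the Weyl algebra are sp(4)-modules. A central element of the enveloping
    algebra becomes a Weyl algebra element commuting with the squares of the generators, and such an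
    element is a scalar ([rweyl_central], [weyl_central]). The even part of the Weil representation
    is the simple module of highest weight (-1/2, -1/2) = (3/2, 1/2) - rho, so the given central
    character is the common one of all Weyl algebra modules ([central_char_weyl]).

    Reduction. A regular nilpotent of sp(4) has nonzero cube on C^4. Hence C^4 restricts to V_3 on a
    principal sl(2), and the subalgebra is conjugate under Sp(4) to the standard one spanned by e,
    h, f = [xe], [xh], [xf] ([principal_standard]). Twisting modules by the conjugating matrix
    reduces to this case. There sp(4) = V_2 + V_6, and X = [xX] is a highest weight vector of V_6.

    Existence. On binary forms whose degrees are congruent to a fixed r = 0 or 1 modulo 3, four
    operators [qop], each the multiplication by a cubic monomial plus a third order differential
    operator divided by a polynomial in the degree, satisfy the Weyl relations ([qop_comm]).
    Products of two of them change degrees by 0 or 6, up to sign, so the degrees congruent to 0, 1,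
    3, 4 modulo 6 give four modules. They are simple ([model_simple]), and each V_d occurs at most
    once in them ([lat_hom_dim]).

    Uniqueness. Let N be simple and bounded with this central character. If X had a kernel, all root
    vectors would act locally nilpotently and N would have a highest weight vector of dominant
    integral weight, where the Casimir element [xCas] is nonpositive; but its value is 5/2
    ([torsion_absurd]). So X is injective. By boundedness the highest weight vectors of each
    sl(2)-weight form a space of bounded dimension; multiplication by powers of X compares the
    weights, so the operators commuting with e and X behave as in finite dimension, up to powers of
    X. This produces a nonzero vector killed by five elements of the Joseph ideal, the kernel of the
    map to the Weyl algebra ([jos_exists]). The vectors killed by them form a submodule
    ([jos_submodule]), which is therefore N.

    The Joseph relations express X^2 f through X, b = [xb], e, h ([fgood]). Hence, up to powers of
    X, every vector of N is a polynomial in X and b applied to one highest weight vector v, and two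
    such modules with highest weight vectors of a common weight n are isomorphic ([fgood_iso]). The
    lowest weight vector of the sl(2)-module generated by v excludes n congruent to 2 modulo 3
    ([hwt_mod3]), and each remaining n occurs in exactly one of the four models. *)

(** * Linear identities in modules, by reflection *)

Section LinearProp.
Variables (C : pzRingType) (U V : lmodType C) (f : U -> V).
Hypothesis lf : linear f.

Lemma lin0 : f 0 = 0.
Proof. by have := lf (-1) 0 0; rewrite !scaleN1r addNr addNr. Qed.
Lemma linD u v : f (u + v) = f u + f v.
Proof. by have := lf 1 u v; rewrite !scale1r. Qed.
Lemma linZ a u : f (a *: u) = a *: f u.
Proof. by have := lf a u 0; rewrite lin0 !addr0. Qed.
Lemma linN u : f (- u) = - f u.
Proof. by rewrite -!scaleN1r linZ. Qed.
Lemma linB u v : f (u - v) = f u - f v.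
Proof. by rewrite linD linN. Qed.
Lemma lin_sum (I : Type) (r : seq I) (P : pred I) (F : I -> U) :
  f (\sum_(i <- r | P i) F i) = \sum_(i <- r | P i) f (F i).
Proof. exact: (big_morph _ linD lin0). Qed.
End LinearProp.

(* Linear identities in a module are reduced to identities between scalars. *)
Inductive lexp (C : Type) :=
  | LAt of nat | LAdd of lexp C & lexp C | LOpp of lexp C | LSc of C & lexp C | L0.
Arguments LAt {C}. Arguments L0 {C}.

Section LinearReflection.
Variables (C : pzRingType) (M : lmodType C).

Fixpoint lden (atoms : seq M) (e : lexp C) : M :=
  match e with
  | LAt n => nth 0 atoms n
  | LAdd e1 e2 => lden atoms e1 + lden atoms e2
  | LOpp e1 => - lden atoms e1
  | LSc c e1 => c *: lden atoms e1
  | L0 => 0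
  end.

Fixpoint lcoef (n : nat) (e : lexp C) : C :=
  match e with
  | LAt k => if eqn k n then 1 else 0
  | LAdd e1 e2 => lcoef n e1 + lcoef n e2
  | LOpp e1 => - lcoef n e1
  | LSc c e1 => c * lcoef n e1
  | L0 => 0
  end.

Fixpoint lcheck (n : nat) (e1 e2 : lexp C) : Prop :=
  if n is k.+1 then lcoef k e1 = lcoef k e2 /\ lcheck k e1 e2 else True.

Lemma lden_coef atoms e : lden atoms e = \sum_(i < size atoms) lcoef i e *: nth 0 atoms i.
Proof.
elim: e => [k|e1 IH1 e2 IH2|e1 IH1|c e1 IH1|] /=.
- have eqbE i : eqn k i = (k == i) by [].
  have [ks|ks] := ltnP k (size atoms); last first.
    rewrite nth_default // big1 // => i _; rewrite eqbE.
    by rewrite gtn_eqF ?scale0r // (leq_trans (ltn_ord i)).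
  rewrite (bigD1 (Ordinal ks)) //= eqbE eqxx scale1r big1 ?addr0 // => i ik.
  by rewrite eqbE -(inj_eq val_inj) /= eq_sym in ik *; rewrite (negPf ik) scale0r.
- by rewrite IH1 IH2 -big_split; apply: eq_bigr => i _; rewrite scalerDl.
- by rewrite IH1 -sumrN; apply: eq_bigr => i _; rewrite scaleNr.
- by rewrite IH1 scaler_sumr; apply: eq_bigr => i _; rewrite scalerA.
- by rewrite big1 // => i _; rewrite scale0r.
Qed.

Lemma lcheckP atoms e1 e2 : lcheck (size atoms) e1 e2 -> lden atoms e1 = lden atoms e2.
Proof.
move=> H; rewrite !lden_coef; apply: eq_bigr => -[i /= i_n] _; congr (_ *: _).
elim: (size atoms) H i_n => // n IH /= [e /IH H]; rewrite ltnS leq_eqVlt.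
by case/orP => [/eqP ->|/H].
Qed.

End LinearReflection.

Ltac lm_find x l :=
  match l with
  | x :: _ => constr:(0%N)
  | _ :: ?l' => let n := lm_find x l' in constr:(n.+1)
  end.
Ltac lm_add x l :=
  match l with
  | _ => let n := lm_find x l in constr:(l)
  | [::] => constr:([:: x])
  | ?y :: ?l' => let l'' := lm_add x l' in constr:(y :: l'')
  end.
Ltac lm_atoms t l :=
  match t with
  | (?x + ?y)%R => let l' := lm_atoms x l in lm_atoms y l'
  | (- ?x)%R => lm_atoms x l
  | (?c *: ?x)%R => lm_atoms x l
  | (0)%R => constr:(l)
  | _ => lm_add t l
  end.
Ltac lm_reify C t l :=
  match t with
  | (?x + ?y)%R => let a := lm_reify C x l in let b := lm_reify C y l in constr:(@LAdd C a b)
  | (- ?x)%R => let a := lm_reify C x l in constr:(@LOpp C a)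
  | (?c *: ?x)%R => let a := lm_reify C x l in constr:(@LSc C c a)
  | (0)%R => constr:(@L0 C)
  | _ => let n := lm_find t l in constr:(@LAt C n)
  end.
(** One scalar equation per atom is left to [tac], which is [ring] or [field]. *)
Ltac lmod_with M tac :=
  match goal with |- @eq _ ?x ?y =>
    match type of M with
    | @GRing.Lmodule.type ?C =>
      let l0 := constr:(@nil (GRing.Lmodule.sort M)) in
      let l1 := lm_atoms x l0 in let l := lm_atoms y l1 in
      let a := lm_reify C x l in let b := lm_reify C y l in
      apply: (@lcheckP C M l a b); cbn [lcheck lcoef size eqn Nat.eqb]; do ?split; tac
    end
  end.

(** * Normal forms of noncommutative polynomials *)

Definition ncpoly := seq (int * seq nat).

Section NormalForm.
Variable br : nat -> nat -> ncpoly.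

Fixpoint nc_insert (c : int) (w : seq nat) (p : ncpoly) : ncpoly :=
  if p is (d, v) :: q then
    if v == w then (d + c, v) :: q else (d, v) :: nc_insert c w q
  else [:: (c, w)].

Definition nc_addl (c : int) (p q : ncpoly) : ncpoly :=
  foldr (fun t => nc_insert (c * t.1) t.2) q p.

Definition nc_bind (F : seq nat -> ncpoly) (p : ncpoly) : ncpoly :=
  foldr (fun t => nc_addl t.1 (F t.2)) [::] p.

(* The fuel only has to be large enough; the result is correct in any case. *)
Fixpoint nc_letter (fuel : nat) (x : nat) (w : seq nat) : ncpoly :=
  if fuel is k.+1 then
    if w is y :: t then
      if (x <= y)%N then [:: (1, x :: w)] else
        nc_addl 1 (nc_bind (fun v => foldr (fun l => nc_bind (nc_letter k l)) [:: (1, t)] v) (br x y))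
          (nc_bind (nc_letter k y) (nc_letter k x t))
    else [:: (1, [:: x])]
  else [:: (1, x :: w)].

Inductive ncexpr := NV of nat | NZ of int | NA of ncexpr & ncexpr | NM of ncexpr & ncexpr.

Definition nc_mul (p q : ncpoly) : ncpoly :=
  nc_bind (fun v => foldr (fun l => nc_bind (nc_letter 60 l)) q v) p.

Fixpoint nc_norm (e : ncexpr) : ncpoly :=
  match e with
  | NV i => [:: (1, [:: i])]
  | NZ z => [:: (z, [::])]
  | NA e1 e2 => nc_addl 1 (nc_norm e1) (nc_norm e2)
  | NM e1 e2 => nc_mul (nc_norm e1) (nc_norm e2)
  end.

(** A sufficient test for equality, on integers and natural numbers only, so that identities in the
    enveloping algebra are proved by [vm_compute] and hold in every module by [nc_eqP]. *)
Definition nc_eq (e1 e2 : ncexpr) : bool :=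
  all (fun t => t.1 == 0) (nc_norm (NA e1 (NM (NZ (-1)) e2))).

Section Eval.
Variables (C : fieldType) (M : lmodType C) (op : nat -> M -> M).

Fixpoint evw (w : seq nat) (m : M) : M := if w is x :: v then op x (evw v m) else m.

Definition evp (p : ncpoly) (m : M) : M := \sum_(t <- p) t.1%:~R *: evw t.2 m.

Fixpoint ev (e : ncexpr) (m : M) : M :=
  match e with
  | NV i => op i m
  | NZ z => z%:~R *: m
  | NA e1 e2 => ev e1 m + ev e2 m
  | NM e1 e2 => ev e1 (ev e2 m)
  end.

Hypothesis op_lin : forall i, linear (op i).

Lemma ev_linear e : linear (ev e).
Proof.
elim: e => [i|z|e1 IH1 e2 IH2|e1 IH1 e2 IH2] a u v /=.
- exact: op_lin.
- by rewrite scalerDr !scalerA mulrC.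
- by rewrite IH1 IH2 scalerDr addrACA.
- by rewrite IH2 IH1.
Qed.

Lemma evw_linear w : linear (evw w).
Proof. by elim: w => //= x w IH a u v; rewrite IH op_lin. Qed.

Lemma evp_linear p : linear (evp p).
Proof.
move=> a u v; rewrite /evp scaler_sumr -big_split /=; apply: eq_bigr => t _.
by rewrite evw_linear scalerDr !scalerA mulrC.
Qed.

Hypothesis br_ok : forall i j m, (j < i)%N ->
  op i (op j m) = op j (op i m) + evp (br i j) m.

Lemma evp_cons t p m : evp (t :: p) m = t.1%:~R *: evw t.2 m + evp p m.
Proof. by rewrite /evp big_cons. Qed.

Lemma evp_nil m : evp [::] m = 0.
Proof. by rewrite /evp big_nil. Qed.

Lemma evp_one w m : evp [:: (1, w)] m = evw w m.
Proof. by rewrite evp_cons evp_nil addr0 /= scale1r. Qed.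

Lemma evp_insert c w p m : evp (nc_insert c w p) m = c%:~R *: evw w m + evp p m.
Proof.
elim: p => [|[d v] p IH] /=; first by rewrite evp_cons.
case: eqP => [->|_]; rewrite !evp_cons /=; last by rewrite IH addrCA.
by rewrite rmorphD /= scalerDl -addrA addrCA.
Qed.

Lemma evp_addl c p q m : evp (nc_addl c p q) m = c%:~R *: evp p m + evp q m.
Proof.
elim: p => [|[d v] p IH] /=; first by rewrite evp_nil scaler0 add0r.
by rewrite evp_insert IH evp_cons /= scalerDr scalerA rmorphM addrA.
Qed.

Lemma evp_bind F (g : M -> M) p m :
  (forall w, evp (F w) m = evw w (g m)) -> evp (nc_bind F p) m = evp p (g m).
Proof.
move=> FE; elim: p => [|[d v] p IH] /=; first by rewrite !evp_nil.
by rewrite evp_addl FE IH evp_cons.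
Qed.

Lemma evp_bindl F x p m :
  (forall w, evp (F w) m = op x (evw w m)) -> evp (nc_bind F p) m = op x (evp p m).
Proof.
have lin0 : op x 0 = 0 by have := op_lin x (-1) 0 0; rewrite !scaler0 scaleN1r !add0r addNr.
move=> FE; elim: p => [|[d v] p IH] /=; first by rewrite !evp_nil.
by rewrite evp_addl FE IH evp_cons op_lin.
Qed.

Lemma evp_word k q v m :
  (forall x w m, evp (nc_letter k x w) m = op x (evw w m)) ->
  evp (foldr (fun l => nc_bind (nc_letter k l)) q v) m = evw v (evp q m).
Proof. by move=> H; elim: v => //= x v IH; rewrite (evp_bindl _ (H x ^~ m)) IH. Qed.

(** Moving x past a smaller letter y costs the commutator of x and y. When the fuel runs out the
    word stays unsorted, which does not change its value. *)
Lemma evp_letter k x w m : evp (nc_letter k x w) m = op x (evw w m).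
Proof.
elim: k x w m => [|k IH] x w m /=; first by rewrite evp_one.
case: w => [|y t]; first by rewrite evp_one.
case: leqP => [_|yx]; first by rewrite evp_one.
rewrite evp_addl scale1r /= br_ok // addrC; congr (_ + _).
  by rewrite (evp_bindl _ (IH y ^~ m)) IH.
apply: (@evp_bind _ (evw t)) => v.
by rewrite evp_word // evp_one.
Qed.

Lemma evp_norm e m : evp (nc_norm e) m = ev e m.
Proof.
elim: e m => [i|z|e1 IH1 e2 IH2|e1 IH1 e2 IH2] m /=.
- by rewrite evp_one.
- by rewrite evp_cons evp_nil addr0.
- by rewrite evp_addl scale1r IH1 IH2.
- rewrite /nc_mul (@evp_bind _ (ev e2)) ?IH1 // => v.
  by rewrite evp_word ?IH2 // => *; exact: evp_letter.
Qed.

Lemma nc_eqP e1 e2 : nc_eq e1 e2 -> forall m, ev e1 m = ev e2 m.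
Proof.
move=> /allP H m; apply/eqP; rewrite -subr_eq0; apply/eqP.
have -> : ev e1 m - ev e2 m = ev (NA e1 (NM (NZ (-1)) e2)) m.
  by rewrite /= rmorphN1 scaleN1r.
rewrite -evp_norm /evp big_seq big1 // => t /H /eqP ->.
by rewrite scale0r.
Qed.

End Eval.
End NormalForm.

(* The basis of sp(4) and its realization by matrices *)
Declare Scope nc_scope.
Delimit Scope nc_scope with nc.
Bind Scope nc_scope with ncexpr.
Notation "x + y" := (NA x y) : nc_scope.
Notation "x * y" := (NM x y) : nc_scope.
Notation "- x" := (NM (NZ (-1)) x) : nc_scope.
Notation "x - y" := (NA x (NM (NZ (-1)) y)) : nc_scope.

(* The basis of sp(4) in terms of quadratic elements of the Weyl algebra with
   [p_i, q_i] = 1: p1^2, p1p2, q2p1, p2^2, q1p1 + 1/2, q2p2 + 1/2, q2^2, q1p2,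
   q1q2, q1^2, in the order of the letters below. *)
Notation xY := (NV 0). Notation xd := (NV 1). Notation xc := (NV 2).
Notation xF := (NV 3). Notation xH := (NV 4). Notation xK := (NV 5).
Notation xE := (NV 6). Notation xa := (NV 7). Notation xb := (NV 8).
Notation xX := (NV 9).

(** For j < i, the commutator of letter i with letter j; the pairs that are not listed commute. *)
Definition sp4_br (i j : nat) : ncpoly :=
  let s (c : int) (k : nat) : ncpoly := [:: (c, [:: k])] in
  match i, j with
  | 2, 1 => s (-1) 0%N
  | 3, 2 => s 2 1%N
  | 4, 0 => s (-2) 0%N | 4, 1 => s (-1) 1%N | 4, 2 => s (-1) 2%N
  | 5, 1 => s (-1) 1%N | 5, 2 => s 1 2%N | 5, 3 => s (-2) 3%N
  | 6, 1 => s (-2) 2%N | 6, 3 => s (-4) 5%N | 6, 5 => s (-2) 6%N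
  | 7, 0 => s (-2) 1%N | 7, 1 => s (-1) 3%N
  | 7, 2 => [:: (1, [:: 4%N]); (-1, [:: 5%N])]
  | 7, 4 => s (-1) 7%N | 7, 5 => s 1 7%N | 7, 6 => s 2 8%N
  | 8, 0 => s (-2) 2%N | 8, 1 => [:: (-1, [:: 4%N]); (-1, [:: 5%N])]
  | 8, 2 => s (-1) 6%N | 8, 3 => s (-2) 7%N | 8, 4 => s (-1) 8%N
  | 8, 5 => s (-1) 8%N | 8, 7 => s (-1) 9%N
  | 9, 0 => s (-4) 4%N | 9, 1 => s (-2) 7%N | 9, 2 => s (-2) 8%N
  | 9, 4 => s (-2) 9%N
  | _, _ => [::]
  end%R.

(** The elements [xJE], [xJK], [xJF], [xGp], [xGm] vanish in the Weyl algebra (for instance X E =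
    q1^2 q2^2 = b^2) and commute with X, a, b. Up to powers of X, the first three behave like the
    basis of an sl(2) and the last two like a doublet for it. *)
Definition xJE : ncexpr := xX * xE - xb * xb.
Definition xJK : ncexpr := NZ 2 * (xX * xK) - xa * xb - xb * xa.
Definition xJF : ncexpr := xX * xF - xa * xa.
Definition xGp : ncexpr := NZ 2 * (xX * (xX * xc)) - xX * (xb * (NZ 2 * xH - NZ 1)) + xb * xJK - NZ 2 * (xa * xJE).
Definition xGm : ncexpr := NZ 2 * (xX * (xX * xd)) - xX * (xa * (NZ 2 * xH - NZ 1)) - xa * xJK + NZ 2 * (xb * xJF).
Definition xCas : ncexpr := xX * xY + NZ 2 * (xb * xd) + xE * xF - NZ 2 * (xa * xc) - xH * xH - xK * xK + NZ 4 * xH + NZ 2 * xK.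
Definition xC4 : ncexpr := xJK * xJK + NZ 4 * (xX * xJK) - NZ 4 * (xJF * xJE).
(** A step operator: [xGm] corrected by [xGp] so that the kernel of [xJE] is preserved. It lowers
    the eigenvalue of [xJK] relative to X by 2. *)
Definition xL : ncexpr := xJF * xGp - xGm * (xJK + NZ 2 * xX).

Section Sp4Basis.
Variable C : fieldType.
Implicit Types x y : 'M[C]_4.

Definition ent (x : 'M[C]_4) (r s : nat) : C := x (inord r) (inord s).

Lemma entE x (r s : 'I_4) : x r s = ent x r s.
Proof. by rewrite /ent !inord_val. Qed.

Lemma ent_inj x y :
  (forall r s, (r < 4)%N -> (s < 4)%N -> ent x r s = ent y r s) -> x = y.
Proof. by move=> H; apply/matrixP => r s; rewrite !entE H. Qed.

Lemma entM x y r s : ent (x *m y) r s =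
  ent x r 0 * ent y 0 s + ent x r 1 * ent y 1 s + ent x r 2 * ent y 2 s
  + ent x r 3 * ent y 3 s.
Proof.
rewrite {1}/ent mxE.
under eq_bigr => t _.
  rewrite -[t in x _ t](inord_val t) -[t in y t _](inord_val t) -![_ (inord _) (inord _)]/(ent _ _ _); over.
rewrite -(big_mkord xpredT (fun t => ent x r t * ent y t s)).
by rewrite /index_iota /= !big_cons big_nil !addrA addr0.
Qed.

Lemma entD x y r s : ent (x + y) r s = ent x r s + ent y r s.
Proof. by rewrite /ent mxE. Qed.
Lemma entN x r s : ent (- x) r s = - ent x r s.
Proof. by rewrite /ent mxE. Qed.
Lemma entZ a x r s : ent (a *: x) r s = a * ent x r s.
Proof. by rewrite /ent mxE. Qed.
Lemma ent0 r s : ent 0 r s = 0.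
Proof. by rewrite /ent mxE. Qed.
Lemma entT x r s : ent x^T r s = ent x s r.
Proof. by rewrite /ent mxE. Qed.
Lemma blockJ (i j : 'I_(2 + 2)) :
  (block_mx 0 1%:M (- 1%:M) 0 : 'M[C]_(2 + 2)) i j =
  (if j == (i + 2)%N :> nat then 1 else if i == (j + 2)%N :> nat then -1 else 0 : int)%:~R.
Proof.
rewrite -(fintype.splitK i) -(fintype.splitK j).
by case: (fintype.split i) => i'; case: (fintype.split j) => j' /=;
  rewrite ?(block_mxEul, block_mxEur, block_mxEdl, block_mxEdr) !mxE;
  case: i' => [[|[|?]] ?] //; case: j' => [[|[|?]] ?] //=; rewrite ?oppr0.
Qed.

Lemma entJ r s : (r < 4)%N -> (s < 4)%N ->
  ent (symplJ C) r s = (if s == (r + 2)%N then 1 else if r == (s + 2)%N then -1 else 0 : int)%:~R.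
Proof. by move=> r4 s4; rewrite /ent [LHS]blockJ !inordK. Qed.

(** The matrix entries of the letters, kept as integers so that the bracket relations can be checked
    by computation. *)
Definition spT (i r s : nat) : int :=
  match i, r, s with
  | 0, 2, 0 => -2
  | 1, 3, 0 => -1 | 1, 2, 1 => -1
  | 2, 1, 0 => 1 | 2, 2, 3 => -1
  | 3, 3, 1 => -2
  | 4, 0, 0 => 1 | 4, 2, 2 => -1
  | 5, 1, 1 => 1 | 5, 3, 3 => -1
  | 6, 1, 3 => 2
  | 7, 0, 1 => 1 | 7, 3, 2 => -1
  | 8, 0, 3 => 1 | 8, 1, 2 => 1
  | 9, 0, 2 => 2
  | _, _, _ => 0
  end%R.

Definition spB (i : nat) : 'M[C]_4 := \matrix_(r, s) (spT i r s)%:~R.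

Lemma ent_spB i r s : (r < 4)%N -> (s < 4)%N -> ent (spB i) r s = (spT i r s)%:~R.
Proof. by move=> r4 s4; rewrite /ent mxE !inordK. Qed.

Definition spM (i j r s : nat) : int :=
  spT i r 0 * spT j 0 s + spT i r 1 * spT j 1 s + spT i r 2 * spT j 2 s
  + spT i r 3 * spT j 3 s.

Lemma ent_spM i j r s : (r < 4)%N -> (s < 4)%N ->
  ent (spB i *m spB j) r s = (spM i j r s)%:~R.
Proof. by move=> r4 s4; rewrite entM !ent_spB // /spM !rmorphD !rmorphM. Qed.

Lemma spB_sp4 i : spB i \in @sp4 C.
Proof.
rewrite mem_sp4; apply/eqP/ent_inj.
pose J r s : int := if s == (r + 2)%N then 1 else if r == (s + 2)%N then -1 else 0.
have chk : [forall i : 'I_10, forall r : 'I_4, forall s : 'I_4,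
  spT i 0 r * J 0 s + spT i 1 r * J 1 s + spT i 2 r * J 2 s + spT i 3 r * J 3 s
  + (J r 0 * spT i 0 s + J r 1 * spT i 1 s + J r 2 * spT i 2 s + J r 3 * spT i 3 s) == 0].
  apply/forallP => -[[|[|[|[|[|[|[|[|[|[|?]]]]]]]]]] ?] //;
  by apply/forallP => -[[|[|[|[|?]]]] ?] //; apply/forallP => -[[|[|[|[|?]]]] ?].
move=> r s r4 s4; rewrite ent0 entD !entM !entT !ent_spB // !entJ //.
rewrite -!rmorphM -!rmorphD /=.
have [i10|i10] := ltnP i 10.
  have /forallP/(_ (Ordinal i10))/forallP/(_ (Ordinal r4))/forallP/(_ (Ordinal s4))/eqP := chk.
  by rewrite /J /= => ->.
have z a c : spT i a c = 0 by case: i i10 => [|[|[|[|[|[|[|[|[|[|?]]]]]]]]]].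
by rewrite !z !(mul0r, mulr0, addr0).
Qed.

Definition spP (r s : nat) (p : ncpoly) : int :=
  foldr (fun t z => t.1 * spT (head 10 t.2) r s + z) 0 p.

Definition all_below (n : nat) (p : pred nat) := all p (iota 0 n).

Lemma all_belowP n p : all_below n p -> forall i, (i < n)%N -> p i.
Proof. by move=> /seq.allP H i i_n; apply: H; rewrite mem_iota. Qed.

Lemma sp4_br_ok : all_below 10 (fun i => all_below i (fun j =>
  all_below 4 (fun r => all_below 4 (fun s =>
   spM i j r s - spM j i r s == spP r s (sp4_br i j))))).
Proof. by vm_compute. Qed.

Lemma sp4_br_single : all_below 10 (fun i => all_below i (fun j =>
  all (fun t => t.2 == [:: head 10 t.2])%N (sp4_br i j))).
Proof. by vm_compute. Qed.

Lemma lie_spB i j : (j < i)%N -> (i < 10)%N ->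
  lie_br (spB i) (spB j) = \sum_(t <- sp4_br i j) t.1%:~R *: spB (head 10 t.2).
Proof.
move=> ji i10; apply: ent_inj => r s r4 s4.
have h1 := all_belowP sp4_br_ok i10.
have h2 := all_belowP h1 ji.
have h3 := all_belowP h2 r4.
have /eqP e := all_belowP h3 s4.
rewrite /lie_br entD entN !ent_spM // -rmorphB e {1}/ent summxE.
elim: (sp4_br i j) => [|t p IH]; first by rewrite big_nil.
by rewrite big_cons -IH /= rmorphD rmorphM !mxE !inordK.
Qed.

Lemma spB_big i : (9 < i)%N -> spB i = 0.
Proof.
move=> i10; apply: ent_inj => r s r4 s4; rewrite ent_spB // ent0.
by case: i i10 => [|[|[|[|[|[|[|[|[|[|?]]]]]]]]]].
Qed.

Lemma sp4_ents x : x \in @sp4 C ->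
  [/\ ent x 2 2 = - ent x 0 0, ent x 3 3 = - ent x 1 1, ent x 2 3 = - ent x 1 0,
      ent x 3 2 = - ent x 0 1 & ent x 1 2 = ent x 0 3 /\ ent x 2 1 = ent x 3 0].
Proof.
rewrite mem_sp4 => /eqP e.
have H r s (r4 : (r < 4)%N) (s4 : (s < 4)%N) : ent (x^T *m symplJ C + symplJ C *m x) r s = 0.
  by rewrite e ent0.
have f r s (r4 : (r < 4)%N) (s4 : (s < 4)%N) := H r s r4 s4.
split.
- have := f 0%N 2%N isT isT; rewrite entD !entM !entT !entJ //= => g.
  by apply/eqP; rewrite -addr_eq0 -g; apply/eqP; ring.
- have := f 1%N 3%N isT isT; rewrite entD !entM !entT !entJ //= => g.
  by apply/eqP; rewrite -addr_eq0 -g; apply/eqP; ring.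
- have := f 0%N 3%N isT isT; rewrite entD !entM !entT !entJ //= => g.
  by apply/eqP; rewrite -addr_eq0 -g; apply/eqP; ring.
- have := f 1%N 2%N isT isT; rewrite entD !entM !entT !entJ //= => g.
  by apply/eqP; rewrite -addr_eq0 -g; apply/eqP; ring.
split.
- have := f 3%N 2%N isT isT; rewrite entD !entM !entT !entJ //= => g.
  by apply/eqP; rewrite -subr_eq0 -oppr_eq0 -g; apply/eqP; ring.
- have := f 0%N 1%N isT isT; rewrite entD !entM !entT !entJ //= => g.
  by apply/eqP; rewrite -subr_eq0 -g; apply/eqP; ring.
Qed.

End Sp4Basis.

Section Sp4Coord.
Variable C : numFieldType.
Implicit Types x y : 'M[C]_4.

Definition sp4_coord x (i : nat) : C :=
  match i with
  | 0 => - ent x 2 0 / 2%:R | 1 => - ent x 3 0 | 2 => ent x 1 0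
  | 3 => - ent x 3 1 / 2%:R | 4 => ent x 0 0 | 5 => ent x 1 1
  | 6 => ent x 1 3 / 2%:R | 7 => ent x 0 1 | 8 => ent x 0 3
  | _ => ent x 0 2 / 2%:R
  end.

Lemma sp4_decomp x : x \in @sp4 C -> x = \sum_(i < 10) sp4_coord x i *: spB C i.
Proof.
move=> /sp4_ents [e1 e2 e3 e4 [e5 e6]].
have n2 : (2%:R : C) != 0 by rewrite pnatr_eq0.
rewrite -(big_mkord xpredT (fun i => sp4_coord x i *: spB C i)).
rewrite /index_iota /= !big_cons big_nil addr0.
apply: ent_inj => -[|[|[|[|?]]]] [|[|[|[|?]]]] // _ _; rewrite !entD !entZ !ent_spB //=;
  rewrite ?(e1, e2, e3, e4, e5, e6); by field.
Qed.

End Sp4Coord.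

Section Sp4Module.
Variables (C : numFieldType) (M : lieMod (@sp4 C)).

Definition opm (i : nat) : M -> M := act (spB C i).

Lemma opm_linear i : linear (opm i).
Proof. exact: act_linear (spB_sp4 C i). Qed.

Lemma act0l (n : nat) (g : lieAlg C n) (N : lieMod g) (m : N) : act 0 m = 0.
Proof.
have := act_linearl (-1) (mem0v g) (mem0v g) m.
by rewrite scaleN1r addNr scaleN1r addNr.
Qed.

Lemma act_suml (n : nat) (g : lieAlg C n) (N : lieMod g) (I : Type) (r : seq I)
    (c : I -> C) (x : I -> 'M[C]_n) (m : N) :
  (forall i, x i \in lie_space g) ->
  act (\sum_(i <- r) c i *: x i) m = \sum_(i <- r) c i *: act (x i) m.
Proof.
move=> gx; elim: r => [|i r IH]; first by rewrite !big_nil act0l.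
rewrite !big_cons act_linearl ?IH //.
by apply: memv_suml => j _; apply: memvZ.
Qed.

Lemma opm_br i j m : (j < i)%N -> opm i (opm j m) = opm j (opm i m) + evp opm (sp4_br i j) m.
Proof.
move=> ji; have [i10|i10] := ltnP i 10; last first.
  rewrite /opm (spB_big _ i10) !act0l.
  have -> : sp4_br i j = [::] by case: i {ji} i10 => [|[|[|[|[|[|[|[|[|[|?]]]]]]]]]].
  by rewrite evp_nil addr0 -/(opm j 0) (lin0 (opm_linear j)).
have -> : evp opm (sp4_br i j) m = act (lie_br (spB C i) (spB C j)) m.
  rewrite lie_spB // act_suml; last by move=> t; apply: spB_sp4.
  have := all_belowP (all_belowP sp4_br_single i10) ji.
  rewrite /evp; elim: (sp4_br i j) => [|[c w] p IH] /=; first by rewrite !big_nil.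
  by case/andP => /eqP e /IH ep; rewrite !big_cons ep /= e.
by rewrite act_br ?spB_sp4 // /opm addrC subrK.
Qed.

Lemma opm_eq e1 e2 : nc_eq sp4_br e1 e2 -> forall m, ev opm e1 m = ev opm e2 m.
Proof. exact: (nc_eqP opm_linear opm_br). Qed.

End Sp4Module.

(** * Submodules, and the enveloping algebra as a module over itself *)

Section QuotientScope.
Local Open Scope quotient_scope.

Section SubModule.
Variables (C : fieldType) (n : nat) (g : lieAlg C n) (M : lieMod g).

Definition subm_pred (P : M -> Prop) (sP : submodule P) : {pred M} := fun m => `[< P m >].

Lemma subm_predP P (sP : submodule P) m : reflect (P m) (m \in subm_pred sP).
Proof. exact: asboolP. Qed.

Lemma subm_pred_closed P (sP : submodule P) : submod_closed (subm_pred sP).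
Proof.
have [P0 Plin _] := sP; split; first exact/subm_predP.
by move=> a u v /subm_predP Pu /subm_predP Pv; apply/subm_predP/Plin.
Qed.

HB.instance Definition _ P (sP : submodule P) :=
  GRing.isSubmodClosed.Build C M (subm_pred sP) (subm_pred_closed sP).

Record subm P (sP : submodule P) := Subm { subm_val : M; _ : subm_val \in subm_pred sP }.

HB.instance Definition _ P (sP : submodule P) := [isSub for @subm_val P sP].
HB.instance Definition _ P (sP : submodule P) := [Choice of subm sP by <:].
HB.instance Definition _ P (sP : submodule P) := [SubChoice_isSubLmodule of subm sP by <:].

Variables (P : M -> Prop) (sP : submodule P).

Lemma subm_act_subproof x (m : subm sP) :
  (if x \in lie_space g then act x (val m) else 0) \in subm_pred sP.
Proof.
have [P0 _ Pact] := sP; case: ifP => gx; last exact/subm_predP.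
by apply/subm_predP/Pact => //; apply/subm_predP/valP.
Qed.

Definition subm_act x (m : subm sP) : subm sP := Subm (subm_act_subproof x m).

Lemma val_subm_act x m : x \in lie_space g -> val (subm_act x m) = act x (val m).
Proof. by rewrite /= => ->. Qed.

Definition sub_lieMod : lieMod g.
Proof.
refine (@LieMod C n g (subm sP : lmodType C) subm_act _ _ _).
- move=> x gx a u v; apply: val_inj; rewrite linearP /= gx.
  by rewrite (act_linear gx).
- move=> a x y gx gy m; apply: val_inj; rewrite linearP /= gx gy.
  by rewrite memvD ?memvZ // act_linearl.
- move=> x y gx gy m; apply: val_inj; rewrite linearB /= gx gy (lie_closed gx gy).
  by rewrite act_br.
Defined.

Definition sub_val : sub_lieMod -> M := @subm_val P sP.

Lemma sub_val_inj : injective sub_val. Proof. exact: val_inj. Qed.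

Lemma sub_val_linear : linear sub_val.
Proof. exact: (linearP (\val : {linear subm sP -> M})). Qed.

Lemma sub_val_act x (m : sub_lieMod) : x \in lie_space g -> sub_val (act x m) = act x (sub_val m).
Proof. by move=> gx; rewrite /sub_val /= gx. Qed.

Lemma sub_valP (m : sub_lieMod) : P (sub_val m).
Proof. exact/subm_predP/valP. Qed.

Definition sub_in (m : M) (Pm : P m) : sub_lieMod := Subm (introT (subm_predP sP m) Pm).

Lemma sub_inK m (Pm : P m) : sub_val (sub_in Pm) = m. Proof. by []. Qed.

End SubModule.

Section UHom.
Variables (C : fieldType) (n : nat) (g : lieAlg C n).

Lemma Uact_hom (M N : lieMod g) (f : M -> N) u m : lm_hom f -> f (Uact u m) = Uact u (f m).
Proof.
case=> lf fact; elim: u m => [x|a|u IHu v IHv|u IHu v IHv] m /=.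
- exact: fact (subvsP x) _.
- exact: linZ.
- by rewrite (linD lf) IHu IHv.
- by rewrite IHu IHv.
Qed.

(* [Uact u] commutes with every linear operator commuting with [g]. *)
Lemma Uact_comm (M : lieMod g) (f : M -> M) u m :
  linear f -> {in lie_space g, forall x m, f (act x m) = act x (f m)} ->
  f (Uact u m) = Uact u (f m).
Proof. by move=> lf fact; apply: Uact_hom. Qed.

Lemma submodule_Uact (M : lieMod g) (P : M -> Prop) u m : submodule P -> P m -> P (Uact u m).
Proof.
move=> [P0 Plin Pact]; elim: u m => [x|a|u IHu v IHv|u IHu v IHv] m Pm /=.
- exact: Pact (subvsP x) _ Pm.
- by rewrite -[_ *: _]addr0; apply: Plin.
- by rewrite -[Uact u m]scale1r; apply: Plin; [apply: IHu | apply: IHv].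
- by apply: IHu; apply: IHv.
Qed.

End UHom.

Section RegularModule.
Variables (C : fieldType) (n : nat) (g : lieAlg C n).

Definition Ueqb (u v : Uterm g) : bool := `[< Ueq u v >].

Lemma Ueqb_refl : reflexive Ueqb.
Proof. by move=> u; apply/asboolP; apply: Ueq_refl. Qed.
Lemma Ueqb_sym : symmetric Ueqb.
Proof. by move=> u v; apply/asbool_equiv_eq; split; apply: Ueq_sym. Qed.
Lemma Ueqb_trans : transitive Ueqb.
Proof. by move=> u v w /asboolP uv /asboolP vw; apply/asboolP/(Ueq_trans uv vw). Qed.


HB.instance Definition _ := gen_eqMixin (Uterm g).
HB.instance Definition _ := gen_choiceMixin (Uterm g).

Canonical Ueq_equiv := EquivRel Ueqb Ueqb_refl Ueqb_sym Ueqb_trans.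
Definition Uquot := {eq_quot Ueq_equiv}.
HB.instance Definition _ := Choice.on Uquot.

Definition Ucl (u : Uterm g) : Uquot := \pi_Uquot u.

Lemma UclP u v : reflect (Ueq u v) (Ucl u == Ucl v).
Proof. by apply: (equivP eqP); split => [/eqmodP/asboolP|e]; last apply/eqmodP/asboolP. Qed.

Lemma Ucl_eq u v : Ueq u v -> Ucl u = Ucl v.
Proof. by move=> e; apply/eqP/UclP. Qed.

Lemma Ueq_repr u : Ueq (repr (Ucl u)) u.
Proof. by apply/UclP; rewrite /Ucl reprK. Qed.

Lemma Ucl_repr x : Ucl (repr x) = x.
Proof. exact: reprK. Qed.

Definition Uq_add (x y : Uquot) : Uquot := Ucl (Uadd (repr x) (repr y)).
Definition Uq_mul (x y : Uquot) : Uquot := Ucl (Umul (repr x) (repr y)).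

Lemma Uq_addE u v : Uq_add (Ucl u) (Ucl v) = Ucl (Uadd u v).
Proof. by apply/Ucl_eq/Ueq_add; apply: Ueq_repr. Qed.
Lemma Uq_mulE u v : Uq_mul (Ucl u) (Ucl v) = Ucl (Umul u v).
Proof. by apply/Ucl_eq/Ueq_mul; apply: Ueq_repr. Qed.

Lemma Ucl_ind (P : Uquot -> Prop) : (forall u, P (Ucl u)) -> forall x, P x.
Proof. by move=> H x; rewrite -(Ucl_repr x). Qed.

Definition Uq_opp x := Uq_mul (Ucl (Uscal g (-1))) x.

Lemma Uq_addA : associative Uq_add.
Proof.
elim/Ucl_ind => u; elim/Ucl_ind => v; elim/Ucl_ind => w.
by rewrite !Uq_addE; apply/Ucl_eq/Ueq_addA.
Qed.
Lemma Uq_addC : commutative Uq_add.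
Proof.
by elim/Ucl_ind => u; elim/Ucl_ind => v; rewrite !Uq_addE; apply/Ucl_eq/Ueq_addC.
Qed.
Lemma Uq_add0 : left_id (Ucl (Uscal g 0)) Uq_add.
Proof. by elim/Ucl_ind => u; rewrite !Uq_addE; apply/Ucl_eq/Ueq_add0. Qed.
Lemma Uq_addN : left_inverse (Ucl (Uscal g 0)) Uq_opp Uq_add.
Proof.
elim/Ucl_ind => u; rewrite /Uq_opp Uq_mulE Uq_addE; apply/Ucl_eq.
apply: (Ueq_trans (Ueq_add (Ueq_refl _) (Ueq_sym (Ueq_mul1 u)))).
apply: (Ueq_trans (Ueq_sym (Ueq_mulDl _ _ _))).
apply: (Ueq_trans (Ueq_mul (Ueq_sym (Ueq_scalD _ _ _)) (Ueq_refl _))).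
by rewrite addNr; apply: Ueq_mul0.
Qed.

HB.instance Definition _ := GRing.isZmodule.Build Uquot Uq_addA Uq_addC Uq_add0 Uq_addN.

Lemma Ucl_add u v : Ucl (Uadd u v) = Ucl u + Ucl v.
Proof. by rewrite -Uq_addE. Qed.

Definition Uq_scale (a : C) x := Uq_mul (Ucl (Uscal g a)) x.

Lemma Uq_scaleA a b x : Uq_scale a (Uq_scale b x) = Uq_scale (a * b) x.
Proof.
elim/Ucl_ind: x => u; rewrite /Uq_scale !Uq_mulE; apply/Ucl_eq.
apply: (Ueq_trans (Ueq_mulA _ _ _)); apply: Ueq_mul (Ueq_refl _).
exact: Ueq_sym (Ueq_scalM _ _ _).
Qed.
Lemma Uq_scale1 : left_id 1 Uq_scale.
Proof. by elim/Ucl_ind => u; rewrite /Uq_scale Uq_mulE; apply/Ucl_eq/Ueq_mul1. Qed.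
Lemma Uq_scaleDr : right_distributive Uq_scale +%R.
Proof.
move=> a; elim/Ucl_ind => u; elim/Ucl_ind => v.
by rewrite -Ucl_add /Uq_scale !Uq_mulE -Ucl_add; apply/Ucl_eq/Ueq_mulDr.
Qed.
Lemma Uq_scaleDl x : {morph Uq_scale^~ x : a b / a + b}.
Proof.
move=> a b; elim/Ucl_ind: x => u; rewrite /Uq_scale !Uq_mulE -Ucl_add; apply/Ucl_eq.
apply: (Ueq_trans (Ueq_mul (Ueq_scalD _ _ _) (Ueq_refl _))).
exact: Ueq_mulDl.
Qed.

HB.instance Definition _ :=
  GRing.Zmodule_isLmodule.Build C Uquot Uq_scaleA Uq_scale1 Uq_scaleDr Uq_scaleDl.

Lemma Ucl_scale a u : Ucl (Umul (Uscal g a) u) = a *: Ucl u.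
Proof. by rewrite -Uq_mulE. Qed.

Definition Uq_act (x : 'M[C]_n) (m : Uquot) : Uquot := Uq_mul (Ucl (Ugen (vsproj g x))) m.

Lemma Uq_actE x u : Uq_act x (Ucl u) = Ucl (Umul (Ugen (vsproj g x)) u).
Proof. exact: Uq_mulE. Qed.

Definition Umodule : lieMod g.
Proof.
refine (@LieMod C n g (Uquot : lmodType C) Uq_act _ _ _).
- move=> x _ a; elim/Ucl_ind => u; elim/Ucl_ind => v.
  rewrite -Ucl_scale -Ucl_add !Uq_actE -Ucl_scale -Ucl_add; apply/Ucl_eq.
  apply: (Ueq_trans (Ueq_mulDr _ _ _)); apply: Ueq_add (Ueq_refl _).
  apply: (Ueq_trans (Ueq_mulA _ _ _)).
  apply: (Ueq_trans (Ueq_mul (Ueq_sym (Ueq_scalC _ _)) (Ueq_refl _))).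
  exact: Ueq_sym (Ueq_mulA _ _ _).
- move=> a x y gx gy; elim/Ucl_ind => u.
  rewrite !Uq_actE -Ucl_scale -Ucl_add; apply/Ucl_eq; rewrite linearP.
  apply: (Ueq_trans (Ueq_mul (Ueq_gen _ _ _) (Ueq_refl _))).
  apply: (Ueq_trans (Ueq_mulDl _ _ _)); apply: Ueq_add (Ueq_refl _).
  exact: Ueq_sym (Ueq_mulA _ _ _).
- move=> x y gx gy; elim/Ucl_ind => u; apply/eqP.
  rewrite !Uq_actE -subr_eq opprK -Ucl_add; apply/UclP.
  apply: (Ueq_trans (Ueq_add (Ueq_refl _) (Ueq_mulA _ _ _))).
  apply: (Ueq_trans (Ueq_sym (Ueq_mulDl _ _ _))).
  apply: Ueq_sym; apply: (Ueq_trans (Ueq_mulA _ _ _)).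
  apply: Ueq_mul (Ueq_refl _); apply: Ueq_sym; apply: Ueq_br.
  by rewrite !vsprojK // lie_closed.
Defined.

Lemma Uact_Umodule u v : Uact u (Ucl v : Umodule) = Ucl (Umul u v).
Proof.
elim: u v => [x|a|u IHu w IHw|u IHu w IHw] v /=.
- by rewrite Uq_actE vsvalK.
- by rewrite -Ucl_scale.
- by rewrite IHu IHw -Ucl_add; apply: Ucl_eq; apply: Ueq_sym; apply: Ueq_mulDl.
- by rewrite IHw IHu; apply/Ucl_eq/Ueq_mulA.
Qed.

(** The left regular module is faithful: an element is recovered from its action on the class of 1.
    Hence centrality of a concrete element can be tested in modules. *)
Lemma Ueq_of_modules u v :
  (forall (M : lieMod g) (m : M), Uact u m = Uact v m) -> Ueq u v.
Proof.
move=> /(_ Umodule (Ucl (Uscal g 1))); rewrite !Uact_Umodule => /eqP/UclP e.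
have e1 w : Ueq (Umul w (Uscal g 1)) w.
  exact: Ueq_trans (Ueq_sym (Ueq_scalC _ _)) (Ueq_mul1 _).
exact: Ueq_trans (Ueq_sym (e1 u)) (Ueq_trans e (e1 v)).
Qed.

Lemma Ucentral_of_modules z :
  (forall (M : lieMod g), {in lie_space g, forall x (m : M), Uact z (act x m) = act x (Uact z m)}) ->
  Ucentral z.
Proof.
move=> H u; apply: Ueq_of_modules => M m /=.
by apply: Uact_comm; [exact: Uact_linear | exact: H].
Qed.

End RegularModule.

End QuotientScope.

(** * From modules over the Weyl algebra to modules over sp(4) *)

Section Weyl.
Variable C : numFieldType.
Local Notation J := (symplJ C).

Lemma ent1 r s : (r < 4)%N -> (s < 4)%N -> ent (1%:M : 'M[C]_4) r s = (r == s)%:R.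
Proof. by move=> r4 s4; rewrite /ent mxE -val_eqE /= !inordK. Qed.

Lemma JJ : J *m J = - 1%:M.
Proof.
apply: ent_inj => -[|[|[|[|?]]]] [|[|[|[|?]]]] // _ _;
  by rewrite entM entN ent1 // !entJ //=; ring.
Qed.

Lemma JT : J^T = - J.
Proof.
apply: ent_inj => -[|[|[|[|?]]]] [|[|[|[|?]]]] // _ _;
  by rewrite entT entN !entJ //=; ring.
Qed.

Record weyl_ops (M : lmodType C) (z : 'I_4 -> M -> M) : Prop := WeylOps {
  weyl_lin : forall k, linear (z k);
  weyl_comm : forall k l m, z k (z l m) = z l (z k m) + J k l *: m }.

(** The matrix A is sent to a quadratic element of the Weyl algebra, normalized so that its
    commutator with z_m is the sum of the A_km z_k ([weyl_ad]): the generators span the natural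
    representation. *)
Definition weyl_act (M : lmodType C) (z : 'I_4 -> M -> M) (A : 'M[C]_4) (m : M) : M :=
  - 2%:R^-1 *: \sum_k \sum_l (A *m J) k l *: z k (z l m).

Lemma addDDK (V : zmodType) (p q r : V) : p + q + r - p = q + r.
Proof. by rewrite -addrA -addrA addrC addrA subrK. Qed.

Section WeylAct.
Variables (M : lmodType C) (z : 'I_4 -> M -> M).
Hypothesis w : weyl_ops z.
Let zl := weyl_lin w.

Lemma weyl_act_linear A : linear (weyl_act z A).
Proof.
move=> a u v; rewrite /weyl_act scalerA mulrC -scalerA -scalerDr; congr (_ *: _).
rewrite scaler_sumr -big_split; apply: eq_bigr => k _ /=.
rewrite scaler_sumr -big_split; apply: eq_bigr => l _ /=.
by rewrite !zl scalerDr !scalerA mulrC.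
Qed.

Lemma weyl_act_linearl a A B m :
  weyl_act z (a *: A + B) m = a *: weyl_act z A m + weyl_act z B m.
Proof.
rewrite /weyl_act scalerA mulrC -scalerA -scalerDr; congr (_ *: _).
rewrite scaler_sumr -big_split; apply: eq_bigr => k _ /=.
rewrite scaler_sumr -big_split; apply: eq_bigr => l _ /=.
by rewrite mulmxDl -scalemxAl !mxE scalerDl !scalerA.
Qed.

Lemma sp4_symJ (A : 'M[C]_4) : A \in @sp4 C -> J *m A^T = - (A *m J).
Proof.
rewrite mem_sp4 addr_eq0 => /eqP e.
have : J *m (A^T *m J) *m J = J *m (- (J *m A)) *m J by rewrite e.
rewrite mulmxN mulNmx -!mulmxA JJ !mulmxN !mulmx1 !mulmxA JJ.
by rewrite !mulNmx mul1mx opprK => /(congr1 (@GRing.opp _)); rewrite opprK.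
Qed.

Lemma sp4_AJ_sym (A : 'M[C]_4) k l : A \in @sp4 C -> (A *m J) k l = (A *m J) l k.
Proof.
move=> /sp4_symJ e.
have : (A *m J)^T = A *m J by rewrite trmx_mul JT mulNmx e opprK.
by move=> /matrixP/(_ l k); rewrite mxE.
Qed.

Lemma weyl_quad k l j m :
  z k (z l (z j m)) = z j (z k (z l m)) + (J l j *: z k m + J k j *: z l m).
Proof.
rewrite (weyl_comm w l j) (linD (zl k)) (linZ (zl k)) (weyl_comm w k j).
by rewrite -addrA; congr (_ + _); rewrite addrC.
Qed.

(** Commuting z_m0 past z_k z_l leaves two linear terms. As A J is symmetric they contribute
    equally, which cancels the factor 1/2. *)
Lemma weyl_ad A m0 m : A \in @sp4 C ->
  weyl_act z A (z m0 m) = z m0 (weyl_act z A m) + \sum_k A k m0 *: z k m.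
Proof.
move=> spA; apply/eqP; rewrite addrC -subr_eq; apply/eqP.
rewrite /weyl_act (linZ (zl m0)) -scalerBr (lin_sum (zl m0)) -sumrB.
have AJJ k : \sum_l (A *m J) k l * J l m0 = - A k m0.
  have : (A *m J *m J) k m0 = (- A) k m0 by rewrite -mulmxA JJ mulmxN mulmx1.
  by rewrite !mxE.
under eq_bigr => k _.
  rewrite (lin_sum (zl m0)) -sumrB.
  under eq_bigr => l _.
    rewrite (linZ (zl m0)) -scalerBr weyl_quad addrAC subrr add0r scalerDr !scalerA; over.
  rewrite big_split /= -scaler_suml AJJ; over.
rewrite big_split /= exchange_big /=.
have -> : \sum_l \sum_k ((A *m J) k l * J k m0) *: z l m = \sum_l (- A l m0) *: z l m.
  apply: eq_bigr => l _; rewrite -scaler_suml; congr (_ *: _).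
  by rewrite -AJJ; apply: eq_bigr => k _; rewrite sp4_AJ_sym.
rewrite -big_split /= scaler_sumr; apply: eq_bigr => k _.
rewrite -scalerDl scalerA; congr (_ *: _).
have n2 : (2%:R : C) != 0 by rewrite pnatr_eq0.
by field.
Qed.

(** By [weyl_ad] the matrix A acts as a derivation on the products z_k z_l, so its commutator with
    the quadratic element of B is again quadratic; the coefficients match because J A^T = - A J. *)
Lemma weyl_act_br A B m : A \in @sp4 C -> B \in @sp4 C ->
  weyl_act z (lie_br A B) m = weyl_act z A (weyl_act z B m) - weyl_act z B (weyl_act z A m).
Proof.
move=> spA spB; rewrite {5}/weyl_act {4}/weyl_act.
rewrite (linZ (weyl_act_linear A)) -scalerBr (lin_sum (weyl_act_linear A)) -sumrB.
under eq_bigr => k _.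
  rewrite (lin_sum (weyl_act_linear A)) -sumrB.
  under eq_bigr => l _.
    rewrite (linZ (weyl_act_linear A)) -scalerBr weyl_ad // weyl_ad //.
    rewrite (linD (zl k)) addDDK scalerDr.
    rewrite (lin_sum (zl k)) !scaler_sumr.
    under [X in X + _]eq_bigr => j _ do rewrite (linZ (zl k)) scalerA.
    under [X in _ + X]eq_bigr => j _ do rewrite scalerA.
    over.
  over.
under eq_bigr => k _ do rewrite big_split /=.
rewrite big_split /= /weyl_act; congr (_ *: _).
rewrite /lie_br mulmxBl.
have DE (X Y : 'M[C]_4) k l : (X + Y) k l = X k l + Y k l by rewrite mxE.
under [LHS]eq_bigr => k _.
  under eq_bigr => l _ do rewrite DE scalerDl.
  rewrite big_split /=; over.
rewrite big_split /= addrC; congr (_ + _).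
  apply: eq_bigr => k _; rewrite [RHS]exchange_big /=; apply: eq_bigr => j _.
  rewrite -scaler_suml; congr (_ *: _).
  have -> : - (B *m A *m J) = B *m J *m A^T by rewrite -!mulmxA sp4_symJ // mulmxN.
  by rewrite [LHS]mxE; apply: eq_bigr => l _; rewrite [A^T _ _]mxE.
under [RHS]eq_bigr => k _ do rewrite exchange_big /=.
rewrite [RHS]exchange_big /=; apply: eq_bigr => j _.
rewrite [RHS]exchange_big /=; apply: eq_bigr => l _.
rewrite -mulmxA mxE scaler_suml; apply: eq_bigr => k _.
by rewrite mulrC.
Qed.

Definition weylMod : lieMod (@sp4 C) :=
  @LieMod C 4 (@sp4 C) M (weyl_act z)
   (fun A _ => weyl_act_linear A)
   (fun a A B _ _ m => weyl_act_linearl a A B m)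
   (fun A B spA spB m => weyl_act_br m spA spB).

End WeylAct.
End Weyl.

Section WeylCentral.
Variable C : numFieldType.
Local Notation J := (symplJ C).

Lemma JE (k l : 'I_4) : J k l =
  (if l == (k + 2)%N :> nat then 1 else if k == (l + 2)%N :> nat then -1 else 0 : int)%:~R.
Proof. by rewrite entE entJ. Qed.

Definition i40 : 'I_4 := @Ordinal 4 0 isT.
Definition i41 : 'I_4 := @Ordinal 4 1 isT.
Definition i42 : 'I_4 := @Ordinal 4 2 isT.
Definition i43 : 'I_4 := @Ordinal 4 3 isT.

Section WeylLetters.
Variables (M : lmodType C) (z : 'I_4 -> M -> M).
Hypothesis w : weyl_ops z.

Lemma weyl_sum4 (F : 'I_4 -> 'I_4 -> M) :
  \sum_k \sum_l F k l =
  F i40 i40 + F i40 i41 + F i40 i42 + F i40 i43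
  + (F i41 i40 + F i41 i41 + F i41 i42 + F i41 i43)
  + (F i42 i40 + F i42 i41 + F i42 i42 + F i42 i43)
  + (F i43 i40 + F i43 i41 + F i43 i42 + F i43 i43).
Proof.
have e k : \sum_l F k l = F k i40 + F k i41 + F k i42 + F k i43.
  rewrite !big_ord_recr big_ord0 /= add0r.
  by do ![congr (_ + _)]; congr F; apply: val_inj.
rewrite (eq_bigr _ (fun k _ => e k)) !big_ord_recr big_ord0 /= add0r.
by do 6?[congr (_ + _)]; congr F; apply: val_inj.
Qed.

Lemma weyl_comm0 k l m : J k l = 0 -> z k (z l m) = z l (z k m).
Proof. by move=> e; rewrite (weyl_comm w) e scale0r addr0. Qed.

Lemma weyl_letter i m : weyl_act z (spB C i) m =
  match i with
  | 9 => z i40 (z i40 m)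
  | 8 => z i40 (z i41 m)
  | 7 => - z i40 (z i43 m)
  | 6 => z i41 (z i41 m)
  | 5 => 2%:R^-1 *: m - z i41 (z i43 m)
  | 4 => 2%:R^-1 *: m - z i40 (z i42 m)
  | 3 => z i43 (z i43 m)
  | 2 => - z i41 (z i42 m)
  | 1 => z i42 (z i43 m)
  | 0 => z i42 (z i42 m)
  | _ => 0
  end.
Proof.
rewrite /weyl_act weyl_sum4 !entE !entM !ent_spB // !entJ //=.
rewrite (weyl_comm w i41 i40) (weyl_comm w i42 i40) (weyl_comm w i43 i40).
rewrite (weyl_comm w i42 i41) (weyl_comm w i43 i41) (weyl_comm w i43 i42) !JE /=.
by case: i => [|[|[|[|[|[|[|[|[|[|i]]]]]]]]]] /=; lmod_with M ltac:(field).
Qed.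


End WeylLetters.
End WeylCentral.

(** * Central elements act by scalars through the Weyl algebra *)

Section WeylWords.
Variable C : numFieldType.
Local Notation J := (symplJ C).

Section WeylLetters.
Variables (M : lmodType C) (z : 'I_4 -> M -> M).
Hypothesis w : weyl_ops z.

Definition wmon : Type := (nat * nat * nat * nat)%type.

Definition wword (t : wmon) (m : M) : M :=
  let: (a, b, c, d) := t in
  iter a (z i40) (iter b (z i41) (iter c (z i42) (iter d (z i43) m))).

Definition wev (s : seq (C * wmon)) (m : M) : M := \sum_(t <- s) t.1 *: wword t.2 m.

Lemma iter_comm (S T : M -> M) (c : C) n m : linear S ->
  (forall m, T (S m) = S (T m) + c *: m) ->
  T (iter n S m) = iter n S (T m) + (c *+ n) *: iter n.-1 S m.
Proof.
move=> lS H; elim: n => [|n IH] /=; first by rewrite scale0r addr0.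
rewrite H IH (linD lS) -addrA; congr (_ + _).
rewrite (linZ lS) [in RHS]mulrSr scalerDl; congr (_ + _).
by case: n {IH} => [|n] //=; rewrite !mulr0n !scale0r.
Qed.

Lemma iter_comm0 (S T : M -> M) n m : linear S ->
  (forall m, T (S m) = S (T m)) -> T (iter n S m) = iter n S (T m).
Proof. by move=> lS H; elim: n => //= n IH; rewrite H IH. Qed.

Lemma iter_lin (S : M -> M) n : linear S -> linear (iter n S).
Proof. by move=> lS; elim: n => // n IH a u v; rewrite /= IH lS. Qed.

Definition wletter (k : nat) (t : wmon) : seq (C * wmon) :=
  let: (a, b, c, d) := t in
  match k with
  | 0 => [:: (1, (a.+1, b, c, d))]
  | 1 => [:: (1, (a, b.+1, c, d))]
  | 2 => [:: (1, (a, b, c.+1, d)); (- a%:R, (a.-1, b, c, d))]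
  | _ => [:: (1, (a, b, c, d.+1)); (- b%:R, (a, b.-1, c, d))]
  end.

Lemma wletterP (k : 'I_4) t m : z k (wword t m) = wev (wletter k t) m.
Proof.
have zl k' : linear (z k') := weyl_lin w k'.
have c0 k' l : J k' l = 0 -> forall m, z k' (z l m) = z l (z k' m).
  by move=> e m'; apply: weyl_comm0.
have c1 k' l : J k' l = -1 -> forall m, z k' (z l m) = z l (z k' m) + (-1) *: m.
  by move=> e m'; rewrite (weyl_comm w) e.
case: t => [[[a b] c] d]; rewrite /wev /wword.
case: k => -[|[|[|[|//]]]] k4 /=; rewrite !big_cons big_nil /= scale1r addr0.
- by rewrite (_ : Ordinal k4 = i40) //; apply: val_inj.
- have -> : Ordinal k4 = i41 by apply: val_inj.
  by rewrite (iter_comm0 _ _ (zl _) (c0 _ _ _)) // JE.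
- have -> : Ordinal k4 = i42 by apply: val_inj.
  rewrite (iter_comm _ _ (zl _) (c1 _ _ _)) ?JE //.
  by rewrite (iter_comm0 _ _ (zl _) (c0 _ _ _)) ?JE // mulNrn.
- have -> : Ordinal k4 = i43 by apply: val_inj.
  rewrite (iter_comm0 _ _ (zl _) (c0 _ _ _)) ?JE //.
  rewrite (iter_comm _ _ (zl _) (c1 _ _ _)) ?JE // mulNrn.
  rewrite (iter_comm0 c _ (zl _) (c0 _ _ _)) ?JE //.
  by rewrite (linD (iter_lin _ (zl _))) (linZ (iter_lin _ (zl _))).
Qed.

Lemma wev_nil m : wev [::] m = 0. Proof. by rewrite /wev big_nil. Qed.
Lemma wev_cat s1 s2 m : wev (s1 ++ s2) m = wev s1 m + wev s2 m.
Proof. by rewrite /wev big_cat. Qed.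
Lemma wev_scale c s m : wev [seq (c * t.1, t.2) | t <- s] m = c *: wev s m.
Proof.
by rewrite /wev big_map scaler_sumr; apply: eq_bigr => t _; rewrite scalerA.
Qed.

Lemma wev_letter (k : 'I_4) s m :
  z k (wev s m) = wev (flatten [seq [seq (t.1 * u.1, u.2) | u <- wletter k t.2] | t <- s]) m.
Proof.
elim: s => [|t s IH]; first by rewrite /= wev_nil (lin0 (weyl_lin w k)).
rewrite /= wev_cat -IH wev_scale -wletterP.
by rewrite {1}/wev big_cons (weyl_lin w k).
Qed.

Lemma wev_coef s m (c0 : C) :
  (forall t, \sum_(u <- s | u.2 == t) u.1 = if t == (0, 0, 0, 0)%N then c0 else 0) ->
  wev s m = c0 *: m.
Proof.
move=> H; pose r := undup ((0, 0, 0, 0)%N :: [seq u.2 | u <- s]).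
have -> : wev s m = \sum_(t <- r) \sum_(u <- s | u.2 == t) u.1 *: wword t m.
  rewrite (exchange_big_dep predT) //= /wev [LHS]big_seq [RHS]big_seq; apply: eq_bigr => u us.
  rewrite -big_filter (_ : [seq t <- r | u.2 == t] = [:: u.2]) ?big_seq1 //.
  have ur : u.2 \in r by rewrite mem_undup inE map_f ?orbT.
  rewrite (eq_filter (a2 := pred1 u.2)); last by move=> t; rewrite /= eq_sym.
  by rewrite filter_pred1_uniq // undup_uniq.
under eq_bigr => t _ do rewrite -scaler_suml H.
rewrite (bigD1_seq (0, 0, 0, 0)%N) ?undup_uniq ?mem_undup ?inE //= big1 ?addr0 //.
by move=> t /negPf ->; rewrite scale0r.
Qed.

End WeylLetters.

(** The list s depends on u alone and serves all Weyl algebra modules at once. The induction works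
    with an arbitrary initial list [s0], so that products become successive transformations of
    lists. *)
Lemma Uterm_weyl (u : Uterm (@sp4 C)) : exists s : seq (C * wmon),
  forall (M : lieMod (@sp4 C)) (z : 'I_4 -> M -> M), weyl_ops z ->
    {in @sp4 C, forall A (m : M), act A m = weyl_act z A m} ->
    forall m, Uact u m = wev z s m.
Proof.
suff H (s0 : seq (C * wmon)) : exists s : seq (C * wmon),
    forall (M : lieMod (@sp4 C)) (z : 'I_4 -> M -> M), weyl_ops z ->
    {in @sp4 C, forall A (m : M), act A m = weyl_act z A m} ->
    forall m, Uact u (wev z s0 m) = wev z s m.
  have [s Hs] := H [:: (1, (0, 0, 0, 0)%N)]; exists s => M z w wa m.
  by rewrite -Hs // /wev big_seq1 /= scale1r.
elim: u s0 => [x|a|u IHu v IHv|u IHu v IHv] s0.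
- have Hl (k : 'I_4) s : exists s' : seq (C * wmon), forall (M : lmodType C) (z : 'I_4 -> M -> M),
     weyl_ops z -> forall m, z k (wev z s m) = wev z s' m.
    by eexists => M z w m; rewrite (wev_letter w).
  have Hsum (I : Type) (r : seq I) (F : I -> forall M : lmodType C, ('I_4 -> M -> M) -> M -> M) :
    (forall i, exists s' : seq (C * wmon), forall (M : lmodType C) (z : 'I_4 -> M -> M),
     weyl_ops z -> forall m, F i M z m = wev z s' m) ->
    exists s' : seq (C * wmon), forall (M : lmodType C) (z : 'I_4 -> M -> M),
     weyl_ops z -> forall m, \sum_(i <- r) F i M z m = wev z s' m.
    move=> HF; elim: r => [|i r [s' IH]].
      by exists [::] => M z w m; rewrite big_nil wev_nil.
    have [s1 Hs1] := HF i; exists (s1 ++ s') => M z w m.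
    by rewrite big_cons wev_cat IH // Hs1.
  have Hsc c s : exists s' : seq (C * wmon), forall (M : lmodType C) (z : 'I_4 -> M -> M),
     weyl_ops z -> forall m, c *: wev z s m = wev z s' m.
    by eexists => M z w m; rewrite -wev_scale.
  have [s Hs] := Hsum _ (index_enum 'I_4) (fun k M z m => \sum_l (vsval x *m J) k l *: z k (z l (wev z s0 m))) (fun k =>
     Hsum _ (index_enum 'I_4) (fun l M z m => (vsval x *m J) k l *: z k (z l (wev z s0 m))) (fun l =>
      let: ex_intro s1 H1 := Hl l s0 in let: ex_intro s2 H2 := Hl k s1 in
      let: ex_intro s3 H3 := Hsc ((vsval x *m J) k l) s2 in
      ex_intro _ s3 (fun M z w m => etrans (congr1 (fun y => _ *: z k y) (H1 M z w m))
        (etrans (congr1 (fun y => _ *: y) (H2 M z w m)) (H3 M z w m))))).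
  have [s' Hs'] := Hsc (- 2%:R^-1) s.
  by exists s' => M z w wa m /=; rewrite wa ?subvsP // /weyl_act -Hs' // -Hs.
- exists [seq (a * t.1, t.2) | t <- s0] => M z w wa m /=.
  by rewrite wev_scale.
- have [s1 H1] := IHu s0; have [s2 H2] := IHv s0; exists (s1 ++ s2) => M z w wa m /=.
  by rewrite H1 // H2 // wev_cat.
- have [s1 H1] := IHv s0; have [s2 H2] := IHu s1; exists s2 => M z w wa m /=.
  by rewrite H1 // H2.
Qed.

End WeylWords.

Section RegularWeyl.
Variable C : numFieldType.
Local Notation J := (symplJ C).

(* Coefficients of normally ordered monomials z0^a z1^b z2^c z3^d; the Weyl
   algebra acts on itself by left multiplication [rwz] and right
   multiplication [rwr]. *)
Definition rweyl : Type := int -> int -> int -> int -> C^o.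
HB.instance Definition _ := GRing.Lmodule.on rweyl.

Definition rwz (k : 'I_4) (r : rweyl) : rweyl := fun a b c d =>
  match val k with
  | 0 => r (a - 1) b c d
  | 1 => r a (b - 1) c d
  | 2 => r a b (c - 1) d - (a + 1)%:~R * r (a + 1) b c d
  | _ => r a b c (d - 1) - (b + 1)%:~R * r a (b + 1) c d
  end.

Definition rwr (k : 'I_4) (r : rweyl) : rweyl := fun a b c d =>
  match val k with
  | 0 => r (a - 1) b c d - (c + 1)%:~R * r a b (c + 1) d
  | 1 => r a (b - 1) c d - (d + 1)%:~R * r a b c (d + 1)
  | 2 => r a b (c - 1) d
  | _ => r a b c (d - 1)
  end.

Lemma rweylE (x : C) (r s : rweyl) a b c d : (x *: r + s) a b c d = x * r a b c d + s a b c d.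
Proof. by []. Qed.

Lemma rwz_linear k : linear (rwz k).
Proof.
move=> x r s; apply/funext=> a; apply/funext=> b; apply/funext=> c; apply/funext=> d.
by rewrite rweylE /rwz !rweylE; case: k => -[|[|[|[|//]]]] _ /=; ring.
Qed.

Lemma rwr_linear k : linear (rwr k).
Proof.
move=> x r s; apply/funext=> a; apply/funext=> b; apply/funext=> c; apply/funext=> d.
by rewrite rweylE /rwr !rweylE; case: k => -[|[|[|[|//]]]] _ /=; ring.
Qed.

Lemma rwr2_linear k : linear (fun r : rweyl => rwr k (rwr k r)).
Proof. by move=> a r s; rewrite !rwr_linear. Qed.

Lemma rwz_rwr k l r : rwz k (rwr l r) = rwr l (rwz k r).
Proof.
apply/funext=> a; apply/funext=> b; apply/funext=> c; apply/funext=> d.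
rewrite /rwz /rwr; case: k => -[|[|[|[|//]]]] _ /=; case: l => -[|[|[|[|//]]]] _ /=;
  rewrite ?subrK ?addrK ?[_ + 1 - 1]addrK; try ring.
Qed.

Lemma rwz_weyl : weyl_ops rwz.
Proof.
split=> [|k l r]; first exact: rwz_linear.
rewrite addrC JE; apply/funext=> a; apply/funext=> b; apply/funext=> c; apply/funext=> d.
rewrite rweylE /rwz; case: k => -[|[|[|[|//]]]] _ /=; case: l => -[|[|[|[|//]]]] _ /=;
  rewrite ?subrK ?addrK ?[_ + 1 - 1]addrK; ring.
Qed.

Definition rw1 : rweyl := fun a b c d => ((a == 0) && (b == 0) && (c == 0) && (d == 0))%:R.

Lemma rwz_rw1 k : rwz k rw1 = rwr k rw1.
Proof.
have z (n : int) x : (n + 1)%:~R * ((n + 1 == 0) && x)%:R = 0 :> C.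
  by case: eqP => [->|_]; rewrite ?mul0r ?mulr0.
apply/funext=> a; apply/funext=> b; apply/funext=> c; apply/funext=> d.
rewrite /rwz /rwr /rw1; case: k => -[|[|[|[|//]]]] _ /=;
  rewrite ?[_ && (_ + 1 == 0)]andbC -?andbA ?z ?subr0 //.
Qed.

Definition rwd (t : wmon) : rweyl := fun i j k l =>
  let: (a, b, c, d) := t in
  ((i == a%:Z) && (j == b%:Z) && (k == c%:Z) && (l == d%:Z))%:R.

Lemma rwd_word t : wword rwz t rw1 = rwd t.
Proof.
have z (n : int) (x : bool) : (x -> n + 1 = 0) -> (n + 1)%:~R * x%:R = 0 :> C.
  by case: x => [->|_]; rewrite ?mul0r ?mulr0.
have s (i : int) (a : nat) : (i - 1 == a%:Z) = (i == a.+1%:Z) by lia.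
case: t => [[[a b] c] d]; rewrite /wword.
have -> : iter d (rwz i43) rw1 = rwd (0, 0, 0, d)%N.
  elim: d => [|d IH] //=; rewrite IH; apply/funext=> i; apply/funext=> j; apply/funext=> k; apply/funext=> l.
  by rewrite /rwz /rwd /= s z ?subr0 //; lia.
have -> : iter c (rwz i42) (rwd (0, 0, 0, d)%N) = rwd (0, 0, c, d)%N.
  elim: c => [|c IH] //=; rewrite IH; apply/funext=> i; apply/funext=> j; apply/funext=> k; apply/funext=> l.
  by rewrite /rwz /rwd /= s z ?subr0 //; lia.
have -> : iter b (rwz i41) (rwd (0, 0, c, d)%N) = rwd (0, b, c, d)%N.
  elim: b => [|b IH] //=; rewrite IH; apply/funext=> i; apply/funext=> j; apply/funext=> k; apply/funext=> l.
  by rewrite /rwz /rwd /= s.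
elim: a => [|a IH] //=; rewrite IH; apply/funext=> i; apply/funext=> j; apply/funext=> k; apply/funext=> l.
by rewrite /rwz /rwd /= s.
Qed.

Lemma intC_eq0 (n : int) : (n%:~R == 0 :> C) = (n == 0).
Proof. exact: intr_eq0. Qed.

(** Comparing coefficients in z_0^2 r = r z_0^2 gives 2 c r(a,b,c,d) = c (c + 1) r(a+1,b,c+1,d), and
    the other generators give similar relations. A nonzero coefficient with a positive exponent
    would propagate along an infinite diagonal, against the bound N. *)
Lemma rweyl_central (r : rweyl) :
  (forall k, rwz k (rwz k r) = rwr k (rwr k r)) ->
  (exists N : int, forall a b c d, r a b c d != 0 -> (a <= N) && (b <= N) && (c <= N) && (d <= N)) ->
  forall a b c d, r a b c d != 0 -> (a < 1) && (b < 1) && (c < 1) && (d < 1).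
Proof.
move=> comm [N rN].
have at4 k a b c d : rwz k (rwz k r) a b c d = rwr k (rwr k r) a b c d by rewrite comm.
have step (x y : C) (n : int) : (n + 1)%:~R * (2%:R * x - (n + 2)%:~R * y) = 0 -> n + 1 != 0 -> x != 0 -> y != 0.
  move=> /eqP; rewrite mulf_eq0 intC_eq0 => /orP [/eqP -> //|/eqP e] _ x0.
  apply: contra_neq x0 => y0; move: e; rewrite y0 mulr0 subr0 => /eqP.
  by rewrite mulf_eq0 pnatr_eq0 => /eqP.
have e0 a b c d : r a b c d != 0 -> 1 <= c -> r (a + 1) b (c + 1) d != 0.
  move=> r0 c1; apply: (step (r a b c d) _ (c - 1)) => //; last by lia.
  have := at4 i40 (a + 1) b (c - 1) d; rewrite /rwz /rwr /=.
  rewrite !subrK !addrK.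
  move=> /eqP; rewrite -subr_eq0 => /eqP <-.
  by rewrite (_ : c - 1 + 2 = c + 1); [rewrite ?subrK; ring | lia].
have e2 a b c d : r a b c d != 0 -> 1 <= a -> r (a + 1) b (c + 1) d != 0.
  move=> r0 c1; apply: (step (r a b c d) _ (a - 1)) => //; last by lia.
  have := at4 i42 (a - 1) b (c + 1) d; rewrite /rwz /rwr /=.
  rewrite !subrK !addrK.
  move=> /eqP; rewrite eq_sym -subr_eq0 => /eqP <-.
  by rewrite (_ : a - 1 + 2 = a + 1); [rewrite ?subrK; ring | lia].
have e1 a b c d : r a b c d != 0 -> 1 <= d -> r a (b + 1) c (d + 1) != 0.
  move=> r0 c1; apply: (step (r a b c d) _ (d - 1)) => //; last by lia.
  have := at4 i41 a (b + 1) c (d - 1); rewrite /rwz /rwr /=.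
  rewrite !subrK !addrK.
  move=> /eqP; rewrite -subr_eq0 => /eqP <-.
  by rewrite (_ : d - 1 + 2 = d + 1); [rewrite ?subrK; ring | lia].
have e3 a b c d : r a b c d != 0 -> 1 <= b -> r a (b + 1) c (d + 1) != 0.
  move=> r0 c1; apply: (step (r a b c d) _ (b - 1)) => //; last by lia.
  have := at4 i43 a (b - 1) c (d + 1); rewrite /rwz /rwr /=.
  rewrite !subrK !addrK.
  move=> /eqP; rewrite eq_sym -subr_eq0 => /eqP <-.
  by rewrite (_ : b - 1 + 2 = b + 1); [rewrite ?subrK; ring | lia].
have chain0 a b c d (n : nat) : r a b c d != 0 -> 1 <= c -> r (a + n%:Z) b (c + n%:Z) d != 0.
  move=> r0 c1; elim: n => [|n IH]; first by rewrite !addr0.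
  by rewrite intS (addrC 1) !addrA; apply: e0 => //; lia.
have chain2 a b c d (n : nat) : r a b c d != 0 -> 1 <= a -> r (a + n%:Z) b (c + n%:Z) d != 0.
  move=> r0 c1; elim: n => [|n IH]; first by rewrite !addr0.
  by rewrite intS (addrC 1) !addrA; apply: e2 => //; lia.
have chain1 a b c d (n : nat) : r a b c d != 0 -> 1 <= d -> r a (b + n%:Z) c (d + n%:Z) != 0.
  move=> r0 c1; elim: n => [|n IH]; first by rewrite !addr0.
  by rewrite intS (addrC 1) !addrA; apply: e1 => //; lia.
have chain3 a b c d (n : nat) : r a b c d != 0 -> 1 <= b -> r a (b + n%:Z) c (d + n%:Z) != 0.
  move=> r0 c1; elim: n => [|n IH]; first by rewrite !addr0.
  by rewrite intS (addrC 1) !addrA; apply: e3 => //; lia.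
move=> a b c d r0.
case: (boolP (a < 1)) => a1; last by have := rN _ _ _ _ (chain2 a b c d `|N|%N r0 ltac:(lia)); lia.
case: (boolP (b < 1)) => b1; last by have := rN _ _ _ _ (chain3 a b c d `|N|%N r0 ltac:(lia)); lia.
case: (boolP (c < 1)) => c1; last by have := rN _ _ _ _ (chain0 a b c d `|N|%N r0 ltac:(lia)); lia.
case: (boolP (d < 1)) => d1; last by have := rN _ _ _ _ (chain1 a b c d `|N|%N r0 ltac:(lia)); lia.
by [].
Qed.

Lemma wev_rw1 s i j k l : (wev rwz s rw1) i j k l = \sum_(t <- s) t.1 * rwd t.2 i j k l.
Proof.
elim: s => [|t s IH]; first by rewrite wev_nil big_nil.
have -> : wev rwz (t :: s) rw1 = t.1 *: rwd t.2 + wev rwz s rw1.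
  by rewrite {1}/wev big_cons rwd_word.
by rewrite rweylE IH big_cons.
Qed.

Section LeftRight.
Variables (M : lieMod (@sp4 C)) (z rho : 'I_4 -> M -> M) (one : M).
Hypotheses (w : weyl_ops z)
  (wa : {in @sp4 C, forall A (m : M), act A m = weyl_act z A m})
  (lrho : forall k, linear (rho k))
  (zrho : forall k l m, z k (rho l m) = rho l (z k m))
  (zone : forall k, z k one = rho k one).

(** The square of z_k comes from an element of sp(4), so it commutes with u. On the vector [one]
    left multiplication equals right multiplication, and the latter commutes with u. *)
Lemma weyl_central_sq (u : Uterm (@sp4 C)) k : Ucentral u ->
  z k (z k (Uact u one)) = rho k (rho k (Uact u one)).
Proof.
move=> uc.
have rhoA A l m : weyl_act z A (rho l m) = rho l (weyl_act z A m).
  rewrite /weyl_act (linZ (lrho l)) (lin_sum (lrho l)); congr (_ *: _).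
  apply: eq_bigr => i _; rewrite (lin_sum (lrho l)); apply: eq_bigr => j _.
  by rewrite (linZ (lrho l)) !zrho.
have [i ri] : exists i, forall m, weyl_act z (spB C i) m = z k (z k m).
  case: k => -[|[|[|[|//]]]] k4;
    [exists 9%N|exists 6%N|exists 0%N|exists 3%N] => m; rewrite (weyl_letter w).
  - by have -> : Ordinal k4 = i40 by apply: val_inj.
  - by have -> : Ordinal k4 = i41 by apply: val_inj.
  - by have -> : Ordinal k4 = i42 by apply: val_inj.
  - by have -> : Ordinal k4 = i43 by apply: val_inj.
have e (m : M) : Uact u (act (spB C i) m) = act (spB C i) (Uact u m).
  have := Uact_Ueq (uc (Ugen (vsproj (@sp4 C) (spB C i)))) m => /=.
  by rewrite vsprojK ?spB_sp4.
have ai m : act (spB C i) m = z k (z k m) by rewrite wa ?spB_sp4.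
rewrite -ai -e ai zone zrho zone.
rewrite -(Uact_comm (f := fun m : M => rho k (rho k m))) //.
- by move=> a m m'; rewrite !lrho.
- by move=> A spA m; rewrite !wa // !rhoA.
Qed.
End LeftRight.

(** The coefficients of the image of u are read off from its action on 1 in the regular
    representation of the Weyl algebra. Only the constant one survives [rweyl_central], and it is
    the scalar in every module. *)
Lemma weyl_central (u : Uterm (@sp4 C)) : Ucentral u -> exists c0 : C,
  forall (M : lieMod (@sp4 C)) (z : 'I_4 -> M -> M), weyl_ops z ->
    {in @sp4 C, forall A (m : M), act A m = weyl_act z A m} ->
    forall m : M, Uact u m = c0 *: m.
Proof.
move=> uc; have [s Hs] := Uterm_weyl u.
pose RM := weylMod rwz_weyl.
pose r : rweyl := Uact u (rw1 : RM).
have wa : {in @sp4 C, forall A (m : RM), act A m = weyl_act rwz A m} by [].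
have re : r = wev rwz s rw1 := Hs RM rwz rwz_weyl wa rw1.
have rE i j k l : r i j k l = \sum_(t <- s) t.1 * rwd t.2 i j k l.
  by rewrite re wev_rw1.
have comm k : rwz k (rwz k r) = rwr k (rwr k r) :=
  @weyl_central_sq RM rwz rwr rw1 rwz_weyl wa rwr_linear rwz_rwr rwz_rw1 u k uc.
have rN : exists N : int, forall a b c d, r a b c d != 0 -> (a <= N) && (b <= N) && (c <= N) && (d <= N).
  pose N := (\max_(t <- s) (t.2.1.1.1 + t.2.1.1.2 + t.2.1.2 + t.2.2))%N.
  exists N%:Z => a b c d; rewrite rE; apply: contra_neqT => H.
  rewrite big_seq big1 // => t ts; rewrite (_ : rwd t.2 a b c d = 0) ?mulr0 //.
  have : (t.2.1.1.1 + t.2.1.1.2 + t.2.1.2 + t.2.2 <= N)%N by apply: leq_bigmax_seq.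
  move: H; rewrite /rwd; case: (t.2) => -[[a' b'] c'] d' /= H1 H2.
  by case: eqP => //= ?; case: eqP => //= ?; case: eqP => //= ?; case: eqP => //= ?; lia.
have r0 := rweyl_central comm rN.
exists (r 0 0 0 0) => M z w wa0 m; rewrite (Hs M z w wa0); apply: wev_coef => t.
have -> : \sum_(v <- s | v.2 == t) v.1 = r t.1.1.1%:Z t.1.1.2%:Z t.1.2%:Z t.2%:Z.
  rewrite rE [LHS]big_mkcond; apply: eq_bigr => -[x v] _; rewrite /rwd /=.
  case: t v => -[[a b] c] d [[[a' b'] c'] d'] /=; rewrite !xpair_eqE !eqz_nat.
  rewrite (eq_sym a') (eq_sym b') (eq_sym c') (eq_sym d').
  by case: ifP; rewrite ?mulr1 ?mulr0.
case: eqP => [->//|t0]; apply: contra_notP t0 => /eqP/r0.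
by case: t => -[[a b] c] d /= H; congr (_, _, _, _); lia.
Qed.

End RegularWeyl.

(** * Highest weights determine the scalars of central elements *)

Section EigenSplit.
Variables (C : fieldType) (M : lmodType C) (T : M -> M) (P : M -> Prop).
Hypothesis lT : linear T.
Hypothesis Plin : forall a u v, P u -> P v -> P (a *: u + v).
Hypothesis PT : forall u, P u -> P (T u).

Definition eigens (mu : C) (s : seq (C * M)) : Prop :=
  forall t, List.In t s -> t.1 != mu /\ T t.2 = t.1 *: t.2.

Lemma eig_sum mu s : eigens mu s -> T (\sum_(t <- s) t.2) = \sum_(t <- s) t.1 *: t.2.
Proof.
elim: s => [|a s IH] Hs; first by rewrite !big_nil (lin0 lT).
rewrite !big_cons (linD lT) IH; last by move=> t H; apply: Hs; right.
by have [_ ->] := Hs a (or_introl erefl).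
Qed.

Lemma eigens_map mu nu s : eigens mu s -> eigens mu [seq (t.1, (t.1 - nu) *: t.2) | t <- s].
Proof.
elim: s => //= a s IH Hs t /= [<-|ts] /=.
  have [a1 a2] := Hs a (or_introl erefl).
  by rewrite (linZ lT) a2 !scalerA mulrC.
by apply: IH => // t' H; apply: Hs; right.
Qed.

(** Each step applies T - nu, which kills the eigenvector of eigenvalue nu and multiplies x by the
    nonzero factor mu - nu. *)
Lemma eig_split (mu : C) (x : M) (s : seq (C * M)) :
  T x = mu *: x -> eigens mu s -> P (x + \sum_(t <- s) t.2) -> P x.
Proof.
move: s x => s x; have [n sn] : exists n, size s = n by exists (size s).
elim: n s sn x => [|n IH] [|[nu w] s] //= sn x Tx Hs Px.
  by rewrite big_nil addr0 in Px.
case: sn => sn.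
have [/= numu Tw] := Hs (nu, w) (or_introl erefl).
have Hs' : eigens mu s by move=> t H; apply: Hs; right.
have Px' : P ((mu - nu) *: x + \sum_(t <- [seq (t.1, (t.1 - nu) *: t.2) | t <- s]) t.2).
  have -> : (mu - nu) *: x + \sum_(t <- [seq (t.1, (t.1 - nu) *: t.2) | t <- s]) t.2
    = (- nu) *: (x + \sum_(t <- (nu, w) :: s) t.2) + T (x + \sum_(t <- (nu, w) :: s) t.2).
    rewrite big_cons /= !(linD lT) Tx Tw (eig_sum Hs') big_map /=.
    have -> : \sum_(j <- s) (j.1 - nu) *: j.2 = \sum_(j <- s) j.1 *: j.2 + (- nu) *: \sum_(j <- s) j.2.
      by rewrite scaler_sumr -big_split; apply: eq_bigr => t _; rewrite scalerDl.
    move: (\sum_(j <- s) j.1 *: j.2) (\sum_(j <- s) j.2) => A B.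
    by lmod_with M ltac:(ring).
  by apply: Plin => //; apply: PT.
have P0 : P 0 by have := Plin (-1) Px Px; rewrite scaleN1r addNr.
have Tx' : T ((mu - nu) *: x) = mu *: ((mu - nu) *: x).
  by rewrite (linZ lT) Tx !scalerA mulrC.
have Pm := IH _ (etrans (size_map _ _) sn) _ Tx' (@eigens_map mu nu s Hs') Px'.
have n0 : mu - nu != 0 by rewrite subr_eq0 eq_sym.
by have := Plin (mu - nu)^-1 Pm P0; rewrite addr0 scalerA mulVf // scale1r.
Qed.

End EigenSplit.

Lemma In_map (A B : Type) (f : A -> B) (s : seq A) y :
  List.In y (map f s) -> exists2 x, List.In x s & f x = y.
Proof.
elim: s => //= a s IH [<-|/IH [x xs <-]]; first by exists a; [left|].
by exists x; [right|].
Qed.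

Section HighestWeightWords.
Variable C : numFieldType.
Variable lam : C * C.
Local Notation sp4mod := (lieMod (@sp4 C)).

Definition hwv (L : sp4mod) (v : L) : Prop :=
  [/\ v != 0, opm 4 v = lam.1 *: v, opm 5 v = lam.2 *: v
    & forall i, (5 < i)%N -> opm i v = 0].

Definition negw (w : seq nat) := all (fun i => i < 4)%N w.

Definition nev (L : sp4mod) (s : seq (C * seq nat)) (v : L) : L :=
  \sum_(t <- s) t.1 *: evw (@opm C L) t.2 v.

(** A single list of words serves all modules and all highest weight vectors of weight [lam]. This
    uniformity is what makes the resulting scalar depend on the weight only. *)
Definition negfam (n : nat) (F : forall L : sp4mod, L -> L) : Prop :=
  exists s, [/\ all (fun t => negw t.2) s, all (fun t => size t.2 <= n)%N s
    & forall (L : sp4mod) (v : L), hwv v -> F L v = nev s v].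

Lemma negfam_lin n a F G : negfam n F -> negfam n G -> negfam n (fun L v => a *: F L v + G L v).
Proof.
move=> [s [s1 s2 s3]] [t [t1 t2 t3]].
exists ([seq (a * u.1, u.2) | u <- s] ++ t); split.
- by rewrite all_cat t1 andbT all_map.
- by rewrite all_cat t2 andbT all_map.
- move=> L v hv; rewrite s3 // t3 // /nev big_cat big_map scaler_sumr /=.
  by congr (_ + _); apply: eq_bigr => u _; rewrite scalerA.
Qed.

Lemma negfam0 n : negfam n (fun L v => 0).
Proof. by exists [::]; split => // L v _; rewrite /nev big_nil. Qed.

Lemma negfam_word n w : negw w -> (size w <= n)%N ->
  negfam n (fun L v => evw (@opm C L) w v).
Proof.
move=> wn ws; exists [:: (1, w)]; split; rewrite /= ?wn ?ws //.
by move=> L v _; rewrite /nev big_seq1 scale1r.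
Qed.

Lemma negfam_ext n F G : (forall (L : sp4mod) (v : L), hwv v -> F L v = G L v) -> negfam n G -> negfam n F.
Proof. by move=> e [s [s1 s2 s3]]; exists s; split => // L v hv; rewrite e // s3. Qed.

Lemma negfam_leq n m F : (n <= m)%N -> negfam n F -> negfam m F.
Proof.
move=> nm [s [s1 s2 s3]]; exists s; split => //.
by apply: sub_all s2 => t /= H; apply: leq_trans nm.
Qed.

Lemma negfam_sum n (p : ncpoly) (F : seq nat -> forall L : sp4mod, L -> L) :
  (forall t, List.In t p -> negfam n (F t.2)) ->
  negfam n (fun L v => \sum_(t <- p) t.1%:~R *: F t.2 L v).
Proof.
elim: p => [|t p IH] H.
  by apply: negfam_ext (negfam0 n) => L v _; rewrite big_nil.
have H1 := negfam_lin t.1%:~R (H t (or_introl erefl)) (IH (fun u hu => H u (or_intror hu))).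
by apply: negfam_ext H1 => L v _; rewrite big_cons.
Qed.

Lemma sp4_br_letter i j t : List.In t (sp4_br i j) -> (j < i)%N -> exists k, t.2 = [:: k].
Proof.
move=> tin ji; have [i10|i10] := ltnP i 10; last first.
  by move: tin; rewrite (_ : sp4_br i j = [::]) //; case: i i10 {ji} => [|[|[|[|[|[|[|[|[|[|?]]]]]]]]]].
have := all_belowP (all_belowP sp4_br_single i10) ji.
elim: (sp4_br i j) tin => //= a p IHp [->|tin] /andP[/eqP e Hp]; last exact: IHp.
by exists (head 10%N t.2).
Qed.

(** A Cartan or positive letter moves to the right until it meets v. Each commutator with a negative
    letter replaces two letters by one, hence the induction on the length. *)
Lemma negfam_opge n i w : (3 < i)%N -> negw w -> (size w <= n)%N ->
  negfam n (fun L v => opm i (evw (@opm C L) w v)).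
Proof.
elim: n i w => [|n IH] i w i4.
  case: w => // _ _ /=.
  have [i5|i5] := ltnP 5 i.
    by apply: negfam_ext (negfam0 _) => L v [_ _ _ ->].
  have H0 c : negfam 0 (fun L v => c *: v).
    by apply: negfam_ext (negfam_lin c (@negfam_word 0 [::] isT isT) (negfam0 0)) => L v _; rewrite addr0.
  case: i i4 i5 => [|[|[|[|[|[|//]]]]]] // _ _.
  - by apply: negfam_ext (H0 lam.1) => L v [_ -> _ _].
  - by apply: negfam_ext (H0 lam.2) => L v [_ _ -> _].
case: w => [|y w].
  by move=> _ _; apply: (negfam_leq (leqnSn n)); apply: IH.
move=> /= /andP[y4 w4]; rewrite ltnS => wn.
have H1 : negfam n.+1 (fun L v => opm y (opm i (evw (@opm C L) w v))).
  have [s [s1 s2 s3]] := IH i w i4 w4 wn.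
  exists [seq (t.1, y :: t.2) | t <- s]; split.
  - by rewrite all_map; apply: sub_all s1 => t /= ->; rewrite y4.
  - by rewrite all_map.
  - move=> L v hv; rewrite s3 // /nev (lin_sum (@opm_linear _ L y)) big_map.
    by apply: eq_bigr => t _; rewrite (linZ (@opm_linear _ L y)).
have H2 : negfam n.+1 (fun L v => evp (@opm C L) (sp4_br i y) (evw (@opm C L) w v)).
  apply: (@negfam_sum n.+1 (sp4_br i y) (fun u L v => evw (@opm C L) u (evw (@opm C L) w v))) => t tin.
  have [k ->] := sp4_br_letter tin (leq_trans y4 i4).
  have [k4|k4] := ltnP k 4; first by apply: (@negfam_word _ (k :: w)); rewrite /= ?k4.
  exact: (negfam_leq (leqnSn n)) (IH k w k4 w4 wn).
apply: negfam_ext (negfam_lin 1 H1 H2) => L v _.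
by rewrite scale1r /= opm_br // (leq_trans y4).
Qed.

Definition negfin F := exists n, negfam n F.

Lemma negfin_lin a F G : negfin F -> negfin G -> negfin (fun L v => a *: F L v + G L v).
Proof.
move=> [n HF] [m HG]; exists (n + m)%N.
by apply: negfam_lin; [exact: negfam_leq (leq_addr _ _) HF|exact: negfam_leq (leq_addl _ _) HG].
Qed.

Lemma negfin_ext F G : (forall (L : sp4mod) (v : L), hwv v -> F L v = G L v) -> negfin G -> negfin F.
Proof. by move=> e [n H]; exists n; apply: negfam_ext H. Qed.

Lemma negfin_op i F : negfin F -> negfin (fun L v => opm i (F L v)).
Proof.
move=> [n [s [s1 s2 s3]]].
have H : negfin (fun L v => opm i (nev s v)).
  elim: s s1 {s2 s3} => [|[c w] s IH] /=.
    move=> _; exists 0%N; apply: negfam_ext (negfam0 0) => L v _.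
    by rewrite /nev big_nil (lin0 (@opm_linear _ L i)).
  move=> /andP[w4 /IH H1].
  have H2 : negfin (fun L v => opm i (evw (@opm C L) w v)).
    exists (size w).+1; have [i4|i4] := ltnP i 4; last by apply: negfam_opge.
    by apply: (@negfam_word _ (i :: w)); rewrite /= ?i4.
  apply: negfin_ext (negfin_lin c H2 H1) => L v _.
  by rewrite /nev big_cons (linD (@opm_linear _ L i)) (linZ (@opm_linear _ L i)).
by apply: negfin_ext H => L v hv; rewrite s3.
Qed.

Lemma negfin0 : negfin (fun L v => 0). Proof. by exists 0%N; apply: negfam0. Qed.

Lemma act_coord (L : sp4mod) x (m : L) : x \in @sp4 C ->
  act x m = \sum_(i < 10) sp4_coord x i *: opm i m.
Proof. by move=> /sp4_decomp {1}->; rewrite act_suml // => i; exact: spB_sp4. Qed.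

Lemma negfin_U (u : Uterm (@sp4 C)) F : negfin F -> negfin (fun L v => Uact u (F L v)).
Proof.
elim: u F => [x|a|u IHu v IHv|u IHu v IHv] F HF.
- have H : negfin (fun L v => \sum_(i <- index_enum 'I_10) sp4_coord (vsval x) i *: opm i (F L v)).
    elim: (index_enum _) => [|i r IH].
      by apply: negfin_ext negfin0 => L v _; rewrite big_nil.
    apply: negfin_ext (negfin_lin (sp4_coord (vsval x) i) (negfin_op i HF) IH) => L v _.
    by rewrite big_cons.
  by apply: negfin_ext H => L v _ /=; rewrite (act_coord _ (subvsP x)).
- by apply: negfin_ext (negfin_lin a HF negfin0) => L v _; rewrite addr0.
- apply: negfin_ext (negfin_lin 1 (IHu F HF) (IHv F HF)) => L m _.
  by rewrite scale1r.
- exact: IHu (IHv F HF).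
Qed.

Definition wheight (w : seq nat) : nat := sumn [seq nth 0%N [:: 6; 4; 2; 2] i | i <- w].

(** The semisimple element of the standard principal sl(2). All letters of a negative word have
    negative weight for it. *)
Definition xh : ncexpr := (NZ 3 * xH + xK)%nc.

Lemma ev_lin (L : sp4mod) e : linear (ev (@opm C L) e).
Proof. by apply: ev_linear => i; apply: opm_linear. Qed.

Lemma xh_word (L : sp4mod) (v : L) w : hwv v -> negw w ->
  ev (@opm C L) xh (evw (@opm C L) w v) =
  (3%:R * lam.1 + lam.2 - (wheight w)%:R) *: evw (@opm C L) w v.
Proof.
move=> [v0 v4 v5 _]; elim: w => [_|y w IH yw].
  by rewrite /= v4 v5 subr0; lmod_with (L : lmodType C) ltac:(ring).
have /andP[y4 w4] : (y < 4)%N && negw w := yw.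
have : ev (@opm C L) xh (opm y (evw (@opm C L) w v)) =
   opm y (ev (@opm C L) xh (evw (@opm C L) w v)) - (nth 0%N [:: 6; 4; 2; 2] y)%:R *: opm y (evw (@opm C L) w v).
  move: (evw _ w v) => m.
  have := @opm_eq C L (xh * NV y)%nc (NV y * xh - NZ (nth 0%N [:: 6; 4; 2; 2] y)%:Z * NV y)%nc.
  by case: y {yw} y4 => [|[|[|[|//]]]] _ /(_ isT m) /= ->; rewrite ?rmorphN1 scaleN1r.
rewrite IH // (linZ (@opm_linear _ L y)) -scalerBl => e.
by apply: (etrans e); congr (_ *: _); rewrite /wheight /= natrD; ring.
Qed.

(** The action of u on v is c0 v plus negative words of strictly smaller [xh]-weight, where c0
    depends on the highest weight only; [eig_split] isolates the component of v. *)
Lemma hw_scalar_unique (u : Uterm (@sp4 C)) (L L' : sp4mod) (v : L) (v' : L') c c' :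
  hwv v -> hwv v' -> Uact u v = c *: v -> Uact u v' = c' *: v' -> c = c'.
Proof.
move=> hv hv' uv uv'.
have [n [s [s1 _ s3]]] : negfin (fun L v => Uact u v).
  by apply: negfin_U; exists 0%N; apply: (@negfam_word 0 [::]).
pose c0 := \sum_(t <- s | t.2 == [::]) t.1.
suff H (N : sp4mod) (x : N) a : hwv x -> Uact u x = a *: x -> a = c0.
  by rewrite (H _ _ _ hv uv) (H _ _ _ hv' uv').
move=> hx; rewrite s3 // => e.
pose r := [seq ((3%:R * lam.1 + lam.2 - (wheight t.2)%:R), t.1 *: evw (@opm C N) t.2 x) | t <- s & t.2 != [::]].
have lxh := @ev_lin N xh.
have x0 : x != 0 by case: hx.
have e0 : (c0 - a) *: x + \sum_(t <- r) t.2 = 0.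
  rewrite /r big_map big_filter scalerBl -e /nev (bigID (fun t => t.2 == [::]) predT) /=.
  rewrite scaler_suml.
  have -> : \sum_(i <- s | i.2 == [::]) i.1 *: x = \sum_(i <- s | i.2 == [::]) i.1 *: evw (@opm C N) i.2 x.
    by apply: eq_bigr => i /eqP ->.
  by rewrite opprD addrA subrr add0r addNr.
have Pl (b : C) (m m' : N) : m = 0 -> m' = 0 -> b *: m + m' = 0.
  by move=> -> ->; rewrite scaler0 addr0.
have PT (m : N) : m = 0 -> ev (@opm C N) xh m = 0 by move=> ->; rewrite (lin0 lxh).
have Tx : ev (@opm C N) xh ((c0 - a) *: x) = (3%:R * lam.1 + lam.2) *: ((c0 - a) *: x).
  have := @xh_word N x [::] hx isT; rewrite subr0 => e1.
  by rewrite (linZ lxh) e1 !scalerA mulrC.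
have Hr : eigens (ev (@opm C N) xh) (3%:R * lam.1 + lam.2) r.
  move=> t H; have [t' ts <-] := In_map H; move: ts => {t H} ts.
  have /andP[t0 t4] : (t'.2 != [::]) && negw t'.2.
    elim: (s) s1 ts => //= a' s' IH /andP[a4 s4].
    by case: ifP => a0 //=; [case=> [<-|]|]; rewrite ?a0 ?a4 //; exact: IH.
  split; last by rewrite (linZ lxh) xh_word // !scalerA mulrC.
  rewrite -subr_eq0 addrAC subrr add0r oppr_eq0 pnatr_eq0 -lt0n.
  case: (t'.2) t0 t4 => // y w _ /andP[y4 _].
  by rewrite /wheight /= addn_gt0; case: y y4 => [|[|[|[|]]]].
have := eig_split lxh Pl PT Tx Hr e0.
by move=> /eqP; rewrite scaler_eq0 (negPf x0) orbF subr_eq0 => /eqP ->.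
Qed.

End HighestWeightWords.

(** * The even Weil representation *)

Section Functions.
Variable C : numFieldType.

(** A polynomial in two variables is given by its coefficients. Integer indices avoid truncated
    subtraction; finiteness and nonnegative exponents are imposed by [lbounded]. *)
Definition lat : Type := int -> int -> C^o.
HB.instance Definition _ := GRing.Lmodule.on lat.

Lemma latE (x : C) (r s : lat) i j : (x *: r + s) i j = x * r i j + s i j.
Proof. by []. Qed.
Lemma latDE (r s : lat) i j : (r + s) i j = r i j + s i j. Proof. by []. Qed.
Lemma latZE (x : C) (r : lat) i j : (x *: r) i j = x * r i j. Proof. by []. Qed.
Lemma lat0E i j : (0 : lat) i j = 0. Proof. by []. Qed.

Lemma lat_ext (r s : lat) : (forall i j, r i j = s i j) -> r = s.
Proof. by move=> H; apply/funext=> i; apply/funext=> j. Qed.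

Definition lat_delta (i0 j0 : int) : lat := fun i j => ((i == i0) && (j == j0))%:R.

Definition lbounded (f : lat) : Prop :=
  exists N : nat, forall i j, f i j != 0 -> (0 <= i <= N%:Z) && (0 <= j <= N%:Z).

Lemma lat_sum (I : Type) (r : seq I) (F : I -> lat) i j :
  (\sum_(t <- r) F t) i j = \sum_(t <- r) F t i j.
Proof. by elim: r => [|t r IH]; [rewrite !big_nil | rewrite !big_cons latDE IH]. Qed.

Lemma lat_decomp (f : lat) (N : nat) :
  (forall i j, f i j != 0 -> (0 <= i <= N%:Z) && (0 <= j <= N%:Z)) ->
  f = \sum_(a < N.+1) \sum_(b < N.+1) f a%:Z b%:Z *: lat_delta a%:Z b%:Z.
Proof.
move=> fN; apply: lat_ext => i j; rewrite lat_sum.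
have -> : \sum_(a < N.+1) (\sum_(b < N.+1) f a%:Z b%:Z *: lat_delta a%:Z b%:Z) i j =
  \sum_(a < N.+1) \sum_(b < N.+1) f a%:Z b%:Z * ((i == a%:Z) && (j == b%:Z))%:R.
  by apply: eq_bigr => a _; rewrite lat_sum; apply: eq_bigr => b _.
have [f0|f0] := eqVneq (f i j) 0.
  rewrite f0 big1 // => a _; rewrite big1 // => b _.
  by case: andP => [[/eqP <- /eqP <-]|_]; rewrite ?f0 ?mul0r ?mulr0.
have /andP[/andP[i0 iN] /andP[j0 jN]] := fN _ _ f0.
have iN' : (`|i| < N.+1)%N by lia.
have jN' : (`|j| < N.+1)%N by lia.
rewrite (bigD1 (Ordinal iN')) //= (bigD1 (Ordinal jN')) //=.
rewrite gez0_abs // gez0_abs // !eqxx mulr1 !big1 ?addr0 //.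
- move=> a; rewrite -val_eqE /= => ai; rewrite big1 // => b _.
  by rewrite (_ : i == a%:Z = false) ?mulr0 //; lia.
- move=> b; rewrite -val_eqE /= => bj.
  by rewrite (_ : j == b%:Z = false) ?mulr0 //; lia.
Qed.

Lemma lat_ind (P : lat -> Prop) (f : lat) :
  P 0 -> (forall a u v, P u -> P v -> P (a *: u + v)) -> lbounded f ->
  (forall i j, f i j != 0 -> P (lat_delta i j)) -> P f.
Proof.
move=> P0 Pl [N fN] Pd; rewrite (lat_decomp fN).
have PD u v : P u -> P v -> P (u + v) by move=> Pu Pv; rewrite -[u]scale1r; apply: Pl.
apply: big_ind => // a _; apply: big_ind => // b _.
have [->|f0] := eqVneq (f a%:Z b%:Z) 0; first by rewrite scale0r.
by rewrite -[_ *: _]addr0; apply: Pl => //; apply: Pd.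
Qed.

(* The Weil representation, with z0, z1 acting as minus the partial
   derivatives and z2, z3 as minus the coordinates. *)
Definition wlz (k : 'I_4) (f : lat) : lat := fun i j =>
  match val k with
  | 0 => - ((i + 1)%:~R * f (i + 1) j)
  | 1 => - ((j + 1)%:~R * f i (j + 1))
  | 2 => - f (i - 1) j
  | _ => - f i (j - 1)
  end.

Lemma wlz_weyl : weyl_ops wlz.
Proof.
split=> [k a f h|k l f]; apply: lat_ext => i j.
  by rewrite latE /wlz !latE; case: k => -[|[|[|[|//]]]] _ /=; ring.
rewrite addrC JE latE /wlz.
by case: k => -[|[|[|[|//]]]] _ /=; case: l => -[|[|[|[|//]]]] _ /=;
  rewrite ?subrK ?addrK ?[_ + 1 - 1]addrK; ring.
Qed.

Definition weil_full : lieMod (@sp4 C) := weylMod wlz_weyl.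

Definition lparity (e : int) (f : lat) : Prop :=
  forall i j, f i j != 0 -> exists k : int, i + j = k * 2 + e.

Definition weil_pred (f : weil_full) : Prop := lbounded f /\ lparity 0 f.

Lemma wlz_bounded k f : lbounded f -> lbounded (wlz k f).
Proof.
move=> [N fN]; exists N.+1 => i j; rewrite /wlz.
by case: k => -[|[|[|[|//]]]] _ /=; rewrite oppr_eq0 ?mulf_eq0 ?negb_or ?intr_eq0;
 first [move=> /andP[i0 /fN] | move=> /fN]; lia.
Qed.

Lemma wlz_parity k e f : lparity e f -> lparity (e + 1) (wlz k f).
Proof.
move=> fe i j; rewrite /wlz.
case: k => -[|[|[|[|//]]]] _ /=; rewrite oppr_eq0 ?mulf_eq0 ?negb_or ?intr_eq0.
- by move=> /andP[_ /fe [k H]]; exists (k - 1); lia.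
- by move=> /andP[_ /fe [k H]]; exists (k - 1); lia.
- by move=> /fe [k H]; exists k; lia.
- by move=> /fe [k H]; exists k; lia.
Qed.

Lemma lbounded_lin a u v : lbounded u -> lbounded v -> lbounded (a *: u + v).
Proof.
move=> [N uN] [K vK]; exists (maxn N K) => i j; rewrite latE => H.
have [u0|/uN] := eqVneq (u i j) 0; last by lia.
by move: H; rewrite u0 mulr0 add0r => /vK; lia.
Qed.
Lemma lbounded0 : lbounded 0. Proof. by exists 0%N => i j; rewrite lat0E eqxx. Qed.
Lemma lparity_lin e a u v : lparity e u -> lparity e v -> lparity e (a *: u + v).
Proof.
move=> ue ve i j; rewrite latE => H.
have [u0|/ue] := eqVneq (u i j) 0; last by [].
by move: H; rewrite u0 mulr0 add0r => /ve.
Qed.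
Lemma lparity0 e : lparity e 0. Proof. by move=> i j; rewrite lat0E eqxx. Qed.

Lemma weyl_act_closed (M : lmodType C) (z : 'I_4 -> M -> M) (P : M -> Prop) A m :
  P 0 -> (forall a u v, P u -> P v -> P (a *: u + v)) ->
  (forall k l, P (z k (z l m))) -> P (weyl_act z A m).
Proof.
move=> P0 Pl Pz; rewrite /weyl_act -[_ *: _]addr0; apply: (Pl _ _ _ _ P0).
have PD u v : P u -> P v -> P (u + v) by move=> Pu Pv; rewrite -[u]scale1r; apply: Pl.
apply: big_ind => // k _; apply: big_ind => // l _.
by rewrite -[_ *: _]addr0; apply: Pl.
Qed.

Lemma weil_submodule : submodule weil_pred.
Proof.
split; first by split; [exact: lbounded0 | exact: lparity0].
- by move=> a u v [u1 u2] [v1 v2]; split; [exact: lbounded_lin | exact: lparity_lin].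
- move=> A _ m [m1 m2]; apply: weyl_act_closed.
  + by split; [exact: lbounded0 | exact: lparity0].
  + by move=> a u v [u1 u2] [v1 v2]; split; [exact: lbounded_lin | exact: lparity_lin].
  + move=> k l; split; first by do 2!apply: wlz_bounded.
    move=> i j /(@wlz_parity k _ _ (@wlz_parity l _ _ m2)) [q H]; exists (q + 1); lia.
Qed.

Definition weil : lieMod (@sp4 C) := sub_lieMod weil_submodule.

Lemma weil_delta_pred i j (q : int) : 0 <= i -> 0 <= j -> i + j = q * 2 -> weil_pred (lat_delta i j).
Proof.
move=> i0 j0 e; rewrite /lat_delta; split.
  exists (`|i| + `|j|)%N => a b; case: andP => [[/eqP -> /eqP ->] _|_]; last by rewrite eqxx.
  by lia.
move=> a b; case: andP => [[/eqP -> /eqP ->] _|_]; last by rewrite eqxx.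
by exists q; lia.
Qed.


Section WeilSimple.
Variable Q : weil -> Prop.
Hypothesis sQ : submodule Q.

Definition weilQ (f : lat) : Prop := exists m : weil, sub_val m = f /\ Q m.

Lemma weilQ_lin a u v : weilQ u -> weilQ v -> weilQ (a *: u + v).
Proof.
have [_ Ql _] := sQ.
move=> [m [<- Qm]] [m' [<- Qm']]; exists (a *: m + m'); split; last exact: Ql.
exact: sub_val_linear.
Qed.

Lemma weilQ_zz i k l f : (forall m : lat, weyl_act wlz (spB C i) m = wlz k (wlz l m)) ->
  weilQ f -> weilQ (wlz k (wlz l f)).
Proof.
have [_ _ Qa] := sQ.
move=> H [m [<- Qm]]; exists (act (spB C i) m); split; last by apply: Qa => //; exact: spB_sp4.
by rewrite sub_val_act ?spB_sp4 // -H.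
Qed.

Lemma weilQ00 f : weilQ f -> weilQ (wlz i40 (wlz i40 f)).
Proof. by apply: (@weilQ_zz 9) => m; rewrite (weyl_letter wlz_weyl). Qed.
Lemma weilQ01 f : weilQ f -> weilQ (wlz i40 (wlz i41 f)).
Proof. by apply: (@weilQ_zz 8) => m; rewrite (weyl_letter wlz_weyl). Qed.
Lemma weilQ11 f : weilQ f -> weilQ (wlz i41 (wlz i41 f)).
Proof. by apply: (@weilQ_zz 6) => m; rewrite (weyl_letter wlz_weyl). Qed.
Lemma weilQ22 f : weilQ f -> weilQ (wlz i42 (wlz i42 f)).
Proof. by apply: (@weilQ_zz 0) => m; rewrite (weyl_letter wlz_weyl). Qed.
Lemma weilQ23 f : weilQ f -> weilQ (wlz i42 (wlz i43 f)).
Proof. by apply: (@weilQ_zz 1) => m; rewrite (weyl_letter wlz_weyl). Qed.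
Lemma weilQ33 f : weilQ f -> weilQ (wlz i43 (wlz i43 f)).
Proof. by apply: (@weilQ_zz 3) => m; rewrite (weyl_letter wlz_weyl). Qed.

Lemma weilQ_pred f : weilQ f -> weil_pred f.
Proof. by move=> [m [<- _]]; apply: sub_valP. Qed.

(** As long as a monomial of degree at least 2 occurs, some second order derivative of f is nonzero
    and has degree smaller by 2. Parity excludes degree 1, so the process ends with a nonzero
    constant. *)
Lemma weilQ_vac D f : weilQ f -> (exists i j, f i j != 0) ->
  (forall i j, f i j != 0 -> i + j <= D%:Z * 2) -> weilQ (lat_delta 0 0).
Proof.
elim: D f => [|D IH] f Qf [i [j fij]] fD.
  have [[N fN] _] := weilQ_pred Qf.
  have := fN _ _ fij; have := fD _ _ fij => h1 h2.
  have i0 : i = 0 by lia. have j0 : j = 0 by lia.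
  rewrite i0 j0 in fij.
  have fE : f = f 0 0 *: lat_delta 0 0.
    apply: lat_ext => a b; rewrite latZE /lat_delta.
    have [f0|fab] := eqVneq (f a b) 0.
      case: andP => [[/eqP ea /eqP eb]|_]; rewrite ?mulr0 //.
      by move: f0; rewrite ea eb => ->; rewrite mul0r.
    have := fN _ _ fab; have := fD _ _ fab => h3 h4.
    have -> : a = 0 by lia. have -> : b = 0 by lia.
    by rewrite !eqxx mulr1.
  have Q0 : weilQ 0 by have := weilQ_lin (-1) Qf Qf; rewrite scaleN1r addNr.
  by have := weilQ_lin (f 0 0)^-1 Qf Q0; rewrite addr0 {2}fE scalerA mulVf // scale1r.
have [[N fN] fp] := weilQ_pred Qf.
have dec g : (forall a b, g a b != 0 -> f (a + 2) b != 0 \/ f (a + 1) (b + 1) != 0 \/ f a (b + 2) != 0) ->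
   forall a b, g a b != 0 -> a + b <= D%:Z * 2.
  by move=> H a b /H [/fD|[/fD|/fD]]; lia.
have [/existsNP [a /existsNP [b /not_implyP [fab ab]]]|small] :=
    pselect (~ forall a b, f a b != 0 -> a + b < 2).
  have [a0 b0] : 0 <= a /\ 0 <= b by have := fN _ _ fab; lia.
  have nz (x y : int) : 0 < x -> 0 < y -> x%:~R * (y%:~R * f a b) != 0.
    by move=> x0 y0; rewrite !mulf_neq0 // intr_eq0; lia.
  have [a2|a2] : 2 <= a \/ a < 2 by lia.
    apply: (IH _ (weilQ00 Qf)).
      exists (a - 2), b; rewrite /wlz /= mulrN opprK.
      rewrite (_ : a - 2 + 1 + 1 = a); last by lia.
      by apply: nz; lia.
    apply: dec => x y; rewrite /wlz /= mulrN opprK -addrA => H; left.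
    by apply: contra_neq H => ->; rewrite !mulr0.
  have [a1|a1] : a = 1 \/ a = 0 by lia.
    apply: (IH _ (weilQ01 Qf)).
      exists (a - 1), (b - 1); rewrite /wlz /= mulrN opprK !subrK.
      by apply: nz; lia.
    apply: dec => x y; rewrite /wlz /= mulrN opprK => H; right; left.
    by apply: contra_neq H => ->; rewrite !mulr0.
  apply: (IH _ (weilQ11 Qf)).
    exists a, (b - 2); rewrite /wlz /= mulrN opprK.
    rewrite (_ : b - 2 + 1 + 1 = b); last by lia.
    by apply: nz; lia.
  apply: dec => x y; rewrite /wlz /= mulrN opprK -addrA => H; right; right.
  by apply: contra_neq H => ->; rewrite !mulr0.
apply: (IH f Qf); first by exists i, j.
move=> a b fab; have /contrapT/(_ a b fab) := small.
by have [q e] := fp _ _ fab; lia.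
Qed.

Lemma weilQ_delta : weilQ (lat_delta 0 0) -> forall i j q : int, 0 <= i -> 0 <= j -> i + j = q * 2 -> weilQ (lat_delta i j).
Proof.
move=> Q0 i j q i0 j0 e.
have H n : forall a b : nat, (a + b = n * 2)%N -> weilQ (lat_delta a%:Z b%:Z).
  elim: n => [|n IH] a b ab.
    have -> : a = 0%N by lia. by have -> : b = 0%N by lia.
  case: a ab => [|[|a]] ab.
  - have -> : lat_delta 0 b = wlz i43 (wlz i43 (lat_delta 0 (b - 2)%N%:Z)).
      by apply: lat_ext => x y; rewrite /wlz /= opprK /lat_delta; congr (_ && _)%:R; lia.
    by apply/weilQ33/(IH 0%N (b - 2)%N); lia.
  - have -> : lat_delta 1 b = wlz i42 (wlz i43 (lat_delta 0 (b - 1)%N%:Z)).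
      by apply: lat_ext => x y; rewrite /wlz /= opprK /lat_delta; congr (_ && _)%:R; lia.
    by apply/weilQ23/(IH 0%N (b - 1)%N); lia.
  - have -> : lat_delta a.+2%:Z b = wlz i42 (wlz i42 (lat_delta a%:Z b%:Z)).
      by apply: lat_ext => x y; rewrite /wlz /= opprK /lat_delta; congr (_ && _)%:R; lia.
    by apply/weilQ22/(IH a b); lia.
have := H `|q|%N `|i|%N `|j|%N; rewrite !gez0_abs //; apply; lia.
Qed.

Lemma weil_simple_sub : (forall m, Q m -> m = 0) \/ (forall m, Q m).
Proof.
have [H|] := pselect (forall m, Q m -> m = 0); first by left.
move=> /existsNP [m /not_implyP [Qm m0]]; right => m'.
pose f : lat := sub_val m.
have Qf : weilQ f by exists m.
have [f0|] := pselect (forall i j, f i j = 0).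
  by case: m0; apply: sub_val_inj; rewrite (lin0 (@sub_val_linear _ _ _ _ _ _)); apply: lat_ext.
move=> /existsNP [i /existsNP [j /eqP fij]].
have [[N fN] _] := weilQ_pred Qf.
have Q0 : weilQ (lat_delta 0 0).
  by apply: (@weilQ_vac N f) => //; [exists i, j | move=> a b /fN; lia].
have [[K hK] hp] := sub_valP m'.
have [m1 [e1 Qm1]] : weilQ (sub_val m').
  apply: lat_ind.
  - by have := weilQ_lin (-1) Q0 Q0; rewrite scaleN1r addNr.
  - exact: weilQ_lin.
  - by exists K.
  - move=> a b hab; have [q e] := hp _ _ hab; rewrite addr0 in e.
    by apply: (weilQ_delta Q0 _ _ e); have := hK _ _ hab; lia.
by rewrite -(sub_val_inj e1).
Qed.

End WeilSimple.

Lemma weil_simple : simple_mod weil.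
Proof.
split; last exact: weil_simple_sub.
exists (sub_in weil_submodule (weil_delta_pred (lexx 0) (lexx 0) (erefl : 0 + 0 = 0 * 2 :> int))).
apply/eqP => /(congr1 (@sub_val _ _ _ _ _ _)); rewrite (lin0 (@sub_val_linear _ _ _ _ _ _)).
by move=> /(congr1 (fun f : lat => f 0 0)); rewrite /= /lat_delta /= => /eqP; rewrite oner_eq0.
Qed.

End Functions.

(** * The central character of the Weil representation *)

Section CentralChar.
Variable C : numFieldType.
Implicit Types h x : 'M[C]_4.

Lemma cartan_spB i : i \in [:: 4; 5]%N -> cartan (spB C i).
Proof.
move=> i45; split; first exact: spB_sp4.
apply/is_diag_mxP => r s rs; rewrite entE ent_spB //.
by move: i45 rs; rewrite !inE => /orP[] /eqP ->;
  case: r s => [[|[|[|[|?]]]] ?] [[|[|[|[|?]]]] ?].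
Qed.

Lemma cartan_ent h : cartan h ->
  [/\ ent h 2 2 = - ent h 0 0, ent h 3 3 = - ent h 1 1
    & forall r s, (r < 4)%N -> (s < 4)%N -> r != s -> ent h r s = 0].
Proof.
move=> [/sp4_ents [e1 e2 _ _ _] /is_diag_mxP hd]; split => // r s r4 s4 rs.
by apply: hd; rewrite /= !inordK.
Qed.

Lemma cartan_off h : cartan h ->
  (ent h 0 1 = 0) * (ent h 0 2 = 0) * (ent h 0 3 = 0) * (ent h 1 0 = 0) * (ent h 1 2 = 0) * (ent h 1 3 = 0) * (ent h 2 0 = 0) * (ent h 2 1 = 0) * (ent h 2 3 = 0) * (ent h 3 0 = 0) * (ent h 3 1 = 0) * (ent h 3 2 = 0).
Proof.
move=> /cartan_ent [_ _ hd].
exact: (hd 0%N 1%N isT isT isT, hd 0%N 2%N isT isT isT, hd 0%N 3%N isT isT isT, hd 1%N 0%N isT isT isT, hd 1%N 2%N isT isT isT, hd 1%N 3%N isT isT isT, hd 2%N 0%N isT isT isT, hd 2%N 1%N isT isT isT, hd 2%N 3%N isT isT isT, hd 3%N 0%N isT isT isT, hd 3%N 1%N isT isT isT, hd 3%N 2%N isT isT isT).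
Qed.

Lemma ent_br h x r s : cartan h -> (r < 4)%N -> (s < 4)%N ->
  ent (lie_br h x) r s = (ent h r r - ent h s s) * ent x r s.
Proof.
move=> /cartan_off hd r4 s4; rewrite /lie_br entD entN !entM.
by case: r r4 => [|[|[|[|?]]]] // _; case: s s4 => [|[|[|[|?]]]] // _;
  rewrite !hd; ring.
Qed.

Definition root_letter (i : nat) : C * C :=
  match i with 6 => (0, 2%:R) | 7 => (1, -1) | 8 => (1, 1) | _ => (2%:R, 0) end.

Lemma root_vector_spB i : (5 < i < 10)%N -> root_vector (root_letter i) (spB C i).
Proof.
move=> i10; split; first exact: spB_sp4.
move=> h ch; have [e1 e2 hd] := cartan_ent ch.
apply: ent_inj => r s r4 s4; rewrite ent_br // entZ ent_spB //.
rewrite /weight -/(ent h 0 0) -/(ent h 1 1).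
case: i i10 => [|[|[|[|[|[|[|[|[|[|//]]]]]]]]]] // _;
by case: r r4 => [|[|[|[|?]]]] // _; case: s s4 => [|[|[|[|?]]]] // _ /=;
  rewrite ?(mulr0z, mulr0) // ?e1 ?e2; ring.
Qed.

Lemma highest_weight_hwv lam (L : lieMod (@sp4 C)) (v : L) :
  highest_weight_vector lam v -> hwv lam v.
Proof.
move=> [v0 vh vr]; split => //.
- rewrite /opm vh; last exact: cartan_spB.
  by rewrite /weight -/(ent _ 0 0) -/(ent _ 1 1) !ent_spB //= mulr1 mulr0 addr0.
- rewrite /opm vh; last exact: cartan_spB.
  by rewrite /weight -/(ent _ 0 0) -/(ent _ 1 1) !ent_spB //= mulr1 mulr0 add0r.
- move=> i i5; have [i10|i10] := ltnP i 10; last by rewrite /opm spB_big // act0l.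
  apply: (vr (root_letter i)); last by apply: root_vector_spB; rewrite i5.
  case: i i5 i10 => [|[|[|[|[|[|[|[|[|[|//]]]]]]]]]] // _ _; by rewrite !inE eqxx ?orbT.
Qed.

Definition weil_vac : weil C :=
  sub_in (weil_submodule C) (weil_delta_pred C (lexx 0) (lexx 0) (erefl : 0 + 0 = 0 * 2 :> int)).

Lemma weil_vac_neq0 : weil_vac != 0.
Proof.
apply/eqP => /(congr1 (@sub_val _ _ _ _ _ _)); rewrite (lin0 (@sub_val_linear _ _ _ _ _ _)).
by move=> /(congr1 (fun f : lat C => f 0 0)); rewrite /= /lat_delta /= => /eqP; rewrite oner_eq0.
Qed.

(** The derivations z0 and z1 kill the constant 1, so among these letters only the Cartan ones
    survive, and each acts by 1/2 - 1, the 1 being the commutator of z0 and z2 or of z1 and z3. *)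
Lemma weil_vac_op i : (3 < i)%N -> opm i weil_vac =
  (if (i == 4) || (i == 5) then - 2%:R^-1 else 0 : C) *: weil_vac.
Proof.
move=> i3; apply: sub_val_inj; rewrite /opm sub_val_act ?spB_sp4 //.
rewrite (linZ (@sub_val_linear _ _ _ _ _ _)) sub_inK.
rewrite [LHS](weyl_letter (wlz_weyl C)).
have n2 : (2%:R : C) != 0 by rewrite pnatr_eq0.
have z (n : int) (b : bool) : (b -> n + 1 = 0) -> (n + 1)%:~R * b%:R = 0 :> C.
  by case: b => [->|_]; rewrite ?mul0r ?mulr0.
have w0 : wlz i40 (lat_delta C 0 0) = 0.
  by apply: lat_ext => a b; rewrite /wlz /= /lat_delta z ?oppr0 //; case/andP => /eqP.
have w1 : wlz i41 (lat_delta C 0 0) = 0.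
  by apply: lat_ext => a b; rewrite /wlz /= /lat_delta z ?oppr0 //; case/andP => _ /eqP.
have l0 k : wlz k 0 = 0 :> lat C by exact: lin0 (weyl_lin (wlz_weyl C) k).
case: i i3 => [|[|[|[|[|[|[|[|[|[|?]]]]]]]]]] //= _;
  rewrite ?w0 ?w1 ?l0 ?oppr0 ?scale0r //.
- have -> : wlz i40 (wlz i42 (lat_delta C 0 0)) = lat_delta C 0 0.
    by rewrite (weyl_comm (wlz_weyl C)) w0 l0 add0r JE /= scale1r.
  by rewrite -[X in _ - X]scale1r -scalerBl; congr (_ *: _); field.
- have -> : wlz i41 (wlz i43 (lat_delta C 0 0)) = lat_delta C 0 0.
    by rewrite (weyl_comm (wlz_weyl C)) w1 l0 add0r JE /= scale1r.
  by rewrite -[X in _ - X]scale1r -scalerBl; congr (_ *: _); field.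
- by rewrite (weyl_comm (wlz_weyl C)) w0 l0 add0r JE /= scale0r oppr0.
Qed.

Lemma weil_hw : highest_weight_vector (3%:R / 2%:R - (rho C).1, 1 / 2%:R - (rho C).2) weil_vac.
Proof.
have n2 : (2%:R : C) != 0 by rewrite pnatr_eq0.
split; first exact: weil_vac_neq0.
- move=> h ch; have [e1 e2 hd] := cartan_ent ch.
  rewrite (act_coord _ ch.1) /weight -/(ent h 0 0) -/(ent h 1 1) /=.
  rewrite -(big_mkord xpredT (fun i => sp4_coord h i *: opm i weil_vac)).
  rewrite /index_iota !big_cons big_nil [sp4_coord h 0]/= [sp4_coord h 1]/= [sp4_coord h 2]/=
    [sp4_coord h 3]/= [sp4_coord h 6]/= [sp4_coord h 7]/= [sp4_coord h 8]/= [sp4_coord h 9]/=.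
  rewrite !(cartan_off ch) !oppr0 !mul0r !scale0r !add0r !addr0 !weil_vac_op //.
  move: weil_vac => v; rewrite /= !scalerA -scalerDl.
  by congr (_ *: _); field.
- move=> r rin x [sx rx].
  rewrite (act_coord _ sx) big1 // => -[i i10] _; rewrite [nat_of_ord _]/=.
  have [i5|i5] := ltnP 5 i.
    by rewrite weil_vac_op ?(ltn_trans _ i5) // !gtn_eqF ?scale0r ?scaler0 // (ltn_trans _ i5).
  have H j a b : j \in [:: 4; 5]%N -> (a < 4)%N -> (b < 4)%N ->
    (ent (spB C j) a a - ent (spB C j) b b) * ent x a b = weight r (spB C j) * ent x a b.
    by move=> j45 a4 b4; rewrite -ent_br ?rx ?entZ //; exact: cartan_spB.
  have H4 a b (a4 : (a < 4)%N) (b4 : (b < 4)%N) := H 4%N a b isT a4 b4.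
  have H5 a b (a4 : (a < 4)%N) (b4 : (b < 4)%N) := H 5%N a b isT a4 b4.
  have w4 : weight r (spB C 4) = r.1.
    by rewrite /weight -/(ent _ 0 0) -/(ent _ 1 1) !ent_spB //= mulr1 mulr0 addr0.
  have w5 : weight r (spB C 5) = r.2.
    by rewrite /weight -/(ent _ 0 0) -/(ent _ 1 1) !ent_spB //= mulr1 mulr0 add0r.
  have E4 a b (a4 : (a < 4)%N) (b4 : (b < 4)%N) : ((spT 4 a a - spT 4 b b)%:~R - r.1) * ent x a b = 0.
    have := H4 a b a4 b4; rewrite w4 !ent_spB // => e.
    by rewrite mulrBl -e rmorphB subrr.
  have E5 a b (a4 : (a < 4)%N) (b4 : (b < 4)%N) : ((spT 5 a a - spT 5 b b)%:~R - r.2) * ent x a b = 0.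
    have := H5 a b a4 b4; rewrite w5 !ent_spB // => e.
    by rewrite mulrBl -e rmorphB subrr.
  have Z (y e : C) : y != 0 -> y * e = 0 -> e = 0.
    by move=> y0 /eqP; rewrite mulf_eq0 (negPf y0) => /eqP.
  suff -> : sp4_coord x i = 0 by rewrite scale0r.
  have nz (n : int) : n != 0 -> (n%:~R : C) != 0 by rewrite intr_eq0.
  (* Positive roots have integral coordinates, so it is decided by comparing integers that a root
     vector has no component along the letters 0 to 5. *)
  have R : exists p q : int, [/\ r.1 = p%:~R, r.2 = q%:~R & (p, q) \in ([:: (1, -1); (0, 2); (1, 1); (2, 0)] : seq (int * int))].
    move: rin; rewrite !inE => /or4P[] /eqP ->.
    - by exists 1, (-1). - by exists 0, 2. - by exists 1, 1. - by exists 2, 0.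
  have [p [q [r1 r2 pq]]] := R.
  have Z4 a b (a4 : (a < 4)%N) (b4 : (b < 4)%N) : spT 4 a a - spT 4 b b != p -> ent x a b = 0.
    by move=> ne; apply: Z (E4 a b a4 b4); rewrite r1 -rmorphB nz // subr_eq0.
  have Z5 a b (a4 : (a < 4)%N) (b4 : (b < 4)%N) : spT 5 a a - spT 5 b b != q -> ent x a b = 0.
    by move=> ne; apply: Z (E5 a b a4 b4); rewrite r2 -rmorphB nz // subr_eq0.
  move: pq; rewrite !inE !xpair_eqE => pq.
  case: i i10 i5 => [|[|[|[|[|[|//]]]]]] _ _ /=.
  - by rewrite Z4 ?oppr0 ?mul0r //; case/or4P: pq => /andP[/eqP -> _].
  - by rewrite Z4 ?oppr0 //; case/or4P: pq => /andP[/eqP -> _].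
  - by rewrite Z4 //; case/or4P: pq => /andP[/eqP -> _].
  - by rewrite Z5 ?oppr0 ?mul0r //; case/or4P: pq => /andP[_ /eqP ->].
  - by case/or4P: pq => /andP[/eqP p1 /eqP q1]; [apply: Z4|apply: Z5|apply: Z4|apply: Z4]; rewrite ?p1 ?q1.
  - by case/or4P: pq => /andP[/eqP p1 /eqP q1]; [apply: Z4|apply: Z5|apply: Z4|apply: Z4]; rewrite ?p1 ?q1.
Qed.

(** The scalar of [weyl_central] is attained on the simple module [weil], and [hw_scalar_unique]
    gives the same scalar on every simple module of that highest weight; so the choice made in
    [central_char] is forced. *)
Lemma central_char_weyl (u : Uterm (@sp4 C)) : Ucentral u ->
  forall (M : lieMod (@sp4 C)) (z : 'I_4 -> M -> M), weyl_ops z ->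
    {in @sp4 C, forall A (m : M), act A m = weyl_act z A m} ->
    forall m : M, Uact u m = central_char (3%:R / 2%:R) (1 / 2%:R) u *: m.
Proof.
move=> uc; have [c0 H] := weyl_central uc.
suff -> : central_char (3%:R / 2%:R) (1 / 2%:R) u = c0 by [].
have Hw (m : weil C) : Uact u m = c0 *: m.
  apply: sub_val_inj; rewrite (linZ (@sub_val_linear _ _ _ _ _ _)).
  rewrite (Uact_hom (N := weil_full C) _ _ (conj (@sub_val_linear _ _ _ _ _ _) _)).
    exact: (H (weil_full C) (@wlz C) (wlz_weyl C)).
  by move=> x sx y; rewrite sub_val_act.
rewrite /central_char; apply: xget_unique.
  exists (weil C); split => //; split; first exact: weil_simple.
  by exists weil_vac; apply: weil_hw.
move=> c [L [[_ [v /highest_weight_hwv hv]] Lc]].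
exact: hw_scalar_unique hv (highest_weight_hwv weil_hw) (Lc v) (Hw _).
Qed.

End CentralChar.

(** * Twisting modules by symplectic matrices *)

Section Twist.
Variable C : numFieldType.
Local Notation J := (symplJ C).
Implicit Types (S x y : 'M[C]_4).

Definition symplectic S : Prop := S^T *m J *m S = J.

Definition spinv S : 'M[C]_4 := - (J *m S^T *m J).

Lemma spinvK S : symplectic S -> spinv S *m S = 1%:M.
Proof.
by move=> e; rewrite /spinv mulNmx -!mulmxA (mulmxA S^T) e JJ opprK.
Qed.

Lemma spinvVK S : symplectic S -> S *m spinv S = 1%:M.
Proof. by move/spinvK/mulmx1C. Qed.

Lemma symplecticT S : symplectic S -> S *m J *m S^T = J.
Proof.
move/spinvVK; rewrite /spinv mulmxN !mulmxA => /(congr1 (fun A => A *m J)).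
by rewrite mulNmx -[X in - X]mulmxA JJ mulmxN mulmx1 opprK mul1mx.
Qed.

Lemma symplectic_inv S : symplectic S -> symplectic (spinv S).
Proof.
move=> hS; rewrite /symplectic.
have h := spinvVK hS; have h' := spinvK hS.
rewrite -[in LHS]hS !mulmxA -trmx_mul h trmx1 mul1mx -[_ *m S *m _]mulmxA h mulmx1.
by [].
Qed.

Lemma spinv_inv S : symplectic S -> spinv (spinv S) = S.
Proof.
move=> hS; rewrite -[LHS]mulmx1 -(spinvK hS) mulmxA.
by rewrite spinvK ?mul1mx //; apply: symplectic_inv.
Qed.

Definition spconj S x := S *m x *m spinv S.

Lemma spconj_sp4 S x : symplectic S -> x \in @sp4 C -> spconj S x \in @sp4 C.
Proof.
move=> hS; rewrite !mem_sp4 !addr_eq0 => /eqP e; apply/eqP.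
have hi := symplectic_inv hS.
have iT : S^T *m J = J *m spinv S.
  by rewrite -[LHS]mulmx1 -(spinvVK hS) !mulmxA hS.
have iT' : (spinv S)^T *m J = J *m S.
  by rewrite -[LHS]mulmx1 -(spinvK hS) !mulmxA hi.
rewrite /spconj !trmx_mul -!mulmxA iT mulmxA -[_ *m x^T *m _]mulmxA.
rewrite (mulmxA x^T) e !(mulNmx, mulmxN) !mulmxA iT'.
by [].
Qed.

Lemma spconj_linear S : linear (spconj S).
Proof. by move=> a x y; rewrite /spconj mulmxDr mulmxDl -scalemxAr -scalemxAl. Qed.

Lemma spconj_br S x y : symplectic S -> spconj S (lie_br x y) = lie_br (spconj S x) (spconj S y).
Proof.
move=> hS; rewrite /spconj /lie_br mulmxBr mulmxBl; congr (_ - _);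
by rewrite !mulmxA -[_ *m spinv S *m S]mulmxA (spinvK hS) mulmx1.
Qed.

Lemma spconjK S x : symplectic S -> spconj (spinv S) (spconj S x) = x.
Proof.
move=> hS; rewrite /spconj spinv_inv // !mulmxA (spinvK hS) mul1mx.
by rewrite -mulmxA (spinvK hS) mulmx1.
Qed.

Lemma spconjVK S x : symplectic S -> spconj S (spconj (spinv S) x) = x.
Proof. by move=> hS; rewrite -{1}(spinv_inv hS) spconjK //; apply: symplectic_inv. Qed.

(** On the twist, the standard principal sl(2) acts as its conjugate by S acts on M. *)
Definition twist S (hS : symplectic S) (M : lieMod (@sp4 C)) : lieMod (@sp4 C) :=
  @LieMod C 4 (@sp4 C) M (fun x => act (spconj S x))
   (fun x sx => act_linear (spconj_sp4 hS sx))
   (fun a x y sx sy m => etrans (congr1 (fun t => act t m) (spconj_linear S a x y))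
     (act_linearl a (spconj_sp4 hS sx) (spconj_sp4 hS sy) m))
   (fun x y sx sy m => etrans (congr1 (fun t => act t m) (spconj_br x y hS))
     (act_br (spconj_sp4 hS sx) (spconj_sp4 hS sy) m)).

Lemma twist_act S (hS : symplectic S) (M : lieMod (@sp4 C)) x (m : M) :
  act x (m : twist hS M) = act (spconj S x) m.
Proof. by []. Qed.

Section TwistWeyl.
Variables (S : 'M[C]_4) (hS : symplectic S) (M : lieMod (@sp4 C)) (z : 'I_4 -> M -> M).
Hypotheses (w : weyl_ops z)
  (wa : {in @sp4 C, forall A (m : M), act A m = weyl_act z A m}).

(** The symplectic group acts on the Weyl algebra by linear changes of the generators, so the twist
    of a Weyl algebra module is again one. *)
Definition twz (k : 'I_4) (m : M) : M := \sum_j S j k *: z j m.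

Lemma twz_weyl : weyl_ops twz.
Proof.
have zl := weyl_lin w.
split=> [k a u v|k l m].
  rewrite /twz scaler_sumr -big_split; apply: eq_bigr => j _ /=.
  by rewrite zl scalerDr !scalerA mulrC.
have tt k' l' : twz k' (twz l' m) = \sum_i \sum_j (S i k' * S j l') *: z i (z j m).
  rewrite /twz; apply: eq_bigr => i _; rewrite (lin_sum (zl i)) scaler_sumr.
  by apply: eq_bigr => j _; rewrite (linZ (zl i)) scalerA.
rewrite !tt [X in _ = X + _]exchange_big /=.
have -> : J k l = \sum_i \sum_j S i k * S j l * J i j.
  rewrite -{1}hS mxE exchange_big /=; apply: eq_bigr => j _.
  rewrite mxE mulr_suml; apply: eq_bigr => i _.
  by rewrite [_^T _ _]mxE mulrAC.
rewrite scaler_suml -big_split; apply: eq_bigr => i _ /=.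
rewrite scaler_suml -big_split; apply: eq_bigr => j _ /=.
by rewrite (weyl_comm w i j) scalerDr scalerA (mulrC (S j l)).
Qed.

Lemma twz_act A : A \in @sp4 C -> forall m : M, act (spconj S A) m = weyl_act twz A m.
Proof.
have zl := weyl_lin w.
move=> sA m; rewrite wa; last exact: spconj_sp4.
rewrite /weyl_act; congr (_ *: _).
have -> : spconj S A *m J = S *m (A *m J) *m S^T.
  rewrite /spconj -!mulmxA; congr (_ *m (_ *m _)).
  by rewrite -{1}(symplecticT hS) !mulmxA (spinvK hS) mul1mx.
under [RHS]eq_bigr => k _.
  under eq_bigr => l _.
    rewrite /twz scaler_sumr.
    under eq_bigr => i _.
      rewrite (lin_sum (zl i)) !scaler_sumr.
      under eq_bigr => j _ do rewrite (linZ (zl i)) !scalerA.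
      over.
    rewrite exchange_big /=.
    over.
  rewrite exchange_big /=; under eq_bigr => j _ do rewrite exchange_big /=.
  over.
rewrite [RHS]exchange_big /=.
under [RHS]eq_bigr => j _ do rewrite exchange_big /=.
rewrite [RHS]exchange_big /=; apply: eq_bigr => i _; apply: eq_bigr => j _.
under [RHS]eq_bigr => k _ do rewrite -scaler_suml.
rewrite -scaler_suml; congr (_ *: _).
rewrite mxE exchange_big /=; apply: eq_bigr => l _.
rewrite [_^T _ _]mxE [X in X * _]mxE mulr_suml; apply: eq_bigr => k _.
by ring.
Qed.

End TwistWeyl.
End Twist.

(** * The value of the Casimir element *)

Section Casimir.
Variable C : numFieldType.

(** The normal form machinery is now used for the Weyl algebra, with letters z0, ..., z3 and
    constant commutators. *)
Definition weyl_br (i j : nat) : ncpoly :=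
  match i, j with 2, 0 => [:: (-1, [::])] | 3, 1 => [:: (-1, [::])] | _, _ => [::] end.

Definition wH : ncexpr := (NZ 1 - NZ 2 * (NV 0 * NV 2))%nc.
Definition wK : ncexpr := (NZ 1 - NZ 2 * (NV 1 * NV 3))%nc.
(** The image of 4 [xCas] in the Weyl algebra, where [wH] and [wK] are twice the images of [xH] and
    [xK], so that all coefficients are integers. *)
Definition wCas : ncexpr :=
  (NZ 4 * (NV 0 * (NV 0 * (NV 2 * NV 2))) + NZ 8 * (NV 0 * (NV 1 * (NV 2 * NV 3)))
   + NZ 4 * (NV 1 * (NV 1 * (NV 3 * NV 3))) - NZ 8 * (NV 0 * (NV 3 * (NV 1 * NV 2)))
   - wH * wH - wK * wK + NZ 8 * wH + NZ 4 * wK)%nc.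

Lemma weyl_casimir (M : lieMod (@sp4 C)) (z : 'I_4 -> M -> M) (m : M) : weyl_ops z ->
  {in @sp4 C, forall A (m : M), act A m = weyl_act z A m} ->
  ev (@opm C M) xCas m = (5%:R / 2%:R) *: m.
Proof.
move=> w wa.
pose zz (k : nat) : M -> M := if (k < 4)%N then z (inord k) else fun _ => 0.
have zzE k (k4 : (k < 4)%N) : zz k = z (Ordinal k4).
  by rewrite /zz k4; congr z; apply: val_inj; rewrite /= inordK.
have zl k : linear (zz k).
  rewrite /zz; case: ifP => _; first exact: weyl_lin w _.
  by move=> a u v; rewrite scaler0 addr0.
have zbr i j m' : (j < i)%N -> zz i (zz j m') = zz j (zz i m') + evp zz (weyl_br i j) m'.
  move=> ji; have [i4|i4] := ltnP i 4; last first.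
    have -> : weyl_br i j = [::] by case: i i4 {ji} => [|[|[|[|?]]]].
    have z0 x : zz i x = 0 by rewrite /zz ltnNge i4.
    by rewrite !z0 evp_nil (lin0 (zl j)) addr0.
  have j4 := ltn_trans ji i4.
  rewrite (zzE _ i4) (zzE _ j4) (weyl_comm w) JE /=; congr (_ + _).
  case: i ji i4 => [|[|[|[|//]]]] ji i4; case: j ji j4 => [|[|[|[|//]]]] ji j4 //=;
    by rewrite ?evp_nil ?evp_cons ?evp_nil /= ?addr0 ?scale0r.
have n2 : (2%:R : C) != 0 by rewrite pnatr_eq0.
have E i m' : (i < 10)%N -> opm i m' = weyl_act z (spB C i) m'.
  by move=> i10; rewrite /opm wa ?spB_sp4.
have Z0 : zz 0%N = z i40 by apply: zzE. have Z1 : zz 1%N = z i41 by apply: zzE.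
have Z2 : zz 2%N = z i42 by apply: zzE. have Z3 : zz 3%N = z i43 by apply: zzE.
have lc k := weyl_lin w k.
have H4 m' : opm 4 m' = 2%:R^-1 *: ev zz wH m'.
  by rewrite E // (weyl_letter w) /= Z0 Z2; lmod_with (M : lmodType C) ltac:(field).
have H5 m' : opm 5 m' = 2%:R^-1 *: ev zz wK m'.
  by rewrite E // (weyl_letter w) /= Z1 Z3; lmod_with (M : lmodType C) ltac:(field).
have lH := @ev_linear _ _ zz zl wH. have lK := @ev_linear _ _ zz zl wK.
have key : 4%:~R *: zz 0%N (zz 0%N (zz 2%N (zz 2%N m))) + 8%:~R *: zz 0%N (zz 1%N (zz 2%N (zz 3%N m)))
   + 4%:~R *: zz 1%N (zz 1%N (zz 3%N (zz 3%N m))) + (-1)%:~R *: (8%:~R *: zz 0%N (zz 3%N (zz 1%N (zz 2%N m))))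
   + (-1)%:~R *: ev zz wH (ev zz wH m) + (-1)%:~R *: ev zz wK (ev zz wK m)
   + 8%:~R *: ev zz wH m + 4%:~R *: ev zz wK m = 10%:~R *: m.
  by have := @nc_eqP weyl_br _ _ zz zl zbr wCas (NZ 10); apply; vm_compute.
rewrite /= !H4 !H5 !E // !(weyl_letter w) -/(ev zz wH) -/(ev zz wK).
rewrite (linZ lH) (linZ lK) -!Z0 -!Z1 -!Z2 -!Z3 !(linN (zl _)).
move: (zz 0%N (zz 0%N (zz 2%N (zz 2%N m)))) (zz 0%N (zz 1%N (zz 2%N (zz 3%N m))))
   (zz 1%N (zz 1%N (zz 3%N (zz 3%N m)))) (zz 0%N (zz 3%N (zz 1%N (zz 2%N m)))) key => a1 a2 a3 a4.
move: (ev zz wH (ev zz wH m)) (ev zz wK (ev zz wK m)) => hh kk.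
move: (ev zz wH m) (ev zz wK m) => hm km key.
transitivity (4%:R^-1 *: (10%:~R *: m)); last by rewrite scalerA; congr (_ *: _); field.
by rewrite -key; lmod_with (M : lmodType C) ltac:(field).
Qed.

Fixpoint uexpr (S : 'M[C]_4) (e : ncexpr) : Uterm (@sp4 C) :=
  match e with
  | NV i => Ugen (vsproj (@sp4 C) (spconj S (spB C i)))
  | NZ n => Uscal (@sp4 C) n%:~R
  | NA e1 e2 => Uadd (uexpr S e1) (uexpr S e2)
  | NM e1 e2 => Umul (uexpr S e1) (uexpr S e2)
  end.

Lemma Uact_uexpr S (hS : symplectic S) (M : lieMod (@sp4 C)) e (m : M) :
  Uact (uexpr S e) m = ev (@opm C (twist hS M)) e m.
Proof.
elim: e m => [i|n|e1 IH1 e2 IH2|e1 IH1 e2 IH2] m //=.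
- by rewrite vsprojK //; apply: spconj_sp4 => //; exact: spB_sp4.
- by rewrite IH1 IH2.
- by rewrite IH2 IH1.
Qed.

Lemma casimir_comm (M : lieMod (@sp4 C)) x (m : M) : x \in @sp4 C ->
  ev (@opm C M) xCas (act x m) = act x (ev (@opm C M) xCas m).
Proof.
move=> sx; rewrite !(act_coord _ sx) (lin_sum (@ev_lin _ M xCas)).
apply: eq_bigr => i _; rewrite (linZ (@ev_lin _ M xCas)); congr (_ *: _).
have chk : all_below 10 (fun i => nc_eq sp4_br (xCas * NV i)%nc (NV i * xCas)%nc) by vm_compute.
by have := @opm_eq C M (xCas * NV i)%nc (NV i * xCas)%nc; apply; exact: (all_belowP chk).
Qed.

Lemma casimir_central S : symplectic S -> Ucentral (uexpr S xCas).
Proof.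
move=> hS; apply: Ucentral_of_modules => M x sx m.
rewrite !(Uact_uexpr hS) -{1}(spconjVK x hS) -[act (spconj S _) m]/(act _ (m : twist hS M)).
rewrite casimir_comm; last by apply: spconj_sp4 => //; apply: symplectic_inv.
by rewrite twist_act spconjVK.
Qed.

(** The Casimir element conjugated by S is central, so its scalar can be read on the twisted Weil
    representation, which is a Weyl algebra module; there it is 5/2 by [weyl_casimir]. *)
Lemma casimir_value S (hS : symplectic S) (M : lieMod (@sp4 C)) (m : M) :
  has_central_character M (central_char (3%:R / 2%:R) (1 / 2%:R)) ->
  ev (@opm C (twist hS M)) xCas m = (5%:R / 2%:R) *: m.
Proof.
move=> hM; have uc := casimir_central hS.
rewrite -Uact_uexpr hM //; congr (_ *: _).
pose W := twist hS (weil_full C).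
have wa : {in @sp4 C, forall A (m : weil_full C), act A m = weyl_act (@wlz C) A m} by [].
have e1 := central_char_weyl uc (M := weil_full C) (wlz_weyl C) wa (lat_delta C 0 0).
have e2 : ev (@opm C W) xCas (lat_delta C 0 0) = (5%:R / 2%:R) *: (lat_delta C 0 0 : W).
  have w2 : @weyl_ops C W (@twz C S (weil_full C) (@wlz C)).
    exact: (@twz_weyl C S hS (weil_full C) (@wlz C) (wlz_weyl C)).
  have wa2 : {in @sp4 C, forall A (m : W), act A m = weyl_act (@twz C S (weil_full C) (@wlz C)) A m}.
    by move=> A sA m'; apply: (@twz_act C S hS (weil_full C) (@wlz C) (wlz_weyl C) wa A sA m').
  exact: (@weyl_casimir W (@twz C S (weil_full C) (@wlz C)) (lat_delta C 0 0) w2 wa2).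
have e3 : central_char (3%:R / 2%:R) (1 / 2%:R) (uexpr S xCas) *: lat_delta C 0 0 = (5%:R / 2%:R) *: lat_delta C 0 0.
  by rewrite -e1 (Uact_uexpr hS) e2.
have := congr1 (fun f : lat C => f 0 0) e3.
by rewrite /= !latZE /lat_delta /= !mulr1.
Qed.

End Casimir.

(** * Eigenvectors of one operator relative to another *)

Section EigenZ.
Variables (C : fieldType) (M : lmodType C) (T Z : M -> M).
Hypotheses (lT : linear T) (lZ : linear Z) (Zinj : forall u, Z u = 0 -> u = 0)
  (TZ : forall u, T (Z u) = Z (T u)).

(** Independence of eigenvectors of Z^-1 T, written without inverting Z: the operator T - mu_a Z
    removes one vector from the sum and rescales the others, up to Z. *)
Lemma eigZ_split n (mu : 'I_n -> C) (w : 'I_n -> M) :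
  injective mu -> (forall i, T (w i) = mu i *: Z (w i)) ->
  \sum_i w i = 0 -> forall i, w i = 0.
Proof.
suff H (s : seq 'I_n) (x : M) nu : uniq s -> injective mu -> (forall i, i \in s -> mu i != nu) ->
    T x = nu *: Z x -> forall w : 'I_n -> M, (forall i, T (w i) = mu i *: Z (w i)) ->
    x + \sum_(i <- s) w i = 0 -> x = 0.
  move=> mi Tw s0 i.
  pose s := [seq j <- index_enum 'I_n | j != i].
  have us : uniq s by rewrite filter_uniq // /index_enum -enumT enum_uniq.
  have hm j : j \in s -> mu j != mu i by rewrite mem_filter => /andP[ji _]; rewrite (inj_eq mi).
  apply: (H s _ (mu i) us mi hm (Tw i) w Tw).
  by move: s0; rewrite (bigD1 i) //= big_filter.
elim: s x => [|a s IH] x /=; first by move=> _ _ _ _ v _; rewrite big_nil addr0.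
move=> /andP[as_ us] mi mun Tx v Tv; rewrite big_cons => e.
have an : nu - mu a != 0 by rewrite subr_eq0 eq_sym mun // mem_head.
have : (nu - mu a) *: Z x = 0.
  have hm i : i \in s -> mu i != nu by move=> is_; apply: mun; rewrite inE is_ orbT.
  have hx : T ((nu - mu a) *: Z x) = nu *: Z ((nu - mu a) *: Z x).
    by rewrite (linZ lT) TZ Tx !(linZ lZ) !scalerA mulrC.
  have hv i : T ((mu i - mu a) *: Z (v i)) = mu i *: Z ((mu i - mu a) *: Z (v i)).
    by rewrite (linZ lT) TZ Tv !(linZ lZ) !scalerA mulrC.
  apply: (IH _ us mi hm hx (fun i => (mu i - mu a) *: Z (v i)) hv).
  have e1 : T (x + (v a + \sum_(i <- s) v i)) = 0 by rewrite e (lin0 lT).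
  have e2 : Z (x + (v a + \sum_(i <- s) v i)) = 0 by rewrite e (lin0 lZ).
    have e3 : T (x + (v a + \sum_(i <- s) v i)) + (- mu a) *: Z (x + (v a + \sum_(i <- s) v i)) = 0.
      by rewrite e1 e2 scaler0 addr0.
    rewrite -[RHS]e3.
    rewrite !(linD lT) !(linD lZ) Tx Tv (lin_sum lT) (lin_sum lZ).
    have -> : \sum_(i <- s) (mu i - mu a) *: Z (v i) =
       \sum_(i <- s) T (v i) + (- mu a) *: \sum_(i <- s) Z (v i).
      by rewrite scaler_sumr -big_split; apply: eq_bigr => i _; rewrite /= Tv scalerDl.
    move: (\sum_(i <- s) T (v i)) (\sum_(i <- s) Z (v i)) => A B.
    by lmod_with M ltac:(ring).
move/eqP; rewrite scaler_eq0 (negPf an) /= => /eqP; exact: Zinj.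
Qed.

End EigenZ.

Section PolyEigen.
Variables (C : closedFieldType) (M : lmodType C) (T Z : M -> M).
Hypotheses (lT : linear T) (lZ : linear Z) (Zinj : forall u, Z u = 0 -> u = 0)
  (TZ : forall u, T (Z u) = Z (T u)).
Variable P : nat -> M -> Prop.
Hypotheses (Plin : forall n a u v, P n u -> P n v -> P n (a *: u + v)) (P0 : forall n, P n 0)
  (PT : forall n u, P n u -> P n.+1 (T u)) (PZ : forall n u, P n u -> P n.+1 (Z u)).

(** The homogenization of p: formally Z^k p(Z^-1 T) u. *)
Definition hpe (k : nat) (p : {poly C}) (u : M) : M :=
  \sum_(i < k.+1) p`_i *: iter i T (iter (k - i) Z u).

Lemma iterT_lin i : linear (iter i T).
Proof. by elim: i => // i IH a u v; rewrite /= IH lT. Qed.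
Lemma iterZ_lin i : linear (iter i Z).
Proof. by elim: i => // i IH a u v; rewrite /= IH lZ. Qed.
Lemma iterTZ i u : iter i T (Z u) = Z (iter i T u).
Proof. by elim: i => //= i ->; rewrite TZ. Qed.

Lemma hpe_factor k (q : {poly C}) (x : C) u : (size q <= k.+1)%N ->
  hpe k.+1 (q * ('X - x%:P)) u = T (hpe k q u) - x *: Z (hpe k q u).
Proof.
move=> sq; rewrite /hpe (lin_sum lT) (lin_sum lZ) scaler_sumr.
have co i : (q * ('X - x%:P))`_i = (if i is j.+1 then q`_j else 0) - x * q`_i.
  by rewrite mulrBr coefB coefMX coefMC mulrC; case: i.
have -> : \sum_(i < k.+2) (q * ('X - x%:P))`_i *: iter i T (iter (k.+1 - i) Z u) =
  \sum_(i < k.+2) (if val i is j.+1 then q`_j else 0) *: iter i T (iter (k.+1 - i) Z u)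
  - \sum_(i < k.+2) (x * q`_i) *: iter i T (iter (k.+1 - i) Z u).
  by rewrite -sumrB; apply: eq_bigr => i _; rewrite co scalerBl.
congr (_ - _).
  rewrite big_ord_recl /= scale0r add0r; apply: eq_bigr => i _.
  by rewrite (linZ lT) /bump /= add1n subSS.
rewrite big_ord_recr /= nth_default // mulr0 scale0r addr0; apply: eq_bigr => i _ /=.
by rewrite (linZ lZ) scalerA subSn ?iterTZ // -ltnS.
Qed.

Lemma hpe_P k p u n : P n u -> P (n + k)%N (hpe k p u).
Proof.
move=> Pu; rewrite /hpe.
have PD v v' : P (n + k)%N v -> P (n + k)%N v' -> P (n + k)%N (v + v').
  by move=> ? ?; rewrite -[v]scale1r; apply: Plin.
apply: big_ind => // -[i ik] _; rewrite -[_ *: _]addr0; apply: Plin => //=.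
have PZi j m : P m u -> P (m + j)%N (iter j Z u).
  by move=> ?; elim: j => [|j IH]; rewrite ?addn0 // addnS; apply: PZ.
have PTi j m v : P m v -> P (m + j)%N (iter j T v).
  by move=> ?; elim: j => [|j IH]; rewrite ?addn0 // addnS; apply: PT.
by rewrite -(subnK (ik : (i <= k)%N)) addnA subnK //; apply/PTi/PZi.
Qed.

(** A root x of p splits off a factor T - x Z. Either what remains is a nonzero vector, which is
    then an eigenvector, or it vanishes and the degree drops. The index of P keeps track of the
    weight. *)
Lemma poly_eigen k (p : {poly C}) u n : p != 0 -> (size p <= k.+1)%N -> P n u -> u != 0 ->
  hpe k p u = 0 -> exists n' u' x, [/\ P n' u', u' != 0 & T u' = x *: Z u'].
Proof.
elim: k p => [|k IH] p p0 sp Pu u0.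
  rewrite /hpe big_ord_recl big_ord0 addr0 /= => /eqP; rewrite scaler_eq0 (negPf u0) orbF => /eqP e.
  by move: p0; rewrite [p]size1_polyC // e eqxx.
have [s1|s1] := leqP (size p) 1.
  have pc := size1_polyC s1; rewrite {1}pc /hpe big_ord_recl big1 ?addr0; last first.
    by move=> i _; rewrite coefC /= scale0r.
  rewrite coefC /= => /eqP; rewrite scaler_eq0 => /orP[/eqP e|/eqP].
    by move: p0; rewrite pc e eqxx.
  have Zi j : iter j Z u = 0 -> u = 0 by elim: j => //= j IHj /Zinj.
  by move=> /(Zi k.+1) e; rewrite e eqxx in u0.
have [x rx] : exists x, root p x by apply: closed_rootP; rewrite neq_ltn s1 orbT.
have [q pq] := factor_theorem _ _ rx.
have q0 : q != 0 by apply: contraNneq p0 => q0; rewrite pq q0 mul0r.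
have sq : (size q <= k.+1)%N.
  by move: sp; rewrite pq size_Mmonic ?monicXsubC // size_XsubC addn2 /= ltnS.
rewrite pq hpe_factor // => e.
have [w0|w0] := eqVneq (hpe k q u) 0; first exact: (IH q).
exists (n + k)%N, (hpe k q u), x; split => //; first exact: hpe_P.
by apply/eqP; rewrite -subr_eq0 e.
Qed.

End PolyEigen.

Opaque opm.

(** * Local nilpotency *)

Definition xe : ncexpr := (xa + xE)%nc.
Definition xf : ncexpr := (NZ 3 * xc - xF)%nc.

Definition adx (x y : ncexpr) : ncexpr := (x * y - y * x)%nc.

Section Operators.
Variables (C : numFieldType) (N : lieMod (@sp4 C)).
Local Notation U := (ev (@opm C N)).

Lemma U_lin e : linear (U e). Proof. exact: ev_lin. Qed.

Lemma Ueqn e1 e2 m : nc_eq sp4_br e1 e2 -> U e1 m = U e2 m.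
Proof. by move=> h; apply: opm_eq. Qed.

Lemma UM e1 e2 m : U (e1 * e2)%nc m = U e1 (U e2 m). Proof. by []. Qed.
Lemma UA e1 e2 m : U (e1 + e2)%nc m = U e1 m + U e2 m. Proof. by []. Qed.
Lemma UZ n m : U (NZ n) m = n%:~R *: m. Proof. by []. Qed.
Lemma USB e1 e2 m : U (e1 - e2)%nc m = U e1 m - U e2 m.
Proof. by rewrite /= rmorphN1 scaleN1r. Qed.

Lemma iterU_lin x j : linear (iter j (U x)).
Proof. by elim: j => // j IH a u v; rewrite /= IH U_lin. Qed.

Lemma sp4_submodule (P : N -> Prop) : P 0 -> (forall a u v, P u -> P v -> P (a *: u + v)) ->
  (forall i m, (i < 10)%N -> P m -> P (opm i m)) -> submodule P.
Proof.
move=> P0 Pl Po; split => // x sx m Pm; rewrite (act_coord _ sx).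
have PD u v : P u -> P v -> P (u + v) by move=> ? ?; rewrite -[u]scale1r; apply: Pl.
apply: big_ind => // i _; rewrite -[_ *: _]addr0; apply: Pl => //; exact: Po.
Qed.

Lemma tors_step x y s j m : nc_eq sp4_br (iter s (adx x) y) (NZ 0) ->
  iter j (U x) m = 0 -> iter (j + s) (U x) (U y m) = 0.
Proof.
elim: s y j m => [|s IH] y j m.
  move=> h _; rewrite (Ueqn _ h) UZ scale0r.
  exact: (lin0 (iterU_lin x _)).
rewrite iterSr => h; elim: j m => [|j IHj] m.
  by move=> e; rewrite (e : m = 0) (lin0 (U_lin y)) (lin0 (iterU_lin x _)).
rewrite iterSr => jm; rewrite addSn iterSr.
have -> : U x (U y m) = U y (U x m) + U (adx x y) m.
  by rewrite /adx USB !UM addrC subrK.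
rewrite (linD (iterU_lin x _)) IHj // add0r addnS -addSn IH //.
by rewrite -iterSr in jm *.
Qed.

Definition tors x (m : N) : Prop := exists j, iter j (U x) m = 0.

Definition adnil x := all_below 10 (fun i => nc_eq sp4_br (iter 7 (adx x) (NV i)) (NZ 0)).

Lemma iterU_add0 x i j m : iter j (U x) m = 0 -> iter (i + j) (U x) m = 0.
Proof. by rewrite iterD => ->; apply: (lin0 (iterU_lin x _)). Qed.

(** By the Leibniz rule this follows from the nilpotency of ad x on sp(4). Seven steps are enough
    for the elements used here, as V_6 is the largest constituent under the principal sl(2). *)
Lemma tors_submodule x : adnil x -> submodule (tors x).
Proof.
move=> hx; apply: sp4_submodule.
- by exists 0%N.
- move=> a u v [i ui] [j vj]; exists (i + j)%N; rewrite (iterU_lin x).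
  by rewrite (iterU_add0 i vj) addnC (iterU_add0 j ui) scaler0 addr0.
- move=> i m i10 [j jm]; exists (j + 7)%N.
  exact: (@tors_step x (NV i) 7 j m (all_belowP hx i10) jm).
Qed.

Lemma last_iter x m : m != 0 -> tors x m -> exists j, iter j (U x) m != 0 /\ iter j.+1 (U x) m = 0.
Proof.
move=> m0 [j]; elim: j => [/= e|j IH /= jm]; first by rewrite e eqxx in m0.
have [/IH //|j0] := eqVneq (iter j (U x) m) 0.
by exists j.
Qed.

Lemma last_in x (P : N -> Prop) m : (forall m, P m -> P (U x m)) -> P m -> m != 0 ->
  tors x m -> exists m', [/\ P m', m' != 0 & U x m' = 0].
Proof.
move=> Px Pm m0 /(last_iter m0) [j [j0 j1]]; exists (iter j (U x) m); split => //.
by elim: j {j0 j1} => //= j IH; apply: Px.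
Qed.

(* Leibniz rule, along the paths of a two-dimensional array of vectors. *)
Lemma leibniz x (A : nat -> nat -> N) k :
  (forall s j, U x (A s j) = A s.+1 j + A s j.+1) ->
  forall s j, iter k (U x) (A s j) = \sum_(i < k.+1) 'C(k, i)%:R *: A (s + i)%N (j + (k - i))%N.
Proof.
move=> HA; elim: k => [|k IH] s j.
  by rewrite big_ord_recl big_ord0 /= bin0 scale1r !addn0 addr0.
rewrite iterSr HA (linD (iterU_lin x _)) !IH [RHS]big_ord_recl /= bin0 addn0 subn0.
have -> : \sum_(i < k.+1) 'C(k.+1, bump 0 i)%:R *: A (s + bump 0 i)%N (j + (k.+1 - bump 0 i))%N =
  \sum_(i < k.+1) 'C(k, i)%:R *: A (s.+1 + i)%N (j + (k - i))%N
  + \sum_(i < k.+1) 'C(k, i.+1)%:R *: A (s + i.+1)%N (j + (k - i))%N.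
  rewrite -big_split; apply: eq_bigr => i _; rewrite /bump /= add1n binS natrD scalerDl addrC.
  by rewrite subSS addSnnS.
rewrite addrCA; congr (_ + _); rewrite big_ord_recl /= bin0 subn0 addn0 -addSnnS; congr (_ + _).
rewrite [RHS]big_ord_recr /= bin_small // scale0r addr0; apply: eq_bigr => i _.
by rewrite /bump /= add1n addSnnS -subSn.
Qed.

(* If [X Y^j = k j Y^(j-1) (H - (j - 1))] on ker X, then some vector of a Y-nilpotent
   part of ker X is an eigenvector of H with natural eigenvalue. *)
Lemma sl2_eig X Y H (k : int) (P : N -> Prop) m : k != 0 ->
  nc_eq sp4_br (X * Y)%nc (Y * X + NZ k * H)%nc ->
  nc_eq sp4_br (H * Y)%nc (Y * H - NZ 2 * Y)%nc ->
  (forall a u v, P u -> P v -> P (a *: u + v)) -> (forall m, P m -> P (U H m)) ->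
  (forall m, P m -> U X m = 0) -> P m -> m != 0 -> tors Y m ->
  exists m' (l : nat), [/\ P m', m' != 0 & U H m' = l%:R *: m'].
Proof.
move=> k0 hXY hHY Pl PH PX.
have XY u : U X (U Y u) = U Y (U X u) + k%:~R *: U H u by exact: (Ueqn u hXY).
have HY u : U H (U Y u) = U Y (U H u) - 2%:R *: U Y u.
  by have := Ueqn u hHY; rewrite USB.
have HYj j u : U H (iter j (U Y) u) = iter j (U Y) (U H u) - (j%:R * 2%:R) *: iter j (U Y) u.
  elim: j => [|j IH] /=; first by rewrite mul0r scale0r subr0.
  rewrite HY IH (linB (U_lin Y)) (linZ (U_lin Y)).
  by rewrite -addrA -opprD -scalerDl -natr1; congr (_ - _ *: _); ring.
have XYj j u : P u -> U X (iter j.+1 (U Y) u) =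
    (k%:~R * j.+1%:R) *: iter j (U Y) (U H u - j%:R *: u).
  move=> Pu; elim: j => [|j IH].
    by rewrite /= XY PX // (lin0 (U_lin Y)) add0r scale0r subr0 mulr1.
  rewrite [iter j.+2 _ _]iterS XY IH HYj (linZ (U_lin Y)) -iterS.
  rewrite !(linB (iterU_lin Y _)) !(linZ (iterU_lin Y _)).
  move: (iter j.+1 (U Y) (U H u)) (iter j.+1 (U Y) u) => A B.
  by rewrite -!natr1; lmod_with (N : lmodType C) ltac:(ring).
move=> Pm m0 [j]; elim: j m Pm m0 => [|j IH] m Pm m0 jm; first by rewrite (jm : m = 0) eqxx in m0.
have := XYj j m Pm; rewrite jm (lin0 (U_lin X)) => /esym/eqP.
rewrite scaler_eq0 mulf_eq0 intr_eq0 (negPf k0) pnatr_eq0 /= => /eqP e.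
have [h0|h0] := eqVneq (U H m - j%:R *: m) 0.
  by exists m, j; split => //; apply/eqP; rewrite -subr_eq0 h0.
by apply: (IH _ _ h0 e); rewrite addrC -scaleNr; apply: Pl => //; apply: PH.
Qed.

End Operators.

Opaque opm ev.

Lemma adnil_list :
  [/\ adnil xe, adnil xf, adnil xX, adnil xY & [/\ adnil xa, adnil xE,
      adnil (NZ 3 * xc)%nc, adnil (NZ (-1) * xF)%nc & adnil xb]].
Proof. by split; last split; vm_compute. Qed.

Section Torsion.
Variables (C : numFieldType) (N : lieMod (@sp4 C)).
Local Notation U := (ev (@opm C N)).
Hypothesis simpleN : simple_mod N.

Lemma simple_all (P : N -> Prop) : submodule P -> (exists m, m != 0 /\ P m) -> forall m, P m.
Proof.
move=> sP [m [m0 Pm]]; have [_ /(_ P sP) [H|//]] := simpleN.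
by rewrite (H m Pm) eqxx in m0.
Qed.

Lemma simple_tors x : adnil x -> (exists m : N, m != 0 /\ tors x m) -> forall m : N, tors x m.
Proof. by move=> hx; apply: simple_all; apply: tors_submodule. Qed.

Lemma U_ad x y m : U x (U y m) = U (adx x y) m + U y (U x m).
Proof. by rewrite /adx USB !UM subrK. Qed.

Lemma ad_vanish x y s i m : nc_eq sp4_br (iter s (adx x) y) (NZ 0) -> (s <= i)%N ->
  U (iter i (adx x) y) m = 0.
Proof.
move=> h /subnK <-; elim: (i - s)%N m => [|j IH] m.
  by rewrite add0n (Ueqn _ h) UZ scale0r.
by rewrite addSn iterS /adx USB !UM !IH (lin0 (U_lin x)) subrr.
Qed.

(** Expand x^(L+s) y m = 0 by the Leibniz rule: a term with more than s brackets vanishes, and a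
    term with fewer contains a power of x beyond L. What remains is a binomial coefficient times the
    wanted vector. *)
Lemma leib_ad x y s (L : nat) (m : N) : nc_eq sp4_br (iter s.+1 (adx x) y) (NZ 0) ->
  U y m = 0 -> iter L.+1 (U x) m = 0 -> U (iter s (adx x) y) (iter L (U x) m) = 0.
Proof.
move=> h ym xm.
pose A i j := U (iter i (adx x) y) (iter j (U x) m).
have HA i j : U x (A i j) = A i.+1 j + A i j.+1 by rewrite /A U_ad.
have A0 i j : (L < j)%N -> A i j = 0.
  move=> Lj; rewrite /A -(subnK Lj) iterD xm (lin0 (iterU_lin x _)).
  exact: lin0 (U_lin _).
have := leibniz (L + s) HA 0 0; rewrite {1}/A /= ym (lin0 (iterU_lin x _)).
have sL : (s < (L + s).+1)%N by rewrite ltnS leq_addl.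
rewrite (bigD1 (Ordinal sL)) //= addnK !add0n big1 ?addr0.
  move=> /esym/eqP; rewrite scaler_eq0 pnatr_eq0 => /orP[|/eqP //].
  by rewrite -leqn0 leqNgt bin_gt0 leq_addl.
move=> i; rewrite -val_eqE /= => is_; rewrite !add0n.
have [si|si] := ltnP s i; first by rewrite /A (ad_vanish _ h si) scaler0.
by rewrite A0 ?scaler0 // ltn_subRL addnC ltn_add2l ltn_neqAle is_.
Qed.

(** The vector x^j m splits into H-eigenvectors with distinct eigenvalues. The extreme components
    are A^j m and B^j m, and each component vanishes separately. *)
Lemma split_tors x A B H (l : C) (sg : int) j (m : N) : sg != 0 ->
  nc_eq sp4_br x (A + B)%nc -> nc_eq sp4_br (H * A)%nc (A * H + NZ sg * A)%nc ->
  nc_eq sp4_br (H * B)%nc (B * H)%nc -> U H m = l *: m -> iter j (U x) m = 0 ->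
  iter j (U A) m = 0 /\ iter j (U B) m = 0.
Proof.
move=> sg0 hx hA hB Hm.
have [w [w1 w2 w3 w4]] : exists w : nat -> N, [/\ iter j (U x) m = \sum_(i < j.+1) w i,
    forall i, U H (w i) = (l + sg%:~R * i%:R) *: w i, w j = iter j (U A) m & w 0%N = iter j (U B) m
    /\ forall i, (j < i)%N -> w i = 0].
  elim: j => [|j [w [w1 w2 w3 [w4 w5]]]].
    exists (fun i => if i is 0%N then m else 0); split => //.
    - by rewrite big_ord_recl big_ord0 addr0.
    - by case=> [|i]; rewrite ?mulr0 ?addr0 ?Hm // (lin0 (U_lin H)) scaler0.
    - by split => // -[|i].
  exists (fun i => (if i is k.+1 then U A (w k) else 0) + U B (w i)); split.
  - rewrite iterS w1 (lin_sum (U_lin x)) [RHS]big_split /= [X in _ = X + _]big_ord_recl /= add0r.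
    rewrite [X in _ = _ + X]big_ord_recr /= (w5 j.+1) // (lin0 (U_lin B)) addr0 -big_split.
    by apply: eq_bigr => i _ /=; rewrite (Ueqn _ hx) UA.
  - move=> i; rewrite (linD (U_lin H)) scalerDr; congr (_ + _); last first.
      have := Ueqn (w i) hB; rewrite !UM => ->.
      by rewrite w2 (linZ (U_lin B)).
    case: i => [|i]; first by rewrite (lin0 (U_lin H)) scaler0.
    have := Ueqn (w i) hA; rewrite UA !UM UZ => ->.
    rewrite w2 (linZ (U_lin A)) -scalerDl -natr1; congr (_ *: _); ring.
  - by rewrite w3 (w5 j.+1) // (lin0 (U_lin B)) addr0.
  - split; first by rewrite add0r w4.
    case=> // i ji; rewrite !w5 ?(lin0 (U_lin _)) ?addr0 //; exact: ltnW.
rewrite w1 => s0; case: w4 => w4 _.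
have lid : linear (@id N) by [].
have inj0 (u : N) : id u = 0 -> u = 0 by [].
have mi : injective (fun i : 'I_j.+1 => l + sg%:~R * (nat_of_ord i)%:R).
  move=> p q /addrI /mulfI e; apply: val_inj; apply/eqP; rewrite -(eqr_nat C); apply/eqP.
  by apply: e; rewrite intr_eq0.
have Z := @eigZ_split C N (U H) id (U_lin H) lid inj0 (fun _ => erefl) j.+1 _ (fun i => w i) mi (fun i => w2 i) s0.
by rewrite -w3 -w4; split; [exact: (Z ord_max) | exact: (Z ord0)].
Qed.

(** If X kills a nonzero vector, then X acts locally nilpotently on N, like e and f. From these
    three one reaches Y, then a, E, c, F and b. There is then a vector killed by the positive root
    vectors with dominant integral weight, on which the Casimir element is nonpositive and cannot be
    5/2. *)
Lemma torsion_absurd (v m0 : N) (n : nat) :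
  (forall m, U xCas m = (5%:R / 2%:R) *: m) ->
  v != 0 -> U xe v = 0 -> U xh v = n%:R *: v -> tors xf v ->
  m0 != 0 -> U xX m0 = 0 -> False.
Proof.
move=> hC v0 ev hv fv m00 Xm0.
have [ae af aX aY [aa aE ac aF ab]] := adnil_list.
have TX := simple_tors aX (ex_intro _ m0 (conj m00 (ex_intro _ 1%N Xm0))).
have Te := simple_tors ae (ex_intro _ v (conj v0 (ex_intro _ 1%N ev))).
have Tf := simple_tors af (ex_intro _ v (conj v0 fv)).
have [v1 [[ev1 [n1 hv1]] v10 Xv1]] : exists v1, [/\ U xe v1 = 0 /\ (exists n : nat, U xh v1 = n%:R *: v1), v1 != 0 & U xX v1 = 0].
  refine (@last_in C N xX (fun m => U xe m = 0 /\ (exists n : nat, U xh m = n%:R *: m)) v _ (conj ev (ex_intro _ n hv)) v0 (TX v)).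
    move=> m [em [k hm]]; split.
      have := @Ueqn C N (xe * xX)%nc (xX * xe)%nc m ltac:(by vm_compute); rewrite !UM => ->.
      by rewrite em (lin0 (U_lin xX)).
    exists (k + 6)%N; have := @Ueqn C N (xh * xX)%nc (xX * xh + NZ 6 * xX)%nc m ltac:(by vm_compute); rewrite UA !UM UZ => ->.
    by rewrite hm (linZ (U_lin xX)) -scalerDl natrD.
have [L [L0 L1]] := last_iter v10 (Tf v1).
(* In V_6 the sixth power of ad f sends the highest weight vector X to a multiple of the lowest one,
   namely 6480 Y. *)
have Yu : U xY (iter L (U xf) v1) = 0.
  have h7 : nc_eq sp4_br (iter 7 (adx xf) xX) (NZ 0) by vm_compute.
  have := leib_ad h7 Xv1 L1.
  rewrite (@Ueqn C N _ (NZ 6480 * xY)%nc); last by vm_compute.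
  by rewrite UM UZ => /eqP; rewrite scaler_eq0 intr_eq0 => /eqP.
have TY := simple_tors aY (ex_intro _ _ (conj L0 (ex_intro _ 1%N Yu))).
have [m3 [l [m3P m30 Hm3]]] : exists m' (l : nat), [/\ U xX m' = 0, m' != 0 & U xH m' = l%:R *: m'].
  refine (@sl2_eig C N xX xY xH (-4) (fun m => U xX m = 0) v1 isT _ _ _ _ (fun m h => h) Xv1 v10 (TY v1)).
  - by vm_compute.
  - by vm_compute.
  - by move=> a u u' hu hu'; rewrite (U_lin xX) hu hu' scaler0 addr0.
  - move=> m hm; have := @Ueqn C N (xX * xH)%nc (xH * xX - NZ 2 * xX)%nc m ltac:(by vm_compute); rewrite USB !UM => ->.
    by rewrite hm (lin0 (U_lin _)) (lin0 (U_lin _)) subrr.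
have [je Hje] := Te m3.
(* The summands of e = a + E have [xH]-weights 1 and 0, those of f = 3 c - F have -1 and 0, and m3
   is an [xH]-eigenvector. *)
have [aj Ej] : iter je (U xa) m3 = 0 /\ iter je (U xE) m3 = 0.
  by refine (@split_tors xe xa xE xH l%:R 1 je m3 isT _ _ _ Hm3 Hje); vm_compute.
have [jf Hjf] := Tf m3.
have [cj Fj] : iter jf (U (NZ 3 * xc)%nc) m3 = 0 /\ iter jf (U (NZ (-1) * xF)%nc) m3 = 0.
  by refine (@split_tors xf (NZ 3 * xc)%nc (NZ (-1) * xF)%nc xH l%:R (-1) jf m3 isT _ _ _ Hm3 Hjf); vm_compute.
have Ta := simple_tors aa (ex_intro _ _ (conj m30 (ex_intro _ je aj))).
have TE := simple_tors aE (ex_intro _ _ (conj m30 (ex_intro _ je Ej))).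
have Tc := simple_tors ac (ex_intro _ _ (conj m30 (ex_intro _ jf cj))).
have TF := simple_tors aF (ex_intro _ _ (conj m30 (ex_intro _ jf Fj))).
have [p [_ p0 ap]] := @last_in C N xa (fun _ => True) v (fun _ _ => I) I v0 (Ta v).
have [s [s0 s1]] := last_iter p0 (TE p).
have bs : U xb (iter s (U xE) p) = 0.
  have h2 : nc_eq sp4_br (iter 2 (adx xE) xa) (NZ 0) by vm_compute.
  have := leib_ad h2 ap s1.
  rewrite (@Ueqn C N _ (NZ (-2) * xb)%nc); last by vm_compute.
  by rewrite UM UZ => /eqP; rewrite scaler_eq0 intr_eq0 => /eqP.
have Tb := simple_tors ab (ex_intro _ _ (conj s0 (ex_intro _ 1%N bs))).
have cm e1 e2 m : nc_eq sp4_br (e1 * e2)%nc (e2 * e1)%nc -> U e1 m = 0 -> U e1 (U e2 m) = 0.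
  by move=> /(@Ueqn C N _ _ m); rewrite !UM => -> ->; apply: lin0 (U_lin _).
have [q2 [Xq2 q20 bq2]] : exists q, [/\ U xX q = 0, q != 0 & U xb q = 0].
  refine (@last_in C N xb (fun m => U xX m = 0) v1 _ Xv1 v10 (Tb v1)) => m.
  by apply: cm; vm_compute.
have [q3 [[Xq3 bq3] q30 aq3]] : exists q, [/\ U xX q = 0 /\ U xb q = 0, q != 0 & U xa q = 0].
  refine (@last_in C N xa (fun m => U xX m = 0 /\ U xb m = 0) q2 _ (conj Xq2 bq2) q20 (Ta q2)) => m [Xm bm].
  split; first by apply: cm => //; vm_compute.
  have := @Ueqn C N (xb * xa)%nc (xa * xb - xX)%nc m ltac:(by vm_compute); rewrite USB !UM => ->.
  by rewrite bm Xm (lin0 (U_lin _)) subrr.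
pose P4 (m : N) := [/\ U xX m = 0, U xb m = 0, U xa m = 0 & U xE m = 0].
have [q4 [[Xq4 bq4 aq4] q40 Eq4]] : exists q, [/\ [/\ U xX q = 0, U xb q = 0 & U xa q = 0], q != 0 & U xE q = 0].
  refine (@last_in C N xE (fun m => [/\ U xX m = 0, U xb m = 0 & U xa m = 0]) q3 _ (And3 Xq3 bq3 aq3) q30 (TE q3)) => m [Xm bm am].
  split; [by apply: cm => //; vm_compute | by apply: cm => //; vm_compute |].
  have := @Ueqn C N (xa * xE)%nc (xE * xa + NZ 2 * xb)%nc m ltac:(by vm_compute); rewrite UA !UM => ->.
  by rewrite bm am !(lin0 (U_lin _)) addr0.
have P4q : P4 q4 := And4 Xq4 bq4 aq4 Eq4.
have P4lin a u u' : P4 u -> P4 u' -> P4 (a *: u + u').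
  move=> [h1 h2 h3 h4] [k1 k2 k3 k4]; split;
  by rewrite U_lin ?h1 ?h2 ?h3 ?h4 ?k1 ?k2 ?k3 ?k4 scaler0 addr0.
have P4K m : P4 m -> P4 (U xK m).
  move=> [h1 h2 h3 h4]; split; first by apply: cm => //; vm_compute.
  - have := @Ueqn C N (xb * xK)%nc (xK * xb - xb)%nc m ltac:(by vm_compute); rewrite USB !UM => ->.
    by rewrite h2 !(lin0 (U_lin _)) subrr.
  - have := @Ueqn C N (xa * xK)%nc (xK * xa + xa)%nc m ltac:(by vm_compute); rewrite UA !UM => ->.
    by rewrite h3 !(lin0 (U_lin _)) addr0.
  - have := @Ueqn C N (xE * xK)%nc (xK * xE - NZ 2 * xE)%nc m ltac:(by vm_compute); rewrite USB !UM => ->.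
    by rewrite h4 !(lin0 (U_lin _)) subrr.
have P4H m : P4 m -> P4 (U xH m).
  move=> [h1 h2 h3 h4]; split; last by apply: cm => //; vm_compute.
  - have := @Ueqn C N (xX * xH)%nc (xH * xX - NZ 2 * xX)%nc m ltac:(by vm_compute); rewrite USB !UM => ->.
    by rewrite h1 !(lin0 (U_lin _)) subrr.
  - have := @Ueqn C N (xb * xH)%nc (xH * xb - xb)%nc m ltac:(by vm_compute); rewrite USB !UM => ->.
    by rewrite h2 !(lin0 (U_lin _)) subrr.
  - have := @Ueqn C N (xa * xH)%nc (xH * xa - xa)%nc m ltac:(by vm_compute); rewrite USB !UM => ->.
    by rewrite h3 !(lin0 (U_lin _)) subrr.
(* The Cartan elements [xK] and [xH] - [xK] are the coroots of the two simple roots, and [sl2_eig]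
   makes both eigenvalues natural numbers. *)
have [q5 [l2 [P4q5 q50 Kq5]]] : exists m' (l : nat), [/\ P4 m', m' != 0 & U xK m' = l%:R *: m'].
  refine (@sl2_eig C N xE (NZ (-1) * xF)%nc xK 4 P4 q4 isT _ _ P4lin P4K _ P4q q40 (TF q4)).
  - by vm_compute.
  - by vm_compute.
  - by move=> m [].
have [q6 [l1 [[P4q6 Kq6] q60 Dq6]]] : exists m' (l : nat), [/\ P4 m' /\ U xK m' = l2%:R *: m', m' != 0 & U (xH - xK)%nc m' = l%:R *: m'].
  refine (@sl2_eig C N xa (NZ 3 * xc)%nc (xH - xK)%nc 3 (fun m => P4 m /\ U xK m = l2%:R *: m) q5 isT _ _ _ _ _ (conj P4q5 Kq5) q50 (Tc q5)).
  - by vm_compute.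
  - by vm_compute.
  - move=> a u u' [h1 h2] [k1 k2]; split; first exact: P4lin.
    by rewrite U_lin h2 k2 scalerDr !scalerA mulrC.
  - move=> m [h1 h2]; split.
      by rewrite USB h2 addrC -scaleNr; exact: (P4lin _ _ _ h1 (P4H _ h1)).
    have := @Ueqn C N (xK * (xH - xK))%nc ((xH - xK) * xK)%nc m ltac:(by vm_compute); rewrite !(UM xK) => ->.
    by rewrite UM h2 (linZ (U_lin _)).
  - by move=> m [[]].
have Hq6 : U xH q6 = (l1 + l2)%:R *: q6.
  by move: Dq6; rewrite USB Kq6 natrD scalerDl => /eqP; rewrite subr_eq => /eqP.
have [h1 h2 h3 h4] := P4q6.
(* With the raising letters on the right, the Casimir element acts on q6 as -(H^2 + K^2 + 4 H + 2
   K). *)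
have := @Ueqn C N xCas (NZ (-1) * (xH * xH) - xK * xK - NZ 4 * xH - NZ 2 * xK + xY * xX + NZ 2 * (xd * xb) + xF * xE - NZ 2 * (xc * xa))%nc q6.
have hn : nc_eq sp4_br xCas (NZ (-1) * (xH * xH) - xK * xK - NZ 4 * xH - NZ 2 * xK + xY * xX + NZ 2 * (xd * xb) + xF * xE - NZ 2 * (xc * xa))%nc by vm_compute.
move=> /(_ hn); rewrite hC !(USB, UA) !UM h1 h2 h3 h4 !(lin0 (U_lin _)) !UZ Hq6 Kq6.
rewrite !(linZ (U_lin _)) Hq6 Kq6 subr0 !addr0 !scalerA -!scaleNr -!scalerDl => /eqP.
rewrite -subr_eq0 -scalerBl scaler_eq0 (negPf q60) orbF => /eqP e.
move: e; clear => e.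
have e' : 5%:R / 2%:R + ((l1 + l2) * (l1 + l2) + l2 * l2 + 4 * (l1 + l2) + 2 * l2)%N%:R = 0 :> C.
  by rewrite !natrD !natrM -[RHS]e !natrD; ring.
move/eqP: e'; rewrite paddr_eq0 ?ler0n ?divr_ge0 ?ler0n // mulf_eq0 invr_eq0 !pnatr_eq0.
by [].
Qed.

End Torsion.

Opaque opm ev.

(** * Consequences of bounded multiplicities *)

(** [xJKt] and [xJFt] are corrections of X [xJK] and X^2 [xJF] that commute with e, so that they act
    on highest weight vectors of the principal sl(2). *)
Definition xJKt : ncexpr := (xX * xJK + NZ 4 * (xb * xJE))%nc.
Definition xJFt : ncexpr :=
  (xX * (xX * xJF) + NZ 2 * (xX * (xb * xJK)) + NZ 4 * (xb * (xb * xJE)))%nc.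

Ltac nc := vm_compute; reflexivity.

Section Bounded.
Variables (C : numClosedFieldType) (N : lieMod (@sp4 C)).
Local Notation U := (ev (@opm C N)).
Hypothesis Xinj : forall m : N, U xX m = 0 -> m = 0.
Variable b : nat.

Definition hwt (n : nat) (m : N) : Prop := U xe m = 0 /\ U xh m = n%:R *: m.

Hypothesis Hbound : forall n (w : 'I_b.+1 -> N), (forall i, hwt n (w i)) ->
  exists c : 'I_b.+1 -> C, (exists i, c i != 0) /\ \sum_i c i *: w i = 0.

Lemma hwt_lin n a u v : hwt n u -> hwt n v -> hwt n (a *: u + v).
Proof.
move=> [u1 u2] [v1 v2]; split; rewrite U_lin ?u1 ?v1 ?u2 ?v2 ?scaler0 ?addr0 //.
by rewrite scalerDr !scalerA mulrC.
Qed.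

Lemma hwt0 n : hwt n 0.
Proof. by split; rewrite (lin0 (U_lin _)) ?scaler0. Qed.

Lemma hwt_step n d e m : nc_eq sp4_br (xe * e)%nc (e * xe)%nc ->
  nc_eq sp4_br (xh * e)%nc (e * xh + NZ d%:Z * e)%nc -> hwt n m -> hwt (n + d) (U e m).
Proof.
move=> h1 h2 [m1 m2]; split.
  by have := @Ueqn C N _ _ m h1; rewrite !UM => ->; rewrite m1 (lin0 (U_lin e)).
have := @Ueqn C N _ _ m h2; rewrite UA !UM UZ => ->.
by rewrite m2 (linZ (U_lin e)) -scalerDl natrD.
Qed.

Lemma hwt_X n m : hwt n m -> hwt (n + 6) (U xX m).
Proof. by apply: hwt_step; nc. Qed.

Lemma hwt_Xj j n m : hwt n m -> hwt (n + 6 * j) (iter j (U xX) m).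
Proof.
move=> hm; elim: j => [|j IH]; first by rewrite muln0 addn0.
by rewrite (_ : n + 6 * j.+1 = n + 6 * j + 6)%N; [apply: hwt_X | lia].
Qed.

Lemma XjX j m : iter j (U xX) m = 0 -> m = 0.
Proof. by elim: j => //= j IH /Xinj. Qed.

Lemma Xj_comm e j m : nc_eq sp4_br (e * xX)%nc (xX * e)%nc ->
  U e (iter j (U xX) m) = iter j (U xX) (U e m).
Proof.
move=> h; elim: j => //= j IH; rewrite -IH.
exact: (@Ueqn C N _ _ (iter j (U xX) m) h).
Qed.

Lemma fd_vanish S T (d t : nat) (lam : C) (sg : int) n (m : N) :
  sg != 0 -> nc_eq sp4_br (T * xX)%nc (xX * T)%nc ->
  (forall i, hwt (n + 2 * d * i) (iter i (U S) m)) ->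
  (forall i, U T (iter i (U S) m) = (lam + sg%:~R * i%:R) *: iter t (U xX) (iter i (U S) m)) ->
  exists i, iter i (U S) m = 0.
Proof.
move=> sg0 TX hS hT; apply: contrapT => nex.
have nz i : iter i (U S) m != 0 by apply/eqP => e; apply: nex; exists i.
pose w (i : 'I_b.+1) := iter (d * (b - i)) (U xX) (iter (3 * i) (U S) m).
have hw i : hwt (n + 6 * d * b) (w i).
  have := hwt_Xj (d * (b - i)) (hS (3 * i)%N).
  rewrite (_ : n + 2 * d * (3 * i) + 6 * (d * (b - i)) = n + 6 * d * b)%N //.
  have ib : (i <= b)%N by rewrite -ltnS.
  by move: (nat_of_ord i) ib => j jb; rewrite -[in RHS](subnK jb); ring.
have [c [[i ci] sc]] := Hbound hw.
have lX := iterU_lin (N := N) xX t.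
have Zinj (u : N) : iter t (U xX) u = 0 -> u = 0 by apply: XjX.
have TZ u : U T (iter t (U xX) u) = iter t (U xX) (U T u) by apply: Xj_comm.
have mi : injective (fun i : 'I_b.+1 => lam + sg%:~R * (3 * i)%:R).
  move=> p q /addrI /mulfI e; apply: val_inj; apply/eqP.
  have n0 : (sg%:~R : C) != 0 by rewrite intr_eq0.
  by have := e n0; move/eqP; rewrite eqr_nat eqn_pmul2l.
have Tw (j : 'I_b.+1) : U T (c j *: w j) = (lam + sg%:~R * (3 * j)%:R) *: iter t (U xX) (c j *: w j).
  rewrite (linZ (U_lin T)) (linZ lX) /w (Xj_comm _ _ TX) hT (linZ (iterU_lin _ _)).
  by rewrite -!iterD (addnC t) !scalerA mulrC.
have := eigZ_split (U_lin T) lX Zinj TZ mi Tw sc i.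
move/eqP; rewrite scaler_eq0 (negPf ci) /= => /eqP /XjX e.
by move: (nz (3 * i)%N); rewrite e eqxx.
Qed.

Lemma fd_last S T (d t : nat) (lam : C) (sg : int) n (m : N) :
  sg != 0 -> nc_eq sp4_br (T * xX)%nc (xX * T)%nc ->
  (forall i, hwt (n + 2 * d * i) (iter i (U S) m)) ->
  (forall i, U T (iter i (U S) m) = (lam + sg%:~R * i%:R) *: iter t (U xX) (iter i (U S) m)) ->
  m != 0 -> exists i, iter i (U S) m != 0 /\ iter i.+1 (U S) m = 0.
Proof.
move=> sg0 TX hS hT m0; have [i hi] := fd_vanish sg0 TX hS hT.
by apply: last_iter => //; exists i.
Qed.

(** Both [xJKt] and X^2 raise the weight by 12, so the b + 1 mixed powers of total degree b applied
    to u are dependent: a polynomial in [xJKt], homogenized by X^2, kills u. *)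
Lemma JKt_eig n (u : N) : hwt n u -> u != 0 ->
  exists n' u' x, [/\ hwt n' u', u' != 0 & U xJKt u' = x *: U (xX * xX)%nc u'].
Proof.
move=> hu u0.
have lT := U_lin (N := N) xJKt; have lZ := U_lin (N := N) (xX * xX)%nc.
have Zinj (m : N) : U (xX * xX)%nc m = 0 -> m = 0 by rewrite UM => /Xinj /Xinj.
have TZ (m : N) : U xJKt (U (xX * xX)%nc m) = U (xX * xX)%nc (U xJKt m).
  by rewrite -!(UM _ _ m); apply: Ueqn; nc.
pose P k (m : N) := hwt (n + 12 * k) m.
have PT k m : P k m -> P k.+1 (U xJKt m).
  move=> h; rewrite /P (_ : n + 12 * k.+1 = n + 12 * k + 12)%N; last by lia.
  apply: (@hwt_step _ 12) h; nc.
have PZ k m : P k m -> P k.+1 (U (xX * xX)%nc m).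
  move=> h; rewrite /P (_ : n + 12 * k.+1 = n + 12 * k + 12)%N; last by lia.
  apply: (@hwt_step _ 12) h; nc.
have P0 : P 0%N u by rewrite /P muln0 addn0.
pose w (i : 'I_b.+1) := iter i (U xJKt) (iter (b - i) (U (xX * xX)%nc) u).
have hw i : hwt (n + 12 * b) (w i).
  rewrite /w; have h1 j : P j (iter j (U (xX * xX)%nc) u).
    by elim: j => // j IH; apply: PZ.
  have h2 k j m : P k m -> P (j + k)%N (iter j (U xJKt) m).
    by move=> h; elim: j => // j IH; apply: PT.
  have := h2 _ i _ (h1 (b - i)%N); rewrite subnKC //; by rewrite -ltnS.
have [c [[i ci] sc]] := Hbound hw.
pose p := \poly_(j < b.+1) c (inord j).
have p0 : p != 0.
  apply: contraNneq ci => p0; have := coef_poly b.+1 (fun j => c (inord j)) i.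
  by rewrite -/p p0 coef0 ltn_ord inord_val => <-.
have sp : (size p <= b.+1)%N by apply: size_poly.
have hp0 : hpe (U xJKt) (U (xX * xX)%nc) b p u = 0.
  by rewrite /hpe -[RHS]sc; apply: eq_bigr => j _; rewrite coef_poly ltn_ord inord_val.
have [n' [u' [x [h1 h2 h3]]]] := poly_eigen lT lZ Zinj TZ (fun n a u v => @hwt_lin _ a u v) (fun k => @hwt0 _) PT PZ p0 sp P0 u0 hp0.
by exists (n + 12 * n')%N, u', x.
Qed.

End Bounded.

Opaque opm ev.

(** * A vector annihilated by the Joseph relations *)

Section Joseph.
Variables (C : numClosedFieldType) (N : lieMod (@sp4 C)).
Local Notation U := (ev (@opm C N)).
Hypothesis Xinj : forall m : N, U xX m = 0 -> m = 0.
Variable b : nat.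
Hypothesis Hbound : forall n (w : 'I_b.+1 -> N), (forall i, hwt n (w i)) ->
  exists c : 'I_b.+1 -> C, (exists i, c i != 0) /\ \sum_i c i *: w i = 0.
Hypothesis hC : forall m : N, U xCas m = (5%:R / 2%:R) *: m.

Lemma ladder S T (t : nat) (sg : int) (lam : C) (m : N) :
  (forall m, U T (U S m) = U S (U T m) + sg%:~R *: iter t (U xX) (U S m)) ->
  (forall m, U S (U xX m) = U xX (U S m)) ->
  U T m = lam *: iter t (U xX) m ->
  forall i, U T (iter i (U S) m) = (lam + sg%:~R * i%:R) *: iter t (U xX) (iter i (U S) m).
Proof.
move=> hTS hSX hm; elim=> [|i IH]; first by rewrite mulr0 addr0.
have hSXt j u : U S (iter j (U xX) u) = iter j (U xX) (U S u).
  by elim: j => //= j IHj; rewrite hSX IHj.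
rewrite !iterS hTS IH (linZ (U_lin S)) hSXt -scalerDl; congr (_ *: _).
by rewrite -natr1; ring.
Qed.

(** Highest weight vectors both for the principal sl(2) and for the triple [xJE], [xJK], [xJF], the
    second weight mu being measured in units of X. *)
Definition zst (n : nat) (mu : C) (w : N) : Prop :=
  [/\ hwt n w, U xJE w = 0 & U xJK w = mu *: U xX w].

Lemma UJKt m : U xJKt m = U xX (U xJK m) + 4%:~R *: U xb (U xJE m).
Proof. by rewrite /xJKt UA (UM xX) (UM (NZ 4)) (UM xb) UZ. Qed.

Lemma UJFt m : U xJFt m = U xX (U xX (U xJF m)) + 2%:~R *: U xX (U xb (U xJK m))
  + 4%:~R *: U xb (U xb (U xJE m)).
Proof. by rewrite /xJFt !UA !(UM xX) (UM (NZ 2)) (UM (NZ 4)) !(UM xX) !(UM xb) !UZ. Qed.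

Lemma UL m : U xL m = U xJF (U xGp m) - U xGm (U xJK m + 2%:~R *: U xX m).
Proof. by rewrite /xL USB (UM xJF) (UM xGm) UA (UM (NZ 2)) UZ. Qed.

Lemma UC4 m : U xC4 m = U xJK (U xJK m) + 4%:~R *: U xX (U xJK m) - 4%:~R *: U xJF (U xJE m).
Proof. by rewrite /xC4 USB UA (UM xJK) !(UM (NZ 4)) (UM xX) (UM xJF) !UZ. Qed.

Lemma zst_JKt n mu w : zst n mu w -> U xJKt w = mu *: U xX (U xX w).
Proof.
move=> [_ h1 h2]; rewrite UJKt h1 h2 !(lin0 (U_lin _)) scaler0 addr0.
by rewrite (linZ (U_lin xX)).
Qed.

(** Finite dimensional sl(2)-theory for the J triple: the lowering operator [xJFt] stops at some
    step i by [fd_last], and applying [xJE] to the next, zero, vector forces mu = 2 i. *)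
Lemma zst_nat n mu w : zst n mu w -> w != 0 ->
  exists i : nat, mu = (2 * i)%:R /\ iter i.+1 (U xJFt) w = 0.
Proof.
move=> hz w0; have hJ := zst_JKt hz; have [hw h1 _] := hz.
have hT : forall i, U xJKt (iter i (U xJFt) w) = (mu + (-4)%:~R * i%:R) *: iter 2 (U xX) (iter i (U xJFt) w).
  apply: (@ladder xJFt xJKt 2 (-4) mu w) hJ => m.
  - have := @Ueqn C N (xJKt * xJFt)%nc (xJFt * xJKt + NZ (-4) * (xX * (xX * xJFt)))%nc m ltac:(nc).
    by rewrite UA !UM.
  - exact: (@Ueqn C N (xJFt * xX)%nc (xX * xJFt)%nc m ltac:(nc)).
have hS i : hwt (n + 2 * 8 * i) (iter i (U xJFt) w).
  elim: i => [|i IH]; first by rewrite muln0 addn0.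
  rewrite (_ : n + 2 * 8 * i.+1 = n + 2 * 8 * i + 16)%N; last by lia.
  by rewrite iterS; refine (hwt_step _ _ IH); nc.
have TX : nc_eq sp4_br (xJKt * xX)%nc (xX * xJKt)%nc by nc.
have [i [i0 i1]] := fd_last Xinj Hbound (isT : (-4 : int) != 0) TX hS hT w0.
exists i; split => //.
have hJE j : U xJE (iter j.+1 (U xJFt) w) =
    (- (2%:R * j.+1%:R * (mu - 2%:R * j%:R))) *: iter 4 (U xX) (iter j (U xJFt) w).
  have step m : U xJE (U xJFt m) = U xJFt (U xJE m) - 2%:R *: U xX (U xX (U xJKt m)).
    have := @Ueqn C N (xJE * xJFt)%nc (xJFt * xJE - NZ 2 * (xX * (xX * xJKt)))%nc m ltac:(nc).
    by rewrite USB !UM.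
  have cX k m : U xJFt (iter k (U xX) m) = iter k (U xX) (U xJFt m).
    by apply: Xj_comm; nc.
  elim: j => [|j IH].
    rewrite /= step h1 hJ (lin0 (U_lin _)) add0r !(linZ (U_lin xX)) scalerA -scaleNr.
    by congr (_ *: _); rewrite mulr0 subr0 mulr1.
  rewrite iterS step IH hT (linZ (U_lin xJFt)) cX -iterS !(linZ (U_lin xX)) scalerA -scaleNr.
  rewrite -[U xX (U xX (iter 2 _ _))]/(iter 4 (U xX) (iter j.+1 (U xJFt) w)) -scalerDl.
  by congr (_ *: _); rewrite -!natr1; ring.
have := hJE i; rewrite i1 (lin0 (U_lin _)) => /esym/eqP; rewrite scaler_eq0.
case/orP => [|/eqP /(XjX Xinj) e]; last by rewrite e eqxx in i0.
rewrite oppr_eq0 mulf_eq0 mulf_eq0 !pnatr_eq0 /= subr_eq0 => /eqP ->.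
by rewrite natrM.
Qed.

(** An eigenvector of [xJKt] is raised by [xJE] until [xJE] kills it, and then by [xGp]. Both change
    the eigenvalue, so both processes stop by [fd_last]. *)
Lemma zst_exists n (u : N) : hwt n u -> u != 0 ->
  exists n' mu w, [/\ zst n' mu w, w != 0 & U xGp w = 0].
Proof.
move=> hu u0; have [n1 [u1 [x [hu1 u10 hx]]]] := JKt_eig Xinj Hbound hu u0.
have hx' : U xJKt u1 = x *: iter 2 (U xX) u1 by rewrite hx UM.
have hT : forall i, U xJKt (iter i (U xJE) u1) = (x + 4%:~R * i%:R) *: iter 2 (U xX) (iter i (U xJE) u1).
  apply: (@ladder xJE xJKt 2 4 x u1) hx' => m.
  - have := @Ueqn C N (xJKt * xJE)%nc (xJE * xJKt + NZ 4 * (xX * (xX * xJE)))%nc m ltac:(nc).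
    by rewrite UA !UM.
  - exact: (@Ueqn C N (xJE * xX)%nc (xX * xJE)%nc m ltac:(nc)).
have hS i : hwt (n1 + 2 * 4 * i) (iter i (U xJE) u1).
  elim: i => [|i IH]; first by rewrite muln0 addn0.
  rewrite (_ : n1 + 2 * 4 * i.+1 = n1 + 2 * 4 * i + 8)%N; last by lia.
  by rewrite iterS; refine (hwt_step _ _ IH); nc.
have TX : nc_eq sp4_br (xJKt * xX)%nc (xX * xJKt)%nc by nc.
have [i [i0 i1]] := fd_last Xinj Hbound (isT : (4 : int) != 0) TX hS hT u10.
move: i0 i1 (hS i) (hT i); rewrite iterS; move: (iter i (U xJE) u1) => w w0 w1 hw hTw.
move: (x + _) (n1 + _)%N hTw hw => mu n2 hTw hw.
(* Where [xJE] vanishes, [xJKt] equals X [xJK], and X can be cancelled. *)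
have hz : zst n2 mu w.
  split => //; apply/eqP; rewrite -subr_eq0; apply/eqP; apply: Xinj.
  rewrite (linB (U_lin _)) (linZ (U_lin _)); apply/eqP; rewrite subr_eq0; apply/eqP.
  by rewrite -[RHS]hTw UJKt w1 !(lin0 (U_lin _)) scaler0 addr0.
have hz' i' : zst (n2 + 10 * i') (mu + 2%:~R * i'%:R) (iter i' (U xGp) w).
  have [_ _ hK] := hz; split.
  - elim: i' => [|i' IH]; first by rewrite muln0 addn0.
    rewrite (_ : n2 + 10 * i'.+1 = n2 + 10 * i' + 10)%N; last by lia.
    by rewrite iterS; refine (hwt_step _ _ IH); nc.
  - elim: i' => // i' IH; rewrite iterS.
    by have := @Ueqn C N (xJE * xGp)%nc (xGp * xJE)%nc (iter i' (U xGp) w) ltac:(nc); rewrite !UM => ->; rewrite IH (lin0 (U_lin _)).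
  - apply: (@ladder xGp xJK 1 2 mu w) => // m.
      have := @Ueqn C N (xJK * xGp)%nc (xGp * xJK + NZ 2 * (xX * xGp))%nc m ltac:(nc).
      by rewrite UA !UM.
    exact: (@Ueqn C N (xGp * xX)%nc (xX * xGp)%nc m ltac:(nc)).
have hS' i' : hwt (n2 + 2 * 5 * i') (iter i' (U xGp) w) by have [] := hz' i'.
have hT' i' : U xJK (iter i' (U xGp) w) = (mu + 2%:~R * i'%:R) *: iter 1 (U xX) (iter i' (U xGp) w).
  by have [_ _] := hz' i'.
have TX' : nc_eq sp4_br (xJK * xX)%nc (xX * xJK)%nc by nc.
have [j [j0 j1]] := fd_last Xinj Hbound (isT : (2 : int) != 0) TX' hS' hT' w0.
by exists (n2 + 10 * j)%N, (mu + 2%:~R * j%:R), (iter j (U xGp) w).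
Qed.

Definition jos (m : N) : Prop :=
  [/\ U xJE m = 0, U xJK m = 0, U xJF m = 0, U xGp m = 0 & U xGm m = 0].

(** Start from w killed by [xJE] and [xGp], with [xJK]-weight mu. The powers of [xL] lower mu by 2
    and stop after k steps. Applying [xGp] to the zero vector L^(k+1) w yields D(mu) + D(mu - 2) +
    ... + D(mu - 2 k) = 0. All these weights are natural numbers by [zst_nat], so every term is
    nonnegative and mu = 0, which makes the remaining relations hold at w. *)
Lemma jos_exists n (u : N) : hwt n u -> u != 0 -> exists w, w != 0 /\ jos w.
Proof.
move=> hu u0; have [n1 [mu [w [hz w0 Gw]]]] := zst_exists hu u0.
have [hw hE hK] := hz.
have hzL i : zst (n1 + 14 * i) (mu + (-2)%:~R * i%:R) (iter i (U xL) w).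
  have hJE j : U xJE (iter j (U xL) w) = 0.
    elim: j => // j IH; rewrite iterS.
    have := @Ueqn C N (xJE * xL)%nc ((xJF * xGp - xGm * (xJK - NZ 2 * xX)) * xJE)%nc (iter j (U xL) w) ltac:(nc).
    by rewrite UM => ->; rewrite UM IH (lin0 (U_lin _)).
  split => //.
  - elim: i => [|i [IH1 IH2]]; first by rewrite muln0 addn0.
    rewrite iterS; split.
      have := @Ueqn C N (xe * xL)%nc (xL * xe + NZ 4 * (xGm * xJE))%nc (iter i (U xL) w) ltac:(nc).
      by rewrite UA !UM => ->; rewrite IH1 hJE !(lin0 (U_lin _)) addr0.
    have := @Ueqn C N (xh * xL)%nc (xL * xh + NZ 14 * xL)%nc (iter i (U xL) w) ltac:(nc).
    rewrite UA !UM UZ => ->; rewrite IH2 (linZ (U_lin _)) -scalerDl; congr (_ *: _).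
    by rewrite mulnS [(14 + _)%N]addnC addnA [in RHS]natrD.
  - apply: (@ladder xL xJK 1 (-2) mu w) => // m.
      have := @Ueqn C N (xJK * xL)%nc (xL * xJK + NZ (-2) * (xX * xL))%nc m ltac:(nc).
      by rewrite UA !UM.
    exact: (@Ueqn C N (xL * xX)%nc (xX * xL)%nc m ltac:(nc)).
have hS i : hwt (n1 + 2 * 7 * i) (iter i (U xL) w) by have [] := hzL i.
have hT i : U xJK (iter i (U xL) w) = (mu + (-2)%:~R * i%:R) *: iter 1 (U xX) (iter i (U xL) w).
  by have [_ _] := hzL i.
have TX : nc_eq sp4_br (xJK * xX)%nc (xX * xJK)%nc by nc.
have [k [k0 k1]] := fd_last Xinj Hbound (isT : (-2 : int) != 0) TX hS hT w0.
(* On a vector of [xJK]-weight nu killed by [xJE], the commutator of [xGp] and [xL] is D(nu) X^4,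
   given that the Casimir element is 5/2. *)
pose D (nu : C) := 2%:R * nu * (nu + 2%:R) * (nu + 4%:R).
pose s j := \sum_(i < j) D (mu + (-2)%:~R * (nat_of_ord i)%:R).
have hG nu m : U xJE m = 0 -> U xJK m = nu *: U xX m ->
    U xGp (U xL m) = U xL (U xGp m) + D nu *: iter 4 (U xX) m.
  move=> mE mK.
  (* The commutator consists of a term containing 2 [xCas] - 5, which acts by zero, and of 2 [xC4] X
     ([xJK] + 2 X); on m the element [xC4] gives nu (nu + 4) X^2. *)
  have := @Ueqn C N (xGp * xL)%nc (xL * xGp + NZ 2 * (xX * (xX * (xX * ((NZ 2 * xCas - NZ 5) * (xJK + NZ 2 * xX))))) + NZ 2 * (xC4 * (xX * (xJK + NZ 2 * xX))))%nc m ltac:(nc).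
  have Cas0 m' : U (NZ 2 * xCas - NZ 5)%nc m' = 0.
    rewrite USB (UM (NZ 2)) !UZ hC scalerA (_ : 2%:~R * (5%:R / 2%:R) = 5%:R :> C); last by field.
    by rewrite subrr.
  have JKX1 m' : U xJK (U xX m') = U xX (U xJK m').
    exact: (@Ueqn C N (xJK * xX)%nc (xX * xJK)%nc m' ltac:(nc)).
  have JEX1 m' : U xJE (U xX m') = U xX (U xJE m').
    exact: (@Ueqn C N (xJE * xX)%nc (xX * xJE)%nc m' ltac:(nc)).
  set e1 := (xX * (xX * _))%nc; set e2 := (xC4 * _)%nc.
  have -> : U (xGp * xL)%nc m = U xGp (U xL m) by [].
  move=> ->; rewrite (UA (xL * xGp + NZ 2 * e1)%nc) (UA (xL * xGp)%nc) (UM xL).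
  have -> : U (NZ 2 * e1)%nc m = 0.
    by rewrite (UM (NZ 2) e1) /e1 !(UM xX) (UM (NZ 2 * xCas - NZ 5)%nc) Cas0 !(lin0 (U_lin _)).
  rewrite addr0; congr (_ + _).
  rewrite (UM (NZ 2) e2) UZ /e2 (UM xC4) (UM xX) UA mK (UM (NZ 2)) UZ -scalerDl !(linZ (U_lin _)).
  rewrite UC4 !JEX1 mE !(lin0 (U_lin _)) scaler0 subr0 !JKX1 mK !(linZ (U_lin _)) !JKX1 mK.
  rewrite !(linZ (U_lin _)) !scalerA -!scalerDl !scalerA; congr (_ *: _).
  by rewrite /D; ring.
have sL j : U xGp (iter j.+1 (U xL) w) = s j.+1 *: iter 4 (U xX) (iter j (U xL) w).
  have LX k' m' : U xL (iter k' (U xX) m') = iter k' (U xX) (U xL m') by apply: Xj_comm; nc.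
  elim: j => [|j IH].
    by rewrite /= (hG mu) // Gw (lin0 (U_lin _)) add0r /s big_ord_recl big_ord0 mulr0 !addr0.
  have [_ zE zK] := hzL j.+1.
  rewrite iterS (hG _ _ zE zK) IH (linZ (U_lin _)) LX -iterS -scalerDl.
  by rewrite [in RHS]/s big_ord_recr.
have sk : s k.+1 = 0.
  have := sL k; rewrite k1 (lin0 (U_lin _)) => /esym/eqP; rewrite scaler_eq0.
  by case/orP => [/eqP //|/eqP /(XjX Xinj) e]; rewrite e eqxx in k0.
have nz j : (j <= k)%N -> iter j (U xL) w != 0.
  move=> jk; apply: contraNneq k0 => e.
  by rewrite -(subnK jk) iterD e (lin0 (iterU_lin _ _)).
have Dge (j : 'I_k.+1) : 0 <= D (mu + (-2)%:~R * (nat_of_ord j)%:R).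
  have [i [-> _]] := zst_nat (hzL j) (nz _ (ltnSE (ltn_ord j))).
  by rewrite /D -!natrD -!natrM ler0n.
have D0 : D mu = 0.
  have := sk; rewrite /s => /eqP; rewrite psumr_eq0 => [|j _]; last exact: Dge.
  move=> /allP/(_ ord0); rewrite mem_index_enum => /(_ isT) /=.
  by rewrite mulr0 addr0 => /eqP.
have [i [mui iF]] := zst_nat hz w0.
have i0 : i = 0%N.
  move/eqP: D0; rewrite /D mui -natrM -!natrD -!natrM pnatr_eq0.
  by case: (i).
rewrite {}i0 muln0 in mui iF; move: hz hK hzL; rewrite mui scale0r => hz hK hzL.
have JF0 : U xJF w = 0.
  apply: Xinj; apply: Xinj; have := iF; rewrite /= UJFt hE hK !(lin0 (U_lin _)) !scaler0 !addr0.
  by [].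
(* Otherwise [xL] w would have weight -2, against [zst_nat]. *)
have L0 : U xL w = 0.
  apply/eqP; apply: contraT => L0.
  have [i' [e _]] := zst_nat (hzL 1%N) L0.
  move/eqP: e; rewrite add0r mulr1 eq_sym -subr_eq0 rmorphN opprK -natrD pnatr_eq0.
  by rewrite addnC.
exists w; split => //; split => //.
apply: Xinj; have := L0; rewrite UL Gw hK add0r (linZ (U_lin xGm)) (lin0 (U_lin _)) add0r.
move=> /eqP; rewrite oppr_eq0 scaler_eq0 intr_eq0 /= => /eqP e.
have := @Ueqn C N (xX * xGm)%nc (xGm * xX)%nc w ltac:(nc); rewrite !UM => ->; exact: e.
Qed.

End Joseph.

Opaque opm ev.

(** * The vectors annihilated by the Joseph relations form a submodule *)

Section JosephSub.
Variables (C : numClosedFieldType) (N : lieMod (@sp4 C)).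
Local Notation U := (ev (@opm C N)).
Hypothesis Xinj : forall m : N, U xX m = 0 -> m = 0.

Lemma UJE m : U xJE m = U xX (U xE m) - U xb (U xb m).
Proof. by rewrite /xJE USB (UM xX) (UM xb). Qed.
Lemma UJF m : U xJF m = U xX (U xF m) - U xa (U xa m).
Proof. by rewrite /xJF USB (UM xX) (UM xa). Qed.
Lemma UJK m : U xJK m = 2%:~R *: U xX (U xK m) - U xa (U xb m) - U xb (U xa m).
Proof. by rewrite /xJK !USB (UM (NZ 2)) UZ (UM xX) (UM xa) (UM xb). Qed.
Lemma UGp m : U xGp m = 2%:~R *: U xX (U xX (U xc m)) - U xX (U xb (2%:~R *: U xH m - m))
   + U xb (U xJK m) - 2%:~R *: U xa (U xJE m).
Proof.
rewrite /xGp USB UA USB !(UM (NZ 2)) !(UM xX) !(UM xb) (UM xa) USB (UM (NZ 2)) !UZ.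
by rewrite mulr1z scale1r.
Qed.
Lemma UGm m : U xGm m = 2%:~R *: U xX (U xX (U xd m)) - U xX (U xa (2%:~R *: U xH m - m))
   - U xa (U xJK m) + 2%:~R *: U xb (U xJF m).
Proof.
rewrite /xGm UA USB USB !(UM (NZ 2)) !(UM xX) !(UM xa) (UM xb) USB (UM (NZ 2)) !UZ.
by rewrite mulr1z scale1r.
Qed.

Lemma jos_lin (a : C) (u v : N) : jos u -> jos v -> jos (a *: u + v : N).
Proof.
move=> [u1 u2 u3 u4 u5] [v1 v2 v3 v4 v5].
by split; rewrite U_lin ?u1 ?u2 ?u3 ?u4 ?u5 ?v1 ?v2 ?v3 ?v4 ?v5 scaler0 addr0.
Qed.

Lemma jos0 : jos (0 : N).
Proof. by split; apply: lin0 (U_lin _). Qed.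

Lemma jos_comm x (m : N) :
  [&& nc_eq sp4_br (xJE * x)%nc (x * xJE)%nc, nc_eq sp4_br (xJK * x)%nc (x * xJK)%nc,
      nc_eq sp4_br (xJF * x)%nc (x * xJF)%nc, nc_eq sp4_br (xGp * x)%nc (x * xGp)%nc
    & nc_eq sp4_br (xGm * x)%nc (x * xGm)%nc] -> jos m -> jos (U x m).
Proof.
move=> /and5P[c1 c2 c3 c4 c5] [m1 m2 m3 m4 m5].
have H e : nc_eq sp4_br (e * x)%nc (x * e)%nc -> U e m = 0 -> U e (U x m) = 0.
  by move=> h em; have := @Ueqn C N _ _ m h; rewrite !UM => ->; rewrite em (lin0 (U_lin _)).
by split; [exact: H c1 m1|exact: H c2 m2|exact: H c3 m3|exact: H c4 m4|exact: H c5 m5].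
Qed.

Lemma jos_X (m : N) : jos m -> jos (U xX m). Proof. by apply: jos_comm; nc. Qed.
Lemma jos_a (m : N) : jos m -> jos (U xa m). Proof. by apply: jos_comm; nc. Qed.
Lemma jos_b (m : N) : jos m -> jos (U xb m). Proof. by apply: jos_comm; nc. Qed.

Lemma jos_H (m : N) : jos m -> jos (U xH m).
Proof.
move=> [m1 m2 m3 m4 m5].
have H (k : int) e : nc_eq sp4_br (e * xH)%nc (xH * e - NZ k * e)%nc -> U e m = 0 -> U e (U xH m) = 0.
  move=> h em; have := @Ueqn C N _ _ m h; rewrite USB !UM UZ => ->.
  by rewrite em (lin0 (U_lin _)) scaler0 subr0.
split; [apply: (H 2) m1|apply: (H 2) m2|apply: (H 2) m3|apply: (H 3) m4|apply: (H 3) m5]; nc.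
Qed.

Lemma jos_Xsat (m : N) : jos (U xX m) -> jos m.
Proof.
have H e : nc_eq sp4_br (e * xX)%nc (xX * e)%nc -> U e (U xX m) = 0 -> U e m = 0.
  by move=> h; have := @Ueqn C N _ _ m h; rewrite !UM => -> /Xinj.
move=> [m1 m2 m3 m4 m5].
split; [apply: H m1|apply: H m2|apply: H m3|apply: H m4|apply: H m5]; nc.
Qed.

Lemma jos_half (m : N) : jos (2%:~R *: m) -> jos m.
Proof.
move=> h; have := jos_lin 2%:~R^-1 h jos0; rewrite addr0 scalerA mulVf ?scale1r //.
by rewrite intr_eq0.
Qed.

Lemma josD (u v : N) : jos u -> jos v -> jos (u + v).
Proof. by move=> hu hv; rewrite -[u]scale1r; apply: jos_lin. Qed.

Lemma josB (u v : N) : jos u -> jos v -> jos (u - v).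
Proof. by move=> hu hv; rewrite addrC -scaleN1r; apply: jos_lin. Qed.

Lemma josZ a (u : N) : jos u -> jos (a *: u).
Proof. by move=> hu; rewrite -[_ *: _]addr0; apply: jos_lin => //; exact: jos0. Qed.

(** Where the relations hold, [xGp] m = 0 expresses 2 X^2 c m through X, b and H, which preserve
    [jos]; then [jos_Xsat] cancels X. The letter d is treated in the same way with [xGm]. *)
Lemma jos_c (m : N) : jos m -> jos (U xc m).
Proof.
move=> h; have [m1 m2 m3 m4 m5] := h; apply: jos_Xsat; apply: jos_Xsat; apply: jos_half.
have := UGp m; rewrite m4 m2 m1 !(lin0 (U_lin _)) scaler0 subr0 addr0 => /esym/eqP.
rewrite subr_eq0 => /eqP ->; apply/jos_X/jos_b/josB => //; apply/josZ/jos_H/h.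
Qed.

Lemma jos_d (m : N) : jos m -> jos (U xd m).
Proof.
move=> h; have [m1 m2 m3 m4 m5] := h; apply: jos_Xsat; apply: jos_Xsat; apply: jos_half.
have := UGm m; rewrite m5 m2 m3 !(lin0 (U_lin _)) scaler0 subr0 addr0 => /esym/eqP.
rewrite subr_eq0 => /eqP ->; apply/jos_X/jos_a/josB => //; apply/josZ/jos_H/h.
Qed.

(** The letters X, a, b commute with the five elements, and H rescales them. The relations express
    multiples of F, K, E, c, d by powers of X through letters already treated, and Y is the
    commutator of d and c. *)
Lemma jos_submodule : submodule (@jos C N).
Proof.
apply: sp4_submodule; [exact: jos0 | exact: jos_lin |].
move=> i m i10 h; have [m1 m2 m3 m4 m5] := h.
rewrite -[opm i m]/(U (NV i) m).
case: i i10 => [|[|[|[|[|[|[|[|[|[|//]]]]]]]]]] _.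
- have := @Ueqn C N xY (xd * xc - xc * xd)%nc m ltac:(nc); rewrite USB !UM => ->.
  by apply: josB; [apply/jos_d/jos_c/h | apply/jos_c/jos_d/h].
- exact: jos_d.
- exact: jos_c.
- apply: jos_Xsat; have := UJF m; rewrite m3 => /esym/eqP; rewrite subr_eq0 => /eqP ->.
  exact/jos_a/jos_a.
- exact: jos_H.
- apply: jos_Xsat; apply: jos_half; have := UJK m; rewrite m2 -addrA -opprD => /esym/eqP.
  rewrite subr_eq0 => /eqP ->; apply: josD; [exact/jos_a/jos_b | exact/jos_b/jos_a].
- apply: jos_Xsat; have := UJE m; rewrite m1 => /esym/eqP; rewrite subr_eq0 => /eqP ->.
  exact/jos_b/jos_b.
- exact: jos_a.
- exact: jos_b.
- exact: jos_X.
Qed.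

(* The relation that determines the action of f on a module annihilated by the
   Joseph ideal on which X is injective. *)
Definition fgood : Prop := forall m : N,
  U xX (U xX (U xf m)) = U xX (U xb (U xh m)) + U xb (U xb (U xe m)) - U xX (U xe (U xe m)).

(** In the enveloping algebra, 2 X times the difference of the two sides is a combination of
    products ending in [xJE], [xJK], [xJF] or [xGp]; then X is cancelled. *)
Lemma jos_fgood : (forall m : N, [/\ U xJE m = 0, U xJK m = 0, U xJF m = 0 & U xGp m = 0]) -> fgood.
Proof.
move=> hj m; have [h1 h2 h3 h4] := hj m.
have h5 : U xX (U xE (U xJE m)) = 0 by rewrite h1 !(lin0 (U_lin _)).
apply/eqP; rewrite -subr_eq0; apply/eqP; apply: Xinj.
have := @Ueqn C N (NZ 2 * (xX * (xX * (xX * xf)) - xX * (xX * (xb * xh) + xb * (xb * xe) - xX * (xe * xe))))%nc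
  (NZ 3 * (xX * xGp) - NZ 4 * (xX * (xb * xJK)) + NZ 10 * (xX * (xa * xJE)) - NZ 2 * (xX * (xX * xJF)) + NZ 2 * (xX * (xE * xJE)))%nc m ltac:(nc).
have r1 : U (NZ 3 * (xX * xGp))%nc m = 0 by rewrite (UM (NZ 3)) (UM xX) h4 !(lin0 (U_lin _)).
have r2 : U (NZ 4 * (xX * (xb * xJK)))%nc m = 0 by rewrite (UM (NZ 4)) (UM xX) (UM xb) h2 !(lin0 (U_lin _)).
have r3 : U (NZ 10 * (xX * (xa * xJE)))%nc m = 0 by rewrite (UM (NZ 10)) (UM xX) (UM xa) h1 !(lin0 (U_lin _)).
have r4 : U (NZ 2 * (xX * (xX * xJF)))%nc m = 0 by rewrite (UM (NZ 2)) !(UM xX) h3 !(lin0 (U_lin _)).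
have r5 : U (NZ 2 * (xX * (xE * xJE)))%nc m = 0 by rewrite (UM (NZ 2)) (UM xX) (UM xE) h1 !(lin0 (U_lin _)).
rewrite UA USB UA USB r1 r2 r3 r4 r5 !subr0 !addr0 (UM (NZ 2)) UZ => /eqP.
rewrite scaler_eq0 intr_eq0 /= => /eqP e.
rewrite (linB (U_lin xX)) -[RHS]e USB !(UM xX) USB UA !(UM xX) !(UM xb) !(UM xe).
by [].
Qed.

End JosephSub.

Opaque opm ev.

(** * Polynomials in X and b applied to a highest weight vector *)

Section PolyEval.
Variables (A : nzRingType) (N : zmodType) (L : nat -> A -> N).
Hypothesis LD : forall j, {morph L j : x y / x + y}.

(** Evaluation in which the coefficient of degree j acts through the additive map L j. It is used
    twice: for polynomials in X over C, and for polynomials in b over those. *)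
Definition pev (p : {poly A}) : N := \sum_(j < size p) L j p`_j.

Lemma pevL0 j : L j 0 = 0.
Proof. by apply: (addIr (L j 0)); rewrite -LD !add0r. Qed.

Lemma pevE B (p : {poly A}) : (size p <= B)%N -> pev p = \sum_(j < B) L j p`_j.
Proof.
move=> h; rewrite /pev (big_ord_widen _ (fun j => L j p`_j) h) big_mkcond.
apply: eq_bigr => i _; case: ltnP => // hi; by rewrite nth_default // pevL0.
Qed.

Lemma pevD : {morph pev : p q / p + q}.
Proof.
move=> p q; pose B := maxn (size p) (size q).
rewrite !(@pevE B) ?size_polyD ?leq_maxl ?leq_maxr //.
by rewrite -big_split; apply: eq_bigr => i _; rewrite coefD LD.
Qed.

Lemma pevC c : pev c%:P = L 0 c.
Proof.
by rewrite (@pevE 1) ?size_polyC ?leq_b1 // big_ord1 coefC eqxx.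
Qed.

Lemma pevMX (p : {poly A}) : pev (p * 'X) = \sum_(j < size p) L j.+1 p`_j.
Proof.
have h : (size (p * 'X)%R <= (size p).+1)%N.
  by rewrite (leq_trans (size_polyMleq _ _)) // size_polyX addn2.
rewrite (pevE h) big_ord_recl coefMX eqxx pevL0 add0r; apply: eq_bigr => i _.
by rewrite coefMX lift0.
Qed.

End PolyEval.

Lemma deriv0_const (A : nzRingType) (p : {poly A}) :
  (forall (x : A) k, x *+ k.+1 = 0 -> x = 0) -> p^`() = 0 -> p = (p`_0)%:P.
Proof.
move=> hA h; apply/polyP => -[|j]; rewrite coefC //=.
by apply: (hA _ j); rewrite -coef_deriv h coef0.
Qed.

Section Span.
Variables (C : numClosedFieldType) (N : lieMod (@sp4 C)).
Local Notation U := (ev (@opm C N)).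

Lemma bX (m : N) : U xb (U xX m) = U xX (U xb m).
Proof.
have h : nc_eq sp4_br (xb * xX)%nc (xX * xb)%nc by nc.
exact: (Ueqn m h).
Qed.
Lemma eX (m : N) : U xe (U xX m) = U xX (U xe m).
Proof.
have h : nc_eq sp4_br (xe * xX)%nc (xX * xe)%nc by nc.
exact: (Ueqn m h).
Qed.
Lemma eb (m : N) : U xe (U xb m) = U xb (U xe m) + U xX m.
Proof.
have h : nc_eq sp4_br (xe * xb)%nc (xb * xe + xX)%nc by nc.
exact: (Ueqn m h).
Qed.
Lemma hX (m : N) : U xh (U xX m) = U xX (U xh m) + 6%:R *: U xX m.
Proof.
have h : nc_eq sp4_br (xh * xX)%nc (xX * xh + NZ 6 * xX)%nc by nc.
exact: (Ueqn m h).
Qed.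
Lemma hb (m : N) : U xh (U xb m) = U xb (U xh m) + 4%:R *: U xb m.
Proof.
have h : nc_eq sp4_br (xh * xb)%nc (xb * xh + NZ 4 * xb)%nc by nc.
exact: (Ueqn m h).
Qed.

(** In [sev] the outer variable stands for b and the inner one for X. *)
Definition xev (v : N) (q : {poly C}) : N := pev (fun l (c : C) => c *: iter l (U xX) v) q.
Definition sev (v : N) (p : {poly {poly C}}) : N := pev (fun j q => iter j (U xb) (xev v q)) p.

Lemma xevD v : {morph xev v : p q / p + q}.
Proof. by apply: pevD => j x y; rewrite scalerDl. Qed.

Lemma sevLD v j : {morph (fun q => iter j (U xb) (xev v q)) : p q / p + q}.
Proof. by move=> p q; rewrite xevD (linD (iterU_lin _ _)). Qed.

Lemma sevD v : {morph sev v : p q / p + q}.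
Proof. by apply: pevD; exact: sevLD. Qed.

Lemma xevC v c : xev v c%:P = c *: v.
Proof. by rewrite /xev pevC // => j x y; rewrite scalerDl. Qed.

Lemma sevC v q : sev v q%:P = xev v q.
Proof. by rewrite /sev pevC //; exact: sevLD. Qed.

Lemma xevMX v q : xev v (q * 'X) = U xX (xev v q).
Proof.
rewrite /xev pevMX; last by move=> j x y; rewrite scalerDl.
rewrite /pev (lin_sum (U_lin xX)); apply: eq_bigr => j _.
by rewrite iterS (linZ (U_lin _)).
Qed.

Lemma sevMb v p : sev v (p * 'X) = U xb (sev v p).
Proof.
rewrite /sev pevMX; last exact: sevLD.
by rewrite /pev (lin_sum (U_lin xb)); apply: eq_bigr.
Qed.

Lemma sevMX v p : sev v (p * 'X%:P) = U xX (sev v p).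
Proof.
elim/poly_ind: p => [|p c IH].
  by rewrite mul0r -[0 : {poly {poly C}}]polyC0 sevC -[0 : {poly C}]polyC0 xevC scale0r (lin0 (U_lin _)).
rewrite mulrDl -mulrA (mulrC 'X) mulrA sevD sevMb IH sevD (linD (U_lin xX)) sevMb.
rewrite -polyCM !sevC xevMX; congr (_ + _).
exact: bX.
Qed.

Lemma xevZ v a q : xev v (a *: q) = a *: xev v q.
Proof.
rewrite /xev (@pevE _ _ _ _ (size q)) ?size_scale_leq //; last by move=> j x y; rewrite scalerDl.
by rewrite /pev scaler_sumr; apply: eq_bigr => i _; rewrite coefZ scalerA.
Qed.

Lemma sevZ v a p : sev v (a%:P *: p) = a *: sev v p.
Proof.
rewrite /sev (@pevE _ _ _ (sevLD v) (size p)) ?size_scale_leq //.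
rewrite /pev scaler_sumr; apply: eq_bigr => i _.
by rewrite coefZ mul_polyC xevZ (linZ (iterU_lin _ _)).
Qed.

Lemma sev0 v : sev v 0 = 0.
Proof. by rewrite /sev /pev size_poly0 big_ord0. Qed.
Lemma xev0 v : xev v 0 = 0.
Proof. by rewrite /xev /pev size_poly0 big_ord0. Qed.

Section Vector.
Variables (n : nat) (v : N).
Hypothesis hv : hwt n v.

Lemma xeve (q : {poly C}) : U xe (xev v q) = 0.
Proof.
elim/poly_ind: q => [|q c IH]; first by rewrite xev0 (lin0 (U_lin _)).
rewrite xevD xevC xevMX (linD (U_lin xe)) (linZ (U_lin xe)) hv.1 scaler0 addr0.
by rewrite eX IH (lin0 (U_lin _)).
Qed.

(** As e kills v, commutes with X and has commutator X with b, it acts as X d/db. *)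
Lemma seve (p : {poly {poly C}}) : U xe (sev v p) = sev v (p^`() * 'X%:P).
Proof.
elim/poly_ind: p => [|p c IH]; first by rewrite deriv0 mul0r sev0 (lin0 (U_lin _)).
rewrite derivMXaddC sevD sevC sevMb (linD (U_lin xe)) xeve addr0.
by rewrite eb IH mulrDl sevD -mulrA (mulrC 'X) mulrA sevMb !sevMX addrC.
Qed.

Lemma xevh (q : {poly C}) : U xh (xev v q) = n%:R *: xev v q + 6%:R *: xev v (q^`() * 'X).
Proof.
elim/poly_ind: q => [|q c IH].
  by rewrite deriv0 mul0r xev0 !scaler0 addr0 (lin0 (U_lin _)).
rewrite derivMXaddC xevD xevC xevMX (linD (U_lin xh)) (linZ (U_lin xh)) hv.2.
rewrite hX IH mulrDl xevD (linD (U_lin xX)) !(linZ (U_lin xX)) !xevMX.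
set A := U xX (xev v q); set D := U xX (U xX (xev v q^`())).
by lmod_with (N : lmodType C) ltac:(ring).
Qed.

(** The action of h: the vector b^j X^l v has weight n + 4 j + 6 l. *)
Definition hop (p : {poly {poly C}}) : {poly {poly C}} :=
  \poly_(j < size p) ((n + 4 * j)%:R *: p`_j + 6%:R *: ((p`_j)^`() * 'X)).

Lemma hop_coef (p : {poly {poly C}}) j : (hop p)`_j = (n + 4 * j)%:R *: p`_j + 6%:R *: ((p`_j)^`() * 'X).
Proof.
rewrite coef_poly; case: ltnP => // h.
by rewrite nth_default // deriv0 mul0r !scaler0 addr0.
Qed.

Lemma sevh (p : {poly {poly C}}) : U xh (sev v p) = sev v (hop p).
Proof.
rewrite /sev (@pevE _ _ _ (sevLD v) (size p) (hop p)) ?size_poly //.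
rewrite /pev (lin_sum (U_lin xh)); apply: eq_bigr => i _; rewrite hop_coef xevD !xevZ.
move: (p`_i) => q; elim: (nat_of_ord i) => [|j IH] /=.
  by rewrite muln0 addn0 xevh.
rewrite hb IH !(linD (iterU_lin _ _)) !(linD (U_lin _)) !(linZ (iterU_lin _ _)) !(linZ (U_lin _)).
set P := U xb _; set Q := U xb _; rewrite !natrD !natrM -natr1.
by lmod_with (N : lmodType C) ltac:(ring).
Qed.

Hypothesis Xinj : forall m : N, U xX m = 0 -> m = 0.
Hypothesis v0 : v != 0.

(** The operator h - n acts as 6 X d/dX and X is injective, so a relation may be differentiated
    until it is constant. In [sev_inj] the operator e = X d/db does the same for b. *)
Lemma xev_inj (q : {poly C}) : xev v q = 0 -> q = 0.
Proof.
have [k] := ubnP (size q); elim: k q => // k IH q hk e.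
have [->//|q0] := eqVneq q 0.
have := xevh q; rewrite e scaler0 add0r (lin0 (U_lin _)) => /esym/eqP.
rewrite scaler_eq0 pnatr_eq0 /= xevMX => /eqP /Xinj e1.
have d0 : q^`() = 0 by apply: IH e1; apply: leq_trans (lt_size_deriv q0) _.
have {}qc : q = (q`_0)%:P.
  apply: deriv0_const d0 => x j /eqP; by rewrite mulrn_eq0 /= => /eqP.
move: e; rewrite qc xevC => /eqP; rewrite scaler_eq0 (negPf v0) orbF => /eqP ->.
by rewrite polyC0.
Qed.

Lemma sev_inj (p : {poly {poly C}}) : sev v p = 0 -> p = 0.
Proof.
have [k] := ubnP (size p); elim: k p => // k IH p hk e.
have [->//|p0] := eqVneq p 0.
have := seve p; rewrite e (lin0 (U_lin _)) sevMX => /esym /Xinj e1.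
have d0 : p^`() = 0 by apply: IH e1; apply: leq_trans (lt_size_deriv p0) _.
have pc : p = (p`_0)%:P.
  apply: deriv0_const d0 => x j /eqP; rewrite -scaler_nat scaler_eq0 pnatr_eq0 /=.
  by move/eqP.
by move: e; rewrite pc sevC => /xev_inj ->; rewrite polyC0.
Qed.

End Vector.
End Span.

Opaque opm ev.

(** * A module satisfying [fgood] is determined by one highest weight *)

Section Relation.
Variable C : numClosedFieldType.
Local Notation U M := (ev (@opm C M)).

Section Rel.
Variables (N N' : lieMod (@sp4 C)) (n : nat) (v : N) (v' : N').
Hypotheses (hv : hwt n v) (hv' : hwt n v').

(** Up to a power of X, m and m' are given by the same polynomial in X and b applied to v and v'.
    This relation will be the graph of an isomorphism. *)
Definition rel (m : N) (m' : N') : Prop := exists k p,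
  iter k (U N xX) m = sev v p /\ iter k (U N' xX) m' = sev v' p.

Lemma rel0 : rel 0 0.
Proof. by exists 0%N, 0; rewrite !sev0. Qed.

Lemma rel_gen : rel v v'.
Proof. by exists 0%N, 1; rewrite -!polyC1 !sevC !xevC !scale1r. Qed.

Lemma sevXk M (u : lm_car M) k p : iter k (U M xX) (sev u p) = sev u (p * ('X ^+ k)%:P).
Proof.
elim: k => [|k IH]; first by rewrite expr0 mulr1.
by rewrite iterS IH -sevMX exprSr polyCM mulrA.
Qed.

Lemma rel_lin a u u' w w' : rel u u' -> rel w w' -> rel (a *: u + w) (a *: u' + w').
Proof.
move=> [k [p [h1 h2]]] [l [q [h3 h4]]].
exists (l + k)%N, (a%:P *: (p * ('X ^+ l)%:P) + q * ('X ^+ k)%:P).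
rewrite !sevD !sevZ -!sevXk -h1 -h2 -h3 -h4 -!iterD [(k + l)%N]addnC.
by rewrite !(iterU_lin xX).
Qed.

Lemma relZ a u u' : rel u u' -> rel (a *: u) (a *: u').
Proof. by move=> h; rewrite -[_ *: u]addr0 -[_ *: u']addr0; apply: rel_lin rel0. Qed.

Lemma rel_Xsat u u' : rel (U N xX u) (U N' xX u') -> rel u u'.
Proof. by move=> [k [p [h1 h2]]]; exists k.+1, p; rewrite !iterSr. Qed.

Definition relcl (g : ncexpr) : Prop := forall m m', rel m m' -> rel (U N g m) (U N' g m').

Lemma relcl_comm g : nc_eq sp4_br (g * xX)%nc (xX * g)%nc ->
  (forall p, exists q, U N g (sev v p) = sev v q /\ U N' g (sev v' p) = sev v' q) -> relcl g.
Proof.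
move=> hg hp m m' [k [p [h1 h2]]]; have [q [q1 q2]] := hp p.
by exists k, q; rewrite -!(Xj_comm _ _ hg) h1 h2.
Qed.

Lemma relcl_X : relcl xX.
Proof.
apply: relcl_comm => [|p]; first by nc.
by exists (p * 'X%:P); rewrite !sevMX.
Qed.

Lemma relcl_b : relcl xb.
Proof.
apply: relcl_comm => [|p]; first by nc.
by exists (p * 'X); rewrite !sevMb.
Qed.

Lemma relcl_e : relcl xe.
Proof.
apply: relcl_comm => [|p]; first by nc.
by exists (p^`() * 'X%:P); rewrite (seve hv) (seve hv').
Qed.

Lemma hXk M k (m : lm_car M) :
  iter k (U M xX) (U M xh m) = U M xh (iter k (U M xX) m) - (6 * k)%:R *: iter k (U M xX) m.
Proof.
elim: k => [|k IH]; first by rewrite muln0 scale0r subr0.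
rewrite iterS IH (linB (U_lin _)) (linZ (U_lin _)) iterS hX.
rewrite mulnS natrD; set A := U M xX _; set B := U M xX _.
by lmod_with (lm_car M) ltac:(ring).
Qed.

Lemma relcl_h : relcl xh.
Proof.
move=> m m' [k [p [h1 h2]]]; exists k, (hop n p + (- (6 * k)%:R)%:P *: p).
by rewrite !hXk h1 h2 (sevh hv) (sevh hv') !sevD !sevZ !scaleNr.
Qed.

Lemma relclA g1 g2 : relcl g1 -> relcl g2 -> relcl (g1 + g2)%nc.
Proof. by move=> h1 h2 m m' h; rewrite !UA -[U N g1 m]scale1r -[U N' g1 m']scale1r; apply: rel_lin; [apply: h1|apply: h2]. Qed.
Lemma relclM g1 g2 : relcl g1 -> relcl g2 -> relcl (g1 * g2)%nc.
Proof. by move=> h1 h2 m m' h; rewrite !UM; apply/h1/h2. Qed.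
Lemma relclZ k : relcl (NZ k).
Proof. by move=> m m' h; rewrite !UZ; apply: relZ. Qed.
Lemma relclB g1 g2 : relcl g1 -> relcl g2 -> relcl (g1 - g2)%nc.
Proof. by move=> h1 h2; apply: relclA => //; apply: relclM => //; apply: relclZ. Qed.
Lemma relcl_br g1 g2 : relcl g1 -> relcl g2 -> relcl (g1 * g2 - g2 * g1)%nc.
Proof. by move=> h1 h2; apply: relclB; apply: relclM. Qed.

Lemma relcl_eq (k : int) g1 g2 : k != 0 -> nc_eq sp4_br (NZ k * g1)%nc g2 -> relcl g2 -> relcl g1.
Proof.
move=> k0 h h2 m m' hm.
have := relZ (k%:~R)^-1 (h2 _ _ hm); rewrite -(Ueqn m h) -(Ueqn m' h) !UM !UZ !scalerA.
by rewrite mulVf ?intr_eq0 // !scale1r.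
Qed.

Hypotheses (gN : fgood N) (gN' : fgood N').

(** By [fgood], X^2 f is a polynomial in operators already known to preserve the relation, and X can
    be cancelled in [rel]. *)
Lemma relcl_f : relcl xf.
Proof.
move=> m m' h; apply/rel_Xsat/rel_Xsat; rewrite gN gN'.
have := @relclB (xX * (xb * xh) + xb * (xb * xe))%nc (xX * (xe * xe))%nc _ _ m m' h.
rewrite !USB !UA !UM; apply; last exact: relclM relcl_X (relclM relcl_e relcl_e).
by apply: relclA; [apply: relclM relcl_X (relclM relcl_b relcl_h) | apply: relclM relcl_b (relclM relcl_b relcl_e)].
Qed.

(** The operators e, f, h, b, X generate sp(4); the commutator of f and b gives a, and the other
    letters follow. *)
Lemma relcl_all i : (i < 10)%N -> relcl (NV i).
Proof.
have ca : relcl xa.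
  have h : nc_eq sp4_br (NZ 5 * xa)%nc (NZ 3 * xe - (xf * xb - xb * xf))%nc by nc.
  refine (@relcl_eq 5 _ _ isT h _); exact: relclB (relclM (relclZ _) relcl_e) (relcl_br relcl_f relcl_b).
have cE : relcl xE.
  have h : nc_eq sp4_br (NZ 1 * xE)%nc (xe - xa)%nc by nc.
  refine (@relcl_eq 1 _ _ isT h _); exact: relclB relcl_e ca.
have cKH : relcl (xK - xH)%nc.
  have h : nc_eq sp4_br (NZ 3 * (xK - xH))%nc (xf * xa - xa * xf)%nc by nc.
  refine (@relcl_eq 3 _ _ isT h _); exact: relcl_br relcl_f ca.
have cH : relcl xH.
  have h : nc_eq sp4_br (NZ 4 * xH)%nc (xh - (xK - xH))%nc by nc.
  refine (@relcl_eq 4 _ _ isT h _); exact: relclB relcl_h cKH.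
have cK : relcl xK.
  have h : nc_eq sp4_br (NZ 1 * xK)%nc ((xK - xH) + xH)%nc by nc.
  refine (@relcl_eq 1 _ _ isT h _); exact: relclA cKH cH.
have cc : relcl xc.
  have h : nc_eq sp4_br (NZ 12 * xc)%nc (((xK - xH) * xf - xf * (xK - xH)) + NZ 2 * xf)%nc by nc.
  refine (@relcl_eq 12 _ _ isT h _); exact: relclA (relcl_br cKH relcl_f) (relclM (relclZ _) relcl_f).
have cF : relcl xF.
  have h : nc_eq sp4_br (NZ 1 * xF)%nc (NZ 3 * xc - xf)%nc by nc.
  refine (@relcl_eq 1 _ _ isT h _); exact: relclB (relclM (relclZ _) cc) relcl_f.
have cd : relcl xd.
  have h : nc_eq sp4_br (NZ 2 * xd)%nc (xF * xc - xc * xF)%nc by nc.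
  refine (@relcl_eq 2 _ _ isT h _); exact: relcl_br cF cc.
have cY : relcl xY.
  have h : nc_eq sp4_br (NZ 1 * xY)%nc (xd * xc - xc * xd)%nc by nc.
  refine (@relcl_eq 1 _ _ isT h _); exact: relcl_br cd cc.
case: i => [|[|[|[|[|[|[|[|[|[|i]]]]]]]]]] //.
- by move=> _; exact: relcl_b.
- by move=> _; exact: relcl_X.
Qed.

Lemma rel_act x m m' : x \in @sp4 C -> rel m m' -> rel (act x m) (act x m').
Proof.
move=> hx h; rewrite !(act_coord _ hx); apply: (big_rec2 rel); first exact: rel0.
by move=> i u u' _ IH; apply: rel_lin => //; exact: relcl_all.
Qed.

Lemma rel_total m : simple_mod N -> v != 0 -> exists m', rel m m'.
Proof.
move=> [_ sN] v0; have [] := sN (fun m => exists m', rel m m').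
- split.
  + by exists 0; exact: rel0.
  + by move=> a u w [u' hu] [w' hw]; exists (a *: u' + w'); apply: rel_lin.
  + by move=> x hx u [u' hu]; exists (act x u'); apply: rel_act.
- by move=> h; rewrite (h v) ?eqxx // in v0; exists v'; exact: rel_gen.
- by move/(_ m).
Qed.

Lemma rel_fun m' : (forall m : N, U N xX m = 0 -> m = 0) -> (forall m : N', U N' xX m = 0 -> m = 0) ->
  v != 0 -> rel 0 m' -> m' = 0.
Proof.
move=> Xi Xi' v0 [k [p [h1 h2]]]; move: h1; rewrite (lin0 (iterU_lin _ _)) => /esym h1.
move: h2; rewrite (sev_inj hv Xi v0 h1) sev0; exact: XjX.
Qed.

End Rel.

Lemma rel_sym N N' (v : lm_car N) (v' : lm_car N') m m' : rel v v' m m' -> rel v' v m' m.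
Proof. by move=> [k [p [h1 h2]]]; exists k, p. Qed.

(** The relation [rel] is stable under sp(4). Its domain and its range are nonzero submodules, hence
    everything by simplicity, and it is single valued in both directions because [sev] and X are
    injective. *)
Lemma fgood_iso (N N' : lieMod (@sp4 C)) n (v : N) (v' : N') :
  simple_mod N -> simple_mod N' -> fgood N -> fgood N' ->
  (forall m : N, U N xX m = 0 -> m = 0) -> (forall m : N', U N' xX m = 0 -> m = 0) ->
  hwt n v -> hwt n v' -> v != 0 -> v' != 0 -> lm_iso N N'.
Proof.
move=> sN sN' gN gN' Xi Xi' hv hv' v0 v0'.
have tot m := rel_total hv hv' gN gN' m sN v0.
have tot' m := rel_total hv' hv gN' gN m sN' v0'.
have uniq m a b : rel v v' m a -> rel v v' m b -> a = b.
  move=> ha hb; apply/eqP; rewrite -subr_eq0; apply/eqP; apply: (@rel_fun N N' n v v' hv (a - b) Xi Xi' v0).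
  have := rel_lin (-1) hb ha; by rewrite !scaleN1r addNr (addrC (- b)).
have uniq' m a b : rel v' v m a -> rel v' v m b -> a = b.
  move=> ha hb; apply/eqP; rewrite -subr_eq0; apply/eqP; apply: (@rel_fun N' N n v' v hv' (a - b) Xi' Xi v0').
  have := rel_lin (-1) hb ha; by rewrite !scaleN1r addNr (addrC (- b)).
pose F m := projT1 (cid (tot m)); pose G m := projT1 (cid (tot' m)).
have FP m : rel v v' m (F m) := projT2 (cid (tot m)).
have GP m : rel v' v m (G m) := projT2 (cid (tot' m)).
exists F; split; [split|].
- by move=> a u w; apply: (uniq _ _ _ (FP _)); apply: rel_lin.
- by move=> x hx m; apply: (uniq _ _ _ (FP _)); apply: (rel_act hv hv' gN gN').
- exists G => m; [apply: (uniq' _ _ _ (GP _)) | apply: (uniq _ _ _ (FP _))]; exact: rel_sym.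
Qed.

(** Write X^k u = p(X, b) v for the lowest weight vector u. The equation f u = 0 becomes, by
    [fgood], a differential equation for p, which forces its lowest degree in b to be 0 or 1.
    Comparing weights then leaves n congruent to 0 or 1 modulo 3. *)
Lemma hwt_mod3 (N : lieMod (@sp4 C)) n (v u : N) :
  simple_mod N -> fgood N -> (forall m : N, U N xX m = 0 -> m = 0) ->
  hwt n v -> v != 0 -> u != 0 -> U N xf u = 0 -> U N xh u = - n%:R *: u ->
  (n %% 3 != 2)%N.
Proof.
move=> sN gN Xi hv v0 u0 fu hu.
have [_ [k [p [hw _]]]] := rel_total hv hv gN gN u sN v0.
set w := iter k (U N xX) u in hw.
have w0 : w != 0 by apply/eqP => e; move: u0; rewrite (XjX Xi e) eqxx.
have p0 : p != 0 by apply: contra_neq w0 => p0; rewrite hw p0 sev0.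
have hhw : U N xh w = ((6 * k)%:R - n%:R) *: w.
  have := hXk k u; rewrite -/w hu (linZ (iterU_lin _ _)) -/w => /esym/eqP.
  by rewrite subr_eq => /eqP ->; rewrite -scalerDl addrC.
have wt j : (hop n p)`_j = ((6 * k)%:R - n%:R)%:P * p`_j.
  have : hop n p - ((6 * k)%:R - n%:R)%:P *: p = 0.
    apply: (sev_inj hv Xi v0); rewrite -scaleNr -polyCN sevD sevZ -(sevh hv) -hw hhw.
    by rewrite scaleNr subrr.
  by move/eqP; rewrite subr_eq0 => /eqP ->; rewrite coefZ.
have eqw : n%:R *: U N xX (U N xb w) + U N xX (U N xe (U N xe w)) = U N xb (U N xb (U N xe w)).
  have e1 : n%:R *: U N xX (U N xb u) + U N xX (U N xe (U N xe u)) = U N xb (U N xb (U N xe u)).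
    have := gN u; rewrite fu !(lin0 (U_lin _)) hu !(linZ (U_lin _)) scaleNr => /esym/eqP.
    by rewrite subr_eq0 => /eqP <-; rewrite addrA subrr add0r.
  have cX g : nc_eq sp4_br (g * xX)%nc (xX * g)%nc -> forall m : N,
    U N g (iter k (U N xX) m) = iter k (U N xX) (U N g m) by move=> h m; exact: Xj_comm.
  have cb := cX xb ltac:(nc); have ce := cX xe ltac:(nc); have cx := cX xX ltac:(nc).
  by rewrite /w !(ce, cb) !cx -(linZ (iterU_lin xX k)) -(linD (iterU_lin xX k)) e1.
have inj2 A B : sev v A = sev v B -> A = B.
  move=> h; apply/eqP; rewrite -subr_eq0; apply/eqP; apply: (sev_inj hv Xi v0).
  by apply: (addIr (sev v B)); rewrite -sevD subrK add0r.
have /polyP pe : n%:R%:P *: (p * 'X * 'X%:P) + (p^`() * 'X%:P)^`() * 'X%:P * 'X%:P = p^`() * 'X%:P * 'X * 'X.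
  have e1 : sev v (p^`() * 'X%:P) = U N xe w by rewrite hw (seve hv).
  have e2 : sev v ((p^`() * 'X%:P)^`() * 'X%:P) = U N xe (U N xe w) by rewrite -e1 (seve hv).
  by apply: inj2; rewrite sevD sevZ (sevMX v (p * 'X)) sevMb -hw (sevMX v (_ * 'X%:P)) e2 !sevMb e1.
have ex : exists j, p`_j != 0.
  by exists (size p).-1; rewrite -lead_coefE lead_coef_eq0.
case: (ex_minnP ex) => j0 pj0 jmin.
have pz j : (j < j0)%N -> p`_j = 0.
  by move=> h; apply/eqP; apply: contraLR h => /jmin; rewrite -leqNgt.
(* In the lowest degree the equation reads j0 (j0 - 1) X^3 p_j0 = 0, because the other terms only
   involve coefficients of lower degree in b. *)
have j01 : (j0 < 2)%N.
  rewrite ltnNge; apply/negP => h; case: j0 h pz pj0 {jmin} => [|[|j]] // _ pz /negP; apply.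
  have := pe j; rewrite coefD coefZ !coefMC !coefMX coef_deriv coefMC !coef_deriv.
  have -> : (if j == 0 then 0 else p`_j.-1) = 0.
    by case: (j) pz => // i pz; rewrite /= pz // ltnS -addn2 leq_addr.
  have -> : (if j == 0 then 0 else if j.-1 == 0 then 0 else (p^`() * 'X%:P)`_j.-2) = 0.
    by case: (j) pz => [|[|i]] pz //=; rewrite coefMC coef_deriv pz ?mul0rn ?mul0r //; lia.
  rewrite mul0r mulr0 add0r => /eqP.
  rewrite !mulf_eq0 polyX_eq0 !orbF -scaler_nat scaler_eq0 pnatr_eq0 /= mulf_eq0 polyX_eq0 orbF.
  by rewrite -scaler_nat scaler_eq0 pnatr_eq0.
have [l pl] : exists l, p`_j0`_l != 0.
  by exists (size p`_j0).-1; rewrite -lead_coefE lead_coef_eq0.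
(* The weight n + 4 j0 + 6 l of a monomial of p equals 6 k - n, so 3 divides n + 2 j0. *)
have := congr1 (fun q : {poly C} => q`_l) (wt j0); rewrite hop_coef coefD !coefZ coefMX coef_deriv coefCM.
have -> : (if l == 0 then 0 else p`_j0`_l.-1.+1 *+ l.-1.+1) = l%:R * p`_j0`_l.
  by case: (l) => [|i]; rewrite ?mul0r //= mulr_natl.
rewrite mulrA -mulrDl => /(mulIf pl) /eqP.
rewrite eq_sym subr_eq -natrM -!natrD eqr_nat => /eqP; lia.
Qed.

End Relation.

Opaque opm ev.

(** * Restrictions on simple bounded modules *)

Section Classify.
Variables (C : numClosedFieldType) (N : lieMod (@sp4 C)).
Local Notation U := (ev (@opm C N)).

Lemma sl2_ef (m : N) : U xe (U xf m) = U xf (U xe m) + U xh m.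
Proof.
have h : nc_eq sp4_br (xe * xf)%nc (xf * xe + xh)%nc by nc.
exact: (Ueqn m h).
Qed.

Lemma sl2_hf (m : N) : U xh (U xf m) = U xf (U xh m) - 2%:R *: U xf m.
Proof.
have h : nc_eq sp4_br (xh * xf)%nc (xf * xh - NZ 2 * xf)%nc by nc.
by have := Ueqn m h; rewrite USB.
Qed.

Lemma hwt_hf n (v : N) j : hwt n v ->
  U xh (iter j (U xf) v) = (n%:R - j%:R *+ 2) *: iter j (U xf) v.
Proof.
move=> [_ hv]; elim: j => [|j IH]; first by rewrite mul0rn subr0.
rewrite iterS sl2_hf IH (linZ (U_lin _)) -scalerBl -natr1; congr (_ *: _); ring.
Qed.

Lemma hwt_ef n (v : N) j : hwt n v ->
  U xe (iter j.+1 (U xf) v) = (j.+1%:R * (n%:R - j%:R)) *: iter j (U xf) v.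
Proof.
move=> hv; elim: j => [|j IH].
  by rewrite /= sl2_ef hv.1 (lin0 (U_lin _)) add0r hv.2 subr0 mul1r.
rewrite [iter j.+2 _ _]iterS sl2_ef IH (linZ (U_lin _)) -iterS (hwt_hf _ hv) -scalerDl.
by rewrite -!natr1; congr (_ *: _); ring.
Qed.

(** The last nonzero f^j v is the vector u; applying e to the next, zero, vector forces j = n. *)
Lemma hwt_lowest n (v : N) : hwt n v -> v != 0 -> tors xf v ->
  exists u, [/\ u != 0, U xf u = 0 & U xh u = - n%:R *: u].
Proof.
move=> hv v0 /(last_iter v0) [j [j0 j1]]; exists (iter j (U xf) v); split => //.
have := hwt_ef j hv; rewrite j1 (lin0 (U_lin _)) => /esym/eqP.
rewrite scaler_eq0 (negPf j0) orbF mulf_eq0 pnatr_eq0 /= subr_eq0 eqr_nat => /eqP e.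
by rewrite (hwt_hf _ hv) e; congr (_ *: _); ring.
Qed.

Hypothesis simpleN : simple_mod N.
Hypothesis casN : forall m : N, U xCas m = (5%:R / 2%:R) *: m.
Variable b : nat.
Hypothesis Hbound : forall n (w : 'I_b.+1 -> N), (forall i, hwt n (w i)) ->
  exists c : 'I_b.+1 -> C, (exists i, c i != 0) /\ \sum_i c i *: w i = 0.

Lemma classify n (v : N) : hwt n v -> v != 0 -> tors xf v ->
  [/\ fgood N, forall m : N, U xX m = 0 -> m = 0 & (n %% 3 != 2)%N].
Proof.
move=> hv v0 tv.
have Xinj (m : N) : U xX m = 0 -> m = 0.
  move=> hm; apply/eqP; apply/negP => /negP m0.
  exact: (torsion_absurd simpleN casN v0 hv.1 hv.2 tv m0 hm).
have [w [w0 jw]] := jos_exists Xinj Hbound casN hv v0.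
have jall (m : N) : jos m.
  apply: (simple_all simpleN (jos_submodule Xinj)); by exists w.
have gN : fgood N.
  by apply: jos_fgood => // m; have [] := jall m.
split => //; have [u [u0 fu hu]] := hwt_lowest hv v0 tv.
exact: (hwt_mod3 simpleN gN Xinj hv v0 u0 fu hu).
Qed.

End Classify.

(** * Sums of spaces of binary forms as sl(2)-modules *)

Section LatticeSl2.
Variables (C : numFieldType) (nu : int -> int).
Local Notation lat := (lat C).
Local Notation ldelta := (lat_delta C).

(* The function f stands for the sum of the f k b x^(nu k - b) y^b, on which
   le, lh, lf are the operators x d/dy, x d/dx - y d/dy, y d/dx. *)
Definition le (f : lat) : lat := fun k b => (b + 1)%:~R * f k (b + 1).
Definition lh (f : lat) : lat := fun k b => (nu k - 2 * b)%:~R * f k b.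
Definition lf (f : lat) : lat := fun k b => (nu k - b + 1)%:~R * f k (b - 1).
Definition lT (f : lat) : lat := fun k b => (nu k * (nu k + 2))%:~R * f k b.

Lemma le_lin : linear le. Proof. by move=> a u v; apply: lat_ext => k b; rewrite /le !latE; ring. Qed.
Lemma lh_lin : linear lh. Proof. by move=> a u v; apply: lat_ext => k b; rewrite /lh !latE; ring. Qed.
Lemma lf_lin : linear lf. Proof. by move=> a u v; apply: lat_ext => k b; rewrite /lf !latE; ring. Qed.

Lemma lTE f : lT f = 4%:R *: lf (le f) + (lh (lh f) + 2%:R *: lh f).
Proof.
by apply: lat_ext => k b; rewrite latE latDE latZE /lT /lf /le /lh subrK; ring.
Qed.

(** Lagrange interpolation: d takes finitely many values on the support of f, and applying (d - c) /
    (mu - c) for each value c other than mu leaves the part where d = mu. *)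
Lemma diag_comp (d : int -> int -> C) (P : lat -> Prop) (mu : C) f :
  (forall a u v, P u -> P v -> P (a *: u + v)) ->
  (forall u, P u -> P (fun k b => d k b * u k b)) -> lbounded f -> P f ->
  P (fun k b => if d k b == mu then f k b else 0).
Proof.
move=> Pl Pd [N fN] Pf.
have [L hL] : exists L : seq C, forall k b, f k b != 0 -> d k b != mu -> d k b \in L.
  exists [seq d (val p.1)%:Z (val p.2)%:Z | p : 'I_N.+1 * 'I_N.+1] => k b /fN h _.
  have kN : (`|k| < N.+1)%N by lia.
  have bN : (`|b| < N.+1)%N by lia.
  apply/mapP; exists (Ordinal kN, Ordinal bN); first by rewrite mem_enum.
  by rewrite /= !gez0_abs //; lia.
elim: L f {fN} Pf hL => [|c L IH] f Pf hL.
  suff -> : (fun k b => if d k b == mu then f k b else 0) = f by [].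
  apply: lat_ext => k b; case: eqP => // /eqP h.
  by have [->//|/hL/(_ h)] := eqVneq (f k b) 0.
have [cm|cm] := eqVneq c mu.
  apply: IH => // k b fk dk; have := hL k b fk dk; rewrite inE cm.
  by rewrite (negPf dk).
pose g : lat := (mu - c)^-1 *: ((- c) *: f + (fun k b => d k b * f k b : C^o)).
have P0 : P 0 by have := Pl (-1) _ _ Pf Pf; rewrite scaleN1r addNr.
have Pg : P g by rewrite /g -[_ *: _]addr0; apply: (Pl) => //; apply: (Pl) => //; exact: Pd.
have gE k b : g k b = (mu - c)^-1 * (d k b - c) * f k b.
  by rewrite /g latZE latDE latZE; ring.
have mc : mu - c != 0 by rewrite subr_eq0 eq_sym.
have := IH g Pg; rewrite (_ : (fun k b => if d k b == mu then g k b else 0) =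
  (fun k b => if d k b == mu then f k b else 0)); last first.
  apply: lat_ext => k b; case: eqP => // e; by rewrite gE e mulVf ?mul1r.
apply=> k b; rewrite gE !mulf_eq0 !negb_or => /andP[/andP[_ h1] h2] h3.
have := hL k b h2 h3; rewrite inE => /orP[/eqP e|//].
by rewrite e subrr eqxx in h1.
Qed.

(** For k in I, row k is the space of binary forms of degree nu k, a copy of V_(nu k). *)
Definition lsupp (I : int -> Prop) (f : lat) : Prop :=
  forall k b, f k b != 0 -> I k /\ (0 <= b <= nu k).
Definition lpred (I : int -> Prop) (f : lat) : Prop := lbounded f /\ lsupp I f.

Lemma lsupp_lin I a u v : lsupp I u -> lsupp I v -> lsupp I (a *: u + v).
Proof.
move=> hu hv k b; rewrite latE => H.
have [u0|/hu //] := eqVneq (u k b) 0.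
by move: H; rewrite u0 mulr0 add0r => /hv.
Qed.
Lemma lpred_lin I a u v : lpred I u -> lpred I v -> lpred I (a *: u + v).
Proof. by move=> [u1 u2] [v1 v2]; split; [exact: lbounded_lin | exact: lsupp_lin]. Qed.
Lemma lpred0 I : lpred I 0.
Proof. by split; [exact: lbounded0 | move=> k b; rewrite lat0E eqxx]. Qed.

Lemma lpred_le I f : lpred I f -> lpred I (le f).
Proof.
move=> [[N fN] fs]; split; first exists N => k b; try move=> k b;
  rewrite /le mulf_eq0 negb_or intr_eq0 => /andP[b0 h].
- by have := fN _ _ h; have [_] := fs _ _ h; lia.
- by have [? ?] := fs _ _ h; split => //; lia.
Qed.
Lemma lpred_lh I f : lpred I f -> lpred I (lh f).
Proof.
move=> [[N fN] fs]; split; first exists N => k b; try move=> k b;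
  rewrite /lh mulf_eq0 negb_or intr_eq0 => /andP[b0 h]; [exact: fN|exact: fs].
Qed.
Lemma lpred_lf I f : lpred I f -> lpred I (lf f).
Proof.
move=> [[N fN] fs]; split; first exists N.+1 => k b; try move=> k b;
  rewrite /lf mulf_eq0 negb_or intr_eq0 => /andP[b0 h].
- by have := fN _ _ h; have [_] := fs _ _ h; lia.
- by have [? ?] := fs _ _ h; split => //; lia.
Qed.

Lemma ldelta_lpred (I : int -> Prop) (k b : int) : I k -> 0 <= k -> 0 <= b <= nu k -> lpred I (ldelta k b).
Proof.
move=> Ik k0 hb; split.
  exists (`|k| + `|b|)%N => i j; rewrite /ldelta.
  by case: andP => [[/eqP -> /eqP ->] _|_]; [lia | rewrite eqxx].
by move=> i j; rewrite /ldelta; case: andP => [[/eqP -> /eqP ->] _|_]; rewrite ?eqxx.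
Qed.

Lemma le_delta k b : le (ldelta k b) = b%:~R *: ldelta k (b - 1).
Proof.
apply: lat_ext => i j; rewrite latZE /le /ldelta.
rewrite (_ : (j + 1 == b) = (j == b - 1)); last by lia.
by case: andP => [[_ /eqP ->]|_]; rewrite ?subrK ?mulr0.
Qed.
Lemma lh_delta k b : lh (ldelta k b) = (nu k - 2 * b)%:~R *: ldelta k b.
Proof.
apply: lat_ext => i j; rewrite latZE /lh /ldelta.
by case: andP => [[/eqP -> /eqP ->]|_]; rewrite ?mulr0.
Qed.
Lemma lf_delta k b : lf (ldelta k b) = (nu k - b)%:~R *: ldelta k (b + 1).
Proof.
apply: lat_ext => i j; rewrite latZE /lf /ldelta.
rewrite (_ : (j - 1 == b) = (j == b + 1)); last by lia.
by case: andP => [[/eqP -> /eqP ->]|_]; rewrite ?mulr0 //; congr (_%:~R * _); lia.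
Qed.

Variable I : int -> Prop.
Hypotheses (I0 : forall k, I k -> 0 <= k) (nu0 : forall k, I k -> 0 <= nu k)
  (nuinj : forall k l, I k -> I l -> nu k = nu l -> k = l).

Section Stable.
Variable P : lat -> Prop.
Hypotheses (PP : forall f, P f -> lpred I f)
  (Pl : forall a u v, P u -> P v -> P (a *: u + v))
  (Pe : forall u, P u -> P (le u)) (Ph : forall u, P u -> P (lh u))
  (Pf : forall u, P u -> P (lf u)).

Lemma stable0 u : P u -> P 0.
Proof. by move=> Pu; have := Pl (-1) Pu Pu; rewrite scaleN1r addNr. Qed.

Lemma stableZ a u : P u -> P (a *: u).
Proof. by move=> Pu; rewrite -[_ *: _]addr0; apply: Pl => //; apply: stable0 Pu. Qed.

(** The rows are separated by the Casimir operator [lT] of sl(2), whose eigenvalue nu (nu + 2)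
    determines a nonnegative nu. Within a row h separates the monomials, as [stable_delta] uses
    next. *)
Lemma stable_row f k0 : P f -> I k0 -> P (fun k b => if k == k0 then f k b else 0).
Proof.
move=> hf Ik.
have PT u : P u -> P (lT u).
  move=> Pu; rewrite lTE; apply: (Pl _ (Pf (Pe Pu))).
  by rewrite addrC; apply: Pl (Ph Pu) (Ph (Ph Pu)).
have [fb fs] := PP hf.
have := diag_comp (d := fun k _ => (nu k * (nu k + 2))%:~R) (nu k0 * (nu k0 + 2))%:~R Pl PT fb hf.
rewrite (_ : (fun k b => _) = (fun k b => if k == k0 then f k b else 0)) //.
apply: lat_ext => k b; rewrite eqr_int.
have [->|fkb] := eqVneq (f k b) 0; first by rewrite !if_same.
have [Ikk _] := fs _ _ fkb.
have := nu0 Ik; have := nu0 Ikk => h1 h2.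
suff -> : (nu k * (nu k + 2) == nu k0 * (nu k0 + 2)) = (k == k0) by [].
apply/eqP/eqP => [e|-> //]; apply: nuinj => //; nia.
Qed.

Lemma stable_delta f k b : P f -> f k b != 0 -> P (ldelta k b).
Proof.
move=> hf fkb; have [_ fs] := PP hf; have [Ik _] := fs _ _ fkb.
have hr := stable_row hf Ik; have [rb _] := PP hr.
have := diag_comp (d := fun k b => (nu k - 2 * b)%:~R) (nu k - 2 * b)%:~R Pl Ph rb hr.
move=> /(stableZ (f k b)^-1); rewrite (_ : _ *: _ = ldelta k b) //.
apply: lat_ext => i j; rewrite latZE eqr_int /ldelta.
have [->|ik] := eqVneq i k; last by rewrite if_same mulr0.
rewrite (_ : (nu k - 2 * j == nu k - 2 * b) = (j == b)); last by lia.
by case: eqP => [->|_]; rewrite ?mulVf ?mulr0.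
Qed.

Lemma stable_delta_row k b b' : P (ldelta k b) -> 0 <= b' <= nu k -> P (ldelta k b').
Proof.
move=> hd hb'; have dd (i j : int) : ldelta i j i j != 0 by rewrite /ldelta !eqxx oner_eq0.
have [_ ds] := PP hd; have [_ hb] := ds _ _ (dd k b).
have down (n : nat) : P (ldelta k n%:Z) -> P (ldelta k 0).
  elim: n => // n IH h; apply: IH.
  have := Pe h; rewrite le_delta => /(stableZ (n.+1%:~R)^-1).
  by rewrite scalerA mulVf ?scale1r ?intr_eq0 // -addn1 PoszD addrK.
have up (n : nat) : n%:Z <= nu k -> P (ldelta k 0) -> P (ldelta k n%:Z).
  elim: n => // n IH hn h.
  have h1 : P (ldelta k n%:Z) by apply: IH => //; lia.
  have := Pf h1; rewrite lf_delta => /(stableZ (nu k - n%:Z)%:~R^-1).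
  rewrite scalerA mulVf ?scale1r; last by rewrite intr_eq0; lia.
  by rewrite -PoszD addn1.
have := up `|b'|%N; rewrite gez0_abs; last by lia.
apply; first by lia.
apply: (down `|b|%N); rewrite gez0_abs //; lia.
Qed.

End Stable.
End LatticeSl2.

Lemma fin_spannedI (C : fieldType) n (g : lieAlg C n) (M : lieMod g) (T : finType)
    (w : T -> M) (P : M -> Prop) :
  (forall m, P m -> exists c : T -> C, m = \sum_p c p *: w p) -> fin_spanned P.
Proof.
move=> H; exists [seq w p | p <- enum T] => m /H [c ->].
have sz : size [seq w p | p <- enum T] = #|T| by rewrite size_map cardE.
exists (fun i => c (enum_val (cast_ord sz i))).
rewrite (reindex (fun i => enum_val (cast_ord sz i))) /=; last first.
  exists (fun p => cast_ord (esym sz) (enum_rank p)) => p _; first by rewrite enum_valK cast_ordK.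
  by rewrite cast_ordKV enum_rankK.
apply: eq_bigr => i _; congr (_ *: _).
have [x _] : exists x : T, True by exists (enum_val (cast_ord sz i)).
by rewrite (nth_map x) ?(enum_val_nth x) //; have := ltn_ord i; rewrite {2}size_map.
Qed.

(** * Multiplicity-free modules over sl(2) *)

Section LatticeModule.
Variables (C : numFieldType) (nu : int -> int) (I : int -> Prop).
Local Notation lat := (lat C).
Local Notation ldelta := (lat_delta C).

Record lat_index : Prop := LatIndex {
  li_I0 : forall k, I k -> 0 <= k;
  li_nu0 : forall k, I k -> 0 <= nu k;
  li_inj : forall k l, I k -> I l -> nu k = nu l -> k = l }.

(** Through [io] the module K is the direct sum of the rows in I. Together with [lat_index], this
    makes it a multiplicity-free sum of finite dimensional simple modules. *)
Record lat_module n (g : lieAlg C n) (K : lieMod g) (io : K -> lat) : Prop := LatModule {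
  lm_lin : linear io;
  lm_inj : injective io;
  lm_pred : forall m, lpred nu I (io m);
  lm_sur : forall f, lpred nu I f -> exists m, io m = f;
  lm_act : {in lie_space g, forall x, exists a b c, forall m,
    io (act x m) = a *: le (io m) + (b *: lh nu (io m) + c *: lf nu (io m))};
  lm_e : exists2 x, x \in lie_space g & forall m, io (act x m) = le (io m);
  lm_h : exists2 x, x \in lie_space g & forall m, io (act x m) = lh nu (io m);
  lm_f : exists2 x, x \in lie_space g & forall m, io (act x m) = lf nu (io m) }.

Hypothesis hI : lat_index.

Lemma lat_hw (f : lat) (d : int) : lpred nu I f -> le f = 0 -> lh nu f = d%:~R *: f ->
  forall k b, f k b != 0 -> b = 0 /\ nu k = d.
Proof.
move=> [_ fs] fe fh k b fkb; have [Ik hb] := fs _ _ fkb.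
have b0 : b = 0.
  have /eqP : le f k (b - 1) = 0 by rewrite fe.
  by rewrite /le subrK mulf_eq0 (negPf fkb) orbF intr_eq0 => /eqP.
split=> //; have /eqP : lh nu f k b = d%:~R * f k b by rewrite fh.
rewrite /lh -subr_eq0 -mulrBl mulf_eq0 (negPf fkb) orbF -rmorphB intr_eq0 b0 /= => /eqP; lia.
Qed.

Lemma lat_hw_delta (f : lat) (k : int) : I k -> lpred nu I f -> le f = 0 ->
  lh nu f = (nu k)%:~R *: f -> f = f k 0 *: ldelta k 0.
Proof.
move=> Ik hf fe fh; have [_ fs] := hf; apply: lat_ext => i j; rewrite latZE /lat_delta.
have [f0|fij] := eqVneq (f i j) 0.
  case: andP => [[/eqP ei /eqP ej]|_]; rewrite ?mulr0 //.
  by rewrite -ei -ej f0 mul0r.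
have [j0 ni] := lat_hw hf fe fh fij; have [Ii _] := fs _ _ fij.
by rewrite (li_inj hI Ii Ik ni) j0 !eqxx mulr1.
Qed.

Section Module.
Variables (n : nat) (g : lieAlg C n) (K : lieMod g) (io : K -> lat).
Hypothesis hK : lat_module io.

Definition im (P : K -> Prop) (f : lat) : Prop := exists m, io m = f /\ P m.

Lemma im_lin P : submodule P -> forall a u v, im P u -> im P v -> im P (a *: u + v).
Proof.
move=> [_ Pl _] a u v [m [<- Pm]] [m' [<- Pm']]; exists (a *: m + m').
by split; [exact: (lm_lin hK) | exact: Pl].
Qed.
Lemma im_pred P f : im P f -> lpred nu I f.
Proof. by move=> [m [<- _]]; apply: (lm_pred hK). Qed.
Lemma im_le P : submodule P -> forall u, im P u -> im P (le u).
Proof.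
move=> [_ _ Pa] u [m [<- Pm]]; have [x gx hx] := lm_e hK.
by exists (act x m); split; [exact: hx | exact: Pa].
Qed.
Lemma im_lh P : submodule P -> forall u, im P u -> im P (lh nu u).
Proof.
move=> [_ _ Pa] u [m [<- Pm]]; have [x gx hx] := lm_h hK.
by exists (act x m); split; [exact: hx | exact: Pa].
Qed.
Lemma im_lf P : submodule P -> forall u, im P u -> im P (lf nu u).
Proof.
move=> [_ _ Pa] u [m [<- Pm]]; have [x gx hx] := lm_f hK.
by exists (act x m); split; [exact: hx | exact: Pa].
Qed.

Lemma im_delta P f k b : submodule P -> im P f -> f k b != 0 -> im P (ldelta k b).
Proof.
move=> sP; apply: (stable_delta (li_nu0 hI) (li_inj hI) (@im_pred P) (im_lin sP) (im_le sP) (im_lh sP) (im_lf sP)).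
Qed.
Lemma im_row P k b b' : submodule P -> im P (ldelta k b) -> 0 <= b' <= nu k -> im P (ldelta k b').
Proof.
move=> sP; apply: (stable_delta_row (@im_pred P) (im_lin sP) (im_le sP) (im_lf sP)).
Qed.

Lemma imP P m : im P (io m) <-> P m.
Proof. by split=> [[m' [/(lm_inj hK) -> //]]|Pm]; exists m. Qed.

Lemma io0 : io 0 = 0. Proof. exact: (lin0 (lm_lin hK)). Qed.
Lemma io_eq0 m : io m = 0 -> m = 0.
Proof. by rewrite -io0 => /(lm_inj hK). Qed.
Lemma io_neq0 m : m <> 0 -> exists k b, io m k b != 0.
Proof.
move=> m0; apply: contrapT => H; apply: m0; apply: io_eq0; apply: lat_ext => k b.
by apply/eqP; apply: contrapT => h; apply: H; exists k, b; apply/negP.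
Qed.

Lemma lat_submodule (D : lat -> Prop) : D 0 ->
  (forall a u v, D u -> D v -> D (a *: u + v)) ->
  (forall u, lpred nu I u -> D u -> D (le u)) -> (forall u, lpred nu I u -> D u -> D (lh nu u)) ->
  (forall u, lpred nu I u -> D u -> D (lf nu u)) ->
  submodule (fun m => D (io m)).
Proof.
move=> D0 Dl De Dh Df; split; first by rewrite io0.
- by move=> a u v hu hv; rewrite (lm_lin hK); apply: Dl.
- move=> x gx m hm; have [a [b [c ->]]] := lm_act hK gx; have hp := lm_pred hK m.
  apply: (Dl); first exact: De; apply: (Dl); first exact: Dh.
  by rewrite -[_ *: _]addr0; apply: (Dl) => //; exact: Df.
Qed.

Definition dm (k b : int) : K := xget 0 [set m | io m = ldelta k b].
Lemma dmE k b : I k -> 0 <= b <= nu k -> io (dm k b) = ldelta k b.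
Proof.
move=> Ik hb; have [m hm] := lm_sur hK (@ldelta_lpred C nu I k b Ik (li_I0 hI Ik) hb).
exact: (@xgetPex _ 0 [set m | io m = ldelta k b] (ex_intro _ m hm)).
Qed.

Lemma dm_sum m N : (forall i j, io m i j != 0 -> (0 <= i <= N%:Z) && (0 <= j <= N%:Z)) ->
  m = \sum_(p : 'I_N.+1 * 'I_N.+1) io m p.1%:Z p.2%:Z *: dm p.1%:Z p.2%:Z.
Proof.
move=> h; apply: (lm_inj hK); rewrite (lin_sum (lm_lin hK)) [LHS](lat_decomp h).
rewrite pair_big /=; apply: eq_bigr => -[i j] _ /=; rewrite (linZ (lm_lin hK)).
have [->|fij] := eqVneq (io m i%:Z j%:Z) 0; first by rewrite !scale0r.
have [_ fs] := lm_pred hK m; have [Ii hb] := fs _ _ fij.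
by rewrite dmE.
Qed.

Lemma lat_locally_finite : locally_finite K.
Proof.
move=> m; have [[N fN] _] := lm_pred hK m.
exists (fun m' => forall k b, io m' k b != 0 -> k <= N%:Z); split.
- apply: (lat_submodule (D := fun f => forall k b, f k b != 0 -> k <= N%:Z)).
  + by move=> k b; rewrite lat0E eqxx.
  + move=> a u v hu hv k b; rewrite latE => H.
    have [u0|/hu //] := eqVneq (u k b) 0.
    by move: H; rewrite u0 mulr0 add0r => /hv.
  + by move=> u _ hu k b; rewrite /le mulf_eq0 negb_or => /andP[_ /hu].
  + by move=> u _ hu k b; rewrite /lh mulf_eq0 negb_or => /andP[_ /hu].
  + by move=> u _ hu k b; rewrite /lf mulf_eq0 negb_or => /andP[_ /hu].
(* B bounds both the row and the position in the row. *)
- pose B := (N + \max_(i < N.+1) `|nu i%:Z|)%N.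
  apply: (@fin_spannedI _ _ _ _ ('I_B.+1 * 'I_B.+1)%type (fun p : 'I_B.+1 * 'I_B.+1 => dm p.1%:Z p.2%:Z)).
  move=> m' hm'; exists (fun p : 'I_B.+1 * 'I_B.+1 => io m' p.1%:Z p.2%:Z); apply: dm_sum => i j fij.
  have [_ fs] := lm_pred hK m'; have [Ii hb] := fs _ _ fij.
  have := li_I0 hI Ii; have := hm' _ _ fij => h1 h2.
  have iN : (`|i| < N.+1)%N by lia.
  have := @leq_bigmax _ (fun i : 'I_N.+1 => `|nu i%:Z|%N) (Ordinal iN).
  rewrite /= gez0_abs //; rewrite /B; move: (\max_(_ < _) _)%N => mx; clear -h1 h2 hb; lia.
- by move=> k b /fN; lia.
Qed.

(** A submodule is a sum of full rows; the functions vanishing on these rows form a complement. *)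
Lemma lat_semisimple : semisimple_mod K.
Proof.
move=> P sP.
exists (fun m => forall k b, im P (ldelta k b) -> io m k b = 0); split.
- apply: (lat_submodule (D := fun f => forall k b, im P (ldelta k b) -> f k b = 0)).
  + by [].
  + by move=> a u v hu hv k b h; rewrite latE hu // hv // mulr0 addr0.
  + move=> u [_ us] hu k b h; rewrite /le; apply/eqP; rewrite mulf_eq0.
    apply/orP; right; have [//|h1] := eqVneq (u k (b + 1)) 0; have [_ h2] := us _ _ h1.
    by rewrite (hu _ _ (im_row sP h h2)) eqxx in h1.
  + by move=> u _ hu k b h; rewrite /lh hu // mulr0.
  + move=> u [_ us] hu k b h; rewrite /lf; apply/eqP; rewrite mulf_eq0.
    apply/orP; right; have [//|h1] := eqVneq (u k (b - 1)) 0; have [_ h2] := us _ _ h1.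
    by rewrite (hu _ _ (im_row sP h h2)) eqxx in h1.
- move=> m Pm Qm; apply: io_eq0; apply: lat_ext => k b.
  have [//|h] := eqVneq (io m k b) 0; apply: Qm; apply: im_delta h => //; exact/imP.
- move=> m; pose f : lat := fun k b => if `[< im P (ldelta k b) >] then io m k b else 0.
  have [[N fN] fs] := lm_pred hK m.
  have fnz k b : f k b != 0 -> io m k b != 0 /\ im P (ldelta k b).
    by rewrite /f; case: asboolP => //; rewrite eqxx.
  have fp : lpred nu I f.
    by split; [exists N => k b /fnz [/fN] | move=> k b /fnz [/fs]].
  have [u hu] := lm_sur hK fp; exists u, (m - u); split.
  + apply/imP; rewrite hu; have [fb _] := fp; apply: lat_ind fb _.
    * by exists 0; split; [exact: io0 | case: sP].
    * exact: im_lin.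
    * by move=> i j /fnz [].
  + move=> k b h; rewrite (linB (lm_lin hK)) hu -[LHS]/(io m k b - f k b) /f.
    by case: asboolP => //; rewrite subrr.
  + by rewrite addrC subrK.
Qed.

(** If phi is nonzero, it is injective and its image contains a full row, whose highest weight
    vector comes from some v0. The image of v0 under psi is a highest weight vector of the same
    weight, hence a multiple c of phi v0 because degrees of rows are distinct; then psi - c phi
    kills v0 and vanishes. *)
Lemma lat_hom_dim (V : lieMod g) : simple_mod V -> hom_dim_le V K 1.
Proof.
move=> sV d f hf li.
have ker (phi : V -> K) : lm_hom phi -> submodule (fun v => phi v = 0).
  move=> [pl pa]; split; first exact: lin0 pl.
    by move=> a u v hu hv; rewrite pl hu hv scaler0 addr0.
  move=> x gx v hv; rewrite pa // hv; exact: (lin0 (act_linear gx)).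
have kerT (phi : V -> K) v : lm_hom phi -> v <> 0 -> phi v = 0 -> forall u, phi u = 0.
  by move=> hp v0 pv; have [_ /(_ _ (ker _ hp)) [/(_ v pv)|]] := sV.
have key (phi psi : V -> K) : lm_hom phi -> lm_hom psi -> (exists v, phi v <> 0) ->
    exists c, forall v, psi v = c *: phi v.
  move=> hp hq [v pv]; have [pl pa] := hp; have [ql qa] := hq.
  have sI : submodule (fun m => exists v, phi v = m).
    split; first by exists 0; exact: lin0 pl.
      by move=> a u w [u' <-] [w' <-]; exists (a *: u' + w'); exact: pl.
    by move=> x gx m [u <-]; exists (act x u); exact: pa.
  have pinj u : phi u = 0 -> u = 0.
    move=> pu; apply: contrapT => u0; apply: pv; exact: kerT hp u0 pu v.
  have [k [b fkb]] := io_neq0 pv.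
  have Iv : im (fun m => exists v, phi v = m) (io (phi v)) by apply/imP; exists v.
  have [_ fs] := lm_pred hK (phi v); have [Ik hb] := fs _ _ fkb.
  have hk0 : (0 : int) <= 0 <= nu k by have := li_nu0 hI Ik; lia.
  have [m0 [m0E [v0 v0E]]] := im_row sI (im_delta sI Iv fkb) hk0.
  rewrite -{}v0E in m0E.
  have [xe ge he] := lm_e hK; have [xh gh hh] := lm_h hK.
  have ev0 : act xe v0 = 0.
    apply: pinj; apply: io_eq0; rewrite pa // he m0E le_delta scale0r //.
  have hv0 : act xh v0 = (nu k)%:~R *: v0.
    apply/eqP; rewrite -subr_eq0; apply/eqP; apply: pinj; apply: io_eq0.
    rewrite (linB pl) (linZ pl) (linB (lm_lin hK)) (linZ (lm_lin hK)) pa // hh m0E lh_delta.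
    by rewrite mulr0 subr0 subrr.
  have qE : io (psi v0) = io (psi v0) k 0 *: ldelta k 0.
    apply: lat_hw_delta => //; first exact: (lm_pred hK).
    - by rewrite -he -qa // ev0 (lin0 ql) io0.
    - by rewrite -hh -qa // hv0 (linZ ql) (linZ (lm_lin hK)).
  exists (io (psi v0) k 0) => u; apply/eqP; rewrite -subr_eq0; apply/eqP.
  apply: (kerT (fun u => psi u - io (psi v0) k 0 *: phi u) v0).
  - split=> [a x y|x gx y]; first by rewrite ql pl; lmod_with (lm_car K) ltac:(ring).
    by rewrite qa // pa // (linB (act_linear gx)) (linZ (act_linear gx)).
  - move=> e; move: m0E; rewrite e (lin0 pl) io0 => /(congr1 (fun f : lat => f k 0)).
    by rewrite lat0E /lat_delta !eqxx => /esym/eqP; rewrite oner_eq0.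
  - by apply: io_eq0; rewrite (linB (lm_lin hK)) (linZ (lm_lin hK)) m0E -qE subrr.
rewrite leqNgt; apply/negP => d2.
pose i0 := Ordinal (ltnW d2); pose i1 := Ordinal d2.
have [z|nz] := pselect (forall v, f i0 v = 0).
  have hz v : \sum_i (i == i0)%:R *: f i v = 0.
    apply: big1 => i _; have [->|_] := eqVneq i i0; first by rewrite z scaler0.
    by rewrite scale0r.
  by have /eqP := li _ hz i0; rewrite /= ?eqxx oner_eq0.
move/existsNP: nz => nz.
have [c hc] := key _ _ (hf i0) (hf i1) nz.
have hz v : \sum_i (if i == i1 then 1 else if i == i0 then - c else 0) *: f i v = 0.
  rewrite (bigD1 i1) //= (bigD1 i0) //= big1 ?addr0 => [|i /andP[h1 h2]].
    by rewrite hc scale1r scaleNr subrr.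
  by rewrite (negPf h1) (negPf h2) scale0r.
by have /eqP := li _ hz i1; rewrite /= ?eqxx oner_eq0.
Qed.

End Module.
End LatticeModule.

Section Rows.
Variables (C : numFieldType) (nu : int -> int).
Local Notation lat := (lat C).
Local Notation ldelta := (lat_delta C).
Variables (n : nat) (g : lieAlg C n).

Section OneRow.
Variables (k0 : int) (K : lieMod g) (io : K -> lat).
Hypotheses (k00 : 0 <= k0) (nk0 : 0 <= nu k0).
Hypothesis hK : lat_module nu (eq^~ k0) io.

Lemma row_index : lat_index nu (eq^~ k0).
Proof. by split=> [k ->|k ->|k l -> ->]. Qed.

Let d := `|nu k0|%N.

Lemma row_in b : (b < d.+1)%N -> 0 <= b%:Z <= nu k0.
Proof. rewrite /d; lia. Qed.

Lemma row_simple : simple_mod K.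
Proof.
have hI := row_index.
have hd b : (b < d.+1)%N -> io (dm io k0 b%:Z) = ldelta k0 b%:Z.
  by move=> hb; apply: (dmE hI hK) => //; exact: row_in.
split.
  exists (dm io k0 0); apply/eqP => e; have := hd 0%N (ltn0Sn _).
  rewrite e (io0 hK) => /(congr1 (fun f : lat => f k0 0)).
  by rewrite lat0E /lat_delta !eqxx => /esym/eqP; rewrite oner_eq0.
move=> P sP; have [H|] := pselect (forall m, P m -> m = 0); first by left.
move=> /existsNP [m /not_implyP [Pm m0]]; right => m'.
have [k [b fkb]] := io_neq0 hK m0.
have [_ fs] := lm_pred hK m; have [kE _] := fs _ _ fkb; rewrite kE in fkb.
have im0 : im io P (ldelta k0 b) by apply: (im_delta hI hK sP _ fkb); exists m.
have [fb fs'] := lm_pred hK m'.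
apply/(imP hK); apply: lat_ind fb _.
- by exists 0; split; [exact: (io0 hK) | case: sP].
- exact: im_lin hK _ sP.
- by move=> i j /fs' [-> hj]; exact: (im_row hK sP im0 hj).
Qed.

Lemma row_dim : has_dim K d.+1.
Proof.
have hI := row_index.
have hd b : (b < d.+1)%N -> io (dm io k0 b%:Z) = ldelta k0 b%:Z.
  by move=> hb; apply: (dmE hI hK) => //; exact: row_in.
pose F (r : 'rV[C]_d.+1) : K := \sum_j r 0 j *: dm io k0 j%:Z.
have lF : linear F.
  move=> a u v; rewrite /F scaler_sumr -big_split; apply: eq_bigr => j _ /=.
  by rewrite !mxE scalerDl scalerA.
have ioF r (j : 'I_d.+1) : io (F r) k0 j%:Z = r 0 j.
  rewrite /F (lin_sum (lm_lin hK)) lat_sum (bigD1 j) //= big1 ?addr0.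
    by rewrite (linZ (lm_lin hK)) hd // latZE /lat_delta !eqxx mulr1.
  move=> i ij; rewrite (linZ (lm_lin hK)) hd // latZE /lat_delta eqxx /=.
  by rewrite (_ : (j%:Z == i%:Z) = false) ?mulr0 // eqz_nat eq_sym val_eqE (negPf ij).
pose F' : {linear 'rV[C]_d.+1 -> lm_car K} := HB.pack F (GRing.isLinear.Build _ _ _ _ F lF).
exists F'; exists (fun m => \row_j io m k0 j%:Z).
  by move=> r; apply/rowP => j; rewrite mxE; exact: ioF.
move=> m; apply: (lm_inj hK); apply: lat_ext => k b.
have hp := lm_pred hK (F (\row_j io m k0 j%:Z)).
have [hb|hb] := pselect (k = k0 /\ 0 <= b <= nu k0); last first.
  have z (f : lat) : lpred nu (eq^~ k0) f -> f k b = 0.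
    move=> [_ fs]; have [//|/fs [h1 h2]] := eqVneq (f k b) 0.
    by case: hb; split => //; rewrite -h1.
  by rewrite (z _ hp) (z _ (lm_pred hK m)).
case: hb => -> hb; have bd : (`|b| < d.+1)%N by rewrite /d; lia.
have := ioF (\row_j io m k0 j%:Z) (Ordinal bd); rewrite mxE /= gez0_abs //; lia.
Qed.

End OneRow.

Variables (I : int -> Prop) (K : lieMod g) (io : K -> lat).
Hypotheses (hI : lat_index nu I) (hK : lat_module nu I io).

Lemma row_submodule k0 : submodule (fun m => lsupp nu (eq^~ k0) (io m)).
Proof.
apply: (lat_submodule hK (D := lsupp nu (eq^~ k0))).
- by have [] := lpred0 C nu (eq^~ k0).
- exact: lsupp_lin.
- by move=> u [ub _] us; have [] := @lpred_le C nu _ u (conj ub us).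
- by move=> u [ub _] us; have [] := @lpred_lh C nu _ u (conj ub us).
- by move=> u [ub _] us; have [] := @lpred_lf C nu _ u (conj ub us).
Qed.

Lemma row_lat_module k0 : I k0 -> lat_module nu (eq^~ k0) (io \o @sub_val _ _ _ _ _ (row_submodule k0)).
Proof.
move=> Ik0; have sl := @sub_val_linear _ _ _ _ _ (row_submodule k0).
split.
- by move=> a u v; rewrite [LHS](congr1 io (sl a u v)) (lm_lin hK).
- by move=> u v /= /(lm_inj hK) /sub_val_inj.
- by move=> m /=; have [mb _] := lm_pred hK (sub_val m); split => //; exact: (sub_valP m).
- move=> f [fb fs].
  have fI : lpred nu I f by split => // k b /fs [-> hb].
  have [m hm] := lm_sur hK fI; have Pm : lsupp nu (eq^~ k0) (io m) by rewrite hm.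
  by exists (sub_in (row_submodule k0) Pm); exact: hm.
- move=> x gx; have [a [b [c H]]] := lm_act hK gx; exists a, b, c => m.
  by rewrite [LHS](congr1 io (sub_val_act m gx)) H.
- by have [x gx H] := lm_e hK; exists x => // m; rewrite [LHS](congr1 io (sub_val_act m gx)) H.
- by have [x gx H] := lm_h hK; exists x => // m; rewrite [LHS](congr1 io (sub_val_act m gx)) H.
- by have [x gx H] := lm_f hK; exists x => // m; rewrite [LHS](congr1 io (sub_val_act m gx)) H.
Qed.

Lemma lat_decomposes (ka : nat -> int) (d : nat -> nat) :
  (forall j, I (ka j)) -> (forall k, I k -> exists j, k = ka j) -> injective ka ->
  (forall j, j%:Z <= ka j) -> (forall j, nu (ka j) = (d j)%:Z) -> decomposes_as K d.
Proof.
move=> kI kS kinj kle kd.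
exists (fun j => sub_lieMod (row_submodule (ka j))); split.
  move=> j; have hj := row_lat_module (kI j).
  have n0 : 0 <= nu (ka j) := li_nu0 hI (kI j).
  have k0 : 0 <= ka j := li_I0 hI (kI j).
  split; first exact: row_simple k0 n0 hj.
  by have := row_dim k0 n0 hj; rewrite kd.
exists (fun j => @sub_val _ _ _ _ _ (row_submodule (ka j))); split.
- move=> j; split; first exact: sub_val_linear.
  by move=> x gx m; exact: sub_val_act.
- move=> m; have [[N fN] fs] := lm_pred hK m; exists N.+1.
  have hr j : lpred nu I (fun k b => if k == ka j then io m k b else 0).
    split; first by exists N => k b; case: (k =P ka j) => [_ /fN //|_]; rewrite eqxx.
    by move=> k b; case: (k =P ka j) => [_ /fs //|_]; rewrite eqxx.
  have hu j : exists u : sub_lieMod (row_submodule (ka j)),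
      io (sub_val u) = (fun k b => if k == ka j then io m k b else 0).
    have [u hu] := lm_sur hK (hr j).
    have Pu : lsupp nu (eq^~ (ka j)) (io u).
      by rewrite hu => k b; case: (k =P ka j) => [-> /fs [_ h] //|_]; rewrite eqxx.
    by exists (sub_in (row_submodule (ka j)) Pu); exact: hu.
  exists (fun j => projT1 (cid (hu j))).
  apply: (lm_inj hK); rewrite (lin_sum (lm_lin hK)); apply: lat_ext => k b; rewrite lat_sum.
  under eq_bigr => j _ do rewrite (projT2 (cid (hu j))).
  have [f0|fkb] := eqVneq (io m k b) 0.
    by rewrite f0 big1 // => j _; case: ifP.
  have [/kS [j kE] _] := fs _ _ fkb; subst k.
  have jN : (j < N.+1)%N by have := fN _ _ fkb; have := kle j; lia.
  rewrite (bigD1 (Ordinal jN)) //= eqxx big1 ?addr0 // => i ij.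
  by case: eqP => // /kinj e; move: ij; rewrite -val_eqE /= e eqxx.
- move=> N v s0 i iN; apply: sub_val_inj; rewrite (lin0 (@sub_val_linear _ _ _ _ _ _)).
  apply: (io_eq0 hK); apply: lat_ext => k b; rewrite lat0E.
  have [//|h] := eqVneq (io (sub_val (v i)) k b) 0.
  have [kE _] := sub_valP (v i) _ _ h.
  have := congr1 (fun m => io m k b) s0.
  rewrite (io0 hK) lat0E (lin_sum (lm_lin hK)) lat_sum (bigD1 (Ordinal iN)) //= big1 ?addr0 //.
  move=> j ij; have [//|h'] := eqVneq (io (sub_val (v j)) k b) 0.
  have [kE' _] := sub_valP (v j) _ _ h'; move: ij; rewrite -val_eqE /=.
  by rewrite (kinj j i) ?eqxx // -kE -kE'.
Qed.

End Rows.

(** * Triples, and highest weight vectors in locally finite modules *)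

(** The coordinate functionals are part of the data, so that x can be made to act on binary forms as
    [al] x e + [be] x h + [ga] x f. *)
Record sl2_triple (C : fieldType) n (g : lieAlg C n) (al be ga : 'M[C]_n -> C^o)
    (e0 h0 f0 : 'M[C]_n) : Prop := Sl2Triple {
  st_e : e0 \in lie_space g; st_h : h0 \in lie_space g; st_f : f0 \in lie_space g;
  st_al : linear al; st_be : linear be; st_ga : linear ga;
  st_dec : {in lie_space g, forall x, x = al x *: e0 + (be x *: h0 + ga x *: f0)};
  st_ve : [/\ al e0 = 1, be e0 = 0 & ga e0 = 0];
  st_vh : [/\ al h0 = 0, be h0 = 1 & ga h0 = 0];
  st_vf : [/\ al f0 = 0, be f0 = 0 & ga f0 = 1];
  st_he : lie_br h0 e0 = 2%:R *: e0;
  st_hf : lie_br h0 f0 = - (2%:R *: f0);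
  st_ef : lie_br e0 f0 = h0 }.

Section Triple.
Variables (C : numClosedFieldType) (n : nat) (g : lieAlg C n) (al be ga : 'M[C]_n -> C^o).
Variables (e0 h0 f0 : 'M[C]_n).
Hypothesis st : sl2_triple g al be ga e0 h0 f0.
Local Notation lat := (lat C).
Local Notation ldelta := (lat_delta C).

Lemma lie_brC (x y : 'M[C]_n) : lie_br x y = - lie_br y x.
Proof. by rewrite /lie_br opprB. Qed.
Lemma lie_brxx (x : 'M[C]_n) : lie_br x x = 0.
Proof. by rewrite /lie_br subrr. Qed.

Lemma triple_br x y : x \in lie_space g -> y \in lie_space g ->
  lie_br x y = (2%:R * (be x * al y - al x * be y)) *: e0
   + ((al x * ga y - ga x * al y) *: h0 + (2%:R * (ga x * be y - be x * ga y)) *: f0).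
Proof.
move=> gx gy.
have brl (z : 'M[C]_n) : linear (fun t => lie_br t z).
  move=> a u v; rewrite lie_brC (@lie_br_linear C n z) (lie_brC u) (lie_brC v).
  by rewrite opprD scalerN.
have brr := @lie_br_linear C n.
rewrite {1}(st_dec st gx) {1}(st_dec st gy).
rewrite !(brl _) !(linZ (brl _)) !(brr _) !(linZ (brr _)).
rewrite !lie_brxx (lie_brC e0 h0) (lie_brC f0 h0) (lie_brC f0 e0) (st_he st) (st_hf st) (st_ef st).
by lmod_with ('M[C]_n : lmodType C) ltac:(ring).
Qed.

Lemma triple_coord (a b c : C) x : x = a *: e0 + (b *: h0 + c *: f0) ->
  [/\ al x = a, be x = b & ga x = c].
Proof.
move=> ->; have [a1 b1 c1] := st_ve st; have [a2 b2 c2] := st_vh st; have [a3 b3 c3] := st_vf st.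
have dec (l : 'M[C]_n -> C^o) : linear l ->
    l (a *: e0 + (b *: h0 + c *: f0)) = a * l e0 + (b * l h0 + c * l f0).
  by move=> ll; rewrite ll (linD ll) !(linZ ll).
by split; rewrite dec; [rewrite a1 a2 a3|exact: (st_al st)|rewrite b1 b2 b3|exact: (st_be st)
  |rewrite c1 c2 c3|exact: (st_ga st)]; ring.
Qed.

Section LatFull.
Variable nu : int -> int.

Definition lat_act (x : 'M[C]_n) (f : lat) : lat := al x *: le f + (be x *: lh nu f + ga x *: lf nu f).

Lemma lat_act_linear x : linear (lat_act x).
Proof.
move=> a u v; apply: lat_ext => k b; rewrite latDE latZE /lat_act !(latDE, latZE) /le /lh /lf !latE.
ring.
Qed.

Lemma lat_act_br x y : x \in lie_space g -> y \in lie_space g -> forall f,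
  lat_act (lie_br x y) f = lat_act x (lat_act y f) - lat_act y (lat_act x f).
Proof.
move=> gx gy f; rewrite {1}/lat_act; have [-> -> ->] := triple_coord (triple_br gx gy).
apply: lat_ext => k b; rewrite /lat_act -[RHS]/(_ k b - _ k b) !(latDE, latZE) /le /lh /lf !(latDE, latZE).
rewrite /= !subrK !addrK; ring.
Qed.

Lemma lat_act_linearl a x y f : lat_act (a *: x + y) f = a *: lat_act x f + lat_act y f.
Proof.
apply: lat_ext => k b; rewrite /lat_act (st_al st) (st_be st) (st_ga st) !(latDE, latZE).
by rewrite -[a *: al x]/(a * al x) -[a *: be x]/(a * be x) -[a *: ga x]/(a * ga x); ring.
Qed.

Definition lat_full : lieMod g :=
  @LieMod C n g lat lat_act (fun x _ => lat_act_linear x)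
    (fun a x y _ _ f => lat_act_linearl a x y f)
    (fun x y gx gy => lat_act_br gx gy).

Lemma lpred_submodule I : submodule (fun f : lat_full => lpred nu I (f : lat)).
Proof.
split; [exact: lpred0 | by move=> a u v; exact: lpred_lin |].
move=> x gx f hf; rewrite /= /lat_act.
apply: lpred_lin; first exact: lpred_le; apply: lpred_lin; first exact: lpred_lh.
rewrite -[_ *: _]addr0; apply: lpred_lin; [exact: lpred_lf | exact: lpred0].
Qed.

Definition lat_mod I : lieMod g := sub_lieMod (lpred_submodule I).
Definition lat_val I : lat_mod I -> lat := @sub_val _ _ _ _ _ (lpred_submodule I).

Lemma lat_mod_lat I : lat_module nu I (@lat_val I).
Proof.
have [a1 b1 c1] := st_ve st; have [a2 b2 c2] := st_vh st; have [a3 b3 c3] := st_vf st.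
have actE x m : x \in lie_space g -> lat_val (act x m : lat_mod I) =
    al x *: le (lat_val m) + (be x *: lh nu (lat_val m) + ga x *: lf nu (lat_val m)).
  by move=> gx; rewrite /lat_val sub_val_act.
split.
- exact: sub_val_linear.
- exact: sub_val_inj.
- exact: sub_valP.
- by move=> f hf; exists (sub_in (lpred_submodule I) hf); exact: erefl.
- by move=> x gx; exists (al x), (be x), (ga x) => m; exact: actE.
- exists e0 => [|m]; first exact: st_e st.
  by rewrite actE ?(st_e st) // a1 b1 c1 !scale0r !addr0 scale1r.
- exists h0 => [|m]; first exact: st_h st.
  by rewrite actE ?(st_h st) // a2 b2 c2 !scale0r addr0 add0r scale1r.
- exists f0 => [|m]; first exact: st_f st.
  by rewrite actE ?(st_f st) // a3 b3 c3 !scale0r !add0r scale1r.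
Qed.
End LatFull.
End Triple.

Section FinSpan.
Variables (C : numClosedFieldType) (n : nat) (g : lieAlg C n) (K : lieMod g).

Lemma span_dep (P : K -> Prop) (w : nat -> K) : fin_spanned P -> (forall j, P (w j)) ->
  exists L, exists c : 'I_L.+1 -> C, (exists i, c i != 0) /\ \sum_i c i *: w i = 0.
Proof.
move=> [s hs] Pw; pose L := size s; exists L.
pose A : 'M[C]_(L.+1, L) := \matrix_(i < L.+1) \row_j projT1 (cid (hs _ (Pw i))) j.
have wE (i : 'I_L.+1) : w i = \sum_j A i j *: s`_j.
  rewrite {1}(projT2 (cid (hs _ (Pw i)))); apply: eq_bigr => j _.
  by rewrite !mxE.
have : kermx A != 0.
  rewrite -mxrank_eq0 mxrank_ker subn_eq0 -ltnNge ltnS; exact: rank_leq_col.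
case/rowV0Pn => r /sub_kermxP rA r0; exists (fun i => r 0 i); split.
  apply: contrapT => H; move: r0; apply/negP; rewrite negbK; apply/eqP/rowP => i; rewrite mxE.
  by apply/eqP; apply: contrapT => h; apply: H; exists i; apply/negP.
under eq_bigr => i _ do rewrite wE scaler_sumr.
rewrite exchange_big big1 // => j _.
under eq_bigr => i _ do rewrite scalerA.
rewrite -scaler_suml.
have -> : \sum_i r 0 i * A i j = 0 by have := congr1 (fun B : 'rV_L => B 0 j) rA; rewrite [X in X = _]mxE [X in _ = X]mxE.
by rewrite scale0r.
Qed.

Lemma eig_vanish (P : K -> Prop) (T : K -> K) (mu : nat -> C) (w : nat -> K) :
  fin_spanned P -> (forall j, P (w j)) -> linear T -> injective mu ->
  (forall j, T (w j) = mu j *: w j) -> exists j, w j = 0.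
Proof.
move=> fP Pw lT mi Tw; have [L [c [[i ci] sc]]] := span_dep fP Pw.
have li : linear (@id K) by [].
have mi' : injective (fun i : 'I_L.+1 => mu i) by move=> a b /mi /val_inj.
have Tw' (j : 'I_L.+1) : T (c j *: w j) = mu j *: id (c j *: w j).
  by rewrite (linZ lT) Tw !scalerA mulrC.
have := @eigZ_split C K T id lT li (fun _ h => h) (fun _ => erefl) _ _ _ mi' Tw' sc i.
by move/eqP; rewrite scaler_eq0 (negPf ci) => /eqP h; exists i.
Qed.

Lemma eig_exists (P : K -> Prop) (T : K -> K) (m : K) :
  fin_spanned P -> (forall a u v, P u -> P v -> P (a *: u + v)) -> P 0 ->
  linear T -> (forall u, P u -> P (T u)) -> P m -> m != 0 ->
  exists u x, [/\ P u, u != 0 & T u = x *: u].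
Proof.
move=> fP Pl P0 lT PT Pm m0.
have Pw j : P (iter j T m) by elim: j => //= j; apply: PT.
have [L [c [[i ci] sc]]] := span_dep fP Pw.
pose p := \poly_(j < L.+1) c (inord j).
have p0 : p != 0.
  apply: contraNneq ci => p0; have := coef_poly L.+1 (fun j => c (inord j)) i.
  by rewrite -/p p0 coef0 ltn_ord inord_val => <-.
have sp : (size p <= L.+1)%N by apply: size_poly.
have li : linear (@id K) by [].
have it j (u : K) : iter j id u = u by elim: j.
have hp0 : hpe T id L p m = 0.
  rewrite /hpe -[RHS]sc; apply: eq_bigr => j _.
  by rewrite coef_poly ltn_ord inord_val it.
have [_ [u [x [h1 h2 h3]]]] := @poly_eigen C K T id lT li (fun _ h => h) (fun _ => erefl)
  (fun _ => P) (fun _ => Pl) (fun _ => P0) (fun _ => PT) (fun _ _ h => h) _ _ _ 0%N p0 sp Pm m0 hp0.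
by exists u, x.
Qed.

Lemma last_iterT (T : K -> K) m : m != 0 -> (exists j, iter j T m = 0) ->
  exists j, iter j T m != 0 /\ iter j.+1 T m = 0.
Proof.
move=> m0 [j]; elim: j => [/= e|j IH /= jm]; first by rewrite e eqxx in m0.
have [/IH //|j0] := eqVneq (iter j T m) 0.
by exists j.
Qed.

Variables (al be ga : 'M[C]_n -> C^o) (e0 h0 f0 : 'M[C]_n).
Hypothesis st : sl2_triple g al be ga e0 h0 f0.
Hypothesis lfK : locally_finite K.
Local Notation E := (act e0 : K -> K).
Local Notation H := (act h0 : K -> K).
Local Notation F := (act f0 : K -> K).

Let lE : linear E := act_linear (st_e st).
Let lH : linear H := act_linear (st_h st).
Let lF : linear F := act_linear (st_f st).

Lemma lin_iter (T : K -> K) j : linear T -> linear (iter j T).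
Proof. by move=> lT; elim: j => // j IH a u v; rewrite /= IH lT. Qed.

Lemma actZm a x m : x \in lie_space g -> act (a *: x) m = a *: act x m :> K.
Proof.
move=> gx; have := act_linearl a gx (mem0v (lie_space g)) m.
have -> : act 0 m = 0 :> K.
  have := act_linearl (-1) gx gx m; rewrite scaleN1r addNr => ->.
  by rewrite scaleN1r addNr.
by rewrite !addr0.
Qed.

Lemma tHE m : H (E m) = E (H m) + 2%:R *: E m.
Proof.
have h : act (lie_br h0 e0) m = 2%:R *: E m.
  by rewrite -(actZm _ _ (st_e st)); congr act; exact: (st_he st).
by rewrite -h (act_br (st_h st) (st_e st)) addrC subrK.
Qed.
Lemma tHF m : H (F m) = F (H m) - 2%:R *: F m.
Proof.
have h : act (lie_br h0 f0) m = - 2%:R *: F m.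
  by rewrite -(actZm _ _ (st_f st)) scaleNr; congr act; exact: (st_hf st).
by rewrite -scaleNr -h (act_br (st_h st) (st_f st)) addrC subrK.
Qed.
Lemma tEF m : E (F m) = F (E m) + H m.
Proof.
have := act_br (st_e st) (st_f st) m; rewrite (st_ef st) => ->.
by rewrite addrC subrK.
Qed.

Lemma tHEj mu m j : H m = mu *: m -> H (iter j E m) = (mu + j%:R *+ 2) *: iter j E m.
Proof.
move=> hm; elim: j => [|j IH]; first by rewrite mul0rn addr0.
by rewrite iterS tHE IH (linZ lE) -scalerDl -natr1; congr (_ *: _); ring.
Qed.
Lemma tHFj mu m j : H m = mu *: m -> H (iter j F m) = (mu - j%:R *+ 2) *: iter j F m.
Proof.
move=> hm; elim: j => [|j IH]; first by rewrite mul0rn subr0.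
by rewrite iterS tHF IH (linZ lF) -scalerBl -natr1; congr (_ *: _); ring.
Qed.
Lemma tEFj mu m j : E m = 0 -> H m = mu *: m ->
  E (iter j.+1 F m) = (j.+1%:R * (mu - j%:R)) *: iter j F m.
Proof.
move=> em hm; elim: j => [|j IH].
  by rewrite /= tEF em (lin0 lF) add0r hm subr0 mul1r.
rewrite [iter j.+2 _ _]iterS tEF IH (linZ lF) -iterS (tHFj _ hm) -scalerDl.
by rewrite -!natr1; congr (_ *: _); ring.
Qed.

Definition hwn (k : nat) (m : K) : Prop := E m = 0 /\ H m = k%:R *: m.

Lemma hw_lower mu v : v != 0 -> E v = 0 -> H v = mu *: v ->
  exists k : nat, mu = k%:R /\ iter k.+1 F v = 0.
Proof.
move=> v0 ev hv; have [P [[P0 Pl Pa] fP Pv]] := lfK v.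
have Pw j : P (iter j F v) by elim: j => //= j; apply: Pa; exact: st_f st.
have mi : injective (fun j : nat => mu - j%:R *+ 2 : C).
  move=> a b /addrI /oppr_inj /eqP; rewrite -!mulrnA eqr_nat => /eqP; lia.
have [j [j0 j1]] := last_iterT v0 (eig_vanish fP Pw lH mi (fun j => tHFj j hv)).
exists j; split=> //; have := tEFj j ev hv; rewrite j1 (lin0 lE) => /esym/eqP.
by rewrite scaler_eq0 (negPf j0) orbF mulf_eq0 pnatr_eq0 /= subr_eq0 => /eqP.
Qed.

Lemma hwn_nilp k v : hwn k v -> iter k.+1 F v = 0.
Proof.
move=> [ev hv]; have [->|v0] := eqVneq v 0; first exact: lin0 (lin_iter _ lF).
have [l [/eqP kl h]] := hw_lower v0 ev hv.
by move: kl; rewrite eqr_nat => /eqP ->.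
Qed.

(** In a finite dimensional submodule h has an eigenvector over the algebraically closed field, and
    raising it by e must stop. *)
Lemma hwn_exists : (exists m : K, m != 0) -> exists k v, hwn k v /\ v != 0.
Proof.
move=> [m m0]; have [P [[P0 Pl Pa] fP Pm]] := lfK m.
have Px x u : x \in lie_space g -> P u -> P (act x u) by move=> gx; exact: Pa.
have [u [mu [Pu u0 hu]]] := eig_exists fP Pl P0 lH (fun u => Px _ u (st_h st)) Pm m0.
have Pw j : P (iter j E u) by elim: j => //= j; apply: Px; exact: st_e st.
have mi : injective (fun j : nat => mu + j%:R *+ 2 : C).
  move=> a b /addrI /eqP; rewrite -!mulrnA eqr_nat => /eqP; lia.
have [j [j0 j1]] := last_iterT u0 (eig_vanish fP Pw lH mi (fun j => tHEj j hu)).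
have [k [e _]] := hw_lower j0 j1 (tHEj j hu).
by exists k, (iter j E u); split => //; split => //; rewrite -e; exact: tHEj.
Qed.

Section Bound.
Local Notation nu k := (fun _ : int => k%:Z).
Definition vmod (k : nat) : lieMod g := lat_mod st (nu k) (eq^~ 0).
Let io k : vmod k -> lat C := @lat_val _ _ _ _ _ _ _ _ _ st (nu k) (eq^~ 0).

(** The homomorphism from V_k to K that sends x^k to w, hence x^(k-b) y^b to (k-b)!/k! f^b w. *)
Definition vphi (k : nat) (w : K) (f : lat C) : K :=
  \sum_(b < k.+1) (f 0 b%:Z * ((k - b)`!%:R / k`!%:R)) *: iter b F w.

Lemma vphi_lin k w : linear (vphi k w).
Proof.
move=> a u v; rewrite /vphi scaler_sumr -big_split; apply: eq_bigr => b _ /=.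
by rewrite latE scalerA -scalerDl; congr (_ *: _); ring.
Qed.

Lemma vphi_e k w f : hwn k w -> lsupp (nu k) (eq^~ 0) f -> vphi k w (le f) = E (vphi k w f).
Proof.
move=> [ew hw] fs; rewrite /vphi (lin_sum lE).
rewrite big_ord_recr [RHS]big_ord_recl /= (linZ lE) ew scaler0 add0r.
have -> : le f 0 k%:Z = 0.
  have [h|h] := eqVneq (f 0 (k%:Z + 1)) 0; first by rewrite /le h mulr0.
  by have [_] := fs _ _ h; lia.
rewrite mul0r scale0r addr0; apply: eq_bigr => b _.
rewrite (linZ lE) /bump /= add1n (tEFj _ ew hw) scalerA; congr (_ *: _).
have kb : (k - b = (k - b.+1).+1)%N by have := ltn_ord b; lia.
rewrite /le (_ : b%:Z + 1 = b.+1%:Z); last by lia.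
rewrite kb factS natrM -[_.+1%:~R]/(b.+1%:R : C); set x := f 0 _.
have -> : (k%:R - b%:R : C) = ((k - b.+1).+1)%:R by rewrite -kb natrB // ltnW.
have k0 : (k`!%:R : C) != 0 by rewrite pnatr_eq0 -lt0n fact_gt0.
by rewrite -!natr1; field.
Qed.

Lemma vphi_h k w f : hwn k w -> vphi k w (lh (nu k) f) = H (vphi k w f).
Proof.
move=> [ew hw]; rewrite /vphi (lin_sum lH); apply: eq_bigr => b _.
rewrite (linZ lH) (tHFj _ hw) scalerA; congr (_ *: _).
by rewrite /lh rmorphB rmorphM /= ; ring.
Qed.

Lemma vphi_f k w f : hwn k w -> lsupp (nu k) (eq^~ 0) f -> vphi k w (lf (nu k) f) = F (vphi k w f).
Proof.
move=> hw fs; rewrite /vphi (lin_sum lF).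
rewrite big_ord_recl [RHS]big_ord_recr /= (linZ lF) -[F (iter k F w)]iterS (hwn_nilp hw) scaler0 addr0.
have -> : lf (nu k) f 0 0 = 0.
  have [h0'|h] := eqVneq (f 0 (0 - 1)) 0; first by rewrite /lf h0' mulr0.
  by have [_] := fs _ _ h; lia.
rewrite mul0r scale0r add0r; apply: eq_bigr => b _.
rewrite (linZ lF) /bump /= add1n; congr (_ *: _).
have kb : (k - b = (k - b.+1).+1)%N by have := ltn_ord b; lia.
rewrite /lf kb factS natrM (_ : b.+1%:Z - 1 = b%:Z); last by lia.
rewrite (_ : k%:Z - b.+1%:Z + 1 = (k - b.+1).+1%:Z); last by have := ltn_ord b; lia.
set x := f 0 _.
have k0 : (k`!%:R : C) != 0 by rewrite pnatr_eq0 -lt0n fact_gt0.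
by rewrite -[_%:~R]/(((k - b.+1).+1)%:R : C); field.
Qed.

(** Highest weight vectors of weight k correspond to homomorphisms from V_k through [vphi], so b + 1
    independent ones would contradict the bound on dimensions. *)
Lemma bounded_hw : bounded_mult K -> exists b, forall k (w : 'I_b.+1 -> K), (forall i, hwn k (w i)) ->
  exists c : 'I_b.+1 -> C, (exists i, c i != 0) /\ \sum_i c i *: w i = 0.
Proof.
move=> [b hb]; exists b => k w hw; apply: contrapT => nex.
have hl := lat_mod_lat st (nu k) (eq^~ 0).
have sV : simple_mod (vmod k) by apply: row_simple hl.
have dV : finite_dim (vmod k) by eexists; apply: row_dim hl.
suff : (b.+1 <= b)%N by rewrite ltnn.
apply: (hb _ sV dV b.+1 (fun i v => vphi k (w i) (io v))); last first.
  move=> c hc; have hd : lpred (nu k) (eq^~ 0) (lat_delta C 0 0) by apply: ldelta_lpred.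
  have [v hv] := lm_sur hl hd.
  have {}hc : \sum_i c i *: w i = 0.
    rewrite -[RHS](hc v); apply: eq_bigr => i _; congr (_ *: _).
    rewrite /vphi big_ord_recl big1 ?addr0 => [|j _].
      by rewrite /io hv /lat_delta !eqxx /= subn0 mul1r divff ?scale1r // pnatr_eq0 -lt0n fact_gt0.
    by rewrite /io hv /lat_delta /= mul0r scale0r.
  move=> i; apply/eqP; apply: contrapT => ci; apply: nex; exists c; split => //.
  by exists i; apply/negP.
move=> i; split.
  by move=> a u v; rewrite /io (lm_lin hl) vphi_lin.
move=> x gx v; have [_ us] := lm_pred hl v.
have -> : act x (vphi k (w i) (io v)) = al x *: E (vphi k (w i) (io v)) +
    (be x *: H (vphi k (w i) (io v)) + ga x *: F (vphi k (w i) (io v))).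
  rewrite {1}(st_dec st gx) act_linearl ?(st_e st) ?memvD ?memvZ ?(st_h st) ?(st_f st) //.
  by rewrite act_linearl ?(st_h st) ?memvZ ?(st_f st) // actZm ?(st_f st).
have -> : io (act x v) = al x *: le (io v) + (be x *: lh (nu k) (io v) + ga x *: lf (nu k) (io v)).
  by rewrite /io /lat_val sub_val_act.
by rewrite !vphi_lin (linZ (vphi_lin _ _)) vphi_e // vphi_h // vphi_f.
Qed.

End Bound.
End FinSpan.

(** * The four models on binary forms *)

Section Model.
Variables (C : numFieldType) (r : int).
Hypothesis r01 : (r == 0) || (r == 1).
Local Notation lat := (lat C).
Local Notation ldelta := (lat_delta C).

(* On binary forms, the operator w(x,y) - w(d/dy,-d/dx) / ((d+1)(d-2)) in
   degree d, for w = x^(3-s) y^s.  The four of them span a copy of V_3 and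
   satisfy the canonical commutation relations.  The coefficient of
   x^(d-b) y^b with d = 3k+r is f k b. *)
Definition qco (s : nat) (N B : C) : C :=
  match s with
  | 0 => - ((B + 3%:R) * (B + 2%:R) * (B + 1))
  | 1 => (B + 2%:R) * (B + 1) * (N - B + 1)
  | 2 => - ((B + 1) * (N - B + 2%:R) * (N - B + 1))
  | _ => (N - B + 3%:R) * (N - B + 2%:R) * (N - B + 1)
  end / ((N + 1) * (N + 4%:R)).

Definition deg (k : int) : int := 3 * k + r.

Definition qop (s : nat) (f : lat) : lat := fun k b =>
  f (k - 1) (b - s%:Z) + qco s (deg k)%:~R b%:~R * f (k + 1) (b + (3 - s%:Z)).

Lemma qop_lin s : linear (qop s).
Proof. by move=> a u v; apply: lat_ext => k b; rewrite /qop !latE; ring. Qed.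

Lemma qop_comp s t f k b : qop s (qop t f) k b =
  f (k - 2) (b - (s%:Z + t%:Z))
  + (qco t ((deg k)%:~R - 3%:R) (b%:~R - s%:R) + qco s (deg k)%:~R b%:~R) * f k (b + 3 - (s%:Z + t%:Z))
  + qco s (deg k)%:~R b%:~R * qco t ((deg k)%:~R + 3%:R) (b%:~R + 3%:R - s%:R)
     * f (k + 2) (b + 6 - (s%:Z + t%:Z)).
Proof.
rewrite /qop.
rewrite (_ : k - 1 - 1 = k - 2); last by lia.
rewrite (_ : b - s%:Z - t%:Z = b - (s%:Z + t%:Z)); last by lia.
rewrite subrK addrK (_ : k + 1 + 1 = k + 2); last by lia.
rewrite (_ : b - s%:Z + (3 - t%:Z) = b + 3 - (s%:Z + t%:Z)); last by lia.
rewrite (_ : b + (3 - s%:Z) - t%:Z = b + 3 - (s%:Z + t%:Z)); last by lia.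
rewrite (_ : b + (3 - s%:Z) + (3 - t%:Z) = b + 6 - (s%:Z + t%:Z)); last by lia.
rewrite (_ : deg (k - 1) = deg k - 3); last by rewrite /deg; lia.
rewrite (_ : deg (k + 1) = deg k + 3); last by rewrite /deg; lia.
rewrite (_ : b + (3 - s%:Z) = b + 3 - s%:Z); last by lia.
rewrite !rmorphB !rmorphD /=; ring.
Qed.

(** All denominators have the form d + m with m congruent to 1 modulo 3; they do not vanish because
    the degrees d are congruent to r = 0 or 1. For r = 2 the construction breaks down. *)
Lemma deg_neq k (m : int) : (exists q, m = 3 * q + 1) -> (deg k)%:~R + m%:~R != 0 :> C.
Proof.
move=> [q ->]; rewrite -rmorphD intr_eq0 /deg; apply/eqP; lia.
Qed.

(** The invariant symplectic form on V_3, in the basis x^(3-s) y^s and up to scale. *)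
Definition qom (s t : nat) : C :=
  match s, t with 0, 3 => -3%:R | 3, 0 => 3%:R | 1, 2 => 1 | 2, 1 => -1 | _, _ => 0 end.

Lemma qco_comm1 (N B : C) s t : N + 1 != 0 -> N + 4%:R != 0 -> N - 2%:R != 0 -> (s < t < 4)%N ->
  qco t (N - 3%:R) (B - s%:R) + qco s N B = qco s (N - 3%:R) (B - t%:R) + qco t N B + qom s t.
Proof.
move=> d1 d4 dm.
have e1 : N - 3%:R + 1 = N - 2%:R by ring.
have e2 : N - 3%:R + 4%:R = N + 1 by ring.
case: s => [|[|[|[|s]]]]; case: t => [|[|[|[|t]]]]; rewrite ?ltnn ?andbF //= => _;
  rewrite /qco /qom e1 e2; field; by rewrite d1 d4 dm.
Qed.

Lemma qco_comm2 (N B : C) s t : N + 1 != 0 -> N + 4%:R != 0 -> N + 7%:R != 0 -> (s < t < 4)%N ->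
  qco s N B * qco t (N + 3%:R) (B + 3%:R - s%:R) = qco t N B * qco s (N + 3%:R) (B + 3%:R - t%:R).
Proof.
move=> d1 d4 d7.
have e3 : N + 3%:R + 1 = N + 4%:R by ring.
have e4 : N + 3%:R + 4%:R = N + 7%:R by ring.
case: s => [|[|[|[|s]]]]; case: t => [|[|[|[|t]]]]; rewrite ?ltnn ?andbF //= => _;
  rewrite /qco e3 e4; field; by rewrite d1 d4 d7.
Qed.

Lemma qom_anti s t : qom s t = - qom t s.
Proof. by case: s => [|[|[|[|s]]]]; case: t => [|[|[|[|t]]]]; rewrite /qom ?oppr0 ?opprK. Qed.

(** A product of two operators has components that raise the degree by 6, keep it, or lower it by 6.
    The outer ones are symmetric in s and t; the middle ones differ by the constant [qom]. *)
Lemma qop_comm s t f : (s < 4)%N -> (t < 4)%N -> qop s (qop t f) = qop t (qop s f) + qom s t *: f.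
Proof.
wlog st : s t / (s < t)%N => [hw s4 t4|].
  have [st|ts|->] := ltngtP s t; first exact: hw.
    by rewrite (hw t s ts t4 s4) (qom_anti s t) scaleNr addrK.
  by rewrite (_ : qom t t = 0) ?scale0r ?addr0 //; case: (t) => [|[|[|[|]]]].
move=> s4 t4; apply: lat_ext => k b; rewrite latDE latZE !qop_comp (addrC t%:Z s%:Z).
have d1 : (deg k)%:~R + 1 != 0 :> C by have := @deg_neq k 1; apply; exists 0.
have d4 : (deg k)%:~R + 4%:R != 0 :> C by have := @deg_neq k 4; apply; exists 1.
have d7 : (deg k)%:~R + 7%:R != 0 :> C by have := @deg_neq k 7; apply; exists 2.
have dm : (deg k)%:~R - 2%:R != 0 :> C.
  by have := @deg_neq k (-2); rewrite rmorphN; apply; exists (-1).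
have st4 : (s < t < 4)%N by rewrite st t4.
rewrite (qco_comm1 _ d1 d4 dm st4) (qco_comm2 _ d1 d4 d7 st4).
have -> : qom s t * f k b = qom s t * f k (b + 3 - (s%:Z + t%:Z)).
  case: (s) st s4 => [|[|[|[|s']]]] //; case: (t) t4 => [|[|[|[|t']]]] // _ _ _; rewrite /qom ?mul0r //.
    by congr (_ * f k _); lia.
  by congr (_ * f k _); lia.
by ring.
Qed.

(** Reordering, and the factor -1/3, bring the form [qom] to the matrix J. *)
Definition mz (k : 'I_4) (f : lat) : lat :=
  match val k with
  | 0 => qop 0 f | 1 => qop 1 f | 2 => - 3%:R^-1 *: qop 3 f | _ => qop 2 f
  end.

Lemma mz_weyl : weyl_ops mz.
Proof.
split=> [k a u v|k l f].
  case: k => -[|[|[|[|//]]]] i; rewrite /mz /= ?qop_lin // scalerDr !scalerA mulrC //.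
have qZ s a u : qop s (a *: u) = a *: qop s u by rewrite (linZ (qop_lin s)).
have n3 : (3%:R : C) != 0 by rewrite pnatr_eq0.
have e3 : - 3%:R^-1 * -3%:R = 1 :> C by field.
have e3' : - 3%:R^-1 * 3%:R = -1 :> C by field.
rewrite JE; case: k => -[|[|[|[|//]]]] i; case: l => -[|[|[|[|//]]]] j; rewrite /mz /= ?qZ
  ?scale0r ?addr0 // qop_comm // ?(qZ, scalerDr, scalerA) /qom ?scale0r ?mulr0 ?scale0r ?addr0 // ?e3 ?e3' //.
Qed.

Definition model_full : lieMod (@sp4 C) := weylMod mz_weyl.

Definition midx (e : int) (k : int) : Prop := 0 <= k /\ exists q : int, k = 2 * q + e.

Lemma midx_index e : lat_index deg (midx e).
Proof. by split=> [k [? _]|k [? _]|k l _ _]; rewrite /deg; lia. Qed.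

Definition qnum (s : nat) (n b : int) : int :=
  match s with
  | 0 => - ((b + 3) * (b + 2) * (b + 1))
  | 1 => (b + 2) * (b + 1) * (n - b + 1)
  | 2 => - ((b + 1) * (n - b + 2) * (n - b + 1))
  | _ => (n - b + 3) * (n - b + 2) * (n - b + 1)
  end.

Lemma qcoE s n b : qco s n%:~R b%:~R = (qnum s n b)%:~R / (((n + 1) * (n + 4))%:~R).
Proof.
rewrite /qco /qnum; congr (_ / _); last by rewrite rmorphM !rmorphD.
case: s => [|[|[|s]]]; rewrite ?rmorphN !rmorphM !rmorphD ?rmorphN //=.
Qed.

Lemma qco_neq0 s n b : qco s n%:~R b%:~R != 0 -> qnum s n b != 0.
Proof. by rewrite qcoE mulf_eq0 negb_or intr_eq0 => /andP[]. Qed.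

(** The numerator of [qco] vanishes wherever the differential operator would produce a monomial
    outside the row. *)
Lemma qop_lpred e s f : (s < 4)%N -> lpred deg (midx e) f -> lpred deg (midx (e + 1)) (qop s f).
Proof.
move=> s4 [[N fN] fs].
have key k b : qop s f k b != 0 -> f (k - 1) (b - s%:Z) != 0 \/
    qnum s (deg k) b != 0 /\ f (k + 1) (b + (3 - s%:Z)) != 0.
  rewrite /qop; have [->|h] := eqVneq (f (k - 1) (b - s%:Z)) 0; last by left.
  by rewrite add0r mulf_eq0 negb_or => /andP[/qco_neq0 h1 h2]; right.
have key2 k b : qop s f k b != 0 -> 0 <= b <= deg k /\ exists q, k = 2 * q + (e + 1).
  move=> /key [h|[h1 h2]].
    by have [[_ [q hq]]] := fs _ _ h; split; [rewrite /deg in b0 *; lia | exists q; lia].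
  have [[_ [q hq]] hb] := fs _ _ h2; split; last by exists (q - 1); lia.
  case: s s4 h1 hb {h2 key} => [|[|[|[|//]]]] _; rewrite /qnum ?oppr_eq0 !mulf_eq0 !negb_or /deg; lia.
split.
  exists (N + 3)%N => k b h; have [hb [q hq]] := key2 _ _ h.
  have [/fN h1|[_ /fN h1]] := key _ _ h; rewrite /deg in hb; lia.
by move=> k b /key2 [hb hq]; split => //; split => //; rewrite /deg in hb; lia.
Qed.

Lemma midx2 e k : midx (e + 1 + 1) k -> midx e k.
Proof. by move=> [h [q hq]]; split => //; exists (q + 1); lia. Qed.

Lemma mz_lpred e k l f : lpred deg (midx e) f -> lpred deg (midx e) (mz k (mz l f)).
Proof.
have mzq j e' u : lpred deg (midx e') u -> lpred deg (midx (e' + 1)) (mz j u).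
  move=> h; case: j => -[|[|[|[|//]]]] i; rewrite /mz /=; try exact: qop_lpred.
  by rewrite -[_ *: _]addr0; apply: lpred_lin; [exact: qop_lpred | exact: lpred0].
move=> h; have [hb hs] := mzq k _ _ (mzq l _ _ h); split => // i j /hs [h1 h2].
by split => //; exact: midx2.
Qed.

Lemma model_submodule e : submodule (fun f : model_full => lpred deg (midx e) (f : lat)).
Proof.
split; [exact: lpred0 | by move=> a u v; exact: lpred_lin |].
move=> A _ m hm; apply: weyl_act_closed; [exact: lpred0 | exact: lpred_lin |].
by move=> k l; exact: mz_lpred.
Qed.

Definition model e : lieMod (@sp4 C) := sub_lieMod (model_submodule e).
Definition mval e : model e -> lat := @sub_val _ _ _ _ _ (model_submodule e).

Definition mE : 'M[C]_4 := spB C 7 + spB C 6.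
Definition mH : 'M[C]_4 := 3%:R *: spB C 4 + spB C 5.
Definition mF : 'M[C]_4 := 3%:R *: spB C 2 - spB C 3.

Lemma deg_nz k : [/\ (deg k)%:~R + 1 != 0 :> C, (deg k)%:~R + 4%:R != 0 :> C,
  (deg k)%:~R + 7%:R != 0 :> C & (deg k)%:~R - 2%:R != 0 :> C].
Proof.
split; [have := @deg_neq k 1; apply; exists 0 | have := @deg_neq k 4; apply; exists 1
 | have := @deg_neq k 7; apply; exists 2 | have := @deg_neq k (-2); rewrite rmorphN; apply; exists (-1)] => //.
Qed.

Lemma qop_comp' s t (u : int) f k b : s%:Z + t%:Z = u -> qop s (qop t f) k b = f (k - 2) (b - u)
  + (qco t ((deg k)%:~R - 3%:R) (b%:~R - s%:R) + qco s (deg k)%:~R b%:~R) * f k (b + (3 - u))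
  + qco s (deg k)%:~R b%:~R * qco t ((deg k)%:~R + 3%:R) (b%:~R + 3%:R - s%:R)
     * f (k + 2) (b + (6 - u)).
Proof. by move=> h; rewrite qop_comp !h !addrA. Qed.

(** The quadratic expressions giving the standard e, f, h of sp(4) reproduce the natural action of
    sl(2) on binary forms, so the restriction of the model is the sum of its rows. *)
Lemma qop_e f : qop 1 (qop 1 f) - qop 0 (qop 2 f) = le f.
Proof.
apply: lat_ext => k b; rewrite -[LHS]/(_ k b - _ k b) !(qop_comp' (u := 2)) // /le.
have eb : (b + 1)%:~R = b%:~R + 1 :> C by rewrite rmorphD.
rewrite (_ : 3 - 2 = 1 :> int) // eb /qco.
have [] := deg_nz k.
move: (f _ _) (f _ _) (f _ _) ((deg k)%:~R : C) (b%:~R : C) => x y z N B d1 d4 d7 dm.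
have e1 : N - 3%:R + 1 = N - 2%:R by ring.
have e2 : N - 3%:R + 4%:R = N + 1 by ring.
have e3 : N + 3%:R + 1 = N + 4%:R by ring.
have e4 : N + 3%:R + 4%:R = N + 7%:R by ring.
rewrite e1 e2 e3 e4; field; by rewrite d1 d4 d7 dm.
Qed.

Lemma qop_f f : qop 1 (qop 3 f) - qop 2 (qop 2 f) = lf deg f.
Proof.
apply: lat_ext => k b; rewrite -[LHS]/(_ k b - _ k b) !(qop_comp' (u := 4)) // /lf.
have eb (d : int) : (d - b + 1)%:~R = d%:~R - b%:~R + 1 :> C by rewrite rmorphD rmorphB.
rewrite (_ : 3 - 4 = -1 :> int) // eb /qco.
have [] := deg_nz k.
move: (f _ _) (f _ _) (f _ _) ((deg k)%:~R : C) (b%:~R : C) => x y z N B d1 d4 d7 dm.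
have e1 : N - 3%:R + 1 = N - 2%:R by ring.
have e2 : N - 3%:R + 4%:R = N + 1 by ring.
have e3 : N + 3%:R + 1 = N + 4%:R by ring.
have e4 : N + 3%:R + 4%:R = N + 7%:R by ring.
rewrite e1 e2 e3 e4; field; by rewrite d1 d4 d7 dm.
Qed.

Lemma qop_h f : 2%:R *: f + (qop 0 (qop 3 f) - qop 1 (qop 2 f)) = lh deg f.
Proof.
apply: lat_ext => k b; rewrite latDE latZE -[X in _ + X]/(_ k b - _ k b) !(qop_comp' (u := 3)) // /lh.
have eb (d : int) : (d - 2 * b)%:~R = d%:~R - 2%:R * b%:~R :> C by rewrite rmorphB rmorphM.
rewrite (_ : 3 - 3 = 0 :> int) // addr0 eb /qco.
have [] := deg_nz k.
move: (f _ _) (f _ _) (f _ _) ((deg k)%:~R : C) (b%:~R : C) => x y z N B d1 d4 d7 dm.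
have e1 : N - 3%:R + 1 = N - 2%:R by ring.
have e2 : N - 3%:R + 4%:R = N + 1 by ring.
have e3 : N + 3%:R + 1 = N + 4%:R by ring.
have e4 : N + 3%:R + 4%:R = N + 7%:R by ring.
rewrite e1 e2 e3 e4; field; by rewrite d1 d4 d7 dm.
Qed.

Section Values.
Variable e : int.
Local Notation mval := (@mval e).

Lemma mval_lin : linear mval. Proof. exact: sub_val_linear. Qed.
Lemma mval_inj : injective mval. Proof. exact: sub_val_inj. Qed.
Lemma mval_pred m : lpred deg (midx e) (mval m). Proof. exact: sub_valP. Qed.
Lemma mval_sur f : lpred deg (midx e) f -> exists m, mval m = f.
Proof. by move=> hf; exists (sub_in (model_submodule e) hf); exact: erefl. Qed.
Lemma mval_act x m : x \in @sp4 C -> mval (act x m) = weyl_act mz x (mval m).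
Proof. by move=> hx; rewrite /mval sub_val_act. Qed.

Lemma wactD A B f : weyl_act mz (A + B) f = weyl_act mz A f + weyl_act mz B f.
Proof. by rewrite -[A]scale1r (@weyl_act_linearl C lat mz 1 A B f) !scale1r. Qed.
Lemma wactZ a A f : weyl_act mz (a *: A) f = a *: weyl_act mz A f.
Proof.
have h0 : weyl_act mz 0 f = 0.
  have := @weyl_act_linearl C lat mz (-1) A A f; rewrite scaleN1r addNr => ->.
  by rewrite scaleN1r addNr.
by rewrite -[a *: A]addr0 (@weyl_act_linearl C lat mz a A 0 f) h0 addr0.
Qed.

Lemma mval_e m : mval (act mE m) = le (mval m).
Proof.
rewrite mval_act ?memvD ?spB_sp4 // wactD !(weyl_letter mz_weyl) /mz /=.
by rewrite -qop_e addrC.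
Qed.

Lemma mval_h m : mval (act mH m) = lh deg (mval m).
Proof.
rewrite mval_act ?memvD ?memvZ ?spB_sp4 // wactD wactZ !(weyl_letter mz_weyl) /mz /=.
rewrite -qop_h !(linZ (qop_lin _)).
have n3 : (3%:R : C) != 0 by rewrite pnatr_eq0.
have n2 : (2%:R : C) != 0 by rewrite pnatr_eq0.
move: (mval m) => z; move: (qop 0 _) (qop 1 _) => x y.
by lmod_with (lat : lmodType C) ltac:(field).
Qed.

Lemma mval_f m : mval (act mF m) = lf deg (mval m).
Proof.
rewrite mval_act ?memvB ?memvZ ?spB_sp4 // wactD -scaleN1r !wactZ !(weyl_letter mz_weyl) /mz /=.
rewrite -qop_f !(linZ (qop_lin _)).
have n3 : (3%:R : C) != 0 by rewrite pnatr_eq0.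
move: (mval m) => z; move: (qop 1 _) (qop 2 _) => x y.
by lmod_with (lat : lmodType C) ltac:(field).
Qed.

Lemma mval_zz (P : model e -> Prop) i k l f : submodule P ->
  (forall u : lat, weyl_act mz (spB C i) u = mz k (mz l u)) ->
  (exists m, mval m = f /\ P m) -> exists m, mval m = mz k (mz l f) /\ P m.
Proof.
move=> [_ _ Pa] H [m [<- Pm]]; exists (act (spB C i) m); split; last by apply: Pa => //; exact: spB_sp4.
by rewrite mval_act ?spB_sp4 // H.
Qed.

Hypothesis e0 : (e == 0) || (e == 1).

(** A submodule is stable under sl(2), hence a sum of full rows. The operators X = z0^2 and Y = z2^2
    lead from row k to row k + 2 and back with nonzero coefficients, so a nonzero submodule contains
    all rows. *)
Lemma model_simple : simple_mod (model e).
Proof.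
have hI := midx_index e.
have dd (i j : int) : ldelta i j i j != 0 by rewrite /lat_delta !eqxx oner_eq0.
have I0 : midx e e by split; [have := e0; lia | exists 0; lia].
have de : 0 <= deg e by have := li_nu0 hI I0.
split.
  have hde : (0 : int) <= 0 <= deg e by lia.
  have [m hm] := mval_sur (ldelta_lpred C I0 I0.1 hde).
  exists m; apply/eqP => m0; move: hm; rewrite m0 (lin0 mval_lin) => /(congr1 (fun f : lat => f e 0)).
  by rewrite lat0E /lat_delta !eqxx => /esym/eqP; rewrite oner_eq0.
move=> P sP; have [H|] := pselect (forall m, P m -> m = 0); first by left.
move=> /existsNP [m /not_implyP [Pm m0]]; right => m'.
pose Q f := exists m, mval m = f /\ P m; have [P0 Pl Pa] := sP.
have QP f : Q f -> lpred deg (midx e) f by move=> [u [<- _]]; exact: mval_pred.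
have Ql a u v : Q u -> Q v -> Q (a *: u + v).
  by move=> [x [<- Px]] [y [<- Py]]; exists (a *: x + y); split; [exact: mval_lin | exact: Pl].
have Qe u : Q u -> Q (le u).
  by move=> [x [<- Px]]; exists (act mE x); split; [exact: mval_e | apply: Pa; rewrite ?memvD ?spB_sp4].
have Qh u : Q u -> Q (lh deg u).
  by move=> [x [<- Px]]; exists (act mH x); split; [exact: mval_h | apply: Pa; rewrite ?memvD ?memvZ ?spB_sp4].
have Qf u : Q u -> Q (lf deg u).
  by move=> [x [<- Px]]; exists (act mF x); split; [exact: mval_f | apply: Pa; rewrite ?memvB ?memvZ ?spB_sp4].
have Qd f k b : Q f -> f k b != 0 -> Q (ldelta k b).
  exact: (stable_delta (li_nu0 hI) (li_inj hI) QP Ql Qe Qh Qf).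
have Qr k b b' : Q (ldelta k b) -> 0 <= b' <= deg k -> Q (ldelta k b').
  exact: (stable_delta_row QP Ql Qe Qf).
have Qup k : Q (ldelta k 0) -> Q (ldelta (k + 2) 0).
  move=> h; have hX := @mval_zz P 9 i40 i40 _ sP (weyl_letter mz_weyl 9) h.
  apply: (Qd _ _ _ hX); rewrite /mz /= (qop_comp' (u := 0)) // addrK subr0 /lat_delta !eqxx.
  rewrite (_ : (k + 2 == k) = false); last by lia.
  rewrite (_ : (k + 2 + 2 == k) = false); last by lia.
  by rewrite /= !mulr0 !addr0 oner_eq0.
have Qdn k : 0 <= k -> Q (ldelta (k + 2) 0) -> Q (ldelta k 0).
  move=> k0 h; have hY := @mval_zz P 0 i42 i42 _ sP (weyl_letter mz_weyl 0) h.
  apply: (Qd _ _ _ hY); rewrite /mz /= (linZ (qop_lin 3)) scalerA latZE (qop_comp' (u := 6)) //.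
  rewrite /lat_delta !eqxx (_ : (k - 2 == k + 2) = false) /=; last by lia.
  rewrite (_ : (k == k + 2) = false) /=; last by lia.
  rewrite mulr0 !add0r mulr1 subrr.
  have hn : (deg k)%:~R + 3%:R = (deg k + 3)%:~R :> C by rewrite (intrD _ (deg k) 3).
  have nz d : 0 <= d -> qco 3 d%:~R 0%:~R != 0 :> C.
    move=> d0; rewrite qcoE mulf_neq0 ?invr_eq0 ?intr_eq0 /qnum ?mulf_neq0 //; lia.
  have dk : 0 <= deg k by have := e0; rewrite /deg; lia.
  have c3 : - 3%:R^-1 != 0 :> C by rewrite oppr_eq0 invr_eq0 pnatr_eq0.
  rewrite hn; apply: mulf_neq0; first exact: mulf_neq0.
  apply: mulf_neq0; [exact: nz | apply: (nz (deg k + 3)); lia].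
have m0' : exists k b, mval m k b != 0.
  apply: contrapT => H; apply: m0; apply: mval_inj; rewrite (lin0 mval_lin); apply: lat_ext => k b.
  by apply/eqP; apply: contrapT => h; apply: H; exists k, b; apply/negP.
have [k [b fkb]] := m0'; have [_ fs] := mval_pred m; have [Ik hb] := fs _ _ fkb.
have Qk : Q (ldelta k 0).
  by apply: (@Qr k b); [apply: Qd fkb; exists m | have := li_nu0 hI Ik; lia].
have Qj (j : nat) : Q (ldelta (e + 2 * j%:Z) 0) -> Q (ldelta e 0).
  elim: j => [|j IH]; first by rewrite mulr0 addr0.
  by rewrite (_ : e + 2 * j.+1%:Z = e + 2 * j%:Z + 2); [move=> /Qdn h; apply/IH/h; case/orP: e0 => /eqP ->; lia | lia].
have idx k' : midx e k' -> exists j : nat, k' = e + 2 * j%:Z.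
  by move=> [h1 [q hq]]; exists `|q|%N; case/orP: e0 hq => /eqP -> hq; lia.
have [j kj] := idx _ Ik; have Q0 : Q (ldelta e 0) by apply: (Qj j); rewrite -kj.
have Qall (i : nat) : Q (ldelta (e + 2 * i%:Z) 0).
  elim: i => [|i IH]; first by rewrite mulr0 addr0.
  by rewrite (_ : e + 2 * i.+1%:Z = e + 2 * i%:Z + 2); [apply: Qup | lia].
have [m1 [m1E Pm1]] : Q (mval m').
  have [fb' fs'] := mval_pred m'; apply: lat_ind fb' _ => //.
    by exists 0; split => //; exact: lin0 mval_lin.
  move=> i b' /fs' [Ii hb']; apply: Qr hb'; have [j' ->] := idx _ Ii; exact: Qall.
by rewrite -(mval_inj m1E).
Qed.

End Values.
End Model.

(** * Regular nilpotent elements of sp(4) *)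

Section Regular.
Variable C : numFieldType.
Local Notation J := (symplJ C).

Lemma centralizerP (g : lieAlg C 4) (x y : 'M[C]_4) :
  reflect (y \in lie_space g /\ lie_br x y = 0) (y \in centralizer g x).
Proof.
rewrite /centralizer memv_cap memv_ker lfunE /=.
by apply: (iffP andP) => -[h1 h2]; split => //; apply/eqP.
Qed.

Lemma ent_mH r s : (r < 4)%N -> (s < 4)%N -> ent (mH C) r s =
  (if r == s then nth 0 [:: 3; 1; -3; -1] r else 0 : int)%:~R.
Proof.
move=> r4 s4; rewrite /mH entD entZ !ent_spB // -[3%:R]/(3%:~R) -rmorphM -rmorphD /=.
by case: r r4 => [|[|[|[|//]]]] _; case: s s4 => [|[|[|[|//]]]] _.
Qed.

(** The eigenvalues 3, 1, -3, -1 are distinct, so the centralizer is diagonal; it bounds the rank of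
    sp(4) by 2. *)
Lemma centralizer_mH : (\dim (centralizer (@sp4 C) (mH C)) <= 2)%N.
Proof.
have sub : (centralizer (@sp4 C) (mH C) <= <<[:: spB C 4; spB C 5]>>)%VS.
  apply/subvP => y /centralizerP [sy cy].
  have off r s : (r < 4)%N -> (s < 4)%N -> r != s -> ent y r s = 0.
    move=> r4 s4 rs; have := congr1 (fun m => ent m r s) cy.
    rewrite /lie_br ent0 entD entN !entM !ent_mH //.
    case: r r4 rs => [|[|[|[|//]]]] _; case: s s4 => [|[|[|[|//]]]] _ //= _ /eqP;
      rewrite ?mul0r ?mulr0 ?add0r ?addr0 mulrC -mulrBr -rmorphB mulf_eq0 intr_eq0 orbF /= => /eqP //.
  have [d2 d3 _ _ _] := sp4_ents sy.
  have -> : y = ent y 0 0 *: spB C 4 + ent y 1 1 *: spB C 5.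
    apply: ent_inj => r s r4 s4; rewrite entD !entZ !ent_spB //.
    case: r r4 => [|[|[|[|//]]]] _; case: s s4 => [|[|[|[|//]]]] _;
      first [by rewrite ?d2 ?d3 /=; ring | by rewrite [LHS]off //=; ring].
  by apply: memvD; apply: memvZ; apply: memv_span; rewrite !inE eqxx ?orbT.
exact: leq_trans (dimvS sub) (dim_span _).
Qed.

(** If the rank were at most 2, there would be two independent rows R with R x = 0, and the matrices
    J R^T M R with M symmetric would form a three-dimensional subspace of the centralizer. *)
Lemma regular_rank (x : 'M[C]_4) : x \in @sp4 C -> regular (@sp4 C) x -> (2 < \rank x)%N.
Proof.
move=> sx /(_ (mH C)) rx; have {}rx : (\dim (centralizer (@sp4 C) x) <= 2)%N.
  by apply: leq_trans centralizer_mH; apply: rx; rewrite ?memvD ?memvZ ?spB_sp4.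
rewrite ltnNge; apply/negP => rk.
pose K := kermx x; have rK : (2 <= \rank K)%N by rewrite /K mxrank_ker; lia.
have /row_freeP [B RB] := row_base_free K.
pose R := (pid_mx 2 : 'M_(2, \rank K)) *m row_base K.
pose D := B *m (pid_mx 2 : 'M_(\rank K, 2)).
have RD : R *m D = 1%:M.
  by rewrite /R /D mulmxA -(mulmxA _ _ B) RB mulmx1 pid_mx_id // pid_mx_1.
have Rx : R *m x = 0.
  rewrite /R -mulmxA (_ : row_base K *m x = 0) ?mulmx0 //.
  by apply/sub_kermxP; rewrite eq_row_base.
move: R D RD Rx => R D RD Rx.
have DR : D^T *m R^T = 1%:M by rewrite -trmx_mul RD trmx1.
pose A (M : 'M[C]_2) := J *m (R^T *m M *m R).
have Jx : x *m J = - (J *m x^T) by rewrite sp4_symJ // opprK.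
have AC M : M^T = M -> A M \in centralizer (@sp4 C) x.
  move=> Ms; apply/centralizerP; split.
    have hS : (R^T *m M *m R)^T = R^T *m M *m R by rewrite !trmx_mul trmxK Ms mulmxA.
    rewrite mem_sp4 /A; move: (R^T *m M *m R) hS => S hS.
    by rewrite trmx_mul hS JT mulmxN mulNmx -mulmxA JJ mulmxA JJ mulmxN mulmx1 mulNmx mul1mx opprK subrr.
  rewrite /lie_br /A !mulmxA Jx.
  rewrite -(mulmxA _ R x) Rx mulmx0 subr0 mulNmx -(mulmxA J) -trmx_mul Rx.
  by rewrite trmx0 mulmx0 oppr0 !mul0mx.
have Ainj M : A M = 0 -> M = 0.
  move=> h; have : R^T *m M *m R = 0.
    have : J *m A M = - (R^T *m M *m R) by rewrite /A mulmxA JJ mulNmx mul1mx.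
    by rewrite h mulmx0 => /esym/eqP; rewrite oppr_eq0 => /eqP.
  move=> /(congr1 (fun Z => D^T *m Z *m D)).
  by rewrite mulmx0 mul0mx !mulmxA DR mul1mx -mulmxA RD mulmx1.
have Alin : linear A.
  by move=> a M M'; rewrite /A mulmxDr mulmxDl mulmxDr -scalemxAr -scalemxAl -scalemxAr.
pose d (i j : 'I_2) : 'M[C]_2 := delta_mx i j.
pose X := [tuple A (d 0 0); A (d 0 1 + d 1 0); A (d 1 1)].
have fX : free X.
  apply/freeP => k; rewrite !big_ord_recl big_ord0 addr0 /= => h.
  have : A (k ord0 *: d 0 0 + (k (lift ord0 ord0) *: (d 0 1 + d 1 0) + k (lift ord0 (lift ord0 ord0)) *: d 1 1)) = 0.
    by rewrite -[RHS]h Alin (linD Alin) !(linZ Alin).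
  move=> /Ainj /matrixP hm.
  have h00 := hm 0 0; have h01 := hm 0 1; have h11 := hm 1 1.
  move: h00 h01 h11; rewrite !mxE /= !(mulr0, mulr1, addr0, add0r) => h0 h1 h2.
  case=> -[|[|[|//]]] i; [rewrite -[RHS]h0|rewrite -[RHS]h1|rewrite -[RHS]h2]; congr k; exact: val_inj.
have : (\dim <<X>> <= \dim (centralizer (@sp4 C) x))%N.
  apply: dimvS; apply/span_subvP => y; rewrite !inE => /or3P[] /eqP ->; apply: AC.
  - by apply/matrixP => i j; rewrite !mxE andbC.
  - by apply/matrixP => i j; rewrite !mxE addrC andbC; congr (_ + _); rewrite andbC.
  - by apply/matrixP => i j; rewrite !mxE andbC.
move: fX; rewrite /free => /eqP ->; rewrite size_tuple => h.
by have := leq_trans h rx.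
Qed.

(** The kernel of x has dimension at most 1, so each further factor x lowers the rank by at most
    1. *)
Lemma regular_cube (x : 'M[C]_4) : (2 < \rank x)%N -> x *m x *m x != 0.
Proof.
move=> h; have h1 := mxrank_mul_min x x; have h2 := mxrank_mul_min (x *m x) x.
rewrite -mxrank_eq0; move: (\rank x) (\rank (x *m x)) (\rank (x *m x *m x)) h h1 h2 => a b c h h1 h2.
by apply/negP => /eqP c0; move: h h1 h2; rewrite c0; lia.
Qed.

End Regular.

(** * Nilpotent elements and triples in sl(2) *)

Section TwoByTwo.
Variable C : numFieldType.

Definition mx2 (a b c d : C) : 'M[C]_2 :=
  \matrix_(i, j) (if i == 0 then (if j == 0 then a else b) else (if j == 0 then c else d)).

Lemma mx2P (A B : 'M[C]_2) : A 0 0 = B 0 0 -> A 0 1 = B 0 1 -> A 1 0 = B 1 0 -> A 1 1 = B 1 1 -> A = B.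
Proof.
move=> h1 h2 h3 h4; apply/matrixP => -[[|[|//]] i] [[|[|//]] j].
- by move: h1; congr (A _ _ = B _ _); exact: val_inj.
- by move: h2; congr (A _ _ = B _ _); exact: val_inj.
- by move: h3; congr (A _ _ = B _ _); exact: val_inj.
- by move: h4; congr (A _ _ = B _ _); exact: val_inj.
Qed.

Lemma mx2E (A : 'M[C]_2) : A = mx2 (A 0 0) (A 0 1) (A 1 0) (A 1 1).
Proof. by apply: mx2P; rewrite !mxE. Qed.
Lemma mx2D a b c d a' b' c' d' : mx2 a b c d + mx2 a' b' c' d' = mx2 (a + a') (b + b') (c + c') (d + d').
Proof. by apply: mx2P; rewrite !mxE. Qed.
Lemma mx2N a b c d : - mx2 a b c d = mx2 (- a) (- b) (- c) (- d).
Proof. by apply: mx2P; rewrite !mxE. Qed.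
Lemma mx2Z x a b c d : x *: mx2 a b c d = mx2 (x * a) (x * b) (x * c) (x * d).
Proof. by apply: mx2P; rewrite !mxE. Qed.
Lemma mx2M a b c d a' b' c' d' : mx2 a b c d *m mx2 a' b' c' d' =
  mx2 (a * a' + b * c') (a * b' + b * d') (c * a' + d * c') (c * b' + d * d').
Proof. by apply: mx2P; rewrite !mxE !big_ord_recl big_ord0 !mxE /= addr0. Qed.
Lemma mx2tr a b c d : \tr (mx2 a b c d) = a + d.
Proof. by rewrite /mxtrace !big_ord_recl big_ord0 !mxE /= addr0. Qed.
Lemma mx2_0 : 0 = mx2 0 0 0 0.
Proof. by apply: mx2P; rewrite !mxE. Qed.
Lemma mx2_inj a b c d a' b' c' d' : mx2 a b c d = mx2 a' b' c' d' -> [/\ a = a', b = b', c = c' & d = d'].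
Proof. by move=> /matrixP h; split; [have := h 0 0|have := h 0 1|have := h 1 0|have := h 1 1]; rewrite !mxE. Qed.

Lemma sl2_mx2 (y : 'M[C]_2) : y \in @sl2 C -> exists p q s, y = mx2 p q s (- p).
Proof.
rewrite mem_sl2 => /eqP h; exists (y 0 0), (y 0 1), (y 1 0); rewrite {1}[y]mx2E; congr mx2.
by move: h; rewrite {1}[y]mx2E mx2tr => /eqP; rewrite addrC addr_eq0 => /eqP.
Qed.

(** The square of y is a scalar [dl], and the cube of ad y is 4 [dl] ad y; so nilpotency forces [dl]
    = 0, or ad y = 0 and hence y = 0. *)
Lemma sl2_ad_nilpotent (y : 'M[C]_2) : y \in @sl2 C ->
  (exists d, {in @sl2 C, forall z, iter d (lie_br y) z = 0}) -> y *m y = 0.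
Proof.
move=> sy [d hd]; have [p [q [s yE]]] := sl2_mx2 sy.
pose dl := p * p + q * s.
have ad3 z : lie_br y (lie_br y (lie_br y z)) = (4%:R * dl) *: lie_br y z.
  rewrite [z]mx2E yE /lie_br !(mx2M, mx2N, mx2D, mx2Z) /dl; congr mx2; ring.
have adm m z : iter (m + m).+1 (lie_br y) z = (4%:R * dl) ^+ m *: lie_br y z.
  elim: m => [|m IH]; first by rewrite expr0 scale1r.
  rewrite addSn addnS iterS iterS IH !(linZ (@lie_br_linear C 2 y)) ad3 scalerA.
  by rewrite exprSr.
have yy : y *m y = dl *: 1%:M.
  rewrite yE mx2M (_ : 1%:M = mx2 1 0 0 1) ?mx2Z; last by apply: mx2P; rewrite !mxE.
  by rewrite /dl; congr mx2; ring.
have [d0|d0] := eqVneq dl 0; first by rewrite yy d0 scale0r.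
have ad0 z : z \in @sl2 C -> lie_br y z = 0.
  move=> sz; have := adm d z; rewrite -addnS addnC iterD hd // => /esym/eqP h.
  move: h; rewrite (_ : iter _ _ 0 = 0); last first.
    by elim: (d.+1) => //= j ->; exact: (lin0 (@lie_br_linear C 2 y)).
  by rewrite scaler_eq0 expf_eq0 mulf_eq0 pnatr_eq0 (negPf d0) andbF /= => /eqP.
have h1 : lie_br y (mx2 0 1 0 0) = 0 by apply: ad0; rewrite mem_sl2 mx2tr addr0.
have h2 : lie_br y (mx2 0 0 1 0) = 0 by apply: ad0; rewrite mem_sl2 mx2tr addr0.
move: h1 h2; rewrite yE /lie_br !(mx2M, mx2N, mx2D) mx2_0 => /mx2_inj [_ h1 _ h2] /mx2_inj [_ _ h3 _].
case/negP: d0; rewrite /dl; apply/eqP.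
have p0 : p = 0.
  apply/eqP; rewrite -(mulrI_eq0 p (mulfI (_ : (2%:R : C) != 0))) ?pnatr_eq0 //.
  by apply/eqP; rewrite -[RHS]h1; ring.
have s0 : s = 0 by rewrite -[RHS]h2; ring.
by rewrite p0 s0 !mulr0 addr0.
Qed.

Lemma sl2_triple_exists (y : 'M[C]_2) : y \in @sl2 C -> y *m y = 0 -> y != 0 ->
  exists h f, sl2_triple (@sl2 C) (fun z => \tr (z *m f) : C^o) (fun z => 2%:R^-1 * \tr (z *m h) : C^o)
    (fun z => \tr (z *m y) : C^o) y h f.
Proof.
move=> sy yy y0; have [p [q [s yE]]] := sl2_mx2 sy.
move: yy; rewrite {1 2}yE mx2M mx2_0 => /mx2_inj [e1 _ _ _].
have trl (A : 'M[C]_2) a : linear (fun z : 'M[C]_2 => a * \tr (z *m A) : C^o).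
  by move=> b u v; rewrite mulmxDl -scalemxAl linearD linearZ /= mulrDr mulrCA.
have trl1 (A : 'M[C]_2) : linear (fun z : 'M[C]_2 => \tr (z *m A) : C^o).
  by move=> b u v; rewrite mulmxDl -scalemxAl linearD linearZ.
have n2 : (2%:R : C) != 0 by rewrite pnatr_eq0.
have fin (h f : 'M[C]_2) : y \in @sl2 C -> h \in @sl2 C -> f \in @sl2 C ->
   {in @sl2 C, forall x, x = \tr (x *m f) *: y + ((2%:R^-1 * \tr (x *m h)) *: h + \tr (x *m y) *: f)} ->
   \tr (y *m f) = 1 -> \tr (y *m h) = 0 -> \tr (y *m y) = 0 -> \tr (h *m f) = 0 -> \tr (h *m h) = 2%:R ->
   \tr (f *m f) = 0 ->
   lie_br h y = 2%:R *: y -> lie_br h f = - (2%:R *: f) -> lie_br y f = h ->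
   sl2_triple (@sl2 C) (fun z => \tr (z *m f) : C^o) (fun z => 2%:R^-1 * \tr (z *m h) : C^o)
    (fun z => \tr (z *m y) : C^o) y h f.
  move=> sy' sh sf dec t1 t2 t3 t4 t5 t6 b1 b2 b3; split => //.
  - by split; rewrite ?t1 ?t2 ?t3 ?mulr0.
  - by split; rewrite ?t4 ?t5 ?mulVf // mxtrace_mulC.
  - by split; rewrite ?t6 // mxtrace_mulC ?t4 ?t1 ?mulr0.
(* Since p^2 + q s = 0, the case q = 0 has p = 0 and s nonzero. Otherwise s = - p^2 / q, and h and f
   are written with q in the denominator. *)
have [q0|q0] := eqVneq q 0.
  have p0 : p = 0 by move/eqP: e1; rewrite q0 mul0r addr0 mulf_eq0 orbb => /eqP.
  have s0 : s != 0.
    by apply: contra_neq y0 => s0; rewrite yE p0 q0 s0 oppr0 -mx2_0.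
  subst p q; exists (mx2 (-1) 0 0 1), (mx2 0 s^-1 0 0); rewrite yE in sy y0 fin *; apply: fin => //;
    try by rewrite mem_sl2 mx2tr; apply/eqP; ring.
  all: try (by move=> x /sl2_mx2 [a [b [c ->]]]; rewrite !(mx2M, mx2tr, mx2Z, mx2D); congr mx2; field; rewrite ?s0 ?n2).
  all: try (by rewrite /lie_br !(mx2M, mx2N, mx2D, mx2Z, mx2tr); try congr mx2; field; rewrite ?s0 ?n2).
have e2 : q * s = - (p * p) by apply/eqP; rewrite -addr_eq0 addrC e1.
have sE : s = - (p * p) / q by rewrite -e2; field.
subst s; clear e1 e2; exists (mx2 1 0 (- (2%:R * p) / q) (-1)), (mx2 0 0 q^-1 0); rewrite yE in sy y0 fin *; apply: fin => //;
    try by rewrite mem_sl2 mx2tr; apply/eqP; ring.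
all: try (by move=> x /sl2_mx2 [a [b [c ->]]]; rewrite !(mx2M, mx2tr, mx2Z, mx2D); congr mx2; field; rewrite ?q0 ?n2).
all: try (by rewrite /lie_br !(mx2M, mx2N, mx2D, mx2Z, mx2tr); try congr mx2; field; rewrite ?q0 ?n2).
Qed.

End TwoByTwo.

(** * The natural representation restricted to a principal sl(2) *)

Section Natural.
Variable C : numClosedFieldType.
Local Notation J := (symplJ C).
Variable f : 'Hom('M[C]_2, 'M[C]_4).
Hypothesis f_br : {in lie_space (@sl2 C) &, forall u v, f (lie_br u v) = lie_br (f u) (f v)}.

Section NatMod.
Variable p : nat.

Lemma nat_linear x : linear (fun m : 'M[C]_(4, p) => f x *m m).
Proof. by move=> a u v; rewrite mulmxDr scalemxAr. Qed.
Lemma nat_linearl a x y (m : 'M[C]_(4, p)) : f (a *: x + y) *m m = a *: (f x *m m) + f y *m m.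
Proof. by rewrite linearP mulmxDl scalemxAl. Qed.
Lemma nat_br x y (m : 'M[C]_(4, p)) : x \in lie_space (@sl2 C) -> y \in lie_space (@sl2 C) ->
  f (lie_br x y) *m m = f x *m (f y *m m) - f y *m (f x *m m).
Proof. by move=> hx hy; rewrite f_br // /lie_br mulmxBl !mulmxA. Qed.

(** The sum of p copies of C^4, so that the results on locally finite modules apply to column
    vectors (p = 1) and to matrices (p = 4). *)
Definition natmod : lieMod (@sl2 C) :=
  @LieMod C 2 (@sl2 C) 'M[C]_(4, p) (fun x m => f x *m m)
    (fun x _ => nat_linear x) (fun a x y _ _ m => nat_linearl a x y m)
    (fun x y hx hy m => nat_br m hx hy).

Lemma nat_fin_spanned : fin_spanned (fun _ : natmod => True).
Proof.
apply: (@fin_spannedI _ _ _ natmod ('I_4 * 'I_p)%type (fun ij => (delta_mx ij.1 ij.2 : 'M[C]_(4, p)))).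
move=> m _; exists (fun ij => (m : 'M[C]_(4, p)) ij.1 ij.2).
by rewrite -(pair_big xpredT xpredT (fun i j => (m : 'M[C]_(4, p)) i j *: (delta_mx i j : 'M[C]_(4, p)))) /=; exact: matrix_sum_delta.
Qed.

Lemma nat_locally_finite : locally_finite natmod.
Proof. by move=> m; exists (fun=> True); split => //; exact: nat_fin_spanned. Qed.
End NatMod.

Variables (al be ga : 'M[C]_2 -> C^o) (y h z : 'M[C]_2).
Hypothesis st : sl2_triple (@sl2 C) al be ga y h z.
Local Notation E := (f y).
Local Notation H := (f h).
Local Notation F := (f z).

Lemma nHE : H *m E - E *m H = 2%:R *: E.
Proof. by rewrite -[LHS]/(lie_br H E) -f_br ?(st_h st) ?(st_e st) // (st_he st) linearZ. Qed.
Lemma nEF : E *m F - F *m E = H.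
Proof. by rewrite -[LHS]/(lie_br E F) -f_br ?(st_f st) ?(st_e st) // (st_ef st). Qed.

Local Notation pw j := (iter j (mulmx E) (1%:M : 'M[C]_4)).

Lemma pw_ad j : H *m pw j - pw j *m H = (j%:R *+ 2) *: pw j.
Proof.
elim: j => [|j IH]; first by rewrite /= mulmx1 mul1mx subrr mul0rn scale0r.
rewrite iterS.
have -> : H *m (E *m pw j) - E *m pw j *m H = (H *m E - E *m H) *m pw j + E *m (H *m pw j - pw j *m H).
  by rewrite mulmxBl mulmxBr !mulmxA addrA subrK.
rewrite nHE IH -scalemxAl -scalemxAr -scalerDl -natr1; congr (_ *: _); ring.
Qed.

(** The powers of E are eigenvectors of the commutator with H for the distinct eigenvalues 2 j, so
    they cannot all be nonzero. *)
Lemma pw_nilp : exists j, pw j = 0.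
Proof.
have lT : linear (fun m : natmod 4 => (H *m (m : 'M[C]_4) - (m : 'M[C]_4) *m H : natmod 4)).
  move=> a u v; rewrite mulmxDr mulmxDl -scalemxAr -scalemxAl scalerBr.
  by rewrite opprD addrACA.
have mi : injective (fun j : nat => j%:R *+ 2 : C).
  by move=> a b /eqP; rewrite -!mulrnA eqr_nat => /eqP; lia.
exact: (@eig_vanish C 2 (@sl2 C) (natmod 4) (fun=> True) _ _ (fun j => pw j) (nat_fin_spanned 4) (fun=> I) lT mi pw_ad).
Qed.

Lemma cube_chain : E *m E *m E != 0 -> exists u : 'cV[C]_4,
  E *m (E *m (E *m u)) != 0 /\ E *m (E *m (E *m (E *m u))) = 0.
Proof.
move=> e3; have one0 : (1%:M : natmod 4) != 0.
  by apply: contra_neq e3 => h1; rewrite -[LHS]mulmx1 h1 mulmx0.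
have pwM a b : pw (a + b) = pw a *m pw b.
  by elim: a => [|a IH]; rewrite ?mul1mx // addSn !iterS IH mulmxA.
have [j [j0 j1]] := @last_iterT C 2 (@sl2 C) (natmod 4) (mulmx E) 1%:M one0 pw_nilp.
have j3 : (3 <= j)%N.
  rewrite leqNgt; apply/negP => jl; move: e3.
  have -> : E *m E *m E = pw (2 - j + j.+1)%N by rewrite addnS subnK //= mulmx1 !mulmxA.
  by rewrite pwM (_ : pw j.+1 = 0) ?mulmx0 ?eqxx.
have [c hc] : exists c, col c (pw j) != 0.
  apply: contrapT => H; move: j0; apply/negP; rewrite negbK; apply/eqP/matrixP => a b.
  rewrite [RHS]mxE; apply/eqP; apply: contrapT => hab; apply: H; exists b.
  by apply/eqP => /matrixP/(_ a 0); rewrite !mxE => hh; apply: hab; rewrite hh.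
exists (col c (pw (j - 3))).
have e k : E *m col c (pw k) = col c (pw k.+1) by rewrite iterS !colE mulmxA.
rewrite !e (_ : (j - 3).+3 = j)%N; last by lia.
by split => //; rewrite (j1 : pw j.+1 = 0) colE mul0mx.
Qed.

Lemma mulmx_inj_unit (P : 'M[C]_4) : (forall c : 'cV[C]_4, P *m c = 0 -> c = 0) -> P \in unitmx.
Proof.
move=> hP; rewrite -unitmx_tr -row_free_unit -kermx_eq0; apply/eqP/row_matrixP => i.
rewrite row0; apply: trmx_inj; rewrite trmx0; apply: hP.
apply: trmx_inj; rewrite trmx_mul trmxK trmx0; apply/sub_kermxP; exact: row_sub.
Qed.

(** In the basis u, E u, E^2 u, E^3 u the matrix of E is a shift. The relations of the triple make
    the diagonal of H increase by 2 with total 0, so its last entry is 3, and the other entries of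
    the last column vanish. *)
Lemma cube_weight (u : 'cV[C]_4) : let v := E *m (E *m (E *m u)) in
  v != 0 -> E *m v = 0 -> H *m v = 3%:R *: v.
Proof.
move=> v v0 ev.
have [w [wS w3 w4]] : exists w : nat -> 'cV[C]_4, [/\ forall j, E *m w j = w j.+1, w 3 = v & w 4 = 0].
  by exists (fun j => iter j (mulmx E) u).
pose P : 'M[C]_4 := \matrix_(i, j) w j i 0.
have Pc (c : 'cV[C]_4) : P *m c = \sum_j c j 0 *: w j.
  apply/colP => i; rewrite !mxE summxE; apply: eq_bigr => j _.
  by rewrite !mxE mulrC.
have Pu : P \in unitmx.
  apply: mulmx_inj_unit => c; rewrite Pc => hc.
  have wbig j : w (j + 4)%N = 0.
    by elim: j => // j IH; rewrite addSn -wS IH mulmx0.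
  have sumE : c (inord 0) 0 *: w 0%N + (c (inord 1) 0 *: w 1%N + (c (inord 2) 0 *: w 2%N + c (inord 3) 0 *: w 3%N)) = 0.
    rewrite -[RHS]hc !big_ord_recl big_ord0 addr0 /=.
    by do 3?[congr (_ + _)]; congr (c _ _ *: _); apply: val_inj; rewrite /= inordK.
  have v0' : w 3 != 0 by rewrite w3.
  have w5 : w 5 = 0 by exact: (wbig 1%N). have w6 : w 6 = 0 by exact: (wbig 2%N).
  have step a : a *: w 3 = 0 -> a = 0 by move/eqP; rewrite scaler_eq0 (negPf v0') orbF => /eqP.
  have c0 : c (inord 0) 0 = 0.
    apply: step; have := congr1 (fun m => E *m (E *m (E *m m))) sumE.
    by rewrite !mulmx0 !mulmxDr -!scalemxAr !wS w4 w5 w6 !scaler0 !addr0.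
  move: sumE; rewrite c0 scale0r add0r => sumE.
  have c1 : c (inord 1) 0 = 0.
    apply: step; have := congr1 (fun m => E *m (E *m m)) sumE.
    by rewrite !mulmx0 !mulmxDr -!scalemxAr !wS w4 w5 !scaler0 !addr0.
  move: sumE; rewrite c1 scale0r add0r => sumE.
  have c2 : c (inord 2) 0 = 0.
    apply: step; have := congr1 (fun m => E *m m) sumE.
    by rewrite !mulmx0 !mulmxDr -!scalemxAr !wS w4 !scaler0 !addr0.
  move: sumE; rewrite c2 scale0r add0r => /step c3.
  apply/colP => j; rewrite mxE; case: j => -[|[|[|[|//]]]] i;
   [rewrite -[RHS]c0|rewrite -[RHS]c1|rewrite -[RHS]c2|rewrite -[RHS]c3]; congr (c _ _); apply: val_inj; rewrite /= inordK //.
pose Nm : 'M[C]_4 := \matrix_(i, j) (i == j.+1 :> nat)%:R.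
have EP : E *m P = P *m Nm.
  apply/matrixP => i j; rewrite -[LHS]/((E *m P) i j).
  have -> : (E *m P) i j = (E *m w j) i 0.
    by rewrite !mxE; apply: eq_bigr => a _; rewrite !mxE.
  rewrite wS [RHS]mxE.
  have [j3|j3] := ltnP j 3.
    have j4 : (j.+1 < 4)%N by [].
    rewrite (bigD1 (Ordinal j4)) //= big1 ?addr0 => [|a aj].
      by rewrite !mxE /= eqxx mulr1.
    rewrite !mxE (_ : (a == j.+1 :> nat) = false) ?mulr0 //; apply/negbTE.
    by move: aj; rewrite -val_eqE.
  have -> : (j : nat) = 3 by have := ltn_ord j; lia.
  rewrite w4 mxE big1 // => a _; rewrite !mxE (_ : (a == j.+1 :> nat) = false) ?mulr0 //.
  by have := ltn_ord a; have := ltn_ord j; lia.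
have conj A B : (invmx P *m A *m P) *m (invmx P *m B *m P) = invmx P *m (A *m B) *m P.
  by rewrite !mulmxA mulmxK //.
have NE : Nm = invmx P *m E *m P by rewrite -mulmxA EP mulKmx.
have [T [F' [r1 r2 hT]]] : exists T F' : 'M[C]_4, [/\ T *m Nm - Nm *m T = 2%:R *: Nm,
    Nm *m F' - F' *m Nm = T & H *m P = P *m T].
  exists (invmx P *m H *m P), (invmx P *m F *m P); split.
  - by rewrite NE !conj -mulmxBl -mulmxBr nHE -scalemxAr -scalemxAl.
  - by rewrite NE !conj -mulmxBl -mulmxBr nEF.
  - by rewrite -mulmxA mulKVmx.
have eN r s : (r < 4)%N -> (s < 4)%N -> ent Nm r s = (r == s.+1)%:R.
  by move=> r4 s4; rewrite /ent mxE !inordK.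
have q1 r s : (r < 4)%N -> (s < 4)%N -> ent (T *m Nm - Nm *m T) r s = ent (2%:R *: Nm) r s by rewrite r1.
have q2 r s : (r < 4)%N -> (s < 4)%N -> ent (Nm *m F' - F' *m Nm) r s = ent T r s by rewrite r2.
have E03 := q1 1%N 3%N isT isT. have E13 := q1 2%N 3%N isT isT. have E23 := q1 3%N 3%N isT isT.
have D1 := q1 1%N 0%N isT isT. have D2 := q1 2%N 1%N isT isT. have D3 := q1 3%N 2%N isT isT.
have T0 := q2 0%N 0%N isT isT. have T1 := q2 1%N 1%N isT isT.
have T2 := q2 2%N 2%N isT isT. have T3 := q2 3%N 3%N isT isT.
move: E03 E13 E23 D1 D2 D3 T0 T1 T2 T3; rewrite !entD !entN !entZ !entM !eN //=.
rewrite !(mulr0, mul0r, mulr1, mul1r, addr0, add0r, sub0r, subr0) => E03 E13 E23 D1 D2 D3 T0 T1 T2 T3.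
(* The trace is zero because T is a commutator, and consecutive diagonal entries differ by 2. *)
have t33 : ent T 3 3 = 3%:R.
  have n4 : (4%:R : C) != 0 by rewrite pnatr_eq0.
  apply: (mulfI n4).
  have -> : 4%:R * ent T 3 3 = ent T 0 0 + ent T 1 1 + ent T 2 2 + ent T 3 3
     + 3%:R * (ent T 3 3 - ent T 2 2) + 2%:R * (ent T 2 2 - ent T 1 1) + (ent T 1 1 - ent T 0 0) by ring.
  by rewrite D1 D2 D3 -T0 -T1 -T2 -T3; ring.
have : col (inord 3) (H *m P) = col (inord 3) (P *m T) by rewrite hT.
have colP3 : col (inord 3) P = v by rewrite -w3; apply/colP => i; rewrite !mxE inordK.
rewrite !colE -!mulmxA -!colE colP3 => ->.
apply/colP => i; rewrite mxE (bigD1 (inord 3)) //= big1 ?addr0.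
  have pv : P i (inord 3) = v i 0 by rewrite -colP3 [RHS]mxE.
  have tv : col (inord 3) T (inord 3) 0 = 3%:R by rewrite mxE -/(ent T 3 3).
  by rewrite pv tv [RHS]mxE mulrC.
move=> a a3; rewrite [X in _ * X]mxE.
suff -> : T a (inord 3) = 0 by rewrite mulr0.
have e3 : T a (inord 3) = ent T a 3 by rewrite /ent inord_val.
have an : (a : nat) != 3 by move: a3; rewrite -val_eqE /= inordK.
rewrite e3; have := ltn_ord a; move: (nat_of_ord a) an => b b3 b4.
case: b b3 b4 => [|[|[|[|b]]]] //= _ _.
- by apply/eqP; rewrite -oppr_eq0 E03.
- by apply/eqP; rewrite -oppr_eq0 E13.
- by apply/eqP; rewrite -oppr_eq0 E23.
Qed.

End Natural.

(** * Principal sl(2)-subalgebras are conjugate to the standard one *)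

Section Standard.
Variable C : numClosedFieldType.
Local Notation J := (symplJ C).
Variable f : 'Hom('M[C]_2, 'M[C]_4).
Hypothesis f_br : {in lie_space (@sl2 C) &, forall u v, f (lie_br u v) = lie_br (f u) (f v)}.
Variables (al be ga : 'M[C]_2 -> C^o) (y h z : 'M[C]_2).
Hypothesis st : sl2_triple (@sl2 C) al be ga y h z.
Local Notation E := (f y).
Local Notation H := (f h).
Local Notation F := (f z).

Lemma ent_mE r s : (r < 4)%N -> (s < 4)%N -> ent (mE C) r s =
  (match r, s with 0, 1 => 1 | 3, 2 => -1 | 1, 3 => 2 | _, _ => 0 end : int)%:~R.
Proof.
move=> r4 s4; rewrite /mE entD !ent_spB // -rmorphD /=.
by case: r r4 => [|[|[|[|//]]]] _; case: s s4 => [|[|[|[|//]]]] _.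
Qed.

Lemma ent_mF r s : (r < 4)%N -> (s < 4)%N -> ent (mF C) r s =
  (match r, s with 1, 0 => 3 | 2, 3 => -3 | 3, 1 => 2 | _, _ => 0 end : int)%:~R.
Proof.
move=> r4 s4; rewrite /mF entD entN entZ !ent_spB // -[3%:R]/(3%:~R) -rmorphM -rmorphN -rmorphD /=.
by case: r r4 => [|[|[|[|//]]]] _; case: s s4 => [|[|[|[|//]]]] _.
Qed.

Section Columns.
Variable w : 'I_4 -> 'cV[C]_4.
Definition colmx : 'M[C]_4 := \matrix_(i, j) w j i 0.

Lemma colmx_mul (c : 'cV[C]_4) : colmx *m c = \sum_j c j 0 *: w j.
Proof.
apply/colP => i; rewrite !mxE summxE; apply: eq_bigr => j _.
by rewrite !mxE mulrC.
Qed.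

Lemma mul_colmx (A B : 'M[C]_4) :
  (forall j, A *m w j = \sum_(i < 4) ent B i j *: w i) -> A *m colmx = colmx *m B.
Proof.
move=> hw; apply/matrixP => r s.
have -> : (A *m colmx) r s = (A *m w s) r 0.
  by rewrite !mxE; apply: eq_bigr => a _; rewrite !mxE.
rewrite hw summxE [RHS]mxE; apply: eq_bigr => a _.
by rewrite !mxE entE mulrC.
Qed.
End Columns.

Lemma sum4 (V : zmodType) (G : 'I_4 -> V) : \sum_i G i = G i40 + (G i41 + (G i42 + G i43)).
Proof.
rewrite !big_ord_recl big_ord0 addr0.
by do 3?[congr (_ + _)]; congr (G _); apply: val_inj.
Qed.

Hypotheses (sE : E \in lie_space (@sp4 C)) (sH : H \in lie_space (@sp4 C)).
Hypothesis E3 : E *m E *m E != 0.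

Lemma standard_basis : exists w : 'I_4 -> 'cV[C]_4, [/\ colmx w \in unitmx,
  E *m colmx w = colmx w *m mE C, H *m colmx w = colmx w *m mH C & F *m colmx w = colmx w *m mF C].
Proof.
have [u [v0 ev]] := cube_chain f_br st E3.
have hv := cube_weight f_br st v0 ev.
move: (E *m (E *m (E *m u))) v0 ev hv => v v0 ev hv.
pose vj j := iter j (mulmx F) v.
have hw : @hwn C 2 (@sl2 C) (natmod f_br 1) y h 3 v by split.
have v4 : vj 4 = 0 := hwn_nilp st (@nat_locally_finite C f f_br 1) hw.
have vH j : H *m vj j = (3%:R - j%:R *+ 2) *: vj j.
  exact: (tHFj st (K := natmod f_br 1) j hv).
have vE j : E *m vj j.+1 = (j.+1%:R * (3%:R - j%:R)) *: vj j.
  exact: (tEFj st (K := natmod f_br 1) j ev hv).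
have vF j : F *m vj j = vj j.+1 by [].
have e0 : E *m vj 0 = 0 by exact: ev.
have nz j : (j < 4)%N -> vj j != 0.
  elim: j => // j IH j4; apply/eqP => e; have := vE j; rewrite e mulmx0 => /esym/eqP.
  rewrite scaler_eq0 (negPf (IH (ltnW j4))) orbF mulf_eq0 pnatr_eq0 /= subr_eq0 eqr_nat.
  by move/eqP => e3; rewrite -e3 in j4.
have n3 : (3%:R : C) != 0 by rewrite pnatr_eq0.
have n18 : (18%:R : C) != 0 by rewrite pnatr_eq0.
have n6 : (6%:R : C) != 0 by rewrite pnatr_eq0.
move: vj v4 vH vE vF e0 nz => vj v4 vH vE vF e0 nz.
(* The order follows the diagonal 3, 1, -3, -1 of [mH], and the scalars are those for which E, H, F
   get exactly the matrices [mE], [mH], [mF]. *)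
pose w (i : 'I_4) : 'cV[C]_4 := match val i with
  | 0 => vj 0 | 1 => 3%:R^-1 *: vj 1 | 2 => - 18%:R^-1 *: vj 3 | _ => 6%:R^-1 *: vj 2 end.
exists w; split.
- apply: mulmx_inj_unit => c; rewrite colmx_mul => hc.
  pose mu (i : 'I_4) : C := (nth 0 [:: 3; 1; -3; -1] i : int)%:~R.
  have mi : injective mu.
    move=> a b /eqP; rewrite eqr_int => /eqP; case: a => -[|[|[|[|//]]]] ia; case: b => -[|[|[|[|//]]]] ib //= _; exact: val_inj.
  have Hw (i : 'I_4) : H *m w i = mu i *: w i.
    rewrite /w /mu; case: i => -[|[|[|[|//]]]] i /=; rewrite -?scalemxAr vH ?scalerA; congr (_ *: _); ring.
  have lH : linear (mulmx H : 'cV[C]_4 -> 'cV[C]_4) by move=> a x x'; rewrite mulmxDr scalemxAr.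
  have lid : linear (@id 'cV[C]_4) by [].
  have Tw (i : 'I_4) : H *m (c i 0 *: w i) = mu i *: id (c i 0 *: w i).
    by rewrite -scalemxAr Hw !scalerA mulrC.
  have z0 := @eigZ_split C 'cV[C]_4 (mulmx H) id lH lid (fun _ h => h) (fun _ => erefl) _ mu (fun i => c i 0 *: w i) mi Tw hc.
  apply/colP => i; rewrite mxE; have /eqP := z0 i; rewrite scaler_eq0 => /orP[/eqP //|].
  rewrite /w; case: i => -[|[|[|[|//]]]] i /=; rewrite ?scaler_eq0 ?oppr_eq0 ?invr_eq0 ?(negPf n3) ?(negPf n6) ?(negPf n18) ?(negPf (nz _ _)) //.
- apply: mul_colmx => j; rewrite sum4 !ent_mE //.
  case: j => -[|[|[|[|//]]]] j /=; rewrite /w /= ?scale0r ?add0r ?addr0 -?scalemxAr ?e0 ?vE // ?scalerA; congr (_ *: _); field; rewrite ?n3 ?n6 ?n18 //.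
- apply: mul_colmx => j; rewrite sum4 !ent_mH //.
  case: j => -[|[|[|[|//]]]] j /=; rewrite /w /= ?scale0r ?add0r ?addr0 -?scalemxAr ?vH // ?scalerA; congr (_ *: _); field; rewrite ?n3 ?n6 ?n18 //.
- apply: mul_colmx => j; rewrite sum4 !ent_mF //.
  case: j => -[|[|[|[|//]]]] j /=; rewrite /w /= ?scale0r ?add0r ?addr0 -?scalemxAr ?vF ?v4 ?scaler0 // -[LHS]scale1r ?scalerA; congr (_ *: _); field; rewrite ?n3 ?n6 ?n18 //.
Qed.

(** The Gram matrix of the symplectic form in the new basis is invariant under [mH] and [mE], hence
    a multiple of J; dividing the basis by a square root of the factor makes the change of basis
    symplectic. *)
Lemma standard_form : exists S, [/\ symplectic S, E = spconj S (mE C), H = spconj S (mH C) & F = spconj S (mF C)].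
Proof.
have [w [Su hE hH hF]] := standard_basis.
move: (colmx w) Su hE hH hF => S0 Su hE hH hF.
pose G := S0^T *m J *m S0.
have inv x m : x \in lie_space (@sp4 C) -> x *m S0 = S0 *m m -> m^T *m G + G *m m = 0.
  move=> sx xm.
  have e1 : G *m m = S0^T *m (J *m x) *m S0 by rewrite /G -mulmxA -xm !mulmxA.
  have e2 : m^T *m G = S0^T *m (x^T *m J) *m S0.
    by rewrite /G !mulmxA -trmx_mul -xm trmx_mul.
  rewrite e1 e2 -mulmxDl -mulmxDr; move: sx; rewrite mem_sp4 => /eqP ->.
  by rewrite mulmx0 mul0mx.
have GT : G^T = - G by rewrite /G !trmx_mul trmxK JT mulNmx mulmxN mulmxA.
have gH := inv _ _ sH hH; have gE := inv _ _ sE hE.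
have hG : S0^T *m J *m S0 = G by [].
clearbody G.
have gT r s : ent G s r = - ent G r s by rewrite -entT GT entN.
have off r s : (r < 4)%N -> (s < 4)%N -> s != (r + 2)%N -> r != (s + 2)%N -> ent G r s = 0.
  move=> r4 s4 d1 d2; have := congr1 (fun m => ent m r s) gH.
  rewrite entD !entM !entT !ent_mH // ent0.
  case: r r4 d1 d2 => [|[|[|[|//]]]] _; case: s s4 => [|[|[|[|//]]]] _ //= _ _ /eqP;
    rewrite ?mul0r ?mulr0 ?add0r ?addr0 mulrC -mulrDr -rmorphD mulf_eq0 intr_eq0 orbF /= => /eqP //.
have g13 : ent G 1 3 = ent G 0 2.
  have := congr1 (fun m => ent m 1 2) gE; rewrite entD !entM !entT !ent_mE // ent0 /=.
  rewrite !(mulr0, mul0r, addr0, add0r, mul1r, mulrN1) => /eqP.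
  by rewrite subr_eq0 => /eqP.
have GJ : G = ent G 0 2 *: J.
  apply: ent_inj => r s r4 s4; rewrite entZ entJ //.
  case: r r4 => [|[|[|[|//]]]] _; case: s s4 => [|[|[|[|//]]]] _ /=;
   first [by rewrite off // mulr0 | by rewrite mulr1 ?g13 | by rewrite [LHS]gT ?g13 mulrN1].
move: (ent G 0 2) GJ => c GJ.
have c0 : c != 0.
  apply/eqP => c0; have Ju : J \in unitmx.
    have JN : J *m (- J) = 1%:M by rewrite mulmxN JJ opprK.
    by have [] := mulmx1_unit JN.
  have : S0^T *m J *m S0 \in unitmx by rewrite !unitmx_mul unitmx_tr Su Ju.
  by rewrite hG GJ c0 scale0r unitmxE det0 unitr0.
have s0 : sqrtC c != 0 by rewrite sqrtC_eq0.
pose S := (sqrtC c)^-1 *: S0.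
have symS : symplectic S.
  have ST : S^T = (sqrtC c)^-1 *: S0^T by rewrite /S linearZ.
  rewrite /symplectic ST /S -!scalemxAl -scalemxAr hG GJ !scalerA.
  by rewrite -{3}(sqrtCK c) expr2 -mulrA mulKf // mulVf // scale1r.
have cj x m : x *m S0 = S0 *m m -> x = spconj S m.
  move=> xm; rewrite /spconj.
  have -> : S *m m = x *m S by rewrite /S -scalemxAl -xm -scalemxAr.
  by rewrite -mulmxA spinvVK // mulmx1.
by exists S; split => //; exact: cj.
Qed.

Lemma standard_coord S x (a b c : C) : symplectic S ->
  x = a *: spconj S (mE C) + (b *: spconj S (mH C) + c *: spconj S (mF C)) ->
  [/\ ent (spconj (spinv S) x) 0 1 = a, ent (spconj (spinv S) x) 1 1 = b
    & 3%:R^-1 * ent (spconj (spinv S) x) 1 0 = c].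
Proof.
move=> hS ->; have n3 : (3%:R : C) != 0 by rewrite pnatr_eq0.
have lS := spconj_linear (spinv S).
rewrite lS (linD lS) !(linZ lS) !(spconjK _ hS) !entD !entZ !ent_mE // !ent_mH // !ent_mF //=.
by split; field.
Qed.

End Standard.

(** The regular nilpotent comes from some y in sl(2) with y^2 = 0, which is completed to a triple.
    Its cube on C^4 is nonzero by [regular_rank] and [regular_cube], so [standard_form] applies. *)
Lemma principal_standard (C : numClosedFieldType) (k : principal_sl2 (@sp4 C)) :
  exists S (hS : symplectic S), exists al be ga : 'M[C]_4 -> C^o,
    sl2_triple k al be ga (spconj S (mE C)) (spconj S (mH C)) (spconj S (mF C)).
Proof.
have [f [fi fk fb]] := psl2_iso k.
have [x [xk rx [d nx]]] := psl2_principal k.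
have sub w : w \in lie_space k -> w \in @sp4 C by move=> wk; apply: (subvP (psl2_sub k)).
have fk' t : t \in lie_space (@sl2 C) -> f t \in lie_space k by move=> ht; rewrite -fk memv_img.
have [y sy xE] : exists2 y, y \in lie_space (@sl2 C) & x = f y.
  by apply/memv_imgP; rewrite fk.
have rk := regular_rank (sub _ xk) rx.
have y0 : y != 0.
  by apply/eqP => y0; move: rk; rewrite xE y0 linear0 mxrank0.
have adn : exists d, {in @sl2 C, forall z, iter d (lie_br y) z = 0}.
  exists d => z sz.
  have it j : iter j (lie_br y) z \in lie_space (@sl2 C) /\ f (iter j (lie_br y) z) = iter j (lie_br x) (f z).
    elim: j => [|j [h1 h2]] //=; split; first exact: (lie_closed sy h1).
    by rewrite fb // h2 xE.
  have [h1 h2] := it d; apply: fi => //; first exact: mem0v.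
  by rewrite h2 nx ?linear0 //; apply: sub; exact: fk'.
have yy := sl2_ad_nilpotent sy adn.
have [h [z st]] := sl2_triple_exists sy yy y0.
have cube : f y *m f y *m f y != 0 by rewrite -xE; exact: regular_cube.
have [S [hS hE hH hF]] := standard_form fb st (sub _ (fk' _ sy)) (sub _ (fk' _ (st_h st))) cube.
exists S, hS, (fun x => ent (spconj (spinv S) x) 0 1 : C^o), (fun x => ent (spconj (spinv S) x) 1 1 : C^o),
  (fun x => 3%:R^-1 * ent (spconj (spinv S) x) 1 0 : C^o).
have lS := spconj_linear (spinv S).
have c1 := @standard_coord C S _ 1 0 0 hS; have c2 := @standard_coord C S _ 0 1 0 hS.
have c3 := @standard_coord C S _ 0 0 1 hS.
split.
- by rewrite -hE; exact: fk'.
- by rewrite -hH; apply: fk'; exact: st_h st.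
- by rewrite -hF; apply: fk'; exact: st_f st.
- by move=> a u v; rewrite lS entD entZ.
- by move=> a u v; rewrite lS entD entZ.
- by move=> a u v; rewrite lS entD entZ mulrDr mulrCA.
- move=> t tk; have [t' st' tE] : exists2 t', t' \in lie_space (@sl2 C) & t = f t'.
    by apply/memv_imgP; rewrite fk.
  have dec := st_dec st st'.
  have e : t = \tr (t' *m z) *: spconj S (mE C) + ((2%:R^-1 * \tr (t' *m h)) *: spconj S (mH C)
      + \tr (t' *m y) *: spconj S (mF C)).
    by rewrite tE {1}dec linearD linearD !linearZ /= hE hH hF.
  by have [-> -> ->] := standard_coord hS e.
- by apply: c1; rewrite !scale0r scale1r !addr0.
- by apply: c2; rewrite !scale0r scale1r addr0 add0r.
- by apply: c3; rewrite !scale0r scale1r !add0r.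
- by rewrite -hH -hE -fb ?(st_h st) ?(st_e st) // (st_he st) linearZ.
- by rewrite -hH -hF -fb ?(st_h st) ?(st_f st) // (st_hf st) linearN linearZ.
- by rewrite -hE -hF -fb ?(st_e st) ?(st_f st) // (st_ef st) hH.
Qed.

(** * Transport between a principal sl(2) and the standard one *)

Section TwistModules.
Variable C : numClosedFieldType.

Lemma U_xe (L : lieMod (@sp4 C)) (m : L) : ev (@opm C L) xe m = act (mE C) m.
Proof.
have := act_linearl 1 (spB_sp4 C 7) (spB_sp4 C 6) m; rewrite !scale1r => ->.
by rewrite /xe UA.
Qed.

Lemma U_xh (L : lieMod (@sp4 C)) (m : L) : ev (@opm C L) xh m = act (mH C) m.
Proof.
have := act_linearl 3%:R (spB_sp4 C 4) (spB_sp4 C 5) m => ->.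
by rewrite /xh UA UM UZ.
Qed.

Lemma U_xf (L : lieMod (@sp4 C)) (m : L) : ev (@opm C L) xf m = act (mF C) m.
Proof.
have e : act (3%:R *: spB C 2 - spB C 3) m = 3%:R *: act (spB C 2) m - act (spB C 3) m.
  have := act_linearl (-1) (spB_sp4 C 3) (memvZ 3%:R (spB_sp4 C 2)) m.
  rewrite addrC !scaleN1r => ->; rewrite addrC; congr (_ - _).
  have := act_linearl 3%:R (spB_sp4 C 2) (mem0v _) m.
  rewrite addr0 => ->.
  have := act_linearl (-1) (mem0v _) (mem0v _) m.
  by rewrite scaler0 addr0 scaleN1r addNr => ->; rewrite addr0.
by rewrite /mF e /xf USB UM UZ.
Qed.

Variables (S : 'M[C]_4) (hS : symplectic S).

Lemma twist_submodule (M : lieMod (@sp4 C)) (P : M -> Prop) :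
  @submodule C 4 (@sp4 C) (twist hS M) P <-> submodule P.
Proof.
split=> -[P0 Pl Pa]; split => // x sx m Pm; last by apply: Pa => //; exact: spconj_sp4.
rewrite -(spconjVK x hS); apply: (Pa (spconj (spinv S) x)) => //.
exact: spconj_sp4 (symplectic_inv hS) sx.
Qed.

Lemma twist_simple (M : lieMod (@sp4 C)) : simple_mod M -> simple_mod (twist hS M).
Proof. by move=> [nz H]; split => // P /twist_submodule /H. Qed.

Lemma untwist_iso (M N : lieMod (@sp4 C)) : lm_iso (twist hS M) (twist hS N) -> lm_iso M N.
Proof.
move=> [f [[fl fa] bf]]; exists f; split=> //; split => // x sx m.
have := fa (spconj (spinv S) x) (spconj_sp4 (symplectic_inv hS) sx) m.
by rewrite !twist_act spconjVK.
Qed.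

(** M embeds into a Weyl algebra module, whose twist is again one, so central elements act by
    [central_char_weyl]. *)
Lemma twist_central (M N : lieMod (@sp4 C)) (z : 'I_4 -> N -> N) (io : M -> N) :
  weyl_ops z -> {in @sp4 C, forall A (m : N), act A m = weyl_act z A m} ->
  lm_hom io -> injective io ->
  has_central_character (twist hS M) (central_char (3%:R / 2%:R) (1 / 2%:R)).
Proof.
move=> w wa [il ia] ii u uc m; apply: ii.
have ht : @lm_hom C 4 (@sp4 C) (twist hS M) (twist hS N) io.
  by split => // x sx v; apply: ia; exact: spconj_sp4.
rewrite (linZ il) (@Uact_hom C 4 (@sp4 C) (twist hS M) (twist hS N) io u m ht).
apply: (central_char_weyl uc (M := twist hS N) (z := twz S z)).
  exact: (@twz_weyl C S hS N z w).
by move=> A sA v; exact: (@twz_act C S hS N z w wa A sA v).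
Qed.

End TwistModules.

Section Principal.
Variables (C : numClosedFieldType) (k : principal_sl2 (@sp4 C)).
Variables (S : 'M[C]_4) (hS : symplectic S) (al be ga : 'M[C]_4 -> C^o).
Hypothesis st : sl2_triple k al be ga (spconj S (mE C)) (spconj S (mH C)) (spconj S (mF C)).

Definition good (M : lieMod (@sp4 C)) : Prop :=
  [/\ simple_mod M, bounded_gk_module (psl2_sub k) M
    & has_central_character M (central_char (3%:R / 2%:R) (1 / 2%:R))].

Lemma good_classify (N : lieMod (@sp4 C)) : good N ->
  let M := twist hS N in
  [/\ simple_mod M, fgood M, forall m : M, ev (@opm C M) xX m = 0 -> m = 0
    & exists n (v : M), [/\ hwt n v, v != 0 & (n %% 3 != 2)%N]].
Proof.
move=> [sN [[lf _] bd] cN] M.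
have sM : simple_mod M := twist_simple hS sN.
have cM (m : M) : ev (@opm C M) xCas m = (5%:R / 2%:R) *: m := @casimir_value C S hS N m cN.
pose K := lm_res (psl2_sub k) N.
have hwE n (m : M) : hwt n m <-> @hwn C 4 k K (spconj S (mE C)) (spconj S (mH C)) n m.
  by rewrite /hwt /hwn U_xe U_xh.
have [b hb] := bounded_hw st lf bd.
have Hb n (w : 'I_b.+1 -> M) : (forall i, hwt n (w i)) ->
    exists c : 'I_b.+1 -> C, (exists i, c i != 0) /\ \sum_i c i *: w i = 0.
  by move=> hw; apply: (hb n w) => i; apply/hwE.
have [n [v [hv v0]]] := hwn_exists st lf sN.1.
have hvM : hwt n (v : M) by apply/hwE.
have tv : tors xf (v : M).
  exists n.+1; rewrite -[RHS](hwn_nilp st lf hv).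
  by elim: (n.+1) => // j IH; rewrite !iterS IH; exact: (@U_xf C M).
have [h1 h2 h3] := classify sM cM Hb hvM v0 tv.
by split => //; exists n, v.
Qed.

Section Model.
Variables (r e : int).
Hypotheses (r01 : (r == 0) || (r == 1)) (e01 : (e == 0) || (e == 1)).

(** Twisting by the inverse of S makes the given subalgebra act by [le], [lh], [lf] on binary
    forms. *)
Definition tmodel : lieMod (@sp4 C) := twist (symplectic_inv hS) (model C r01 e).
Let io : tmodel -> lat C := @mval C r r01 e.

Lemma tmodel_act x (m : tmodel) : x \in lie_space k ->
  io (act x m) = al x *: le (io m) + (be x *: lh (deg r) (io m) + ga x *: lf (deg r) (io m)).
Proof.
move=> xk; have s1 := memvD (spB_sp4 C 7) (spB_sp4 C 6).
have s2 := memvD (memvZ 3%:R (spB_sp4 C 4)) (spB_sp4 C 5).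
have s3 := memvB (memvZ 3%:R (spB_sp4 C 2)) (spB_sp4 C 3).
have lS := spconj_linear (spinv S).
have ex : spconj (spinv S) x = al x *: mE C + (be x *: mH C + ga x *: mF C).
  by rewrite {1}(st_dec st xk) lS (linD lS) !(linZ lS) !(spconjK _ hS).
rewrite -[act x m]/(@act C 4 (@sp4 C) (model C r01 e) (spconj (spinv S) x) m) ex.
rewrite /io mval_act ?memvD ?memvZ // !wactD !wactZ -!mval_act //.
by rewrite mval_e mval_h mval_f.
Qed.

Lemma tmodel_lat : lat_module (deg r) (midx e) (K := lm_res (psl2_sub k) tmodel) io.
Proof.
have [a1 b1 c1] := st_ve st; have [a2 b2 c2] := st_vh st; have [a3 b3 c3] := st_vf st.
split.
- exact: mval_lin.
- exact: mval_inj.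
- exact: mval_pred.
- exact: mval_sur.
- by move=> x xk; exists (al x), (be x), (ga x) => m; exact: tmodel_act.
- exists (spconj S (mE C)) => [|m]; first exact: st_e st.
  by rewrite [LHS](tmodel_act m (st_e st)) a1 b1 c1 !scale0r !addr0 scale1r.
- exists (spconj S (mH C)) => [|m]; first exact: st_h st.
  by rewrite [LHS](tmodel_act m (st_h st)) a2 b2 c2 !scale0r addr0 add0r scale1r.
- exists (spconj S (mF C)) => [|m]; first exact: st_f st.
  by rewrite [LHS](tmodel_act m (st_f st)) a3 b3 c3 !scale0r !add0r scale1r.
Qed.

Lemma tmodel_good : good tmodel.
Proof.
have hI := midx_index r01 e; split.
- exact (twist_simple (symplectic_inv hS) (model_simple C r01 e01)).
- split; first split.
  + exact (lat_locally_finite hI tmodel_lat).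
  + exact (lat_semisimple hI tmodel_lat).
  + by exists 1%N => V sV _; exact: (lat_hom_dim hI tmodel_lat sV).
- have wa : {in @sp4 C, forall A (m : model_full C r01), act A m = weyl_act (@mz C r) A m} by [].
  have hm : lm_hom (@sub_val _ _ _ _ _ (model_submodule C r01 e)).
    by split; [exact: sub_val_linear | move=> x sx m; exact: sub_val_act].
  exact (@twist_central C (spinv S) (symplectic_inv hS) (model C r01 e) (model_full C r01) (@mz C r)
    _ (mz_weyl C r01) wa hm (@sub_val_inj _ _ _ _ _ _)).
Qed.

Lemma tmodel_decomposes : decomposes_as (lm_res (psl2_sub k) tmodel) (fun j => `|(3 * e + r)%R| + 6 * j)%N.
Proof.
have hI := midx_index r01 e.
apply: (lat_decomposes hI tmodel_lat (ka := fun j => 2 * j%:Z + e)).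
- by move=> j; split; [have := e01; lia | exists j%:Z].
- by move=> q [h1 [q' h2]]; exists `|q'|%N; have := e01; lia.
- by move=> i j; lia.
- by move=> j; have := e01; lia.
- by move=> j; rewrite /deg; have := e01; have := r01; lia.
Qed.

Lemma tmodel_hwt (q : nat) : (exists a : int, q%:Z = 2 * a + e) ->
  exists v : twist hS tmodel, v != 0 /\ hwt (absz (3 * q%:Z + r)) v.
Proof.
move=> hq; have Iq : midx e q%:Z by split.
have dq : (0 : int) <= 0 <= deg r q%:Z by have := r01; rewrite /deg; lia.
have [m hm] := lm_sur tmodel_lat (ldelta_lpred C Iq Iq.1 dq).
exists m; split.
  apply/eqP => m0; move: hm; rewrite m0 (io0 tmodel_lat) => /(congr1 (fun f : lat C => f q%:Z 0)).
  by rewrite lat0E /lat_delta !eqxx => /esym/eqP; rewrite oner_eq0.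
have [a1 b1 c1] := st_ve st; have [a2 b2 c2] := st_vh st.
split.
  rewrite U_xe; apply: (io_eq0 tmodel_lat); rewrite [LHS](tmodel_act m (st_e st)) a1 b1 c1.
  by rewrite !scale0r !addr0 scale1r hm le_delta scale0r.
rewrite U_xh; apply: (lm_inj tmodel_lat); rewrite [LHS](tmodel_act m (st_h st)) a2 b2 c2.
rewrite !scale0r addr0 add0r scale1r [RHS](linZ (lm_lin tmodel_lat)) hm lh_delta mulr0 subr0.
by congr (_ *: _); rewrite /deg -[LHS]/((3 * q%:Z + r)%:~R); rewrite -{1}(gez0_abs (_ : 0 <= 3 * q%:Z + r)) //; have := r01; lia.
Qed.

Lemma hwt_tmodel n (v : twist hS tmodel) : hwt n v -> v != 0 ->
  exists q : int, n%:Z = 3 * q + r /\ exists a, q = 2 * a + e.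
Proof.
move=> [h1 h2] v0.
have [a1 b1 c1] := st_ve st; have [a2 b2 c2] := st_vh st.
have e1 : le (io v) = 0.
  have := congr1 io h1; rewrite U_xe [LHS](tmodel_act v (st_e st)) a1 b1 c1.
  by rewrite !scale0r !addr0 scale1r (io0 tmodel_lat).
have e2 : lh (deg r) (io v) = (n%:Z)%:~R *: io v.
  have e3 : io (n%:R *: v) = n%:R *: io v by exact (linZ (lm_lin tmodel_lat) n%:R v).
  have e4 : io (act (mH C) v) = lh (deg r) (io v).
    by rewrite [LHS](tmodel_act v (st_h st)) a2 b2 c2 !scale0r addr0 add0r scale1r.
  exact (etrans (esym e4) (etrans (congr1 io (etrans (esym (@U_xh C (twist hS tmodel) v)) h2)) e3)).
have [q [b fqb]] := io_neq0 tmodel_lat (elimN eqP v0).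
have hp := lm_pred tmodel_lat v; have [_ hn] := lat_hw hp e1 e2 fqb.
have [_ fs] := hp; have [[_ hq] _] := fs _ _ fqb.
by exists q; split.
Qed.

End Model.
End Principal.

(** * The classification *)

Section Classification.
Variables (C : numClosedFieldType) (k : principal_sl2 (@sp4 C)).

(** The smallest degrees 3 e + r of the four models are 0, 1, 3, 4. *)
Definition index_r (i : 'I_4) : int := nth 0 [:: 0; 1; 0; 1] i.
Definition index_e (i : 'I_4) : int := nth 0 [:: 0; 0; 1; 1] i.

Lemma index_r01 i : (index_r i == 0) || (index_r i == 1).
Proof. by case: i => -[|[|[|[|//]]]]. Qed.
Lemma index_e01 i : (index_e i == 0) || (index_e i == 1).
Proof. by case: i => -[|[|[|[|//]]]]. Qed.

Lemma index_inj i j : index_r i = index_r j -> index_e i = index_e j -> i = j.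
Proof.
rewrite /index_r /index_e.
by case: i => -[|[|[|[|//]]]] hi; case: j => -[|[|[|[|//]]]] hj //= _ _; exact: val_inj.
Qed.

Lemma index_sur (r e : nat) : (r < 2)%N -> (e < 2)%N -> exists i, index_r i = r%:Z /\ index_e i = e%:Z.
Proof.
case: r => [|[|//]] _; case: e => [|[|//]] _;
  [exists i40|exists i42|exists i41|exists i43]; by [].
Qed.

Theorem principal_classification : exists M : 'I_4 -> lieMod (@sp4 C),
  [/\ forall i, good k (M i),
      forall i j, lm_iso (M i) (M j) -> i = j,
      forall N, good k N -> exists i, lm_iso N (M i)
    & forall i, decomposes_as (lm_res (psl2_sub k) (M i))
        (fun j => nth 0 [:: 0; 1; 3; 4] i + 6 * j)%N].
Proof.
have [S [hS [al [be [ga st]]]]] := principal_standard k.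
pose M i := tmodel hS (index_e i) (index_r01 i).
have gM i : good k (M i) := tmodel_good hS st (index_r01 i) (index_e01 i).
exists M; split=> //.
- move=> i j [f [[fl fa] bf]].
  (* An isomorphism carries a highest weight vector of the smallest weight 3 e + r of the first
     model into the second, and this weight determines r modulo 3 and then e modulo 2. *)
  have hq : exists a : int, (absz (index_e i))%:Z = 2 * a + index_e i.
    by exists 0; have := index_e01 i; lia.
  have [v [v0 hv]] := tmodel_hwt hS st (index_r01 i) (index_e01 i) hq.
  have fv0 : (f v : twist hS (M j)) != 0.
    apply: contra_neq v0 => fv; apply: (bij_inj bf); rewrite fv.
    exact (esym (lin0 fl)).
  have fact x (u : M i) : x \in @sp4 C -> f (act (spconj S x) u) = act (spconj S x) (f u).
    by move=> sx; apply: fa; exact: spconj_sp4.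
  have sE : mE C \in @sp4 C by exact (memvD (spB_sp4 C 7) (spB_sp4 C 6)).
  have sH : mH C \in @sp4 C by exact (memvD (memvZ 3%:R (spB_sp4 C 4)) (spB_sp4 C 5)).
  have hfv : hwt (absz (3 * (absz (index_e i))%:Z + index_r i)) (f v : twist hS (M j)).
    have [h1 h2] := hv; split.
      rewrite U_xe; have := congr1 f h1; rewrite U_xe => h.
      exact (etrans (esym (fact _ v sE)) (etrans h (lin0 fl))).
    rewrite U_xh; have := congr1 f h2; rewrite U_xh => h.
    exact (etrans (esym (fact _ v sH)) (etrans h (linZ fl _ _))).
  have [q [hq1 [a hq2]]] := hwt_tmodel st hfv fv0.
  have := index_r01 i; have := index_r01 j; have := index_e01 i; have := index_e01 j.
  by move=> h1 h2 h3 h4; apply: index_inj; lia.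
- move=> N gN; have [sT fT XT [n [v [hv v0 n3]]]] := good_classify hS st gN.
  (* With n = 3 q + r, the model with this r and with e the parity of q has a highest weight vector
     of weight n, so [fgood_iso] applies. *)
  have [i [hr he]] : exists i, index_r i = (n %% 3)%N%:Z /\ index_e i = ((n %/ 3) %% 2)%N%:Z.
    apply: index_sur; last by rewrite ltn_mod.
    have n33 : (n %% 3 < 3)%N by rewrite ltn_mod.
    move/eqP: n3; lia.
  exists i; have [sM fM XM _] := good_classify hS st (gM i).
  have hq : exists a : int, (n %/ 3)%N%:Z = 2 * a + index_e i.
    by exists ((n %/ 3) %/ 2)%N%:Z; rewrite he; lia.
  have [u [u0 hu]] := tmodel_hwt hS st (index_r01 i) (index_e01 i) hq.
  have nE : absz (3 * (n %/ 3)%N%:Z + index_r i) = n by rewrite hr; lia.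
  rewrite nE in hu.
  exact: untwist_iso (fgood_iso sT sM fT fM XT XM hv hu v0 u0).
- move=> i; have := tmodel_decomposes hS st (index_r01 i) (index_e01 i).
  have -> : absz (3 * index_e i + index_r i) = nth 0%N [:: 0; 1; 3; 4]%N i by case: i => -[|[|[|[|//]]]].
  by [].
Qed.

End Classification.


Theorem corollary10p8 (R : realType) (k : principal_sl2 (@sp4 R[i])) :
  let P (M : lieMod (@sp4 R[i])) :=
    [/\ simple_mod M, bounded_gk_module (psl2_sub k) M
      & has_central_character M (central_char (3%:R / 2%:R) (1 / 2%:R))] in
  exists M : 'I_4 -> lieMod (@sp4 R[i]),
    [/\ forall i, P (M i),
        forall i j, lm_iso (M i) (M j) -> i = j,
        forall N, P N -> exists i, lm_iso N (M i)
      & forall i, decomposes_as (lm_res (psl2_sub k) (M i))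
          (fun j => nth 0 [:: 0; 1; 3; 4] i + 6 * j)%N].
Proof. exact (@principal_classification (R[i] : numClosedFieldType) k). Qed.
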